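(* Fix any $\varepsilon>0$ and $K\in\mathbb N$, and let $c_\tau(r)$, $\tau\in(-\varepsilon,\varepsilon)$, be an admissible family of profiles with discontinuities at $r_k(\tau)$ for $k=1,\dots,K$. Let $\operatorname{blsp}(\tau)$ denote the basic length spectrum of the ball $\bar B(0,1)$ with the velocity profile $c_\tau$. Suppose $\operatorname{blsp}(\tau)$ is countable for all $\tau\in(-\varepsilon,\varepsilon)$. Let $S(\tau)$, $\tau\in(-\varepsilon,\varepsilon)$, be any collection of countable subsets of $\mathbb R$ indexed by $\tau$. If $\operatorname{blsp}(\tau)\cup S(\tau)=\operatorname{blsp}(0)\cup S(0)$ for all $\tau\in(-\varepsilon,\varepsilon)$, then $c_\tau=c_0$ and $r_k(\tau)=r_k(0)$ for all $\tau\in(-\varepsilon,\varepsilon)$ and $k=1,\dots,K$.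
   Context: Annuli and metric. For $0\le r'<r''$ let $A(r',r'')=\bar B(0,r'')\setminus B(0,r')$ (closed Euclidean annulus). A velocity profile $c$ on $[0,1]$ defines on the ball $\bar B(0,1)$ the (rough) Riemannian metric $g=c(|x|)^{-2}\,dx^2$. If $c$ has jump discontinuities exactly at $1=r_0>r_1>\dots>r_K>0$ (apart from $r_0$), the spheres $\{|x|=r_k\}$, $1\le k\le K$, are called interfaces, and together with the boundary $\{|x|=1\}$ they form $\Gamma$. Put $r_{K+1}=0$; the regions $A(r_k,r_{k-1})$, $k=1,\dots,K+1$, are called layers. By symmetry every ray lies in a two-dimensional plane through the origin, so the dimension ($2$, $3$ or higher) is irrelevant. Smooth Herglotz condition: $\frac{d}{dr}\bigl(r/c(r)\bigr)>0$ at all points away from the discontinuities of $c$ (no condition is imposed on the sign of jumps). Countable conjugacy condition: a $C^{1,1}$ sound speed $c\colon(a,b]\to(0,\infty)$ on an annulus $A(a,b)$ satisfies it if there are only countably many (possibly finitely many or no) radii $r\in(a,b)$ such that the endpoints of the maximal geodesic $\gamma(r)$ (the geodesic, unique up to rotation, whose minimal distance to the origin is $r$, with endpoints on $|x|=b$) are conjugate along that geodesic. Admissible family of profiles: a collection of functions $c_\tau\colon[0,1]\to(0,\infty)$, $\tau\in(-\varepsilon,\varepsilon)$, such that (i) there are radii $r_k(\tau)\in(0,1)$, $k=1,\dots,K$, depending $C^1$-smoothly on $\tau$, with $1=:r_0(\tau)>r_1(\tau)>\dots>r_K(\tau)>0$ for all $\tau$; (ii) for every $\tau$, $c_\tau$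 is piecewise $C^{1,1}$ and satisfies the smooth Herglotz condition; (iii) the only singular points of each $c_\tau$ are the radii $r_k(\tau)$, $k=1,\dots,K$, where it has a jump discontinuity; (iv) within each layer $A(r_k(\tau),r_{k-1}(\tau))$ the profile $c_\tau$ satisfies the countable conjugacy condition, for all $\tau$; (v) $(r,\tau)\mapsto c_\tau(r)$ is $C^1$ at all points where $r\notin\{r_1(\tau),\dots,r_K(\tau)\}$. Broken rays. A broken ray is a continuous, piecewise smooth unit-speed path which is a concatenation of geodesics of $g$ in the complement of $\Gamma$ (its legs), such that at each meeting with $\Gamma$ consecutive legs obey the law of reflection or Snell's law of refraction (the tangential component of the covector is preserved). It is periodic if it closes up with the reflection/refraction condition also satisfied at the closing point. A broken ray is basic if either (type 1) it stays within a single layer and all of its legs are reflections from a single interface (or the boundary), or (type 2) it is a radial ray (zero angular momentum, i.e. contained in a line through the origin) contained in a single layer. The basic length spectrum $\operatorname{blsp}$ is the set of $g$-lengths of all periodic basic rays. *)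

(* Defs.v *)
From HB Require Import structures.
From mathcomp Require Import all_boot all_order all_algebra.
From mathcomp Require Import all_classical all_reals all_analysis.
Import Order.TTheory GRing.Theory Num.Theory.
Import numFieldNormedType.Exports.

Set Implicit Arguments.
Unset Strict Implicit.
Unset Printing Implicit Defensive.

Local Open Scope classical_set_scope.
Local Open Scope ring_scope.

(* The library norm on row vectors is the sup norm, hence these two. *)
Definition dotp {R : realType} {n : nat} (x y : 'rV[R]_n) : R :=
  \sum_(i < n) x ord0 i * y ord0 i.

Definition enorm {R : realType} {n : nat} (x : 'rV[R]_n) : R :=
  Num.sqrt (dotp x x).

(* Derivative relative to a domain D: it is one-sided at the endpoints when D
   is a closed interval. *)
Definition is_derive_in {R : realType} (D : set R) (f : R -> R) (x l : R) : Prop :=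
  (f y - f x) / (y - x) @[y --> within D (x^')] --> l.

(** * Geodesics and Jacobi fields of c(|x|)^-2 dx^2 *)

(* Right-hand side of the geodesic equation x'' = accel c x x'.  For the metric
   e^(2 phi) dx^2 the equation is
     x'' = |x'|^2 grad phi - 2 (grad phi . x') x',
   and here phi = - ln c(|x|), so grad phi = - c'(|x|) / (c(|x|) |x|) x. *)
Definition accel {R : realType} {n : nat} (c : R -> R) (x v : 'rV[R]_n) : 'rV[R]_n :=
  (derive1 c (enorm x) / (c (enorm x) * enorm x)) *:
    ((2 * dotp x v) *: v - dotp v v *: x).

(* Unit-speed geodesics on the open interval ]s, t[.  A profile need not satisfy
   c'(0) = 0, so at the origin grad phi may not exist; there only continuity of
   the velocity is required, i.e. the geodesic goes straight through. *)
Definition geodesic {R : realType} {n : nat} (c : R -> R) (g : R -> 'rV[R]_n)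
    (s t : R) : Prop :=
  forall u, s < u < t ->
    [/\ derivable g u 1,
        {for u, continuous (derive1 g)},
        enorm (derive1 g u) = c (enorm (g u)) &
        g u != 0 -> is_derive u 1 (derive1 g) (accel c (g u) (derive1 g u))].

(* Jacobi fields: solutions J of the linearization of x'' = accel c x x' along
   g.  When c is only C^{1,1}, c'' exists almost everywhere and J' is only
   Lipschitz, so the second-order equation is required for almost every time. *)
Definition jacobi_field {R : realType} {n : nat} (c : R -> R)
    (g J : R -> 'rV[R]_n) (s t : R) : Prop :=
  [/\ {within `[s, t], continuous J},
      (forall u, s < u < t -> derivable J u 1),
      [lipschitz derive1 J u | u in `]s, t[] &
      {ae @lebesgue_measure R, forall u, s < u < t ->
        exists2 w, is_derive u 1 (derive1 J) w &
          is_derive (0 : R) 1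
            (fun h : R => accel c (g u + h *: J u) (derive1 g u + h *: derive1 J u)) w}].

Definition conjugate_along {R : realType} {n : nat} (c : R -> R)
    (g : R -> 'rV[R]_n) (s t : R) : Prop :=
  exists J : R -> 'rV[R]_n,
    [/\ jacobi_field c g J s t, J s = 0, J t = 0 &
        exists2 u, s < u < t & J u != 0].

(* g is, on [0, T], the maximal geodesic gamma(r) of the annulus A(a, b). *)
Definition maximal_geodesic {R : realType} {n : nat} (c : R -> R) (a b r T : R)
    (g : R -> 'rV[R]_n) : Prop :=
  [/\ 0 < T,
      {within `[0, T], continuous g} /\ geodesic c g 0 T,
      (forall u, 0 < u < T -> a < enorm (g u) < b),
      enorm (g 0) = b /\ enorm (g T) = b &
      (forall u, 0 <= u <= T -> r <= enorm (g u)) /\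
      (exists2 u, 0 <= u <= T & enorm (g u) = r)].

Definition countable_conjugacy {R : realType} (n : nat) (c : R -> R) (a b : R) : Prop :=
  countable [set r : R | a < r < b /\
    exists (T : R) (g : R -> 'rV[R]_n),
      maximal_geodesic c a b r T g /\ conjugate_along c g 0 T].

(** * Layered profiles *)

(* r_0 = 1, r_1, ..., r_K, r_{K+1} = 0; only r 1, ..., r K are used. *)
Definition layer_radius {R : realType} (K : nat) (r : nat -> R) (k : nat) : R :=
  if k == 0%N then 1 else if (k <= K)%N then r k else 0.

Definition is_jump_radius {R : realType} (K : nat) (r : nat -> R) (x : R) : Prop :=
  exists2 k : nat, (1 <= k <= K)%N & x = r k.

Definition on_Gamma {R : realType} {n : nat} (K : nat) (r : nat -> R)
    (x : 'rV[R]_n) : Prop :=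
  exists2 k : nat, (k <= K)%N & enorm x = layer_radius K r k.

(* C^{1,1} on ]a, b]; as the derivative is Lipschitz on ]a, b[, the profile and
   its derivative also extend continuously to a. *)
Definition C11 {R : realType} (c : R -> R) (a b : R) : Prop :=
  [/\ (forall x, a < x < b -> derivable c x 1),
      [lipschitz derive1 c x | x in `]a, b[] &
      c x @[x --> b^'-] --> c b].

(* A profile on a layer is a function on the half-open interval
   ]r_{k+1}, r_k], so c (r_k) is the limit from below at a jump; without such a
   convention the values of c at its jumps would be arbitrary. *)
Definition piecewise_C11 {R : realType} (K : nat) (r : nat -> R) (c : R -> R) : Prop :=
  (forall k, (k <= K)%N -> C11 c (layer_radius K r k.+1) (layer_radius K r k)) /\
  c x @[x --> 0^'+] --> c 0.

Definition jump_at {R : realType} (c : R -> R) (x : R) : Prop :=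
  exists2 l, c y @[y --> x^'+] --> l & l != c x.

Definition smooth_herglotz {R : realType} (K : nat) (r : nat -> R) (c : R -> R) : Prop :=
  forall x, 0 <= x <= 1 -> ~ is_jump_radius K r x ->
    exists2 l, is_derive_in `[0, 1] (fun y => y / c y) x l & 0 < l.

Definition regular_points {R : realType} (K : nat) (eps : R) (r : nat -> R -> R) :
    set (R * R) :=
  [set z | [/\ 0 <= z.1 <= 1, - eps < z.2 < eps &
               ~ is_jump_radius K (r ^~ z.2) z.1]].

Record admissible {R : realType} (n K : nat) (eps : R)
    (r : nat -> R -> R) (c : R -> R -> R) : Prop := Admissible {
  adm_pos : forall tau x, - eps < tau < eps -> 0 <= x <= 1 -> 0 < c tau x;
  adm_radius_order : forall tau k, - eps < tau < eps -> (k <= K)%N ->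
    layer_radius K (r ^~ tau) k.+1 < layer_radius K (r ^~ tau) k;
  adm_radius_C1 : forall tau k, - eps < tau < eps -> (1 <= k <= K)%N ->
    derivable (r k) tau 1 /\ {for tau, continuous (derive1 (r k))};
  adm_C11 : forall tau, - eps < tau < eps ->
    piecewise_C11 K (r ^~ tau) (c tau);
  adm_herglotz : forall tau, - eps < tau < eps ->
    smooth_herglotz K (r ^~ tau) (c tau);
  adm_jump : forall tau k, - eps < tau < eps -> (1 <= k <= K)%N ->
    jump_at (c tau) (r k tau);
  adm_conjugacy : forall tau k, - eps < tau < eps -> (k <= K)%N ->
    countable_conjugacy n (c tau)
      (layer_radius K (r ^~ tau) k.+1) (layer_radius K (r ^~ tau) k);
  adm_C1 : exists d1 d2 : R * R -> R,
    [/\ (forall z, regular_points K eps r z ->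
           is_derive_in `[0, 1] (c z.2) z.1 (d1 z) /\
           is_derive z.2 1 (fun tau => c tau z.1) (d2 z)),
        {within regular_points K eps r, continuous d1} &
        {within regular_points K eps r, continuous d2}]
}.

(** * Broken rays and the basic length spectrum *)

(* The momentum covector g(v, .) of the velocity v, in Euclidean coordinates. *)
Definition covector {R : realType} {n : nat} (c : R -> R) (g : R -> 'rV[R]_n)
    (u : R) : 'rV[R]_n :=
  (c (enorm (g u)) ^- 2) *: derive1 g u.

(* Component of p tangential to the sphere through x centred at the origin. *)
Definition tangential {R : realType} {n : nat} (x p : 'rV[R]_n) : 'rV[R]_n :=
  p - (dotp p x / dotp x x) *: x.

(* The leg ending at time s and the leg starting at time t (g s = g t) obey the
   law of reflection or Snell's law.  The covectors have Euclidean norm 1 / c on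
   their own side of the sphere, so the tangential component determines the
   normal one up to sign, and the sign is determined by the sides. *)
Definition reflects_or_refracts {R : realType} {n : nat} (c : R -> R)
    (g : R -> 'rV[R]_n) (s t : R) : Prop :=
  exists p q : 'rV[R]_n,
    [/\ covector c g u @[u --> s^'-] --> p,
        covector c g u @[u --> t^'+] --> q &
        tangential (g s) p = tangential (g t) q].

(* The m legs are the restrictions of g to ]t i, t i.+1[, i < m. *)
Definition broken_ray {R : realType} {n : nat} (K : nat) (r : nat -> R)
    (c : R -> R) (m : nat) (t : nat -> R) (g : R -> 'rV[R]_n) : Prop :=
  [/\ (0 < m)%N /\ t 0%N = 0,
      (forall i, (i < m)%N -> t i < t i.+1),
      {within `[0, t m], continuous g} /\
        (forall u, 0 <= u <= t m -> enorm (g u) <= 1),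
      (forall i, (i < m)%N -> geodesic c g (t i) (t i.+1) /\
        forall u, t i < u < t i.+1 -> ~ on_Gamma K r (g u)) &
      (forall i, (0 < i < m)%N -> on_Gamma K r (g (t i)) /\
        reflects_or_refracts c g (t i) (t i))].

Definition periodic_broken_ray {R : realType} {n : nat} (K : nat) (r : nat -> R)
    (c : R -> R) (m : nat) (t : nat -> R) (g : R -> 'rV[R]_n) : Prop :=
  [/\ broken_ray K r c m t g, g (t m) = g 0, on_Gamma K r (g 0) &
      reflects_or_refracts c g (t m) 0].

Definition in_single_layer {R : realType} {n : nat} (K : nat) (r : nat -> R)
    (T : R) (g : R -> 'rV[R]_n) : Prop :=
  exists2 k : nat, (k <= K)%N &
    forall u, 0 <= u <= T -> layer_radius K r k.+1 <= enorm (g u) <= layer_radius K r k.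

Definition single_interface {R : realType} {n : nat} (K : nat) (r : nat -> R)
    (m : nat) (t : nat -> R) (g : R -> 'rV[R]_n) : Prop :=
  exists2 k : nat, (k <= K)%N &
    forall i, (i <= m)%N -> enorm (g (t i)) = layer_radius K r k.

Definition radial {R : realType} {n : nat} (T : R) (g : R -> 'rV[R]_n) : Prop :=
  exists e : 'rV[R]_n, forall u, 0 <= u <= T -> exists a : R, g u = a *: e.

Definition basic {R : realType} {n : nat} (K : nat) (r : nat -> R)
    (m : nat) (t : nat -> R) (g : R -> 'rV[R]_n) : Prop :=
  in_single_layer K r (t m) g /\
  (single_interface K r m t g \/ radial (t m) g).

(* Rays have unit speed for the metric, so their length is their duration. *)
Definition blsp {R : realType} (n K : nat) (r : nat -> R) (c : R -> R) : set R :=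
  [set L | exists (m : nat) (t : nat -> R) (g : R -> 'rV[R]_n),
     [/\ periodic_broken_ray K r c m t g, basic K r m t g & L = t m]].

(* Main.v *)
Require Import Defs.
From HB Require Import structures.
From mathcomp Require Import all_boot all_order all_algebra.
From mathcomp Require Import all_classical all_reals all_analysis.
From mathcomp Require Import measurable_realfun lebesgue_integral_under lra ring.
Import Order.TTheory GRing.Theory Num.Theory.
Import numFieldNormedType.Exports.

(** Put rho = r / c.  By the Herglotz condition rho increases with the radius r in
    each layer.  A ray has a conserved angular momentum p, and p = rho(m) where m is
    its smallest radius.  In a layer with outer radius b, a leg from the sphere
    r = b down to r = m and back has an aperture Delta(p), the angle seen from the
    origin, and a duration T(p) = H(p) + p Delta(p), where the action
      H(p) = 2 int sqrt((rho^2 - p^2)_+) / r dr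
    satisfies H' = - Delta.  When N Delta = 2 pi M, the leg closes up after N
    reflections, so N T is a basic length ([leg_length_blsp]).

    The layers are treated from the outside in, so the outer radius b of the layer
    can be assumed not to depend on tau.

    The action does not depend on tau.  Where Delta' is not zero, H is strictly
    convex or concave.  For a = 2 pi M / N the critical value of q |-> H(q) + a q
    is T at the momentum where Delta = a, a basic length divided by N.  It depends
    continuously on tau and takes countably many values, hence is constant.  These
    critical values for a dense set of slopes a determine H locally.  So H is
    locally independent of tau where Delta' is not zero; there Delta' = - H'' is
    constant in tau, and it cannot leave a nonzero value by continuity; then
    Delta' does not depend on tau anywhere, nor does H
    ([countable_spectrum_rigidity]).  The argument needs Delta' not to vanish on an
    interval, which is the countable conjugacy condition: if Delta'(p) = 0, varying
    the turning radius displaces the ends of the leg only tangentially to the leg to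
    first order, and the normal part of the displacement is a Jacobi field that
    vanishes at both ends ([countable_critical_radii]).

    The argument uses continuity in tau but no derivative of travel times in tau.
    The derivative of c in tau is not assumed to be bounded near the interfaces, so
    that differentiation under the integral is not available.  Continuity requires
    bounds on rho and its derivatives that are uniform in tau; by Baire's theorem
    they hold for tau in a dense open set ([uniformly_tame]).

    The action is an Abel transform of rho, and a monotone rho can be recovered from
    it ([abel_injective_le]).  So c is locally constant in tau on this dense set of
    parameters ([profile_locally_constant]); its derivative in tau vanishes there,
    and by continuity everywhere in the layer ([layer_stationary]).

    Finally, if the inner interface of the layer moved, it would move strictly
    monotonically for tau in some interval.  As the speed is constant there, the
    radial ray of the layer would have length 2 int 1/c taking uncountably many
    values ([radial_length_blsp], [interface_stationary]).  So the interface is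
    fixed, and the argument applies to the next layer ([layer_radius_constant]). *)

Set Implicit Arguments.
Unset Strict Implicit.
Unset Printing Implicit Defensive.

Local Open Scope classical_set_scope.
Local Open Scope ring_scope.

(** * Real functions and countable sets *)

(** lra reads every hypothesis, which is slow below many analytic ones: only the
    inequalities and equations are kept. *)
Ltac linarith :=
  repeat match goal with H : ?T |- _ =>
    lazymatch type of T with Prop =>
      lazymatch T with is_true _ => fail | _ = _ => fail | _ => clear H end end end;
  lra.

Section RealFunctions.
Context {R : realType}.
Implicit Types (f g F : R -> R) (a b x y t : R).

Lemma is_derive1_continuous f x l : is_derive x 1 f l -> {for x, continuous f}.
Proof. by move=> [df _]; apply: differentiable_continuous; apply/derivable1_diffP. Qed.

Lemma continuous_itvW f x y :
  (forall z, x <= z <= y -> {for z, continuous f}) ->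
  {within `[x, y], continuous f}.
Proof.
move=> cf; apply: continuous_in_subspaceT => z.
by rewrite inE /= in_itv /= => /cf.
Qed.

Lemma mean_value f f' a b x y : a < x -> x < y -> y < b ->
  (forall z, a < z < b -> is_derive z 1 f (f' z)) ->
  exists2 z, x < z < y & f y - f x = f' z * (y - x).
Proof.
move=> ax xy yb df.
have [||z] := @MVT _ f f' x y xy.
- by move=> z; rewrite in_itv /= => /andP[xz zy]; apply: df; lra.
- apply: continuous_itvW => z /andP[xz zy].
  by apply: (@is_derive1_continuous f z (f' z)); apply: df; lra.
by rewrite in_itv /= => zxy ->; exists z.
Qed.

Lemma derive_pos_increasing f f' a b :
  (forall z, a < z < b -> is_derive z 1 f (f' z)) ->
  (forall z, a < z < b -> 0 < f' z) ->
  forall x y, a < x -> x < y -> y < b -> f x < f y.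
Proof.
move=> df f'0 x y ax xy yb.
have [z /andP[xz zy] e] := mean_value ax xy yb df.
by rewrite -subr_gt0 e mulr_gt0 ?subr_gt0// f'0//; lra.
Qed.

Lemma derive_eq0_constant f a b :
  (forall z, a < z < b -> is_derive z 1 f 0) ->
  forall x y, a < x < b -> a < y < b -> f x = f y.
Proof.
move=> df.
suff h x y : a < x -> x < y -> y < b -> f x = f y.
  move=> x y /andP[ax xb] /andP[ay yb].
  by case: (ltgtP x y) => [xy|yx|->//]; [|apply/esym]; apply: h.
move=> ax xy yb; have [z _ e] := mean_value (f' := fun=> 0) ax xy yb df.
by apply/eqP; rewrite eq_sym -subr_eq0 e mul0r.
Qed.

(** Connectedness of the interval, from the intermediate value theorem for the
    indicator function of P. *)
Lemma clopen_interval (P : R -> Prop) a b x :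
  (forall t, a < t < b -> P t -> \forall s \near t, P s) ->
  (forall t, a < t < b -> ~ P t -> \forall s \near t, ~ P s) ->
  a < x < b -> P x -> forall y, a < y < b -> P y.
Proof.
move=> oP cP axb Px y ayb; apply: contrapT => nPy.
pose f t : R := (`[< P t >])%:R.
have cf t : a < t < b -> {for t, continuous f}.
  move=> atb; have [Pt|nPt] := pselect (P t).
  - have ft : f t = 1 by rewrite /f asboolT.
    rewrite /prop_for /continuous_at ft; apply: cvg_near_cst.
    by apply: filterS (oP _ atb Pt) => s Ps; rewrite /f asboolT.
  - have ft : f t = 0 by rewrite /f asboolF.
    rewrite /prop_for /continuous_at ft; apply: cvg_near_cst.
    by apply: filterS (cP _ atb nPt) => s Ps; rewrite /f asboolF.
have f01 t : f t = 0 \/ f t = 1.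
  by rewrite /f; case: asboolP => _; [right|left].
have ivt u v : u <= v -> a < u -> v < b ->
    (f u = 0 /\ f v = 1) \/ (f u = 1 /\ f v = 0) -> False.
  move=> uv au vb e.
  have cw : {within `[u, v], continuous f}.
    by apply: continuous_itvW => z /andP[uz zv]; apply: cf; lra.
  have [|z _ fz] := @IVT _ f u v (1/2) uv cw.
    have [[-> ->]|[-> ->]] := e; rewrite 
      /Num.min /Num.max ?ltr01 ?ltr10 ?ltxx; lra.
  by have [] := f01 z; rewrite fz; lra.
have fx : f x = 1 by rewrite /f asboolT.
have fy : f y = 0 by rewrite /f asboolF.
have [xy|yx] := leP x y.
- by apply: (ivt x y) => //; [lra|lra|right].
- by apply: (ivt y x) => //; [exact: ltW|lra|lra|left].
Qed.

(** Countable sets have Lebesgue measure zero. *)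
Lemma countable_itv_absurd (C : set R) a b : a < b -> countable C ->
  (forall x, a < x < b -> C x) -> False.
Proof.
move=> ab cC h.
have /countable_lebesgue_measure0 : countable `]a, b[.
  by apply: sub_countable cC; apply: subset_card_le => x /=; rewrite in_itv => /h.
by rewrite lebesgue_measure_itv /= lte_fin ab => -[]; lra.
Qed.

(** By the intermediate value theorem, since a nondegenerate interval is
    uncountable. *)
Lemma countable_valued_constant (C : set R) f a b : countable C ->
  (forall t, a < t < b -> {for t, continuous f}) ->
  (forall t, a < t < b -> C (f t)) ->
  forall x y, a < x < b -> a < y < b -> f x = f y.
Proof.
move=> cC cf fC.
suff h x y : a < x -> x < y -> y < b -> f x = f y.
  move=> x y /andP[ax xb] /andP[ay yb].
  by case: (ltgtP x y) => [xy|yx|->//]; [|apply/esym]; apply: h.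
move=> ax xy yb.
have cw : {within `[x, y], continuous f}.
  by apply: continuous_itvW => z /andP[uz zv]; apply: cf; lra.
have ivt v : Num.min (f x) (f y) <= v <= Num.max (f x) (f y) -> C v.
  move=> hv; have [z] := IVT (ltW xy) cw hv.
  by rewrite in_itv /= => /andP[xz zy] <-; apply: fC; lra.
have [e|e|//] := ltgtP (f x) (f y); exfalso; apply: (countable_itv_absurd e cC);
  move=> z /andP[? ?]; apply: ivt; rewrite /Num.min /Num.max.
- by rewrite e; lra.
- by rewrite ltNge (ltW e) /=; lra.
Qed.

Lemma countable_codense (C : set R) a b : a < b -> countable C ->
  exists2 x, a < x < b & ~ C x.
Proof.
move=> ab cC; apply: contrapT => h; apply: (countable_itv_absurd ab cC) => x axb.
by apply: contrapT => nC; apply: h; exists x.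
Qed.

End RealFunctions.

(** * Integrals of bounded functions over bounded intervals *)

Section Integrals.
Context {R : realType}.
Notation mu := (@lebesgue_measure R).
Implicit Types (f g F : R -> R) (a b c x y t : R).

Definition integral a b f : R := (\int[mu]_(x in `]a, b[) f x)%R.

(** All integrands below belong to this class, which is closed under sums and
    products; it spares separate integrability arguments. *)
Definition bounded_measurable a b f :=
  measurable_fun `]a, b[ f /\ exists C, forall x, a < x < b -> `|f x| <= C.

Lemma continuous_measurable_itv a b f :
  (forall x, a < x < b -> {for x, continuous f}) -> measurable_fun `]a, b[ f.
Proof.
move=> cf; apply: subspace_continuous_measurable_fun => //.
by apply: continuous_in_subspaceT => x; rewrite inE /= in_itv /= => /cf.
Qed.

Lemma continuous_bounded_measurable a b f (C : R) :
  (forall x, a < x < b -> {for x, continuous f}) ->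
  (forall x, a < x < b -> `|f x| <= C) -> bounded_measurable a b f.
Proof. by move=> cf fC; split; [exact: continuous_measurable_itv|exists C]. Qed.

Lemma itvoo_measure_lty a b : (mu `]a, b[ < +oo)%E.
Proof.
by rewrite lebesgue_measure_itv /=; case: ifP => // _; rewrite -EFinB ltry.
Qed.

Lemma bounded_measurable_integrable a b f :
  bounded_measurable a b f -> mu.-integrable `]a, b[ (EFin \o f).
Proof.
move=> [mf [C fC]]; apply: measurable_bounded_integrable => //.
  exact: itvoo_measure_lty.
exists C; split; first exact: num_real.
move=> M CM x /=; rewrite in_itv /= => axb.
by rewrite (le_trans (fC _ axb)) // ltW.
Qed.

Lemma bounded_measurable_sub a b c d f : a <= c -> d <= b ->
  bounded_measurable a b f -> bounded_measurable c d f.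
Proof.
move=> ac db [mf [C fC]]; split.
  by apply: measurable_funS mf => // x /=; rewrite !in_itv /=; lra.
by exists C => x cxd; apply: fC; lra.
Qed.

Lemma bounded_measurableD a b f g : bounded_measurable a b f ->
  bounded_measurable a b g -> bounded_measurable a b (fun x => f x + g x).
Proof.
move=> [mf [C fC]] [mg [D gD]]; split; first exact: measurable_funD.
by exists (C + D) => x h; rewrite (le_trans (ler_normD _ _))// lerD ?fC ?gD.
Qed.

Lemma bounded_measurableM a b f g : bounded_measurable a b f ->
  bounded_measurable a b g -> bounded_measurable a b (fun x => f x * g x).
Proof.
move=> [mf [C fC]] [mg [D gD]]; split; first exact: measurable_funM.
by exists (C * D) => x h; rewrite normrM ler_pM ?fC ?gD.
Qed.

Lemma bounded_measurableN a b f : bounded_measurable a b f ->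
  bounded_measurable a b (fun x => - f x).
Proof.
move=> [mf [C fC]]; split; first exact: measurable_funN.
by exists C => x h; rewrite normrN fC.
Qed.

Lemma bounded_measurableB a b f g : bounded_measurable a b f ->
  bounded_measurable a b g -> bounded_measurable a b (fun x => f x - g x).
Proof. by move=> bf bg; apply: bounded_measurableD => //; exact: bounded_measurableN. Qed.

Lemma bounded_measurable_cst a b k : bounded_measurable a b (fun=> k).
Proof. by split; [exact: measurable_cst|exists `|k|]. Qed.

Lemma integral_eq a b f g : (forall x, a < x < b -> f x = g x) ->
  integral a b f = integral a b g.
Proof.
by move=> fg; apply: eq_Rintegral => x; rewrite inE /= in_itv /= => /fg.
Qed.

Lemma integralZ a b f k : bounded_measurable a b f ->
  integral a b (fun x => k * f x) = k * integral a b f.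
Proof.
by move=> bf; rewrite /integral RintegralZl//; exact: bounded_measurable_integrable.
Qed.

Lemma integralD a b f g : bounded_measurable a b f -> bounded_measurable a b g ->
  integral a b (fun x => f x + g x) = integral a b f + integral a b g.
Proof.
by move=> bf bg; rewrite /integral RintegralD//; exact: bounded_measurable_integrable.
Qed.

Lemma integralB a b f g : bounded_measurable a b f -> bounded_measurable a b g ->
  integral a b (fun x => f x - g x) = integral a b f - integral a b g.
Proof.
by move=> bf bg; rewrite /integral RintegralB//; exact: bounded_measurable_integrable.
Qed.

Lemma integral_le a b f g : bounded_measurable a b f -> bounded_measurable a b g ->
  (forall x, a < x < b -> f x <= g x) -> integral a b f <= integral a b g.
Proof.
move=> bf bg fg; apply: le_Rintegral => [//|||x /=]; try exact: bounded_measurable_integrable.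
by rewrite in_itv /= => /fg.
Qed.

Lemma integral_cst a b k : a <= b -> integral a b (fun=> k) = k * (b - a).
Proof.
move=> ab; rewrite /integral Rintegral_cst//=; congr (_ * _).
have := lebesgue_measure_itv `]a, b[; rewrite /= lte_fin => /(congr1 fine) /= ->.
by move: ab; rewrite le_eqVlt => /predU1P[->|->//]; rewrite ltxx subrr.
Qed.

Lemma integral_empty a b f : b <= a -> integral a b f = 0.
Proof.
by move=> ba; rewrite /integral set_itv_ge ?Rintegral_set0// bnd_simp -leNgt.
Qed.

Lemma integral_norm_le a b f (C : R) : a <= b -> bounded_measurable a b f ->
  (forall x, a < x < b -> `|f x| <= C) -> `|integral a b f| <= C * (b - a).
Proof.
move=> ab bf fC; rewrite -(integral_cst _ ab) ler_norml; apply/andP; split.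
- rewrite integral_cst// -mulNr -integral_cst//.
  apply: integral_le => //; first exact: bounded_measurable_cst.
  by move=> x /fC; rewrite ler_norml => /andP[].
- apply: integral_le => //; first exact: bounded_measurable_cst.
  by move=> x /fC; rewrite ler_norml => /andP[].
Qed.

Lemma integral_ge0 a b f : (forall x, a < x < b -> 0 <= f x) -> 0 <= integral a b f.
Proof. by move=> h; apply: Rintegral_ge0 => x /=; rewrite in_itv /= => /h. Qed.

Lemma integral_split a c b f : a <= c -> c <= b -> bounded_measurable a b f ->
  integral a b f = integral a c f + integral c b f.
Proof.
rewrite le_eqVlt => /predU1P[-> _ _|ac]; first by rewrite (integral_empty _ (lexx c)) add0r.
rewrite le_eqVlt => /predU1P[-> _|cb bf]; first by rewrite (integral_empty _ (lexx b)) addr0.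
have bi := bounded_measurable_integrable bf.
have := Rintegral_itvB (x := c) bi; rewrite !bnd_simp => /(_ (ltW ac) cb).
rewrite -Rintegral_itv_bndo_bndc; last first.
  by apply: bounded_measurable_integrable; apply: bounded_measurable_sub bf => //; exact: ltW.
by rewrite /integral => <-; rewrite addrC subrK.
Qed.

(** Dominated convergence with a constant as dominating function. *)
Lemma integral_bounded_cvg a b (f_ : nat -> R -> R) f (C : R) :
  (forall n, measurable_fun `]a, b[ (f_ n)) ->
  (forall n x, a < x < b -> `|f_ n x| <= C) ->
  (forall x, a < x < b -> f_ ^~ x @ \oo --> f x) ->
  (fun n => integral a b (f_ n)) @ \oo --> integral a b f.
Proof.
move=> mf fC cf.
have mlim : measurable_fun `]a, b[ f.
  apply: measurable_fun_cvg => [n|]; first exact: mf.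
  by move=> x /=; rewrite in_itv /= => /cf.
have fC' x : a < x < b -> `|f x| <= C.
  move=> axb; apply: (@cvgr_to_le nat \oo _ R (fun n => `|f_ n x|)).
    by apply: cvg_norm; exact: cf.
  by apply: nearW => n; exact: fC.
have bl : bounded_measurable a b f by split => //; exists C.
have [|||||_ _ h] := @dominated_convergence _ _ _ mu `]a, b[ (measurable_itv _)
  (fun n => EFin \o f_ n) (EFin \o f) (cst C%:E).
- by move=> n; apply/measurable_EFinP; exact: mf.
- by apply/measurable_EFinP.
- apply: aeW => x /=; rewrite in_itv /= => /cf h.
  by apply: cvg_EFin => //; exact: nearW.
- by apply: bounded_measurable_integrable; exact: bounded_measurable_cst.
- by apply: aeW => x n /=; rewrite in_itv /= lee_fin => /fC.
apply: fine_cvg; rewrite fineK; first exact: h.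
exact: integrable_fin_num (bounded_measurable_integrable bl).
Qed.

(** Reduction to sequences, so that dominated convergence applies. *)
Lemma cvg_seq (T : pseudoMetricType R) (f : T -> R) (U : set T) (x : T) (l : R) :
  nbhs x U ->
  (forall u : nat -> T, (forall n, U (u n)) -> u @ \oo --> x -> f \o u @ \oo --> l) ->
  f @ x --> l.
Proof.
move=> xU h; apply/cvgrPdist_lt => e e0; apply: contrapT => nf.
have w (n : nat) : exists y : T, [/\ U y, ball x (n.+1%:R^-1) y & ~ (`|l - f y| < e)].
  apply: contrapT => hn; apply: nf; near=> y; apply: contrapT => fy; apply: hn.
  by exists y; split => //; near: y; [exact: xU|apply: nbhsx_ballx; rewrite invr_gt0].
have [u hu] := choice w.
have ux : u @ \oo --> x.
  apply/cvg_ballP => d d0.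
  have := near_infty_natSinv_lt (PosNum d0); apply: filterS => n nd.
  by have [_ /(le_ball (ltW nd)) ? _] := hu n.
have /cvgrPdist_lt /(_ _ e0)[N _ hN] := h u (fun n => let: And3 p _ _ := hu n in p) ux.
by have [_ _] := hu N; apply; apply: hN => /=.
Unshelve. all: by end_near. Qed.

Lemma integral_param_cvg (T : pseudoMetricType R) (f : T -> R -> R) a b (z0 : T)
    (C : R) :
  (\forall z \near z0, measurable_fun `]a, b[ (f z) /\
     forall x, a < x < b -> `|f z x| <= C) ->
  (forall x, a < x < b -> f z x @[z --> z0] --> f z0 x) ->
  integral a b (f z) @[z --> z0] --> integral a b (f z0).
Proof.
move=> bf cf; apply: (cvg_seq bf) => u hu uz0.
apply: (@integral_bounded_cvg a b (fun n => f (u n)) (f z0) C).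
- by move=> n; have [] := hu n.
- by move=> n; have [] := hu n.
- by move=> x /cf fx; exact: (cvg_comp u (f ^~ x) uz0 fx).
Qed.

Lemma is_derive1_unique (f g : R -> R) x (l m : R) : (\forall y \near x, f y = g y) ->
  is_derive x 1 f l -> is_derive x 1 g m -> l = m.
Proof.
move=> fg df dg; have := near_eq_is_derive fg df => dg'.
by rewrite -(@derive_val _ _ _ _ _ _ _ dg) (@derive_val _ _ _ _ _ _ _ dg').
Qed.

Lemma near_dist (x : R) (P : R -> Prop) : (\forall y \near x, P y) ->
  exists2 d, 0 < d & forall y, `|y - x| < d -> P y.
Proof. by move=> /nbhs_ballP[d /= d0 h]; exists d => // y yx; apply: h; rewrite /ball /= distrC. Qed.

Lemma dist_near (x d : R) (P : R -> Prop) : 0 < d ->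
  (forall y, `|y - x| < d -> P y) -> \forall y \near x, P y.
Proof. by move=> d0 h; apply/nbhs_ballP; exists d => //= y; rewrite /ball /= distrC => /h. Qed.

Lemma near_itv a b x : a < x < b -> \forall y \near x, a < y < b.
Proof.
move=> axb; have : x \in `]a, b[ by rewrite in_itv.
by move=> /near_in_itvoo; apply: filterS => y; rewrite in_itv.
Qed.

Lemma within_continuousB a b f g : {within `[a, b], continuous f} ->
  {within `[a, b], continuous g} -> {within `[a, b], continuous (f \- g)}.
Proof. by move=> cf cg x; apply: cvgB; [exact: cf|exact: cg]. Qed.

(** The antiderivative is taken from the left endpoint of the open interval, where
    f need not be defined. *)
Lemma integral_derive a b f x : a < x < b -> bounded_measurable a b f ->
  {for x, continuous f} -> is_derive x 1 (fun y => integral a y f) (f x).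
Proof.
move=> /andP[ax xb] bf cf.
have xu : x < (x + b) / 2 by lra.
have iu : mu.-integrable `]a, (x + b) / 2] (EFin \o f).
  apply: integrableS (bounded_measurable_integrable bf) => // y /=.
  by rewrite !in_itv /=; lra.
have [||d1 d2] := @continuous_FTC1 _ f (BRight a) x ((x + b) / 2) xu iu.
- by rewrite lte_fin.
- exact: cf.
apply: (@near_eq_is_derive _ _ _ (fun y => (\int[mu]_(t in [set` `]a, y]]) f t)%R)); last first.
  by split; [exact: d1|rewrite -derive1E; exact: d2].
have xb' : \forall y \near x, y < b by exact: lt_nbhsl.
apply: filterS xb' => y yb; rewrite /integral Rintegral_itv_bndo_bndc//.
apply: bounded_measurable_integrable; apply: bounded_measurable_sub bf => //.
exact: ltW.
Qed.

Lemma lipschitz_within a b f (C : R) :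
  (forall x y, a <= x -> x <= y -> y <= b -> `|f y - f x| <= C * (y - x)) ->
  {within `[a, b], continuous f}.
Proof.
move=> fC; have [ab|ba] := ltP a b; last first.
  have [ab|ab] := ltP b a.
    by rewrite set_itv_ge ?bnd_simp -?ltNge//; exact: continuous_subspace0.
  have -> : a = b by apply/le_anti; rewrite ab ba.
  by rewrite set_itv1; exact: continuous_subspace1.
have cvgC x y : a <= x <= b -> forall e, 0 < e ->
    a <= y <= b -> `|x - y| < e / (`|C| + 1) -> `|f x - f y| < e.
  move=> xab e e0 yab xy.
  have h : `|f x - f y| <= `|C| * `|x - y|.
    have [xley|/ltW ylex] := leP x y.
      rewrite distrC (distrC x) (ger0_norm (x := y - x)) ?subr_ge0//.
      apply: (le_trans (fC x y _ xley _)); [lra|lra|].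
      by rewrite ler_wpM2r ?subr_ge0// ler_norm.
    rewrite (ger0_norm (x := x - y)) ?subr_ge0//.
    apply: (le_trans (fC y x _ ylex _)); [lra|lra|].
    by rewrite ler_wpM2r ?subr_ge0// ler_norm.
  apply: (le_lt_trans h).
  have C0 : 0 < `|C| + 1 by rewrite ltr_wpDl.
  rewrite ltr_pdivlMr// in xy; apply: le_lt_trans xy.
  by rewrite mulrC ler_wpM2l// lerDl.
have Cp e : 0 < e -> 0 < e / (`|C| + 1) by move=> e0; rewrite divr_gt0// ltr_wpDl.
apply/(continuous_within_itvP _ ab); split.
- move=> x; rewrite in_itv /= => /andP[ax xb].
  apply/cvgrPdist_lt => e e0; near=> y; apply: (cvgC x y _ e e0); first lra.
    have /andP[] : a < y < b by near: y; apply: near_itv; lra.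
    by move=> ay yb; rewrite !ltW.
  by near: y; apply: cvgr_dist_lt => //; exact: Cp.
- apply/cvgrPdist_lt => e e0; near=> y; apply: (cvgC a y _ e e0); first lra.
    by apply/andP; split; apply: ltW; near: y; [exact: nbhs_right_gt|exact: nbhs_right_lt].
  by near: y; move: (e / _) (Cp _ e0) => d d0; apply: cvgr_dist_lt => //; exact: cvg_at_right_filter.
- apply/cvgrPdist_lt => e e0; near=> y; apply: (cvgC b y _ e e0); first lra.
    by apply/andP; split; apply: ltW; near: y; [exact: nbhs_left_gt|exact: nbhs_left_lt].
  by near: y; move: (e / _) (Cp _ e0) => d d0; apply: cvgr_dist_lt => //; exact: cvg_at_left_filter.
Unshelve. all: by end_near. Qed.

Lemma integral_lipschitz a b f (C : R) x y : a <= x -> x <= y -> y <= b ->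
  measurable_fun `]a, b[ f -> (forall t, a < t < b -> `|f t| <= C) ->
  `|integral a y f - integral a x f| <= C * (y - x).
Proof.
move=> ax xy yb mf fC; have bf : bounded_measurable a b f by split => //; exists C.
rewrite (@integral_split a x y)//; last exact: bounded_measurable_sub bf.
rewrite addrAC subrr add0r; apply: integral_norm_le => //.
  exact: bounded_measurable_sub bf.
by move=> t h; apply: fC; lra.
Qed.

Lemma integral_within a b f : bounded_measurable a b f ->
  {within `[a, b], continuous (fun x => integral a x f)}.
Proof.
move=> [mf [C fC]]; apply: (@lipschitz_within _ _ _ C) => x y ax xy yb.
exact: (@integral_lipschitz a b).
Qed.

(** The derivative may oscillate at the endpoints, as long as it is bounded and the
    antiderivative is continuous up to them: the difference of F and the integral
    of f is constant by the mean value theorem. *)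
Lemma integral_fundamental a b f F (C : R) : a < b ->
  (forall x, a < x < b -> is_derive x 1 F (f x)) ->
  (forall x, a < x < b -> {for x, continuous f}) ->
  (forall x, a < x < b -> `|f x| <= C) ->
  {within `[a, b], continuous F} -> integral a b f = F b - F a.
Proof.
move=> ab dF cf fC cF.
have bf := continuous_bounded_measurable cf fC.
have [||z _ e] := @MVT _ (fun x => F x - integral a x f) (fun=> 0) a b ab.
- move=> x; rewrite in_itv /= => xab; rewrite -(subrr (f x)).
  apply: is_deriveB; first exact: dF.
  by apply: (@integral_derive a b) => //; exact: cf.
- by apply: within_continuousB => //; exact: integral_within.
by move: e; rewrite mul0r (integral_empty _ (lexx a)); lra.
Qed.

Lemma continuousT_bounded_measurable a b f : continuous f -> bounded_measurable a b f.
Proof.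
move=> cf; have [ab|ba] := ltP a b; last first.
  by split; [rewrite set_itv_ge ?bnd_simp -?leNgt//; exact: measurable_fun_set0|exists 0 => x h; exfalso; lra].
have cw : {within `[a, b], continuous f} by exact: continuous_subspaceT.
have [c _ hc] := EVT_max (ltW ab) cw; have [d _ hd] := EVT_min (ltW ab) cw.
apply: (@continuous_bounded_measurable _ _ _ (`|f c| + `|f d|)) => [y _|y yab].
  exact: cf.
have yab' : y \in `[a, b] by rewrite in_itv /=; lra.
have := hc _ yab'; have := hd _ yab'.
rewrite ler_norml; have := ler_norm (f c); have := ler_norm (- f d).
by have := normr_ge0 (f c); have := normr_ge0 (f d); rewrite normrN; lra.
Qed.

Lemma primitive_exists f : continuous f ->
  exists F : R -> R, forall x, is_derive x 1 F (f x).
Proof.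
move=> cf; exists (fun x => integral 0 x f - integral x 0 f) => x.
pose M := `|x| + 1.
have xM : - M < x < M.
  by rewrite /M; have := ler_norm x; have := ler_norm (- x); rewrite normrN; lra.
have M0 : 0 < M by rewrite /M ltr_wpDl.
have bf : bounded_measurable (- M) M f by exact: continuousT_bounded_measurable.
apply: (@near_eq_is_derive _ _ _ (fun y => integral (- M) y f - integral (- M) 0 f)); last first.
  have := integral_derive xM bf (cf x) => h.
  by apply: is_derive_eq; rewrite subr0.
have : \forall y \near x, - M < y < M.
  exact: near_itv.
apply: filterS => y yM.
have [y0|y0] := leP 0 y.
- rewrite (integral_empty _ y0) subr0 (@integral_split (- M) 0 y)//; try lra.
  by apply: bounded_measurable_sub bf; lra.
- rewrite (integral_empty _ (ltW y0)) sub0r (@integral_split (- M) y 0); try lra.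
  by apply: bounded_measurable_sub bf; lra.
Unshelve. all: by end_near. Qed.

Lemma integral_substitution a b c d f (phi phi' : R -> R) (C D : R) : c < d -> a < b ->
  phi c = a -> phi d = b ->
  (forall x, c < x < d -> a < phi x < b) ->
  (forall x, c < x < d -> is_derive x 1 phi (phi' x)) ->
  (forall x, c < x < d -> {for x, continuous phi'}) ->
  (forall x, c < x < d -> `|phi' x| <= D) ->
  (forall x y, c <= x -> x <= y -> y <= d -> phi x <= phi y) ->
  (forall x y, c <= x -> x <= y -> y <= d -> `|phi y - phi x| <= D * (y - x)) ->
  (forall x, a < x < b -> {for x, continuous f}) ->
  (forall x, a < x < b -> `|f x| <= C) ->
  integral a b f = integral c d (fun x => f (phi x) * phi' x).
Proof.
move=> cd ab phic phid phiab dphi cphi' phi'D phi_le phiL cf fC.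
have bf := continuous_bounded_measurable cf fC.
have C0 : 0 <= C by apply: le_trans (fC ((a + b) / 2) _) => //; lra.
transitivity (integral a (phi d) f - integral a (phi c) f).
  by rewrite phid phic (integral_empty _ (lexx a)) subr0.
apply/esym; apply: (@integral_fundamental c d _ (fun x => integral a (phi x) f)
  (C * D) cd).
- move=> x xcd.
  apply: (@is_derive1_comp _ (fun y => integral a y f) phi).
    by apply: (@integral_derive a b); [exact: phiab|exact: bf|apply: cf; exact: phiab].
  exact: dphi.
- move=> x xcd; apply: continuousM; last exact: cphi'.
  apply: continuous_comp; first exact: is_derive1_continuous (dphi _ xcd).
  by apply: cf; exact: phiab.
- by move=> x xcd; rewrite normrM ler_pM// ?phi'D// fC// phiab.
- apply: (@lipschitz_within _ _ _ (C * D)) => x y cx xy yd.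
  have aphi : a <= phi x by rewrite -phic; apply: phi_le => //; lra.
  have phib : phi y <= b by rewrite -phid; apply: phi_le => //; lra.
  have phixy : phi x <= phi y by apply: phi_le.
  apply: (le_trans (@integral_lipschitz a b f C _ _ aphi phixy phib bf.1 fC)).
  rewrite -mulrA ler_wpM2l//; apply: le_trans (phiL x y cx xy yd).
  exact: ler_norm.
Qed.

End Integrals.

(** * Families of travel times with countably many periodic lengths *)

Section Rigidity.
Context {R : realType}.

(** Apertures that are rational multiples of a full turn are dense, so periodic
    rays exist near every momentum where the aperture is not stationary. *)
Lemma rational_angle (x y : R) : 0 < x -> x < y ->
  exists N M : nat, [/\ (0 < N)%N, (0 < M)%N & x < 2 * pi * M%:R / N%:R < y].
Proof.
move=> x0 xy; have pi0 := @pi_gt0 R.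
have xy' : x / (2 * pi) < y / (2 * pi) by rewrite ltr_pM2r ?invr_gt0 ?mulr_gt0.
have [q] := rat_in_itvoo xy'; rewrite in_itv /= => /andP[xq qy].
have q0 : 0 < q.
  by rewrite -(@ltr0q R); apply: lt_trans xq; rewrite divr_gt0 ?mulr_gt0.
exists `|denq q|%N, `|numq q|%N; split.
- by rewrite absz_gt0.
- by rewrite absz_gt0 numq_eq0 gt_eqF.
have -> : 2 * pi * (`|numq q|%N)%:R / (`|denq q|%N)%:R = ratr q * (2 * pi) :> R.
  rewrite /ratr -[(`|numq q|%N)%:R]/((Posz `|numq q|%N)%:~R)
    -[(`|denq q|%N)%:R]/((Posz `|denq q|%N)%:~R).
  rewrite !abszE !gtr0_norm ?denq_gt0 ?numq_gt0//.
  by field; rewrite intr_eq0 denq_eq0.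
by rewrite -ltr_pdivrMr ?mulr_gt0// xq /= -ltr_pdivlMr ?mulr_gt0.
Qed.

(** Travel-time data of a family of profiles over a box of ray parameters p and
    family parameters t: Delta is the angle of a leg, H + p Delta its length, and
    C contains the lengths of the periodic rays. *)
Record spectral_family (p1 p2 t1 t2 : R) (H Delta D : R -> R -> R) (C : set R) :
    Prop := SpectralFamily {
  derive_H : forall p t, p1 < p < p2 -> t1 < t < t2 ->
    is_derive p 1 (H ^~ t) (- Delta p t);
  derive_Delta : forall p t, p1 < p < p2 -> t1 < t < t2 ->
    is_derive p 1 (Delta ^~ t) (D p t);
  continuous_D : forall p t, p1 < p < p2 -> t1 < t < t2 ->
    {for (p, t), continuous (fun z : R * R => D z.1 z.2)};
  continuous_Delta : forall p t, p1 < p < p2 -> t1 < t < t2 ->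
    {for t, continuous (Delta p)};
  continuous_H : forall t (e : R), t1 < t < t2 -> 0 < e ->
    \forall s \near t, forall p, p1 < p < p2 -> `|H p s - H p t| < e;
  Delta_gt0 : forall p t, p1 < p < p2 -> t1 < t < t2 -> 0 < Delta p t;
  D_neq0_dense : forall t a b, t1 < t < t2 -> p1 < a -> a < b -> b < p2 ->
    exists2 p, a < p < b & D p t != 0;
  countable_C : countable C;
  periodic_lengths : forall p t (N M : nat), p1 < p < p2 -> t1 < t < t2 ->
    (0 < N)%N -> (0 < M)%N -> N%:R * Delta p t = 2 * pi * M%:R ->
    C (N%:R * (H p t + p * Delta p t))
}.

(** Here s H is strictly concave in p, so q |-> s (H q t + a q) has its maximum where
    Delta = a.  Up to a factor this maximum is the length of a periodic ray; it
    depends continuously on t and takes countably many values, so it is constant.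
    The tangent of slope - s a to the graph of s H therefore does not depend on t,
    and all the graphs lie below it. *)
Lemma tangents_constant {p1 p2 t1 t2 : R} {H Delta D : R -> R -> R} {C : set R}
  (F : spectral_family p1 p2 t1 t2 H Delta D C) (q1 q2 u1 u2 s a : R) (N M : nat) :
  s = 1 \/ s = -1 -> q1 < q2 -> (forall p, q1 <= p <= q2 -> p1 < p < p2) ->
  (forall t, u1 < t < u2 -> t1 < t < t2) ->
  (forall t x y, u1 < t < u2 -> q1 <= x -> x < y -> y <= q2 -> s * Delta x t < s * Delta y t) ->
  (forall t, u1 < t < u2 -> s * Delta q1 t < s * a < s * Delta q2 t) ->
  (0 < N)%N -> (0 < M)%N -> N%:R * a = 2 * pi * M%:R ->
  forall t t' p, u1 < t < u2 -> u1 < t' < u2 -> q1 < p < q2 -> Delta p t = a ->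
    s * H p t' <= s * H p t.
Proof.
move=> s1 q12 pp tt inc ends N0 M0 NM.
have crit t : exists p, u1 < t < u2 -> q1 < p < q2 /\ Delta p t = a.
  have [te|te] := boolP (u1 < t < u2); last by exists 0.
  have /andP[a1 a2] := ends t te.
  have cw : {within `[q1, q2], continuous (fun p => s * Delta p t)}.
    apply: continuous_itvW => z zq; apply: continuousM; first exact: cst_continuous.
    exact: is_derive1_continuous (derive_Delta F (pp z zq) (tt t te)).
  have l := lt_trans a1 a2.
  have [|p] := @IVT _ _ _ _ (s * a) (ltW q12) cw.
    by rewrite (min_l (ltW l)) (max_r (ltW l)) (ltW a1) (ltW a2).
  rewrite in_itv /= => pq sa; exists p => _.
  have pa : Delta p t = a by case: s1 sa => ->; rewrite ?mul1r ?mulN1r// => /oppr_inj.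
  split => //; move: pq; rewrite !le_eqVlt => /andP[/predU1P[e|->] /predU1P[e'|->]] //.
  - by move: a1; rewrite e sa ltxx.
  - by move: a1; rewrite e sa ltxx.
  - by move: a2; rewrite -e' sa ltxx.
have [P hP] := choice crit.
pose m t := s * (H (P t) t + a * P t).
have m_max t p : u1 < t < u2 -> q1 < p < q2 -> s * (H p t + a * p) <= m t.
  move=> te pq; have [Pq Pa] := hP t te.
  have df z : q1 < z < q2 ->
      is_derive z 1 (fun z => s * (H z t + a * z)) (s * a - s * Delta z t).
    move=> zq; have zq' : q1 <= z <= q2 by lra.
    have h := derive_H F (pp z zq') (tt t te).
    by apply: is_derive_eq; rewrite /GRing.scale /=; ring.
  have [[qp pq2] [qP Pq2]] := (andP pq, andP Pq).
  rewrite /m; case: (ltgtP p (P t)) => [pP|Pp|->//].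
  - have [z /andP[z1 z2] ez] := mean_value qp pP Pq2 df.
    rewrite -subr_ge0 ez mulr_ge0//; last by rewrite subr_ge0 ltW.
    by rewrite -Pa subr_ge0 ltW// inc//; [apply: ltW; exact: lt_trans z1|exact: ltW].
  - have [z /andP[z1 z2] ez] := mean_value qP Pp pq2 df.
    rewrite -subr_le0 ez mulr_le0_ge0//; last by rewrite subr_ge0 ltW.
    by rewrite -Pa subr_le0 ltW// inc//; [exact: ltW|apply: ltW; exact: lt_trans pq2].
have norm_s x : `|s * x| = `|x|.
  by rewrite normrM; case: s1 => ->; rewrite ?normrN normr1 mul1r.
have m_const : forall t t', u1 < t < u2 -> u1 < t' < u2 -> m t = m t'.
  apply: (@countable_valued_constant _ [set s * c / N%:R | c in C]).
  - exact: sub_countable (card_image_le _ _) (countable_C F).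
  - move=> t te; apply/cvgrPdist_lt => g g0.
    have := continuous_H F (tt t te) g0; have := near_itv te.
    apply: filterS2 => u ue hu.
    have [Pq _] := hP u ue; have [Pq' _] := hP t te.
    have hu' p : q1 < p < q2 -> `|s * H p u - s * H p t| < g.
      by move=> pq; rewrite -mulrBr norm_s hu// pp//; lra.
    have := hu' _ Pq; have := hu' _ Pq'.
    have := m_max u (P t) ue Pq'; have := m_max t (P u) te Pq.
    by rewrite /m !ltr_norml !mulrDr; clear; lra.
  - move=> t te; have [Pq Pa] := hP t te.
    have pP : p1 < P t < p2 by apply: pp; lra.
    exists (N%:R * (H (P t) t + P t * Delta (P t) t)).
      by apply: (periodic_lengths F (M := M) pP (tt t te) N0 M0); rewrite Pa.
    rewrite /m Pa mulrCA [X in X / _]mulrC mulfK ?pnatr_eq0 -?lt0n//.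
    by rewrite [P t * a]mulrC.
move=> t t' p te te' pq pa.
have := m_max t' p te' pq; rewrite (m_const t' t te' te).
suff -> : m t = s * (H p t + a * p) by rewrite !mulrDr lerD2r.
have [Pq Pa] := hP t te; have [[qp pq2] [qP Pq2]] := (andP pq, andP Pq).
rewrite /m; suff -> : P t = p by [].
have [l|l|//] := ltgtP (P t) p.
- by have := inc t _ _ te (ltW qP) l (ltW pq2); rewrite pa Pa ltxx.
- by have := inc t _ _ te (ltW qp) l (ltW Pq2); rewrite pa Pa ltxx.
Qed.

(** The slopes a that are rational multiples of a full turn are dense, so the points
    of contact of the corresponding tangents are dense too. *)
Lemma H_locally_constant_le {p1 p2 t1 t2 : R} {H Delta D : R -> R -> R} {C : set R}
  (F : spectral_family p1 p2 t1 t2 H Delta D C) (q0 d s : R) (t0 : R) : 0 < d -> s = 1 \/ s = -1 ->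
  (forall p t, `|p - q0| < d -> `|t - t0| < d ->
    [/\ p1 < p < p2, t1 < t < t2 & 0 < s * D p t]) ->
  exists2 e, 0 < e & forall p t t', `|p - q0| < e -> `|t - t0| < e -> `|t' - t0| < e ->
    s * H p t' <= s * H p t.
Proof.
move=> d0 s1 hd.
have ss : s * s = 1 by case: s1 => ->; linarith.
have near_q0 p : q0 - d < p < q0 + d -> `|p - q0| < d by rewrite ltr_norml; linarith.
have inc t : `|t - t0| < d -> forall x y, q0 - d < x -> x < y -> y < q0 + d ->
    s * Delta x t < s * Delta y t.
  move=> td; apply: (@derive_pos_increasing _ _ (fun x => s * D x t)) => z zq.
  - have [zp tt _] := hd _ _ (near_q0 _ zq) td.
    have h := derive_Delta F zp tt.
    by apply: is_derive_eq; rewrite /GRing.scale /=; linarith.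
  - by have [] := hd _ _ (near_q0 _ zq) td.
have t0d : `|t0 - t0| < d by rewrite subrr normr0.
(* The slopes between A and B are attained between q0 - d / 2 and q0 + d / 2 for all
   t near t0, and they include those attained near q0. *)
pose A := (s * Delta (q0 - d / 2) t0 + s * Delta (q0 - d / 4) t0) / 2.
pose B := (s * Delta (q0 + d / 2) t0 + s * Delta (q0 + d / 4) t0) / 2.
have cD p : q0 - d < p < q0 + d -> {for t0, continuous (fun t => s * Delta p t)}.
  move=> pq; have [pp tt _] := hd _ _ (near_q0 _ pq) t0d.
  by apply: continuousM; [exact: cst_continuous|exact: (continuous_Delta F pp tt)].
have l1 := inc t0 t0d (q0 - d / 2) (q0 - d / 4) ltac:(linarith) ltac:(linarith) ltac:(linarith).
have l2 := inc t0 t0d (q0 + d / 4) (q0 + d / 2) ltac:(linarith) ltac:(linarith) ltac:(linarith).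
have : \forall t \near t0, [/\ `|t - t0| < d,
    s * Delta (q0 - d / 2) t < A, A < s * Delta (q0 - d / 4) t,
    s * Delta (q0 + d / 4) t < B & B < s * Delta (q0 + d / 2) t].
  near=> t; split; near: t.
  - by apply: (dist_near d0).
  - by apply: (cvgr_lt _ (cD (q0 - d / 2) _)); rewrite /A /=; linarith.
  - by apply: (cvgr_gt _ (cD (q0 - d / 4) _)); rewrite /A /=; linarith.
  - by apply: (cvgr_lt _ (cD (q0 + d / 4) _)); rewrite /B /=; linarith.
  - by apply: (cvgr_gt _ (cD (q0 + d / 2) _)); rewrite /B /=; linarith.
move=> /near_dist[e e0 he].
have te0 t : t0 - e < t < t0 + e -> `|t - t0| < e by rewrite ltr_norml; linarith.
have in_e t : `|t - t0| < e -> t0 - e < t < t0 + e by rewrite ltr_norml; linarith.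
have extremal (a : R) (N M : nat) : (0 < N)%N -> (0 < M)%N -> N%:R * a = 2 * pi * M%:R ->
    A < s * a < B -> forall t t' p, `|t - t0| < e -> `|t' - t0| < e ->
    q0 - d / 2 < p < q0 + d / 2 -> Delta p t = a ->
    s * H p t' <= s * H p t.
  move=> N0 M0 NM /andP[Aa aB] t t' p /in_e te /in_e te'.
  apply: (tangents_constant F s1 _ _ _ _ _ N0 M0 NM te te').
  - by clear -d0; lra.
  - move=> x hx; have [||//] := hd x t0; last by rewrite subrr normr0.
    by apply: near_q0; clear -d0 hx; lra.
  - move=> u /te0 /he[ud _ _ _ _]; have [||//] := hd q0 u; last by [].
    by rewrite subrr normr0.
  - by move=> u x y /te0 /he[ud _ _ _ _] h1 h2 h3; apply: (inc u ud) => //; clear -d0 h1 h2 h3; lra.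
  - by move=> u /te0 /he[_ l3 _ _ l4]; rewrite (lt_trans l3 Aa) (lt_trans aB l4).
exists (Num.min e (d / 4)); first by rewrite lt_min e0 divr_gt0.
move=> p t t'; rewrite !lt_min => /andP[pe pd] /andP[te _] /andP[te' _].
rewrite leNgt; apply/negP => lt_H.
have [td e1 e2 e3 e4] := he _ te; have [td' _ _ _ _] := he _ te'.
have pd' : `|p - q0| < d by apply: lt_trans pd _; linarith.
have cH u : `|u - t0| < d -> {for p, continuous (fun p => s * H p u)}.
  move=> ud; have [pp tt _] := hd p u pd' ud.
  apply: continuousM; first exact: cst_continuous.
  exact: is_derive1_continuous (derive_H F pp tt).
have : \forall x \near p, 0 < s * H x t' - s * H x t.
  apply: (cvgr_gt _ (cvgB (cH t' td') (cH t td))); rewrite /=; linarith.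
have : \forall x \near p, q0 - d / 4 < x < q0 + d / 4.
  by apply: near_itv; move: pd; rewrite ltr_norml; linarith.
move=> /filterI/[apply] /near_dist[g g0 hg].
have [v [pv vg]] : exists v, p < v /\ v < p + g.
  by exists (p + g / 2); move: g0; clear; lra.
have near_p x : p <= x <= v -> `|x - p| < g.
  by move: g0 vg; clear => ? ? /andP[? ?]; rewrite ger0_norm; lra.
have hp x : p <= x <= v -> q0 - d / 4 < x < q0 + d / 4 by move=> /near_p /hg[].
have hd' x : p <= x <= v -> [/\ p1 < x < p2, t1 < t < t2 & 0 < s * D x t].
  by move=> /hp h; apply: hd => //; apply: near_q0; move: d0 h; clear; lra.
have pvp : p <= p <= v by rewrite lexx ltW.
have pvv : p <= v <= v by rewrite lexx ltW.
have [pp tt _] := hd' p pvp; have [vp _ _] := hd' v pvv.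
have [luv lu lv] : [/\ s * Delta p t < s * Delta v t, s * Delta (q0 - d / 4) t < s * Delta p t &
    s * Delta v t < s * Delta (q0 + d / 4) t].
  have := hp _ pvp; have := hp _ pvv; move: d0 pv; clear -inc td => d0 pv h h'.
  by split; apply: (inc t td); lra.
have Dp := Delta_gt0 F pp tt; have Dv := Delta_gt0 F vp tt.
have [a [N [M [N0 M0 NM sa]]]] : exists a (N M : nat),
    [/\ (0 < N)%N, (0 < M)%N, N%:R * a = 2 * pi * M%:R &
      s * Delta p t < s * a < s * Delta v t].
  have NE (N M : nat) : (0 < N)%N -> N%:R * (2 * pi * M%:R / N%:R) = 2 * pi * M%:R :> R.
    by move=> N0; rewrite mulrC divfK// pnatr_eq0 -lt0n.
  case: s1 luv => ->; rewrite ?mul1r ?mulN1r ?ltrN2 => luv.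
  - have [N [M [N0 M0 h]]] := rational_angle Dp luv.
    by exists (2 * pi * M%:R / N%:R), N, M; split => //; [exact: NE|rewrite !mul1r].
  - have [N [M [N0 M0 h]]] := rational_angle Dv luv.
    exists (2 * pi * M%:R / N%:R), N, M; split => //; first exact: NE.
    by rewrite !mulN1r !ltrN2 andbC.
have cw : {within `[p, v], continuous (fun x => s * Delta x t)}.
  apply: continuous_itvW => z /hd'[zp' _ _]; apply: continuousM; first exact: cst_continuous.
  exact: is_derive1_continuous (derive_Delta F zp' tt).
have [|x] := @IVT _ _ _ _ (s * a) (ltW pv) cw.
  by rewrite (min_l (ltW luv)) (max_r (ltW luv)); case/andP: sa => /ltW -> /ltW ->.
rewrite in_itv /= => xp xa.
have xa' : Delta x t = a by case: s1 xa => ->; rewrite ?mul1r ?mulN1r// => /oppr_inj.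
have [_ xq] := hg x (near_p x xp).
have hx : q0 - d / 2 < x < q0 + d / 2 by have := hp x xp; move: d0; clear; lra.
have hA : A < s * a < B by move: sa e2 e3 lu lv; clear; lra.
have := extremal a N M N0 M0 NM hA t t' x te te' hx xa'.
by rewrite leNgt -subr_gt0 xq.
Unshelve. all: by end_near. Qed.

(** The inequality of the preceding lemma holds in both directions. *)
Lemma H_locally_constant {p1 p2 t1 t2 : R} {H Delta D : R -> R -> R} {C : set R}
  (F : spectral_family p1 p2 t1 t2 H Delta D C) (p0 t0 : R) : p1 < p0 < p2 -> t1 < t0 < t2 -> D p0 t0 != 0 ->
  exists2 e, 0 < e & forall p t, `|p - p0| < e -> `|t - t0| < e -> H p t = H p t0.
Proof.
move=> p0p t0t D0.
pose s := Num.sg (D p0 t0).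
have s1 : s = 1 \/ s = -1.
  move: D0; rewrite neq_lt => /orP[h|h]; [right|left].
    by rewrite /s ltr0_sg.
  by rewrite /s gtr0_sg.
have sD : 0 < s * D p0 t0 by rewrite /s -normrEsg normr_gt0.
have cs : (fun z : R * R => s * D z.1 z.2) z @[z --> (p0, t0)] --> s * D p0 t0.
  by apply: cvgM; [exact: cvg_cst|exact: (continuous_D F p0p t0t)].
have [[U V] /= [/near_dist[d1 d10 hU] /near_dist[d2 d20 hV]] UV] := cvgr_gt _ cs _ sD.
have [d3 d30 hp] := near_dist (near_itv p0p).
have [d4 d40 ht] := near_dist (near_itv t0t).
pose d := Num.min (Num.min d1 d2) (Num.min d3 d4).
have d0 : 0 < d by rewrite !lt_min d10 d20 d30 d40.
have [|e e0 he] := @H_locally_constant_le _ _ _ _ _ _ _ _ F p0 d s t0 d0 s1.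
  move=> p t; rewrite !lt_min -!andbA => /and4P[pd1 _ pd3 _] /and4P[_ td2 _ td4].
  split; [exact: hp|exact: ht|].
  by apply: (UV (p, t)); split; [exact: hU|exact: hV].
exists e => // p t pe te; have t0e : `|t0 - t0| < e by rewrite subrr normr0.
have := he p t t0 pe te t0e; have := he p t0 t pe t0e te.
by case: s1 => ->; linarith.
Qed.

Lemma derivatives_locally_constant {p1 p2 t1 t2 : R} {H Delta D : R -> R -> R} {C : set R}
  (F : spectral_family p1 p2 t1 t2 H Delta D C) (p0 t0 : R) :
  p1 < p0 < p2 -> t1 < t0 < t2 -> D p0 t0 != 0 ->
  \forall t \near t0, [/\ H p0 t = H p0 t0, Delta p0 t = Delta p0 t0 & D p0 t = D p0 t0].
Proof.
move=> p0p t0t D0; have [e e0 he] := H_locally_constant F p0p t0t D0.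
have [d d0 hd] := near_dist (near_itv t0t).
have [g g0 hg] := near_dist (near_itv p0p).
apply: (@dist_near _ _ (Num.min e d)); first by rewrite lt_min e0 d0.
move=> t; rewrite lt_min => /andP[te /hd tt].
have DeltaE p : `|p - p0| < Num.min e g -> Delta p t = Delta p t0.
  rewrite lt_min => /andP[pe /hg pp]; apply: oppr_inj.
  apply: (is_derive1_unique _ (derive_H F pp tt) (derive_H F pp t0t)).
  have ep : 0 < e - `|p - p0| by rewrite subr_gt0.
  apply: (dist_near ep) => y yp; apply: he => //.
  by have := ler_distD p y p0; linarith.
have p0e : `|p0 - p0| < e by rewrite subrr normr0.
split; [exact: he|by apply: DeltaE; rewrite subrr normr0 lt_min e0|].
apply: (is_derive1_unique _ (derive_Delta F p0p tt) (derive_Delta F p0p t0t)).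
by apply: (@dist_near _ _ (Num.min e g)); rewrite ?lt_min ?e0.
Qed.

(** Where D is not zero it is locally constant in t, being - H''.  So by continuity it
    cannot leave a nonzero value, and it cannot leave zero either. *)
Lemma D_constant {p1 p2 t1 t2 : R} {H Delta D : R -> R -> R} {C : set R}
  (F : spectral_family p1 p2 t1 t2 H Delta D C) (p t t' : R) : p1 < p < p2 -> t1 < t < t2 -> t1 < t' < t2 -> D p t = D p t'.
Proof.
move=> pp.
have cD t0 : t1 < t0 < t2 -> {for t0, continuous (D p)}.
  move=> tt; apply: (continuous_comp (f := fun u => (p, u)) (g := fun z => D z.1 z.2)).
    rewrite /prop_for /continuous_at.
    exact: (@cvg_pair _ _ _ (nbhs t0) (nbhs p) (nbhs t0) _ _ _ _ _ (cvg_cst p) cvg_id).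
  exact: (continuous_D F pp tt).
have key t0 : t1 < t0 < t2 -> D p t0 != 0 -> forall u, t1 < u < t2 -> D p u = D p t0.
  move=> tt D0; apply: (@clopen_interval _ (fun u => D p u = D p t0) t1 t2 t0 _ _ tt).
  - move=> u ut Du; have := derivatives_locally_constant F pp ut.
    by rewrite Du => /(_ D0); apply: filterS => v [].
  - move=> u ut /eqP Du.
    have Du0 : 0 < `|D p u - D p t0| by rewrite normr_gt0 subr_eq0.
    near=> v => e; have : `|D p u - D p v| < `|D p u - D p t0|.
      by near: v; apply: cvgr_dist_lt => //; exact: cD.
    by rewrite e ltxx.
  - by [].
move=> tt tt'; have [D0|D0] := eqVneq (D p t) 0; last by apply/esym/key.
by apply/eqP; rewrite D0 eq_sym; apply: contraT => D0'; have := key t' tt' D0' t tt; rewrite D0 => e; rewrite -e eqxx in D0'.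
Unshelve. all: by end_near. Qed.

(** No differentiability in t is involved.  Once D is constant in t, H and Delta are
    locally constant in t, hence constant, at a momentum where D does not vanish;
    integrating D twice from there gives H. *)
Lemma countable_spectrum_rigidity {p1 p2 t1 t2 : R} {H Delta D : R -> R -> R} {C : set R}
  (F : spectral_family p1 p2 t1 t2 H Delta D C) (p t t' : R) : p1 < p < p2 ->
  t1 < t < t2 -> t1 < t' < t2 -> H p t = H p t'.
Proof.
move=> pp tt tt'.
have [|||p0 p0p D0] := D_neq0_dense F (t := t) (a := ((2 * p1 + p2) / 3)) (b := ((p1 + 2 * p2) / 3)) tt; try linarith.
have {}p0p : p1 < p0 < p2 by linarith.
have [H0 Delta0] : H p0 t' = H p0 t /\ Delta p0 t' = Delta p0 t.
  move: t' tt'; apply: (@clopen_interval _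
    (fun u => H p0 u = H p0 t /\ Delta p0 u = Delta p0 t) t1 t2 t _ _ tt) => // u ut.
  - move=> [<- <-]; have : D p0 u != 0 by rewrite (D_constant F p0p ut tt).
    by move=> /(derivatives_locally_constant F p0p ut); apply: filterS => v [].
  - move=> h; have : D p0 u != 0 by rewrite (D_constant F p0p ut tt).
    move=> /(derivatives_locally_constant F p0p ut).
    by apply: filterS => v [-> ->].
have DeltaE q : p1 < q < p2 -> Delta q t = Delta q t'.
  move=> qp.
  suff : Delta q t - Delta q t' = Delta p0 t - Delta p0 t' by rewrite Delta0; linarith.
  apply: (@derive_eq0_constant _ (fun q => Delta q t - Delta q t') p1 p2) => // z zp.
  have h := derive_Delta F zp tt; have h' := derive_Delta F zp tt'.
  by apply: is_derive_eq; rewrite (D_constant F zp tt tt') subrr.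
suff : H p t - H p t' = H p0 t - H p0 t' by rewrite H0; linarith.
apply: (@derive_eq0_constant _ (fun q => H q t - H q t') p1 p2) => // z zp.
have h := derive_H F zp tt; have h' := derive_H F zp tt'.
by apply: is_derive_eq; rewrite (DeltaE z zp) subrr.
Qed.

End Rigidity.

(** * Abel's integral equation *)

Section AbelTransform.
Context {R : realType}.

(** Dominated convergence, with the difference quotients bounded by the mean value
    theorem. *)
Lemma integral_derive_under (a b u v x : R) (F dF : R -> R -> R) (C : R) :
  u < x < v -> (forall y, u < y < v -> bounded_measurable a b (F y)) ->
  (forall y w, u < y < v -> a < w < b -> is_derive y 1 (F ^~ w) (dF y w)) ->
  (forall y w, u < y < v -> a < w < b -> `|dF y w| <= C) ->
  is_derive x 1 (fun y => integral a b (F y)) (integral a b (dF x)).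
Proof.
move=> uxv bF dF' dFC.
have h1 y : `]u, v[%classic y -> lebesgue_measure.-integrable `]a, b[ (EFin \o F y).
  by rewrite /= in_itv => /bF; exact: bounded_measurable_integrable.
have h2 y w : `]u, v[%classic y -> `]a, b[%classic w -> derivable (F ^~ w) y 1.
  by rewrite /= !in_itv => uyv awb; have [] := dF' y w uyv awb.
have d1 y w : u < y < v -> a < w < b -> partial1of2 F y w = dF y w.
  move=> uyv awb; rewrite partial1of2E.
  by have h := dF' y w uyv awb; exact: derive_val.
have h3 y w : `]u, v[%classic y -> `]a, b[%classic w -> `|partial1of2 F y w| <= `|C|.
  rewrite /= !in_itv => uyv awb; rewrite d1//.
  by apply: le_trans (dFC y w uyv awb) _; exact: ler_norm.
have Ix : `]u, v[%classic x by rewrite /= in_itv.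
have iC : lebesgue_measure.-integrable `]a, b[ (EFin \o (fun=> `|C|)).
  exact: bounded_measurable_integrable (bounded_measurable_cst _ _ _).
have C0 (y : R) : 0 <= `|C| by [].
have D1 := @derivable_under_integral R _ _ (@lebesgue_measure R) F `]a, b[%classic
  (measurable_itv _) x u v Ix h1 h2 (fun=> `|C|) C0 iC h3.
have D2 := @differentiation_under_integral R _ _ (@lebesgue_measure R) F `]a, b[%classic
  (measurable_itv _) x u v Ix h1 h2 (fun=> `|C|) C0 iC h3.
split; first exact: D1.
rewrite -derive1E D2; apply: eq_Rintegral => w; rewrite inE /= in_itv /= => awb.
exact: d1.
Qed.

Lemma sqrt_dist (x y : R) : `|Num.sqrt x - Num.sqrt y| <= Num.sqrt `|x - y|.
Proof.
wlog xy : x y / y <= x.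
  move=> h; have [yx|/ltW xy] := leP y x; first exact: h.
  by rewrite distrC [`|x - y|]distrC; exact: h.
have s : Num.sqrt y <= Num.sqrt x by rewrite ler_wsqrtr.
rewrite !ger0_norm ?subr_ge0// lerBlDr -ler_sqr ?nnegrE ?addr_ge0 ?sqrtr_ge0//.
have [y0|y0] := leP 0 y.
  rewrite sqrrD !sqr_sqrtr ?subr_ge0//; last exact: le_trans xy.
  have := mulr_ge0 (sqrtr_ge0 (x - y)) (sqrtr_ge0 y); rewrite -[_ *+ 2]mulr_natr; lra.
rewrite [Num.sqrt y]ltr0_sqrtr// addr0 (@sqr_sqrtr _ (x - y)) ?subr_ge0//.
have [x0|x0] := leP 0 x; first by rewrite sqr_sqrtr//; lra.
by rewrite ltr0_sqrtr// expr0n /=; lra.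
Qed.

(** Up to the factor 2 and with x = p^2 this is the radial action of a leg with
    momentum p, the travel-time datum that the length spectrum controls. *)
Definition abel (a b : R) (rho : R -> R) (x : R) : R :=
  integral a b (fun r => Num.sqrt (rho r ^+ 2 - x) / r).

(** The area under a half-ellipse: up to scale the only explicit integral that
    Abel's equation requires. *)
Definition half_disc : R := integral 0 1 (fun s => Num.sqrt (1 - s) * Num.sqrt s).

Lemma half_disc_gt0 : 0 < half_disc.
Proof.
have bm (u v : R) : 0 <= u -> v <= 1 ->
    bounded_measurable u v (fun s : R => Num.sqrt (1 - s) * Num.sqrt s).
  move=> u0 v1; apply: (@continuous_bounded_measurable _ _ _ _ 1) => x xuv.
    apply: continuousM; last exact: sqrt_continuous.
    apply: (continuous_comp (f := fun s : R => 1 - s)); last exact: sqrt_continuous.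
    by apply: continuousB; [exact: cst_continuous|exact: cvg_id].
  rewrite normrM !ger0_norm ?sqrtr_ge0// -[leRHS]mulr1.
  by apply: ler_pM; rewrite ?sqrtr_ge0// -[leRHS]sqrtr1 ler_wsqrtr//; lra.
rewrite /half_disc (@integral_split _ 0 (1/4) 1); [|lra|lra|exact: (bm _ _ (lexx _) (lexx _))].
rewrite (@integral_split _ (1/4) (1/2) 1); [|lra|lra|by apply: bm; lra].
have h (u v : R) : 0 <= integral u v (fun s : R => Num.sqrt (1 - s) * Num.sqrt s).
  by apply: integral_ge0 => s _; rewrite mulr_ge0 ?sqrtr_ge0.
apply: (@lt_le_trans _ _ (integral (1/4) (1/2) (fun s : R => Num.sqrt (1 - s) * Num.sqrt s))); last first.
  by have := h 0 (1/4); have := h (1/2) 1; lra.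
apply: (@lt_le_trans _ _ (integral (1/4) (1/2) (fun=> Num.sqrt (1/2) * Num.sqrt (1/4)))).
  by rewrite integral_cst; [rewrite !mulr_gt0 ?sqrtr_gt0//; lra|lra].
apply: integral_le; [exact: bounded_measurable_cst|by apply: bm; lra|move=> s hs].
by apply: ler_pM; rewrite ?sqrtr_ge0// ler_wsqrtr//; lra.
Qed.

Lemma sqrt_shift_continuous (X : R) : continuous (fun x : R => Num.sqrt (X - x)).
Proof.
move=> x; apply: (continuous_comp (f := fun s : R => X - s)); last exact: sqrt_continuous.
by apply: continuousB; [exact: cst_continuous|exact: cvg_id].
Qed.

Lemma sqrt_shift_continuous' (X : R) : continuous (fun x : R => Num.sqrt (x - X)).
Proof.
move=> x; apply: (continuous_comp (f := fun s : R => s - X)); last exact: sqrt_continuous.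
by apply: continuousB; [exact: cvg_id|exact: cst_continuous].
Qed.

(** The product whose integral over x equals a multiple of ((X - Z)_+)^2; it turns
    the square root in the Abel transform into a polynomial. *)
Definition kernel (X Z x : R) : R := Num.sqrt (X - x) * Num.sqrt (x - Z).

Lemma kernel_continuous X Z : continuous (kernel X Z).
Proof.
move=> x; exact: (continuousM (sqrt_shift_continuous (x := x)) (sqrt_shift_continuous' (x := x))).
Qed.

Lemma kernel_bound X Z M x (N : R) : X <= N -> Z < x < M -> `|kernel X Z x| <=
  Num.sqrt (N - Z) * Num.sqrt (M - Z).
Proof.
move=> XN xZM; rewrite /kernel normrM !ger0_norm ?sqrtr_ge0//.
by apply: ler_pM; rewrite ?sqrtr_ge0// ler_wsqrtr//; lra.
Qed.

Lemma kernel_bm X Z M : bounded_measurable Z M (kernel X Z).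
Proof.
apply: (@continuous_bounded_measurable _ _ _ _ (Num.sqrt (X - Z) * Num.sqrt (M - Z))) => x h.
  exact: kernel_continuous.
exact: (@kernel_bound X Z M x X).
Qed.

Lemma kernel_integral X Z M : X < M -> Z < M ->
  integral Z M (kernel X Z) = half_disc * (Num.max (X - Z) 0) ^+ 2.
Proof.
move=> XM ZM; have [XZ|ZX] := leP X Z.
  rewrite (_ : Num.max _ _ = 0); last by apply/max_idPr; lra.
  rewrite expr0n mulr0 (@integral_eq _ _ _ _ (fun=> 0)); first by rewrite integral_cst ?mul0r// ltW.
  by move=> x h; rewrite /kernel ler0_sqrtr ?mul0r//; lra.
rewrite (_ : Num.max _ _ = X - Z); last by apply/max_idPl; lra.
rewrite (@integral_split _ Z X M) ?ltW//; last exact: kernel_bm.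
rewrite [X in _ + X](_ : _ = 0) ?addr0; last first.
  rewrite (@integral_eq _ _ _ _ (fun=> 0)); first by rewrite integral_cst ?mul0r// ltW.
  by move=> x h; rewrite /kernel ler0_sqrtr ?mul0r//; lra.
have XZ0 : 0 < X - Z by rewrite subr_gt0.
transitivity (integral 0 1 (fun s => kernel X Z (Z + (X - Z) * s) * (X - Z))).
  apply: (@integral_substitution _ Z X 0 1 _ (fun s => Z + (X - Z) * s) (fun=> X - Z)
  (Num.sqrt (X - Z) * Num.sqrt (X - Z)) (X - Z)) => //.
  - by rewrite mulr0 addr0.
  - by rewrite mulr1; ring.
  - move=> s /andP[s0 s1]; apply/andP; split; first by rewrite ltrDl mulr_gt0.
    by rewrite -ltrBrDl -[ltRHS]mulr1 ltr_pM2l.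
  - by move=> s _; apply: is_derive_eq; rewrite /GRing.scale /=; ring.
  - by move=> s _; exact: cst_continuous.
  - by move=> s _; rewrite ger0_norm// ltW.
  - by move=> x y _ xy _; rewrite lerD2l ler_pM2l.
  - move=> x y _ xy _; rewrite (_ : _ - _ = (X - Z) * (y - x)); last by ring.
    by rewrite ger0_norm// mulr_ge0 ?subr_ge0// ltW.
  - by move=> s _; exact: kernel_continuous.
  - by move=> s h; exact: (@kernel_bound X Z X s X).
rewrite (@integral_eq _ _ _ _ (fun s => (X - Z) ^+ 2 * (Num.sqrt (1 - s) * Num.sqrt s))).
  rewrite integralZ; first by rewrite mulrC.
  apply: (@continuous_bounded_measurable _ _ _ _ 1) => x h.
    by apply: continuousM; [exact: sqrt_shift_continuous|exact: sqrt_continuous].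
  rewrite normrM !ger0_norm ?sqrtr_ge0// -[leRHS]mulr1.
  by apply: ler_pM; rewrite ?sqrtr_ge0// -[leRHS]sqrtr1 ler_wsqrtr//; lra.
move=> s /andP[s0 s1]; rewrite /kernel.
rewrite (_ : X - (Z + (X - Z) * s) = (X - Z) * (1 - s)); last by ring.
rewrite (_ : Z + (X - Z) * s - Z = (X - Z) * s); last by ring.
rewrite !sqrtrM ?ltW// -[in RHS](sqr_sqrtr (ltW XZ0)) -[X in _ * X = _](sqr_sqrtr (ltW XZ0)).
by ring.
Qed.

Definition bounded_profile (a b N : R) (rho : R -> R) : Prop :=
  [/\ 0 < a, a < b, (forall r, a < r < b -> {for r, continuous rho}) &
      (forall r, a < r < b -> 0 <= rho r <= N)].

Lemma rho2_bound a b N rho r : bounded_profile a b N rho -> a < r < b -> rho r ^+ 2 <= N ^+ 2.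
Proof. by move=> [_ _ _ rho_bound] /rho_bound/andP[h0 hN]; rewrite ler_sqr ?nnegrE//; exact: le_trans hN. Qed.

Lemma inv_continuous (a b r : R) : 0 < a -> a < r < b -> {for r, continuous (fun r : R => r^-1)}.
Proof. by move=> a0 h; apply: continuousV; [rewrite gt_eqF//; lra|exact: cvg_id]. Qed.

Lemma inv_bound (a b r : R) : 0 < a -> a < r < b -> `|r^-1| <= a^-1.
Proof.
move=> a0 h; have r0 : 0 < r by lra.
by rewrite ger0_norm ?invr_ge0 ?(ltW r0)// lef_pV2// ?posrE//; lra.
Qed.

Lemma inv_bounded_measurable (a b : R) : 0 < a -> bounded_measurable a b (fun r => r^-1).
Proof.
move=> a0; apply: (@continuous_bounded_measurable _ _ _ _ a^-1) => r h.
  exact: inv_continuous h.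
exact: inv_bound h.
Qed.

Lemma rho2_continuous a b N rho r : bounded_profile a b N rho -> a < r < b -> {for r, continuous (fun r => rho r ^+ 2)}.
Proof. by move=> [_ _ rho_cont _] h; apply: continuousM; exact: rho_cont. Qed.

Lemma abel_integrand_bm a b N rho x : bounded_profile a b N rho ->
  bounded_measurable a b (fun r => Num.sqrt (rho r ^+ 2 - x) / r).
Proof.
move=> hr; have [a0 ab _ _] := hr; apply: bounded_measurableM.
  apply: (@continuous_bounded_measurable _ _ _ _ (Num.sqrt (N ^+ 2 - x))) => r h.
    apply: (continuous_comp (f := fun r => rho r ^+ 2 - x)); last exact: sqrt_continuous.
    by apply: continuousB; [exact: rho2_continuous hr h|exact: cst_continuous].
  by rewrite ger0_norm ?sqrtr_ge0// ler_wsqrtr// lerD2r (rho2_bound hr h).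
apply: (@continuous_bounded_measurable _ _ _ _ a^-1) => r h; first exact: inv_continuous h.
exact: inv_bound h.
Qed.

Lemma abel_continuous a b N rho : bounded_profile a b N rho -> continuous (abel a b rho).
Proof.
move=> hr x; have [a0 ab _ _] := hr; have bm y := abel_integrand_bm y hr.
 apply/cvgrPdist_le => e e0.
have K0 : 0 < a^-1 * (b - a) by rewrite mulr_gt0 ?invr_gt0 ?subr_gt0.
have g0 : 0 < (e / (a^-1 * (b - a))) ^+ 2 by rewrite exprn_gt0// divr_gt0.
apply: (@dist_near _ x _ _ g0) => y xy; rewrite /abel -integralB; [|exact: bm|exact: bm].
have -> : e = (a^-1 * (e / (a^-1 * (b - a)))) * (b - a).
  by field; rewrite !gt_eqF ?subr_gt0.
apply: integral_norm_le; first exact: ltW.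
  exact: bounded_measurableB.
move=> r h; rewrite -mulrBl normrM mulrC; apply: ler_pM => //; first exact: inv_bound h.
apply: le_trans (sqrt_dist _ _) _.
rewrite (_ : _ - _ = y - x); last by ring.
have d0 : 0 <= e / (a^-1 * (b - a)) by rewrite divr_ge0// ltW.
rewrite (_ : e / _ = Num.sqrt ((e / (a^-1 * (b - a))) ^+ 2)); last first.
  by rewrite sqrtr_sqr ger0_norm.
by rewrite ler_wsqrtr// ltW.
Qed.

Lemma kernel_integral_continuous Z M : Z <= M ->
  continuous (fun X => integral Z M (kernel X Z)).
Proof.
move=> ZM X.
apply: (@integral_param_cvg _ _ (fun X => kernel X Z) Z M X
  (Num.sqrt (X + 1 - Z) * Num.sqrt (M - Z))).
  have : \forall Y \near X, Y < X + 1 by apply: lt_nbhsl; rewrite ltrDl.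
  apply: filterS => Y YX; split; first by have [] := kernel_bm Y Z M.
  by move=> x h; apply: (@kernel_bound Y Z M) => //; exact: ltW.
move=> x _; apply: cvgM; last exact: cvg_cst.
exact: (sqrt_shift_continuous' (X := x)).
Qed.

(** Exchange of the integrals over x and r: both sides vanish for M = Z and have the
    same derivative with respect to M. *)
Lemma abel_fubini a b N rho Z M : bounded_profile a b N rho -> Z < M ->
  integral Z M (fun x => abel a b rho x * Num.sqrt (x - Z)) =
  integral a b (fun r => integral Z M (kernel (rho r ^+ 2) Z) / r).
Proof.
move=> hr ZM; have [a0 ab _ _] := hr.
pose f x := abel a b rho x * Num.sqrt (x - Z).
have cf : continuous f.
  move=> x; exact: (continuousM (abel_continuous hr (x := x)) (sqrt_shift_continuous' (x := x))).
have bmf : bounded_measurable Z (M + 1) f by exact: continuousT_bounded_measurable.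
pose F M1 r := integral Z M1 (kernel (rho r ^+ 2) Z) / r.
pose C := Num.sqrt (N ^+ 2 - Z) * Num.sqrt (M + 1 - Z).
have C0 : 0 <= C by rewrite mulr_ge0 ?sqrtr_ge0.
have FC M1 r : Z < M1 -> M1 < M + 1 -> a < r < b -> `|F M1 r| <= (C / a) * (M1 - Z).
  move=> ZM1 M1M h; rewrite normrM mulrAC; apply: ler_pM => //; last exact: inv_bound h.
  apply: integral_norm_le; [exact: ltW|exact: kernel_bm|move=> x hx].
  apply: kernel_bound; first exact: rho2_bound hr h.
  by lra.
have bmF M1 : Z < M1 -> M1 < M + 1 -> bounded_measurable a b (F M1).
  move=> ZM1 M1M; apply: (@continuous_bounded_measurable _ _ _ _ (C / a * (M1 - Z))) => r h.
    apply: continuousM; last exact: inv_continuous h.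
    apply: (continuous_comp (f := fun r => rho r ^+ 2)
      (g := fun X => integral Z M1 (kernel X Z))).
      exact: rho2_continuous hr h.
    by apply: kernel_integral_continuous; exact: ltW.
  exact: FC.
have bmA x : bounded_measurable a b (fun r => Num.sqrt (rho r ^+ 2 - x) / r).
  exact: abel_integrand_bm hr.
have dG M1 : Z < M1 < M + 1 -> is_derive M1 1 (fun M1 => integral Z M1 f) (f M1).
  by move=> h; apply: (@integral_derive _ Z (M + 1)) => //; exact: cf.
have dG2 M1 : Z < M1 < M + 1 -> is_derive M1 1 (fun M1 => integral a b (F M1)) (f M1).
  move=> h.
  have -> : f M1 = integral a b (fun r => kernel (rho r ^+ 2) Z M1 / r).
    rewrite /f /abel mulrC -integralZ//; apply: integral_eq => r hr'.
    by rewrite /kernel mulrA [in RHS]mulrC [in RHS]mulrC; ring.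
  apply: (@integral_derive_under a b Z (M + 1) M1 F
    (fun M1 r => kernel (rho r ^+ 2) Z M1 / r) (C / a)) => //.
  - by move=> y /andP[y1 y2]; exact: bmF.
  - move=> y r hy h'.
    have D := @integral_derive _ Z (M + 1) _ y hy (kernel_bm (rho r ^+ 2) Z (M + 1))
      (@kernel_continuous (rho r ^+ 2) Z y).
    have -> : kernel (rho r ^+ 2) Z y / r = r^-1 * kernel (rho r ^+ 2) Z y by rewrite mulrC.
    rewrite (_ : F ^~ r = (fun M1 => r^-1 * integral Z M1 (kernel (rho r ^+ 2) Z))); last first.
      by apply/funext => M2; rewrite /F mulrC.
    by apply: is_derive_eq.
  - move=> y r hy h'; rewrite normrM; apply: ler_pM => //; last exact: inv_bound h'.
    by apply: (@kernel_bound _ _ (M + 1)) => //; exact: rho2_bound hr h'.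
have bA : exists2 B, 0 <= B & forall x, Z < x < M + 1 -> `|f x| <= B.
  have [_ [B hB]] := bmf; exists `|B| => // x /hB h; apply: le_trans h _; exact: ler_norm.
have [B B0 hB] := bA.
pose K := B + C / a * (b - a).
have K0 : 0 <= K by rewrite addr_ge0// mulr_ge0 ?subr_ge0 ?(ltW ab)// mulr_ge0// invr_ge0 ltW.
pose D M1 := integral Z M1 f - integral a b (F M1).
have DK M1 : Z < M1 < M + 1 -> `|D M1| <= K * (M1 - Z).
  move=> /andP[h1 h2]; apply: le_trans (ler_normB _ _) _; rewrite mulrDl lerD//.
    apply: integral_norm_le; [exact: ltW| |by move=> x hx; apply: hB; lra].
    by apply: bounded_measurable_sub bmf => //; exact: ltW.
  rewrite mulrAC; apply: integral_norm_le; [exact: ltW|exact: bmF|by move=> r; exact: FC].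
suff : D M = 0 by move=> /eqP; rewrite subr_eq0 => /eqP.
have Dc M1 : Z < M1 < M + 1 -> D M1 = D M.
  move=> h; apply: (@derive_eq0_constant _ D Z (M + 1)) => //; last lra.
  move=> z hz; rewrite -(subrr (f z)); apply: is_deriveB; [exact: dG|exact: dG2].
apply/eqP; rewrite -normr_le0; apply/ler_addgt0Pl => e e0; rewrite addr0.
pose h := Num.min (e / (K + 1)) (M - Z).
have h0 : 0 < h by rewrite lt_min subr_gt0 ZM andbT divr_gt0// ltr_wpDl.
have hM : h <= M - Z by rewrite ge_min lexx orbT.
have hZ : Z < Z + h < M + 1 by lra.
rewrite -(Dc _ hZ); apply: le_trans (DK _ hZ) _.
rewrite addrC addKr; apply: (@le_trans _ _ (K * (e / (K + 1)))).
  by rewrite ler_wpM2l// ge_min lexx.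
rewrite mulrA ler_pdivrMr ?ltr_wpDl// mulrC ler_wpM2l ?(ltW e0)//; lra.
Qed.

(** Integrating the transform against sqrt (x - Z) and evaluating the inner integral
    over x. *)
Lemma abel_square a b N rho1 rho2 xbar Z :
  bounded_profile a b N rho1 -> bounded_profile a b N rho2 ->
  (forall x, xbar < x -> abel a b rho1 x = abel a b rho2 x) -> xbar <= Z ->
  integral a b (fun r => (Num.max (rho1 r ^+ 2 - Z) 0) ^+ 2 / r) =
  integral a b (fun r => (Num.max (rho2 r ^+ 2 - Z) 0) ^+ 2 / r).
Proof.
move=> hr1 hr2 e xZ.
pose M := N ^+ 2 + `|Z| + 1.
have ZM : Z < M by rewrite /M; have := ler_norm Z; have := sqr_ge0 N; lra.
have key rho : bounded_profile a b N rho ->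
    integral a b (fun r => (Num.max (rho r ^+ 2 - Z) 0) ^+ 2 / r) =
    half_disc^-1 * integral Z M (fun x => abel a b rho x * Num.sqrt (x - Z)).
  move=> hr; have [a0 ab _ _] := hr; rewrite (abel_fubini hr ZM).
  rewrite -integralZ; last first.
    apply: bounded_measurableM; last exact: inv_bounded_measurable.
    apply: (@continuous_bounded_measurable _ _ _ _ (Num.sqrt (N ^+ 2 - Z) * Num.sqrt (M - Z) * (M - Z))) => r h.
      apply: (continuous_comp (f := fun r => rho r ^+ 2)
        (g := fun X => integral Z M (kernel X Z))).
        exact: rho2_continuous hr h.
      by apply: kernel_integral_continuous; exact: ltW.
    apply: integral_norm_le; [exact: ltW|exact: kernel_bm|move=> x hx].
    by apply: kernel_bound => //; exact: rho2_bound hr h.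
  apply: integral_eq => r h; rewrite kernel_integral//; last first.
    by have := rho2_bound hr h; rewrite /M; have := normr_ge0 Z; lra.
  by rewrite -mulrA mulKf// gt_eqF// half_disc_gt0.
have E : integral Z M (fun x => abel a b rho1 x * Num.sqrt (x - Z)) =
    integral Z M (fun x => abel a b rho2 x * Num.sqrt (x - Z)).
  by apply: integral_eq => x /andP[Zx _]; rewrite e//; exact: le_lt_trans Zx.
by rewrite (key _ hr1) E -(key _ hr2).
Qed.

(** Divided by 2 h^2, a continuous approximation of the indicator of X > 0: applied to
    rho^2 - Y it counts radii. *)
Definition second_difference (h X : R) : R :=
  (Num.max (X + h) 0) ^+ 2 - 2 * (Num.max X 0) ^+ 2 + (Num.max (X - h) 0) ^+ 2.

Lemma max_pos (X : R) : 0 <= X -> Num.max X 0 = X.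
Proof. by move=> ?; apply/max_idPl. Qed.

Lemma max_neg (X : R) : X <= 0 -> Num.max X 0 = 0.
Proof. by move=> ?; apply/max_idPr. Qed.

Lemma second_difference_hi h X : 0 <= h -> h <= X -> second_difference h X = 2 * h ^+ 2.
Proof. by move=> h0 hX; rewrite /second_difference !max_pos; [ring|lra|lra|lra]. Qed.

Lemma second_difference_lo h X : 0 <= h -> X <= - h -> second_difference h X = 0.
Proof.
move=> h0 hX; rewrite /second_difference !max_neg; [|lra|lra|lra].
by rewrite expr0n /= mulr0 subr0 addr0.
Qed.

Lemma second_difference_bound h X : 0 <= h -> 0 <= second_difference h X <= 2 * h ^+ 2.
Proof.
move=> h0; have hh := sqr_ge0 h.
have [X1|X1] := leP X (- h); first by rewrite second_difference_lo//; lra.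
have [X2|X2] := leP h X; first by rewrite second_difference_hi//; lra.
rewrite /second_difference (max_pos (X := X + h)); last lra.
rewrite (max_neg (X := X - h)); last lra.
have [X3|X3] := leP X 0; nra.
Qed.

(** For f the second difference of a monotone profile at a level, the integral grows
    with the set of radii above the level. *)
Lemma level_count a b c r1 r0 (f1 f2 : R -> R) :
  0 < a -> a < r1 -> r1 < r0 -> r0 < b -> 0 < c ->
  bounded_measurable a b (fun r => f1 r / r) ->
  bounded_measurable a b (fun r => f2 r / r) ->
  (forall r, a < r < b -> 0 <= f1 r) -> (forall r, r1 < r < b -> f1 r = c) ->
  (forall r, a < r < b -> f2 r <= c) -> (forall r, a < r < r0 -> f2 r = 0) ->
  integral a b (fun r => f2 r / r) < integral a b (fun r => f1 r / r).
Proof.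
move=> a0 ar1 r10 r0b c0 bf1 bf2 f10 f1c f2c f20.
have [r1b ar0] : r1 < b /\ a < r0 by split; [exact: lt_trans r0b|exact: lt_trans r10].
have bi (u v : R) : a <= u -> v <= b -> bounded_measurable u v (fun r => c * r^-1).
  move=> au vb; apply: bounded_measurableM; first exact: bounded_measurable_cst.
  exact: bounded_measurable_sub (inv_bounded_measurable b a0).
have lo : integral r1 b (fun r => c * r^-1) <= integral a b (fun r => f1 r / r).
  rewrite (integral_split (ltW ar1) (ltW r1b) bf1) -[leLHS]add0r; apply: lerD.
    apply: integral_ge0 => r hh.
    by rewrite mulr_ge0 ?invr_ge0// ?f10//; lra.
  apply: integral_le; [by apply: bi => //; exact: ltW| |by move=> r /f1c ->].
  by apply: bounded_measurable_sub bf1 => //; exact: ltW.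
have hi : integral a b (fun r => f2 r / r) <= integral r0 b (fun r => c * r^-1).
  rewrite (integral_split (ltW ar0) (ltW r0b) bf2) -[leRHS]add0r; apply: lerD.
    rewrite (@integral_eq _ _ _ _ (fun=> 0)); last by move=> r /f20 ->; rewrite mul0r.
    by rewrite integral_cst ?mul0r// ltW.
  apply: integral_le; [|by apply: bi => //; exact: ltW|move=> r hr].
    by apply: bounded_measurable_sub bf2 => //; exact: ltW.
  by rewrite ler_wpM2r ?invr_ge0 ?f2c//; lra.
apply: (le_lt_trans hi); apply: lt_le_trans lo.
rewrite [ltRHS](@integral_split _ _ r0)//; [|exact: ltW|exact: ltW|by apply: bi => //; exact: ltW].
rewrite ltrDr; apply: (@lt_le_trans _ _ (integral r1 r0 (fun=> c * b^-1))).
  rewrite integral_cst; last exact: ltW.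
  by rewrite !mulr_gt0 ?invr_gt0 ?subr_gt0//; lra.
apply: integral_le; [exact: bounded_measurable_cst|by apply: bi; apply: ltW|move=> r hr].
by rewrite ler_pM2l// lef_pV2 ?posrE; lra.
Qed.

Lemma second_difference_bounded_measurable a b N rho h Y : bounded_profile a b N rho ->
  0 <= h -> bounded_measurable a b (fun r => second_difference h (rho r ^+ 2 - Y) / r).
Proof.
move=> hr h0; apply: bounded_measurableM; last first.
  by apply: inv_bounded_measurable; case: hr.
have cmax k : continuous (fun X : R => (Num.max (X + k) 0) ^+ 2).
  have c : continuous (fun X : R => Num.max (X + k) 0).
    move=> X; apply: (continuous_comp (f := fun X : R => X + k) (g := fun X : R => Num.max X 0)).
      by apply: continuousD; [exact: cvg_id|exact: cst_continuous].
    by apply: continuous_max; [exact: cvg_id|exact: cst_continuous].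
  by move=> X; exact: (continuousM (c X) (c X)).
have cmax0 : continuous (fun X : R => (Num.max X 0) ^+ 2).
  have := cmax 0; rewrite (_ : (fun X => Num.max (X + 0) 0 ^+ 2) = (fun X => Num.max X 0 ^+ 2))//.
  by apply/funext => x; rewrite addr0.
have cd : continuous (second_difference h).
  move=> X; have c2 := continuousM (@cst_continuous R R 2 X) (cmax0 X).
  exact: (continuousD (continuousB (cmax h X) c2) (cmax (- h) X)).
apply: (@continuous_bounded_measurable _ _ _ _ (2 * h ^+ 2)) => r hr'.
  apply: (continuous_comp (f := fun r => rho r ^+ 2 - Y)
      (g := second_difference h)); last exact: cd.
  by apply: continuousB; [exact: rho2_continuous hr hr'|exact: cst_continuous].
by have /andP[d0 d1] := second_difference_bound (rho r ^+ 2 - Y) h0; rewrite ger0_norm.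
Qed.

Lemma abel_second_difference a b N rho1 rho2 xbar Y h :
  bounded_profile a b N rho1 -> bounded_profile a b N rho2 ->
  (forall x, xbar < x -> abel a b rho1 x = abel a b rho2 x) -> 0 <= h -> xbar <= Y - h ->
  integral a b (fun r => second_difference h (rho1 r ^+ 2 - Y) / r) =
  integral a b (fun r => second_difference h (rho2 r ^+ 2 - Y) / r).
Proof.
move=> hr1 hr2 e h0 xY; have [a0 _ _ _] := hr1.
have bq rho Z : bounded_profile a b N rho ->
    bounded_measurable a b (fun r => (Num.max (rho r ^+ 2 - Z) 0) ^+ 2 / r).
  move=> hr; apply: bounded_measurableM; last exact: inv_bounded_measurable.
  have c : forall r, a < r < b -> {for r, continuous (fun r => Num.max (rho r ^+ 2 - Z) 0)}.
    move=> r hh; apply: continuous_max; last exact: cst_continuous.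
    by apply: continuousB; [exact: rho2_continuous hr hh|exact: cst_continuous].
  apply: (@continuous_bounded_measurable _ _ _ _ ((Num.max (N ^+ 2 - Z) 0) ^+ 2)) => r hh.
    by apply: continuousM; exact: c.
  rewrite ger0_norm ?sqr_ge0// ler_sqr ?nnegrE ?[0 <= _]le_max ?lexx ?orbT//.
  have l := rho2_bound hr hh; have [X0|X0] := leP (rho r ^+ 2 - Z) 0.
    by rewrite le_max lexx orbT.
  by rewrite le_max lerD2r l.
have dE rho : bounded_profile a b N rho ->
    integral a b (fun r => second_difference h (rho r ^+ 2 - Y) / r) =
    integral a b (fun r => (Num.max (rho r ^+ 2 - (Y - h)) 0) ^+ 2 / r) -
    2 * integral a b (fun r => (Num.max (rho r ^+ 2 - Y) 0) ^+ 2 / r) +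
    integral a b (fun r => (Num.max (rho r ^+ 2 - (Y + h)) 0) ^+ 2 / r).
  move=> hr.
  have b1 := bq _ (Y - h) hr; have b2 := bq _ Y hr; have b3 := bq _ (Y + h) hr.
  have b4 := bounded_measurableM (bounded_measurable_cst a b 2) b2.
  have b5 := bounded_measurableB b1 b4.
  rewrite -(integralZ 2 b2) -(integralB b1 b4) -(integralD b5 b3).
  apply: integral_eq => r _; rewrite /second_difference.
  by rewrite opprB addrA opprD addrA [_ - Y + h]addrAC; ring.
have sq Z (xZ : xbar <= Z) := abel_square hr1 hr2 e xZ.
by rewrite (dE _ hr1) (dE _ hr2) !sq//; lra.
Qed.

(** Uniqueness in Abel's integral equation: the transform determines a monotone
    profile where it exceeds the threshold.  Integrating the transform against
    sqrt (x - Z) gives the integrals of ((rho^2 - Z)_+)^2 / r; their second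
    differences in Z count the radii where rho^2 > Z. *)
Lemma abel_injective_le a b N rho1 rho2 xbar r0 :
  bounded_profile a b N rho1 -> bounded_profile a b N rho2 ->
  (forall r s, a < r -> r <= s -> s < b -> rho1 r <= rho1 s) ->
  (forall r s, a < r -> r <= s -> s < b -> rho2 r <= rho2 s) ->
  (forall x, xbar < x -> abel a b rho1 x = abel a b rho2 x) ->
  a < r0 < b -> xbar < rho1 r0 ^+ 2 -> rho1 r0 <= rho2 r0.
Proof.
move=> hr1 hr2 inc1 inc2 e hr0 x1; have [a0 ab cr1 pos1] := hr1.
have [_ _ _ pos2] := hr2; have /andP[ar0 r0b] := hr0.
have le_sqr rho r s : bounded_profile a b N rho ->
    (forall r s, a < r -> r <= s -> s < b -> rho r <= rho s) ->
    a < r -> r <= s -> s < b -> rho r ^+ 2 <= rho s ^+ 2.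
  move=> [_ _ _ pos] inc ar rs sb; rewrite ler_sqr ?nnegrE ?inc//.
    by have /andP[] : 0 <= rho r <= N by apply: pos; rewrite ar; exact: le_lt_trans sb.
  by have /andP[] : 0 <= rho s <= N by apply: pos; rewrite sb andbT; exact: lt_le_trans rs.
have /andP[p1 _] := pos1 _ hr0; have /andP[p2 _] := pos2 _ hr0.
rewrite -ler_sqr ?nnegrE// leNgt; apply/negP => lt21.
(* If rho2 < rho1 at r0, the levels between Y - h and Y + h lie above the threshold
   and separate the two values. *)
pose Ya := Num.max xbar (rho2 r0 ^+ 2); pose Yb := rho1 r0 ^+ 2.
have Yab : Ya < Yb by rewrite gt_max x1.
have xYa : xbar <= Ya by rewrite le_max lexx.
have r2Ya : rho2 r0 ^+ 2 <= Ya by rewrite le_max lexx orbT.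
pose h := (Yb - Ya) / 4; pose Y := (Ya + Yb) / 2.
have h0 : 0 < h by rewrite /h; linarith.
have [YaY YYb] : Ya < Y - h /\ Y + h < Yb by rewrite /h /Y; split; linarith.
have hle := ltW h0.
have : \forall r \near r0, Y + h < rho1 r ^+ 2.
  exact: (cvgr_gt _ (rho2_continuous hr1 hr0)).
move=> /filterI/(_ (near_itv hr0))/near_dist[g g0 hg].
pose r1 := r0 - g / 2.
have [Y1 /andP[ar1 r1b]] : Y + h < rho1 r1 ^+ 2 /\ a < r1 < b.
  by apply: hg; rewrite /r1 addrAC subrr add0r normrN ger0_norm; clear -g0; lra.
have r10 : r1 < r0 by rewrite /r1; clear -g0; lra.
have := @level_count a b (2 * h ^+ 2) r1 r0 (fun r => second_difference h (rho1 r ^+ 2 - Y))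
  (fun r => second_difference h (rho2 r ^+ 2 - Y)) a0 ar1 r10 r0b.
rewrite (abel_second_difference hr1 hr2 e hle) ?ltxx; last by linarith.
move=> cnt; suff : false by [].
apply: cnt; [by rewrite mulr_gt0// exprn_gt0|exact: second_difference_bounded_measurable hr1 hle|
  exact: second_difference_bounded_measurable hr2 hle| | | |].
- by move=> r _; have /andP[] := second_difference_bound (rho1 r ^+ 2 - Y) hle.
- move=> r /andP[r1r rb]; apply: second_difference_hi => //.
  have := le_sqr _ _ _ hr1 inc1 ar1 (ltW r1r) rb; clear -Y1; lra.
- by move=> r _; have /andP[] := second_difference_bound (rho2 r ^+ 2 - Y) hle.
- move=> r /andP[ar rr0]; apply: second_difference_lo => //.
  have := le_sqr _ _ _ hr2 inc2 ar (ltW rr0) r0b; clear -YaY r2Ya; lra.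
Qed.

End AbelTransform.

(** * Legs and turning points *)

Section Turning.
Context {R : realType}.

(** The lower bound on the derivative makes the function onto the line, so that its
    inverse needs no domain. *)
Lemma increasing_inverse (G g : R -> R) (d : R) : 0 < d ->
  (forall w : R, is_derive w 1 G (g w)) -> (forall w, d <= g w) ->
  exists inv : R -> R, [/\ cancel inv G, cancel G inv &
    forall t : R, is_derive t 1 inv (g (inv t))^-1].
Proof.
move=> d0 dG gd.
have cG : continuous G by move=> w; exact: is_derive1_continuous (dG w).
have incG x y : x < y -> d * (y - x) <= G y - G x.
  move=> xy; have [||z _ ->] := @mean_value _ G g (x - 1) (y + 1) x y _ xy _ _.
  - by rewrite ltrBlDr ltrDl.
  - by rewrite ltrDl.
  by rewrite ler_wpM2r ?gd// subr_ge0 ltW.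
have surj t : exists w, G w = t.
  pose h := (`|t - G 0| + 1) / d.
  have h0 : 0 < h by rewrite divr_gt0// ltr_wpDl.
  have dh : d * h = `|t - G 0| + 1 by rewrite /h mulrC divfK// gt_eqF.
  have l1 : d * h <= G h - G 0 by rewrite -[X in d * X]subr0 incG.
  have l2 : d * h <= G 0 - G (- h).
    by rewrite -[X in d * X]opprK -[X in d * X]add0r incG// oppr_lt0.
  have hh : - h <= h by lra.
  have [|w _ e] := @IVT _ G (- h) h t hh (continuous_subspaceT cG); last by exists w.
  have := ler_norm (t - G 0); have := ler_norm (- (t - G 0)); rewrite normrN.
  move=> a1 a2; have l3 : G (- h) <= G h by lra.
  by rewrite (min_l l3) (max_r l3); lra.
have [inv invK] := choice surj.
have Kinv : cancel G inv.
  move=> w; apply/eqP; apply: contraT; rewrite neq_lt => /orP[l|l].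
  - have := incG _ _ l; rewrite invK subrr => h.
    have : 0 < d * (w - inv (G w)) by rewrite mulr_gt0// subr_gt0.
    by rewrite ltNge h.
  - have := incG _ _ l; rewrite invK subrr => h.
    have : 0 < d * (inv (G w) - w) by rewrite mulr_gt0// subr_gt0.
    by rewrite ltNge h.
exists inv; split => // t.
have gt0 : g (inv t) != 0 by rewrite gt_eqF// (lt_le_trans d0).
have nK : {near inv t, cancel G inv} by apply/nbhs_ballP; exists 1 => //= w _; exact: Kinv.
have nG : {near inv t, continuous G} by apply/nbhs_ballP; exists 1 => //= w _; exact: cG.
by have := is_derive_inverse nK nG (dG (inv t)) gt0; rewrite invK.
Qed.

Variables (rho rho1 : R -> R) (b m : R).

(** A leg with turning radius m is parametrized by w in [-1, 1] through its radius,
    a quadratic function of w: the square root at the turning point becomes smooth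
    in w. *)
Definition leg_radius (w : R) : R := m + (b - m) * w ^+ 2.

(** The positive factor by which rho^2 - p^2, with p = rho m, differs from w^2; its
    value at w = 0 is the limit. *)
Definition leg_slope (w : R) : R :=
  if w == 0 then 2 * (b - m) * rho m * rho1 m
  else (rho (leg_radius w) ^+ 2 - rho m ^+ 2) / w ^+ 2.

(** The radial momentum: the square root of rho^2 - p^2, negative on the way down. *)
Definition leg_root (w : R) : R := w * Num.sqrt (leg_slope w).

(** The derivative of leg_radius divided by leg_root; together they are regular at the
    turning point. *)
Definition leg_density (w : R) : R := 2 * (b - m) / Num.sqrt (leg_slope w).

(** The rate of change of time with respect to w. *)
Definition leg_time (w : R) : R := rho (leg_radius w) ^+ 2 * leg_density w / leg_radius w.

(** The rate of change of the polar angle with respect to w. *)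
Definition leg_angle (w : R) : R := rho m * leg_density w / leg_radius w.

Definition clamp (w : R) : R := Num.max (-1) (Num.min w 1).

End Turning.

Section TurningTheory.
Context {R : realType}.

(** A profile rho = r / c on the part ]x0, b[ of a layer with outer radius b, in
    which a ray with turning radius m stays.  The Herglotz condition is tp_pos1; it
    may degenerate at b, where only continuity is required. *)
Record turning_profile (rho rho1 : R -> R) (x0 b m : R) : Prop := TurningProfile {
  tp_x0 : 0 < x0;
  tp_m : x0 < m;
  tp_b : m < b;
  tp_derive : forall r, x0 < r < b -> is_derive r 1 rho (rho1 r);
  tp_pos1 : forall r, x0 < r < b -> 0 < rho1 r;
  tp_cont1 : forall r, x0 < r < b -> {for r, continuous rho1};
  tp_pos : forall r, x0 < r < b -> 0 < rho r;
  tp_left : rho r @[r --> b^'-] --> rho b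
}.

Variables (rho rho1 : R -> R) (x0 b m : R).
Hypothesis tp : turning_profile rho rho1 x0 b m.
Local Notation rad := (leg_radius b m).
Local Notation slope := (leg_slope rho rho1 b m).
Local Notation root := (leg_root rho rho1 b m).
Local Notation density := (leg_density rho rho1 b m).

Lemma clamp_id w : -1 <= w <= 1 -> clamp w = w :> R.
Proof.
by move=> /andP[w1 w2]; rewrite /clamp (min_l w2) max_r.
Qed.

Lemma clamp_itv (w : R) : -1 <= clamp w <= 1.
Proof.
rewrite /clamp le_max lexx /= ge_max ge_min lexx orbT andbT.
by rewrite (le_trans (lerN10 _)) ?ler01.
Qed.

Lemma clamp_continuous : continuous (@clamp R).
Proof.
move=> w; have c : {for w, continuous (fun w : R => Num.min w 1)}.
  by apply: continuous_min; [exact: cvg_id|exact: cst_continuous].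
exact: (continuous_max (@cst_continuous R R (-1) w) c).
Qed.

Lemma rho_increasing r s : x0 < r -> r < s -> s <= b -> rho r < rho s.
Proof.
move=> xr rs; rewrite le_eqVlt => /predU1P[sb|sb]; last first.
  exact: (derive_pos_increasing (tp_derive tp) (tp_pos1 tp)).
subst s; pose s := (r + b) / 2.
have [rs' sb] : r < s /\ s < b by move: rs; rewrite /s; lra.
apply: (@lt_le_trans _ _ (rho s)).
  exact: (derive_pos_increasing (tp_derive tp) (tp_pos1 tp)).
apply: (@cvgr_to_ge R b^'- _ R rho); first exact: tp_left tp.
near=> y; apply/ltW/(derive_pos_increasing (tp_derive tp) (tp_pos1 tp)).
- exact: lt_trans rs'.
- by near: y; exact: nbhs_left_gt.
- by near: y; exact: nbhs_left_lt.
Unshelve. all: by end_near. Qed.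

Lemma rho_gt0 r : x0 < r <= b -> 0 < rho r.
Proof.
move=> /andP[xr]; rewrite le_eqVlt => /predU1P[->|rb]; last by apply: (tp_pos tp); rewrite xr.
have [xm mb] := (tp_m tp, tp_b tp).
apply: lt_trans (rho_increasing xm mb (lexx b)); apply: (tp_pos tp); rewrite xm; exact: mb.
Qed.

Lemma rho_min_continuous r : x0 < r -> {for r, continuous (fun r => rho (Num.min r b))}.
Proof.
move=> xr; have [rb|br|rb] := ltgtP r b.
- have crho : {for r, continuous rho} by apply: is_derive1_continuous (tp_derive tp _); rewrite xr.
  have e : \forall s \near r, rho s = rho (Num.min s b).
    have := lt_nbhsl rb; apply: filterS => s sb.
    by rewrite min_l// ltW.
  rewrite /prop_for /continuous_at (min_l (ltW rb)).
  exact: (cvg_trans (near_eq_cvg e) crho).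
- rewrite /prop_for /continuous_at (min_r (ltW br)); apply: cvg_near_cst.
  have := lt_nbhsr br; apply: filterS => s bs.
  by rewrite min_r// ltW.
- subst r; rewrite /prop_for; apply/left_right_continuousP; split.
  + rewrite minxx; have e : \forall s \near b^'-, rho s = rho (Num.min s b).
      by near=> s; rewrite min_l// ltW//; near: s; exact: nbhs_left_lt.
    exact: (cvg_trans (near_eq_cvg e) (tp_left tp)).
  + rewrite minxx; apply: cvg_near_cst.
    by near=> s; rewrite min_r// ltW//; near: s; exact: nbhs_right_gt.
Unshelve. all: by end_near. Qed.

Lemma rad_itv (w : R) : -1 <= w <= 1 -> m <= rad w <= b.
Proof.
move=> hw; have mb := tp_b tp.
have w2 : 0 <= w ^+ 2 <= 1 by nra.
rewrite /leg_radius; nra.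
Qed.

Lemma rad_itv_oo (w : R) : -1 < w < 1 -> x0 < rad w < b.
Proof.
move=> hw; have [xm mb] := (tp_m tp, tp_b tp).
have w2 : 0 <= w ^+ 2 < 1 by nra.
rewrite /leg_radius; nra.
Qed.

Lemma rad_gt0 (w : R) : -1 <= w <= 1 -> 0 < rad w.
Proof.
move=> /rad_itv /andP[mr _]; apply: lt_le_trans mr.
exact: lt_trans (tp_x0 tp) (tp_m tp).
Qed.

Lemma rho_rad_gt0 (w : R) : -1 <= w <= 1 -> 0 < rho (rad w).
Proof.
move=> /rad_itv /andP[mr rb]; apply: rho_gt0; rewrite rb andbT.
exact: lt_le_trans (tp_m tp) mr.
Qed.

Lemma rho_m_gt0 : 0 < rho m.
Proof. by apply: rho_gt0; rewrite (tp_m tp) ltW// (tp_b tp). Qed.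

Lemma rho1_m_gt0 : 0 < rho1 m.
Proof. by apply: (tp_pos1 tp); rewrite (tp_m tp) (tp_b tp). Qed.

(** At w = 0 this is the Herglotz condition at the turning radius. *)
Lemma slope_gt0 (w : R) : -1 <= w <= 1 -> 0 < slope w.
Proof.
move=> hw; rewrite /leg_slope; case: eqVneq => [_|w0].
  by rewrite !mulr_gt0 ?rho_m_gt0 ?rho1_m_gt0// subr_gt0 (tp_b tp).
have /andP[_ rb] := rad_itv hw.
have mr : m < rad w.
  by rewrite /leg_radius ltrDl mulr_gt0 ?subr_gt0 ?(tp_b tp)// exprn_even_gt0.
have := rho_increasing (tp_m tp) mr rb; have := rho_m_gt0 => p0 l.
by rewrite divr_gt0 ?exprn_even_gt0// subr_gt0 ltr_pXn2r// nnegrE ltW// (lt_trans p0).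
Qed.

Lemma slope_even (w : R) : slope (- w) = slope w.
Proof. by rewrite /leg_slope /leg_radius oppr_eq0 sqrrN. Qed.

Lemma root_sqr (w : R) : -1 <= w <= 1 -> root w ^+ 2 = rho (rad w) ^+ 2 - rho m ^+ 2.
Proof.
move=> hw; rewrite /leg_root exprMn sqr_sqrtr ?(ltW (slope_gt0 hw))//.
rewrite /leg_slope; case: eqVneq => [->|w0].
  by rewrite /leg_radius expr0n /= mul0r mulr0 addr0 subrr.
by rewrite mulrC divfK// sqrf_eq0.
Qed.

Lemma rad_continuous : continuous rad.
Proof.
move=> w; have c := continuousM (@cst_continuous R R (b - m) w) (@exprn_continuous R 2 w).
exact: (continuousD (@cst_continuous R R m w) c).
Qed.

(** Composing with clamp makes the integrands continuous on the whole line, so that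
    they have global primitives and time has a global inverse. *)
Lemma rad_clamp_continuous : continuous (fun w => rad (clamp w)).
Proof. by move=> w; apply: continuous_comp; [exact: clamp_continuous|exact: rad_continuous]. Qed.

Lemma rho_rad_clamp_continuous : continuous (fun w => rho (rad (clamp w))).
Proof.
move=> w; rewrite (_ : (fun w => _) = (fun w => rho (Num.min (rad (clamp w)) b))); last first.
  by apply/funext => v; have /andP[_ rb] := rad_itv (clamp_itv v); rewrite min_l.
apply: (continuous_comp (f := fun w => rad (clamp w)) (g := fun r => rho (Num.min r b))).
  exact: rad_clamp_continuous.
apply: rho_min_continuous; have /andP[mr _] := rad_itv (clamp_itv w).
exact: lt_le_trans (tp_m tp) mr.
Qed.

Lemma clamp_near (w : R) : w != 0 -> \forall v \near w, clamp v != 0 :> R.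
Proof.
move=> w0; have c0 : clamp w != 0.
  rewrite /clamp; have [h1|h1] := leP w 1; last first.
    by rewrite max_r ?oner_eq0// (le_trans (lerN10 _)) ?ler01.
  by have [h2|h2] := leP w (-1); rewrite ?oppr_eq0 ?oner_eq0.
have a0 : 0 < `|clamp w| by rewrite normr_gt0.
near=> v; apply/negP => /eqP cv.
have : `|clamp w - clamp v| < `|clamp w|.
  by near: v; apply: (@cvgr_dist_lt _ _ _ (nbhs w) _ clamp (clamp w)) => //; exact: clamp_continuous.
by rewrite cv subr0 ltxx.
Unshelve. all: by end_near. Qed.

(** At w = 0 this is the differentiability of rho^2 at the turning radius. *)
Lemma slope_clamp_continuous : continuous (fun w => slope (clamp w)).
Proof.
move=> w; have [->|w0] := eqVneq w 0; last first.
  have e : \forall v \near w,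
      (rho (rad (clamp v)) ^+ 2 - rho m ^+ 2) / clamp v ^+ 2 = slope (clamp v).
    by apply: filterS (clamp_near w0) => v v0; rewrite /leg_slope (negbTE v0).
  have w0' := nbhs_singleton (clamp_near w0).
  rewrite /prop_for /continuous_at -(nbhs_singleton e); apply: cvg_trans (near_eq_cvg e) _.
  have cr := @rho_rad_clamp_continuous w.
  have cc := @clamp_continuous w.
  apply: cvgM.
    by apply: cvgB; [exact: (cvgM cr cr)|exact: cvg_cst].
  by apply: cvgV; [rewrite sqrf_eq0|exact: (cvgM cc cc)].
have c0 : clamp 0 = 0 :> R by apply: clamp_id; rewrite lerN10 ler01.
have [xm mb] := (tp_m tp, tp_b tp).
have dr : is_derive m 1 (fun r => rho r ^+ 2) (2 * rho m * rho1 m).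
  have h : is_derive m 1 rho (rho1 m) by apply: (tp_derive tp); rewrite xm mb.
  by apply: is_derive_eq; rewrite /GRing.scale /=; ring.
have [g [gE cg gm]] := (is_derive1_caratheodory _ _ _).1 dr.
have slopeE v : slope v = (b - m) * g (rad v).
  rewrite /leg_slope; case: eqVneq => [->|v0].
    by rewrite /leg_radius expr0n /= mulr0 addr0 gm; ring.
  by rewrite gE /leg_radius; field; rewrite v0.
rewrite /prop_for (_ : (fun w => slope (clamp w)) = (fun w => (b - m) * g (rad (clamp w)))); last first.
  by apply/funext => v.
have c : {for 0, continuous (fun w => g (rad (clamp w)))}.
  apply: (continuous_comp (f := fun w => rad (clamp w)) (g := g)).
    exact: rad_clamp_continuous.
  by rewrite c0 /leg_radius expr0n /= mulr0 addr0.
exact: (continuousM (@cst_continuous R R (b - m) 0) c).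
Qed.

Lemma density_gt0 (w : R) : -1 <= w <= 1 -> 0 < density w.
Proof.
by move=> hw; rewrite divr_gt0 ?sqrtr_gt0 ?slope_gt0// mulr_gt0// subr_gt0 (tp_b tp).
Qed.

Lemma sqrt_slope_clamp_continuous : continuous (fun w => Num.sqrt (slope (clamp w))).
Proof.
move=> w; apply: (continuous_comp (f := fun w => slope (clamp w))); last exact: sqrt_continuous.
exact: slope_clamp_continuous.
Qed.

Lemma root_clamp_continuous : continuous (fun w => root (clamp w)).
Proof.
by move=> w; exact: (continuousM (@clamp_continuous w) (@sqrt_slope_clamp_continuous w)).
Qed.

Lemma density_clamp_continuous : continuous (fun w => density (clamp w)).
Proof.
move=> w; have q0 : Num.sqrt (slope (clamp w)) != 0.
  by rewrite gt_eqF// sqrtr_gt0 slope_gt0 ?clamp_itv.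
have c : {for w, continuous (fun w => (Num.sqrt (slope (clamp w)))^-1)}.
  by apply: continuousV => //; exact: sqrt_slope_clamp_continuous.
exact: (continuousM (@cst_continuous R R (2 * (b - m)) w) c).
Qed.

Lemma rad_derive (w : R) : -1 < w < 1 -> is_derive w 1 rad (root w * density w).
Proof.
move=> hw; have s0 : 0 < slope w by apply: slope_gt0; lra.
rewrite /leg_root /leg_density.
have -> : w * Num.sqrt (slope w) * (2 * (b - m) / Num.sqrt (slope w)) = 2 * (b - m) * w.
  by field; rewrite gt_eqF// sqrtr_gt0.
rewrite /leg_radius; apply: is_derive_eq; rewrite /GRing.scale /=; ring.
Qed.

Lemma rho_rad_derive (w : R) : -1 < w < 1 ->
  is_derive w 1 (fun w => rho (rad w)) (rho1 (rad w) * (root w * density w)).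
Proof.
move=> hw; apply: (@is_derive1_comp _ rho rad); last exact: rad_derive.
by apply: (tp_derive tp); exact: rad_itv_oo.
Qed.

Lemma root_derive (w : R) : -1 < w < 1 ->
  is_derive w 1 root (rho (rad w) * rho1 (rad w) * density w).
Proof.
move=> hw; have hw' : -1 <= w <= 1 by lra.
have s0 := slope_gt0 hw'; have q0 : 0 < Num.sqrt (slope w) by rewrite sqrtr_gt0.
have [w0|w0] := eqVneq w 0.
  subst w; have r0 : rad 0 = m by rewrite /leg_radius expr0n /= mulr0 addr0.
  have E : rho (rad 0) * rho1 (rad 0) * density 0 = Num.sqrt (slope 0).
    have q0' : Num.sqrt (slope 0) != 0 by rewrite gt_eqF.
    rewrite r0 /leg_density; apply: (mulIf q0').
    rewrite -expr2 sqr_sqrtr ?(ltW s0)// mulrA divfK ?gt_eqF//.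
    by rewrite {1}/leg_slope eqxx; ring.
  rewrite E; apply/is_derive1_caratheodory; exists (fun w => Num.sqrt (slope w)); split => //.
    by move=> z; rewrite /leg_root mul0r !subr0 mulrC.
  have e : \forall v \near (0 : R), Num.sqrt (slope (clamp v)) = Num.sqrt (slope v).
    have : -1 < (0 : R) < 1 by rewrite ltrN10 ltr01.
    move=> /near_itv; apply: filterS => v vv; rewrite clamp_id//; lra.
  rewrite /prop_for /continuous_at -[slope 0](congr1 slope (clamp_id hw')).
  exact: (cvg_trans (near_eq_cvg e) (@sqrt_slope_clamp_continuous 0)).
pose S v := rho (rad v) ^+ 2 - rho m ^+ 2.
have SE v : -1 <= v <= 1 -> Num.sqrt (S v) = `|v| * Num.sqrt (slope v).
  move=> hv; rewrite /S -root_sqr// sqrtr_sqr /leg_root normrM.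
  by rewrite [in LHS](ger0_norm (sqrtr_ge0 _)).
have e : \forall v \near w, Num.sg w * Num.sqrt (S v) = root v.
  have sgw : \forall v \near w, Num.sg v = Num.sg w.
    move: w0; rewrite neq_lt => /orP[w0|w0].
      by apply: filterS (lt_nbhsl w0) => v v0; rewrite !ltr0_sg.
    by apply: filterS (lt_nbhsr w0) => v v0; rewrite !gtr0_sg.
  apply: filterS2 sgw (near_itv hw) => v <- hv.
  by rewrite SE; [rewrite mulrA -numEsg|lra].
apply: (near_eq_is_derive e).
have S0 : 0 < S w by rewrite /S -root_sqr// /leg_root exprn_even_gt0//= mulf_neq0// gt_eqF.
have dS : is_derive w 1 S (2 * rho (rad w) * (rho1 (rad w) * (root w * density w))).
  have h := rho_rad_derive hw.
  by apply: is_derive_eq; rewrite /GRing.scale /= subr0; ring.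
have dq := is_derive1_sqrt S0.
have dc := @is_derive1_comp _ Num.sqrt S w _ _ dq dS.
apply: (is_derive_eq (is_deriveZ (Num.sg w) dc)); rewrite /GRing.scale /=.
rewrite SE// /leg_root.
have -> : w * Num.sqrt (slope w) = Num.sg w * `|w| * Num.sqrt (slope w) by rewrite -numEsg.
have sw : Num.sg w * Num.sg w = 1 by rewrite -expr2 sqr_sg w0.
have nw : `|w| != 0 by rewrite normr_eq0.
transitivity ((Num.sg w * Num.sg w) * (rho (rad w) * rho1 (rad w) * density w)).
  by field; rewrite nw gt_eqF.
by rewrite sw mul1r.
Qed.

End TurningTheory.

(** * Legs parametrized by time *)

Section LegExists.
Context {R : realType}.
Implicit Types s t w : R.

(** A leg parametrized by time: wt t and th t are the parameter w and the angle at
    time t, T is the duration and D the aperture.  The functions are extended past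
    the ends of [0, T] by freezing the speeds at the ends. *)
Record leg_param (rho rho1 : R -> R) (b m : R) (wt th : R -> R) (T D : R) : Prop :=
  LegParam {
  lp_T : 0 < T;
  lp_wt : forall t : R, is_derive t 1 wt (leg_time rho rho1 b m (clamp (wt t)))^-1;
  lp_th : forall t : R, is_derive t 1 th
    (leg_angle rho rho1 b m (clamp (wt t)) / leg_time rho rho1 b m (clamp (wt t)));
  lp_wt0 : wt 0 = -1;
  lp_wtT : wt T = 1;
  lp_wtm : wt (T / 2) = 0;
  lp_th0 : th 0 = 0;
  lp_thT : th T = D;
  lp_odd : forall t : R, wt (T - t) = - wt t;
  lp_inv : exists tw : R -> R, [/\ cancel wt tw, cancel tw wt &
    forall w : R, is_derive w 1 tw (leg_time rho rho1 b m (clamp w))]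
}.

Definition leg_duration (rho rho1 : R -> R) (b m : R) : R :=
  2 * integral 0 1 (leg_time rho rho1 b m).

Definition leg_aperture (rho rho1 : R -> R) (b m : R) : R :=
  2 * integral 0 1 (leg_angle rho rho1 b m).

Lemma clampN (w : R) : clamp (- w) = - clamp w.
Proof.
rewrite /clamp; have [h1|h1] := leP w 1; have [h2|h2] := leP (- w) 1.
- by rewrite !max_r; lra.
- by rewrite (max_r (y := 1)) ?(max_l (x := -1)) ?opprK//; lra.
- by rewrite (max_l (x := -1)) ?(max_r (y := 1))//; lra.
- by lra.
Qed.

Lemma even_primitive (f : R -> R) : continuous f -> (forall w, f (- w) = f w) ->
  exists F : R -> R, [/\ forall w : R, is_derive w 1 F (f w), F 0 = 0,
    forall w, F (- w) = - F w & F 1 = integral 0 1 f].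
Proof.
move=> cf ef; have [F0 dF0] := primitive_exists cf.
pose F w := F0 w - F0 0.
have dF (w : R) : is_derive w 1 F (f w).
  by have h := dF0 w; apply: is_derive_eq; rewrite subr0.
have F00 : F 0 = 0 by rewrite /F subrr.
exists F; split => // [w|].
  suff : F w + F (- w) = F 0 + F (- 0) by rewrite oppr0 F00 addr0; lra.
  apply: (@derive_eq0_constant _ (fun w => F w + F (- w)) (- `|w| - 1) (`|w| + 1)).
  - move=> z _; have h1 := dF z; have h2 := dF (- z).
    have h3 : is_derive z 1 (fun z => - z) (-1 : R) by apply: is_derive_eq.
    have h4 := @is_derive1_comp _ F (fun z => - z) z _ _ h2 h3.
    apply: (is_derive_eq (is_deriveD h1 h4)).
    by rewrite ef mulrN1 subrr.
  - by have := ler_norm w; have := ler_norm (- w); rewrite normrN; lra.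
  - by have := normr_ge0 w; lra.
have [C hC] : exists C, forall x, 0 < x < 1 -> `|f x| <= C.
  by have [_ h] := continuousT_bounded_measurable 0 1 cf.
rewrite (@integral_fundamental _ 0 1 f F C); rewrite ?F00 ?subr0//.
  by move=> x _; exact: cf.
by apply: continuous_itvW => z _; exact: is_derive1_continuous (dF z).
Qed.

Variables (rho rho1 : R -> R) (x0 b m : R).
Hypothesis tp : turning_profile rho rho1 x0 b m.

Lemma leg_time_gt0 w : -1 <= w <= 1 -> 0 < leg_time rho rho1 b m w.
Proof.
move=> hw; rewrite /leg_time divr_gt0 ?(rad_gt0 tp hw)// mulr_gt0 ?(density_gt0 tp hw)//.
by rewrite exprn_gt0// (rho_rad_gt0 tp hw).
Qed.

Lemma leg_time_continuous : continuous (fun w => leg_time rho rho1 b m (clamp w)).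
Proof.
move=> w; have r0 : leg_radius b m (clamp w) != 0.
  by rewrite gt_eqF// (rad_gt0 tp)// clamp_itv.
have c : {for w, continuous (fun w => (leg_radius b m (clamp w))^-1)}.
  by apply: continuousV => //; exact: rad_clamp_continuous.
have cr := @rho_rad_clamp_continuous _ _ _ _ _ _ tp w.
exact: (continuousM (continuousM (continuousM cr cr) (density_clamp_continuous tp (x := w))) c).
Qed.

Lemma leg_angle_continuous : continuous (fun w => leg_angle rho rho1 b m (clamp w)).
Proof.
move=> w; have r0 : leg_radius b m (clamp w) != 0.
  by rewrite gt_eqF// (rad_gt0 tp)// clamp_itv.
have c : {for w, continuous (fun w => (leg_radius b m (clamp w))^-1)}.
  by apply: continuousV => //; exact: rad_clamp_continuous.
exact: (continuousM (continuousM (@cst_continuous R R (rho m) w)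
  (density_clamp_continuous tp (x := w))) c).
Qed.

Lemma leg_radiusN w : leg_radius b m (- w) = leg_radius b m w.
Proof. by rewrite /leg_radius sqrrN. Qed.

Lemma leg_densityN w : leg_density rho rho1 b m (- w) = leg_density rho rho1 b m w.
Proof. by rewrite /leg_density slope_even. Qed.

(** Time is a primitive of leg_time in w; its inverse gives the parameter as a
    function of time. *)
Lemma leg_exists : exists wt th : R -> R,
  leg_param rho rho1 b m wt th (leg_duration rho rho1 b m) (leg_aperture rho rho1 b m).
Proof.
pose f w := leg_time rho rho1 b m (clamp w).
pose g w := leg_angle rho rho1 b m (clamp w).
have ef w : f (- w) = f w.
  by rewrite /f /leg_time clampN leg_radiusN leg_densityN.
have eg w : g (- w) = g w.
  by rewrite /g /leg_angle clampN leg_radiusN leg_densityN.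
have [F [dF F0 FN F1]] := even_primitive leg_time_continuous ef.
have [G [dG G0 GN G1]] := even_primitive leg_angle_continuous eg.
have clamp01 (w : R) : 0 < w < 1 -> clamp w = w by move=> hw; apply: clamp_id; lra.
have {}F1 : F 1 = integral 0 1 (leg_time rho rho1 b m).
  by rewrite F1; apply: integral_eq => w /clamp01 ->.
have {}G1 : G 1 = integral 0 1 (leg_angle rho rho1 b m).
  by rewrite G1; apply: integral_eq => w /clamp01 ->.
have m11 : -1 <= 1 :> R by rewrite (le_trans (lerN10 _)) ?ler01.
have [c hc cmin] := EVT_min m11 (continuous_subspaceT leg_time_continuous).
have d0 : 0 < f c by apply: leg_time_gt0; exact: clamp_itv.
have clampK (w : R) : clamp (clamp w) = clamp w by apply: clamp_id; exact: clamp_itv.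
have fd w : f c <= f w.
  have := cmin (clamp w); rewrite -/(f _) /f clampK; apply.
  by rewrite in_itv /=; exact: clamp_itv.
have [inv [invK Kinv dinv]] := increasing_inverse d0 dF fd.
have Fpos : 0 < F 1.
  have [||z _ e] := @mean_value _ F f (-1) 2 0 1 _ ltr01 _ (fun z _ => dF z); try lra.
  by move: e; rewrite F0 !subr0 mulr1 => ->; apply: lt_le_trans (fd z).
pose wt t := inv (t - F 1); pose th t := G (wt t) + G 1.
have dwt (t : R) : is_derive t 1 wt (f (wt t))^-1.
  have h1 : is_derive t 1 (fun t => t - F 1) 1 by apply: is_derive_eq; rewrite subr0.
  have h := @is_derive1_comp _ inv (fun t => t - F 1) t _ _ (dinv _) h1.
  by apply: (is_derive_eq h); rewrite mulr1.
exists wt, th; split.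
- by rewrite /leg_duration -F1 mulr_gt0.
- exact: dwt.
- move=> t; have h := @is_derive1_comp _ G wt t _ _ (dG (wt t)) (dwt t).
  by apply: is_derive_eq; rewrite addr0.
- by rewrite /wt sub0r -FN Kinv.
- by rewrite /wt /leg_duration -F1 (_ : 2 * F 1 - F 1 = F 1) ?Kinv//; ring.
- by rewrite /wt /leg_duration -F1 (_ : 2 * F 1 / 2 - F 1 = F 0) ?Kinv// F0; field.
- by rewrite /th /wt sub0r -FN Kinv GN addrC subrr.
- rewrite /th /wt /leg_duration -F1 (_ : 2 * F 1 - F 1 = F 1) ?Kinv; last by ring.
  by rewrite /leg_aperture -G1; ring.
- move=> t; rewrite /wt /leg_duration -F1 -[RHS]Kinv FN invK.
  by congr inv; ring.
- exists (fun w => F w + F 1); split => [t|w|w].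
  + by rewrite /wt invK subrK.
  + by rewrite /wt addrK Kinv.
  + apply: (is_derive_eq (is_deriveD (dF w) (is_derive_cst (F 1) w 1))).
    by rewrite addr0.
Qed.

Variables (wt th : R -> R) (T D : R).
Hypothesis lp : leg_param rho rho1 b m wt th T D.

Lemma wt_increasing s t : s < t -> wt s < wt t.
Proof.
move=> st; apply: (@derive_pos_increasing _ wt (fun t => (leg_time rho rho1 b m (clamp (wt t)))^-1)
  (s - 1) (t + 1)) => //.
- by move=> z _; exact: (lp_wt lp).
- by move=> z _; rewrite invr_gt0 leg_time_gt0// clamp_itv.
- by rewrite ltrBlDr ltrDl.
- by rewrite ltrDl.
Qed.

Lemma wt_itv t : 0 < t < T -> -1 < wt t < 1.
Proof.
move=> /andP[t0 tT]; rewrite -{1}(lp_wt0 lp) -(lp_wtT lp).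
by rewrite !wt_increasing.
Qed.

Lemma wt_continuous : continuous wt.
Proof. by move=> t; exact: is_derive1_continuous (lp_wt lp t). Qed.

Definition traj_radius t := leg_radius b m (clamp (wt t)).
Definition traj_root t := leg_root rho rho1 b m (clamp (wt t)).

Lemma traj_radius_itv t : m <= traj_radius t <= b.
Proof. exact: (rad_itv tp (clamp_itv _)). Qed.

Lemma traj_radius_oo t : 0 < t < T -> m <= traj_radius t /\ x0 < traj_radius t < b.
Proof.
move=> /wt_itv ht; have := traj_radius_itv t; rewrite /traj_radius clamp_id; last lra.
by move=> /andP[h _]; split => //; exact: (rad_itv_oo tp).
Qed.

Lemma traj_radius_continuous : continuous traj_radius.
Proof.
move=> t; apply: (continuous_comp (f := wt) (g := fun w => leg_radius b m (clamp w))).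
  exact: wt_continuous.
exact: rad_clamp_continuous.
Qed.

Lemma traj_root_continuous : continuous traj_root.
Proof.
move=> t; apply: (continuous_comp (f := wt) (g := fun w => leg_root rho rho1 b m (clamp w))).
  exact: wt_continuous.
exact: (root_clamp_continuous tp).
Qed.

Lemma traj_rho_continuous : continuous (fun t => rho (traj_radius t)).
Proof.
move=> t; apply: (continuous_comp (f := wt) (g := fun w => rho (leg_radius b m (clamp w)))).
  exact: wt_continuous.
exact: (rho_rad_clamp_continuous tp).
Qed.

Lemma traj_rho_gt0 t : 0 < rho (traj_radius t).
Proof. exact: (rho_rad_gt0 tp (clamp_itv _)). Qed.

Lemma traj_radius_gt0 t : 0 < traj_radius t.
Proof. exact: (rad_gt0 tp (clamp_itv _)). Qed.

Lemma traj_root_sqr t : traj_root t ^+ 2 = rho (traj_radius t) ^+ 2 - rho m ^+ 2.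
Proof. exact: (root_sqr tp (clamp_itv _)). Qed.

Lemma clamp_wt_near t : 0 < t < T -> \forall s \near t, wt s = clamp (wt s).
Proof.
move=> /near_itv; apply: filterS => s /wt_itv hs; rewrite clamp_id//; lra.
Qed.

Lemma traj_radius_derive t : 0 < t < T ->
  is_derive t 1 traj_radius (traj_radius t * traj_root t / rho (traj_radius t) ^+ 2).
Proof.
move=> ht; have hw := wt_itv ht; have e := clamp_wt_near ht; have et := nbhs_singleton e.
have h := @is_derive1_comp _ (leg_radius b m) wt t _ _ (rad_derive tp hw) (lp_wt lp t).
apply: (near_eq_is_derive (f := leg_radius b m \o wt)).
  by apply: filterS e => s es; rewrite /traj_radius -es.
apply: (is_derive_eq h); rewrite /traj_radius /traj_root -et /leg_time.
have hw' : -1 <= wt t <= 1 by lra.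
by field; rewrite !gt_eqF ?(rad_gt0 tp hw') ?(density_gt0 tp hw') ?(rho_rad_gt0 tp hw').
Qed.

Lemma traj_root_derive t : 0 < t < T -> is_derive t 1 traj_root
  (traj_radius t * rho1 (traj_radius t) / rho (traj_radius t)).
Proof.
move=> ht; have hw := wt_itv ht; have e := clamp_wt_near ht; have et := nbhs_singleton e.
have h := @is_derive1_comp _ (leg_root rho rho1 b m) wt t _ _ (root_derive tp hw) (lp_wt lp t).
apply: (near_eq_is_derive (f := leg_root rho rho1 b m \o wt)).
  by apply: filterS e => s es; rewrite /traj_root -es.
apply: (is_derive_eq h); rewrite /traj_radius -et /leg_time.
have hw' : -1 <= wt t <= 1 by lra.
by field; rewrite !gt_eqF ?(rad_gt0 tp hw') ?(density_gt0 tp hw') ?(rho_rad_gt0 tp hw').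
Qed.

Lemma traj_angle_derive (t : R) : is_derive t 1 th (rho m / rho (traj_radius t) ^+ 2).
Proof.
apply: (is_derive_eq (lp_th lp t)); rewrite /traj_radius /leg_time /leg_angle.
have hw := clamp_itv (wt t).
by field; rewrite !gt_eqF ?(rad_gt0 tp hw) ?(density_gt0 tp hw) ?(rho_rad_gt0 tp hw).
Qed.

Lemma traj_radius0 : traj_radius 0 = b.
Proof.
rewrite /traj_radius (lp_wt0 lp) clamp_id ?lexx ?(le_trans (lerN10 _)) ?ler01//.
by rewrite /leg_radius sqrrN expr1n mulr1 addrC subrK.
Qed.

Lemma traj_radiusT : traj_radius T = b.
Proof.
rewrite /traj_radius (lp_wtT lp) clamp_id ?lexx ?(le_trans (lerN10 _)) ?ler01//.
by rewrite /leg_radius expr1n mulr1 addrC subrK.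
Qed.

Lemma traj_radius_mid : traj_radius (T / 2) = m.
Proof.
rewrite /traj_radius (lp_wtm lp) clamp_id ?lerN10 ?ler01//.
by rewrite /leg_radius expr0n /= mulr0 addr0.
Qed.

End LegExists.

(** * Rays in a plane and periodic billiards *)

Section PlaneCurves.
Context {R : realType} {n : nat}.
Implicit Types (a b u x y : R).

Lemma is_derive_cvg (V : normedModType R) (f : R -> V) (t : R) (l : V) :
  (h^-1 *: (f (h + t) - f t) @[h --> 0^'] --> l) <-> is_derive t 1 f l.
Proof.
have E : (fun h => h^-1 *: ((f \o shift t) (h *: (1 : R)) - f t)) =
    (fun h => h^-1 *: (f (h + t) - f t)).
  by apply/funext => h /=; rewrite /GRing.scale /= mulr1.
split=> [h|[d e]].
  have h' : h^-1 *: ((f \o shift t) (h *: (1 : R)) - f t) @[h --> 0^'] --> l by rewrite E.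
  by apply: DeriveDef; [apply/cvg_ex; exists l|exact: cvg_lim].
by move: d; rewrite /derivable /= E -e /derive E.
Qed.

Lemma is_derive_scalel (V : normedModType R) (X : R -> R) (e : V) (t X1 : R) :
  is_derive t 1 X X1 -> is_derive t 1 (fun t => X t *: e) (X1 *: e).
Proof.
move=> /is_derive_cvg h; apply/is_derive_cvg.
rewrite (_ : (fun h => _) = (fun h => (h^-1 *: (X (h + t) - X t)) *: e)).
  exact: cvgZr_tmp.
by apply/funext => k; rewrite -scalerA scalerBl.
Qed.

Lemma dotpC (x y : 'rV[R]_n) : dotp x y = dotp y x.
Proof. by apply: eq_bigr => i _; rewrite mulrC. Qed.

Lemma dotpDl (x y z : 'rV[R]_n) : dotp (x + y) z = dotp x z + dotp y z.
Proof. by rewrite -big_split; apply: eq_bigr => i _; rewrite mxE mulrDl. Qed.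

Lemma dotpZl a (x z : 'rV[R]_n) : dotp (a *: x) z = a * dotp x z.
Proof. by rewrite mulr_sumr; apply: eq_bigr => i _; rewrite mxE mulrA. Qed.

Lemma dotpDr (x y z : 'rV[R]_n) : dotp z (x + y) = dotp z x + dotp z y.
Proof. by rewrite dotpC dotpDl !(dotpC z). Qed.

Lemma dotpZr a (x z : 'rV[R]_n) : dotp z (a *: x) = a * dotp z x.
Proof. by rewrite dotpC dotpZl dotpC. Qed.

Variables e1 e2 : 'rV[R]_n.
Hypotheses (e11 : dotp e1 e1 = 1) (e22 : dotp e2 e2 = 1) (e12 : dotp e1 e2 = 0).

(** The vector with components a, b in the frame (e1, e2) rotated by theta. *)
Definition frame a b theta : 'rV[R]_n :=
  (a * cos theta - b * sin theta) *: e1 + (a * sin theta + b * cos theta) *: e2.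

Lemma frame_dotp a b a' b' theta :
  dotp (frame a b theta) (frame a' b' theta) = a * a' + b * b'.
Proof.
rewrite /frame !(dotpDl, dotpDr, dotpZl, dotpZr) e11 e22 (dotpC e2) e12.
have := cos2Dsin2 theta; move: (cos theta) (sin theta) => C S CS.
by transitivity ((a * a' + b * b') * (C ^+ 2 + S ^+ 2)); [ring|rewrite CS mulr1].
Qed.

Lemma frame_enorm a b theta : enorm (frame a b theta) = Num.sqrt (a ^+ 2 + b ^+ 2).
Proof. by rewrite /enorm frame_dotp. Qed.

Lemma frame_radius a theta : 0 <= a -> enorm (frame a 0 theta) = a.
Proof. by move=> a0; rewrite frame_enorm expr0n /= addr0 sqrtr_sqr ger0_norm. Qed.

Lemma frameZ k a b theta : k *: frame a b theta = frame (k * a) (k * b) theta.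
Proof. by rewrite /frame scalerDr !scalerA; congr (_ *: _ + _ *: _); ring. Qed.

Lemma frameD a b a' b' theta :
  frame a b theta + frame a' b' theta = frame (a + a') (b + b') theta.
Proof.
by rewrite /frame addrACA -!scalerDl; congr (_ *: _ + _ *: _); ring.
Qed.

Lemma frameB a b a' b' theta :
  frame a b theta - frame a' b' theta = frame (a - a') (b - b') theta.
Proof. by rewrite -scaleN1r frameZ frameD !mulN1r. Qed.

Lemma frame_neq0 a b theta : a != 0 -> frame a b theta != 0.
Proof.
move=> a0; apply/eqP => e; have := frame_dotp a b a b theta; rewrite e -(scale0r e1) dotpZl mul0r.
have : 0 < a ^+ 2 by rewrite exprn_even_gt0.
by rewrite -!expr2; have := sqr_ge0 b; lra.
Qed.

Lemma frame_derive (A B th : R -> R) (t A1 B1 w : R) :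
  is_derive t 1 A A1 -> is_derive t 1 B B1 -> is_derive t 1 th w ->
  is_derive t 1 (fun t => frame (A t) (B t) (th t)) (frame (A1 - B t * w) (B1 + A t * w) (th t)).
Proof.
move=> dA dB dth.
have dc : is_derive t 1 (fun t => cos (th t)) (- sin (th t) * w).
  by apply: (@is_derive1_comp _ cos th).
have ds : is_derive t 1 (fun t => sin (th t)) (cos (th t) * w).
  by apply: (@is_derive1_comp _ sin th).
apply: (is_derive_eq (is_deriveD (is_derive_scalel e1 _) (is_derive_scalel e2 _))).
rewrite /frame; congr (_ *: _ + _ *: _); rewrite /GRing.scale /=; ring.
Qed.

Lemma frame_cvg (T : Type) (F : set_system T) (FF : Filter F) (A B th : T -> R) (a b theta : R) :
  A @ F --> a -> B @ F --> b -> th @ F --> theta ->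
  frame (A t) (B t) (th t) @[t --> F] --> frame a b theta.
Proof.
move=> cA cB cth.
have cc : cos (th t) @[t --> F] --> cos theta by apply: continuous_cvg => //; exact: continuous_cos.
have cs : sin (th t) @[t --> F] --> sin theta by apply: continuous_cvg => //; exact: continuous_sin.
apply: cvgD; apply: cvgZr_tmp.
- by apply: cvgB; exact: cvgM.
- by apply: cvgD; exact: cvgM.
Qed.

Lemma frame_continuous (A B th : R -> R) : continuous A -> continuous B -> continuous th ->
  continuous (fun t => frame (A t) (B t) (th t)).
Proof. by move=> cA cB cth t; apply: frame_cvg; [exact: cA|exact: cB|exact: cth]. Qed.

Lemma frame_accel (c : R -> R) a b a' b' theta :
  accel c (frame a b theta) (frame a' b' theta) =
  let s := Num.sqrt (a ^+ 2 + b ^+ 2) in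
  let q := derive1 c s / (c s * s) in
  frame (q * (2 * (a * a' + b * b') * a' - (a' ^+ 2 + b' ^+ 2) * a))
        (q * (2 * (a * a' + b * b') * b' - (a' ^+ 2 + b' ^+ 2) * b)) theta.
Proof.
by rewrite /accel frame_enorm !frame_dotp !frameZ frameB frameZ -!expr2.
Qed.

Lemma cos_sin_full_turns (N : nat) : cos (2 * pi * N%:R) = 1 :> R /\ sin (2 * pi * N%:R) = 0 :> R.
Proof.
have -> : 2 * pi * N%:R = 0 + (pi *+ 2) *+ N :> R.
  by rewrite add0r -[(pi *+ 2) *+ N]mulr_natr -[pi *+ 2]mulr_natl.
by rewrite (periodicn (@cosD2pi R)) (periodicn (@sinD2pi R)) cos0 sin0.
Qed.

Lemma frame_full_turns a b (N : nat) : frame a b (2 * pi * N%:R) = frame a b 0.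
Proof. by rewrite /frame; have [-> ->] := cos_sin_full_turns N; rewrite cos0 sin0. Qed.

End PlaneCurves.

Section Tangential.
Context {R : realType} {n : nat}.
Variables e1 e2 : 'rV[R]_n.
Hypotheses (e11 : dotp e1 e1 = 1) (e22 : dotp e2 e2 = 1) (e12 : dotp e1 e2 = 0).

(** In the rotating frame the component tangential to the sphere is the angular one,
    so reflection preserves it as long as the momentum does not change. *)
Lemma frame_tangential (r a b theta : R) : r != 0 ->
  tangential (frame e1 e2 r 0 theta) (frame e1 e2 a b theta) = frame e1 e2 0 b theta.
Proof.
move=> r0; rewrite /tangential !frame_dotp// frameZ frameB; congr frame; last by ring.
by field.
Qed.

End Tangential.

Section PolarRays.
Context {R : realType} {n : nat}.
Variables e1 e2 : 'rV[R]_n.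
Hypotheses (e11 : dotp e1 e1 = 1) (e22 : dotp e2 e2 = 1) (e12 : dotp e1 e2 = 0).

(** Hamilton's equations for the radius r, the angle th and the radial momentum sg of
    a ray with angular momentum p, at one time t. *)
Record ray_equations (rho rho1 : R -> R) (p : R) (r th sg : R -> R) (t : R) : Prop :=
  RayEquations {
  re_r : is_derive t 1 r (r t * sg t / rho (r t) ^+ 2);
  re_th : is_derive t 1 th (p / rho (r t) ^+ 2);
  re_sg : is_derive t 1 sg (r t * rho1 (r t) / rho (r t));
  re_sqr : sg t ^+ 2 = rho (r t) ^+ 2 - p ^+ 2;
  re_r_gt0 : 0 < r t;
  re_rho_gt0 : 0 < rho (r t);
  re_rho : is_derive (r t) 1 rho (rho1 (r t))
}.

(** The speed is recovered from rho = r / c; the geodesic equation involves only its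
    value and its derivative along the ray. *)
Definition speed_of (rho rho1 : R -> R) (c : R -> R) (x : R) : Prop :=
  c x = x / rho x /\ is_derive x 1 c ((rho x)^-1 - x * rho1 x / rho x ^+ 2).

Variables (c rho rho1 : R -> R) (p s t : R) (r th sg : R -> R).
Hypothesis eqs : forall u, s < u < t -> ray_equations rho rho1 p r th sg u.
Hypothesis speed : forall u, s < u < t -> speed_of rho rho1 c (r u).

Definition ray_position u := frame e1 e2 (r u) 0 (th u).
Definition ray_velocity u :=
  frame e1 e2 (r u * sg u / rho (r u) ^+ 2) (r u * p / rho (r u) ^+ 2) (th u).

Lemma ray_position_derive u : s < u < t -> is_derive u 1 ray_position (ray_velocity u).
Proof.
move=> /eqs e; have h := frame_derive e1 e2 (re_r e) (is_derive_cst (0 : R) u 1) (re_th e).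
by apply: (is_derive_eq h); rewrite /ray_velocity /cst; congr frame; ring.
Qed.

Lemma ray_derive1 u : s < u < t -> derive1 ray_position u = ray_velocity u.
Proof. by move=> /ray_position_derive h; rewrite derive1E; exact: derive_val. Qed.

(** The geodesic equation in polar coordinates reduces to conservation of the angular
    momentum and of the energy sg^2 + p^2 = rho^2. *)
Lemma ray_velocity_derive u : s < u < t ->
  is_derive u 1 ray_velocity (accel c (ray_position u) (ray_velocity u)).
Proof.
move=> hu; have e := eqs hu; have [cE dc] := speed hu.
have r0 := re_r_gt0 e; have rho0 := re_rho_gt0 e.
have rho0' : rho (r u) != 0 by rewrite gt_eqF.
have d1 := re_r e; have d2 := re_sg e; have d3 := re_rho e.
have d4 : is_derive u 1 (rho \o r) _ := @is_derive1_comp _ rho r u _ _ d3 d1.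
have d5 : is_derive u 1 (fun u => rho (r u) ^+ 2) (2 * rho (r u) * (rho1 (r u) * (r u * sg u / rho (r u) ^+ 2))).
  by have h := is_deriveM d4 d4; apply: (is_derive_eq h); rewrite /GRing.scale /=; ring.
have rho2 : rho (r u) ^+ 2 != 0 by rewrite expf_neq0.
have d6 := @is_deriveV R (fun u => rho (r u) ^+ 2) u _ 1 rho2 d5.
have h1 := is_deriveM (is_deriveM d1 d2) d6.
have h2 := is_deriveM (is_deriveM d1 (is_derive_cst p u 1)) d6.
apply: (is_derive_eq (frame_derive e1 e2 h1 h2 (re_th e))).
rewrite /ray_position /ray_velocity frame_accel//=.
rewrite expr0n /= addr0 sqrtr_sqr ger0_norm ?ltW//.
have -> : derive1 c (r u) = (rho (r u))^-1 - r u * rho1 (r u) / rho (r u) ^+ 2.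
  by rewrite derive1E; exact: derive_val.
have q := re_sqr e.
have n0 : r u != 0 by rewrite gt_eqF.
rewrite cE /GRing.scale !fctE /cst /=; move: (r u) (rho (r u)) (rho1 (r u)) (sg u) q n0 rho0'.
move=> x y z w q x0 y0; congr frame.
- apply: subr0_eq; transitivity (x ^+ 2 * z / y ^+ 5 * (y ^+ 2 - p ^+ 2 - w ^+ 2)).
    by field; rewrite x0 y0.
  by rewrite q; ring.
- by field; rewrite x0 y0.
Qed.

Lemma ray_speed u : s < u < t -> enorm (ray_velocity u) = c (r u).
Proof.
move=> hu; have e := eqs hu; have [cE _] := speed hu.
have r0 := re_r_gt0 e; have rho0 := re_rho_gt0 e; have q := re_sqr e.
rewrite /ray_velocity frame_enorm// cE -[RHS]ger0_norm; last by rewrite divr_ge0 ?ltW.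
rewrite -sqrtr_sqr; congr Num.sqrt.
transitivity (r u ^+ 2 / rho (r u) ^+ 4 * (sg u ^+ 2 + p ^+ 2)).
  by field; rewrite gt_eqF.
by rewrite q; field; rewrite gt_eqF.
Qed.

Lemma ray_geodesic : geodesic c ray_position s t.
Proof.
move=> u hu; have dg := ray_position_derive hu.
have e : \forall v \near u, ray_velocity v = derive1 ray_position v.
  by apply: filterS (near_itv hu) => v /ray_derive1.
have dv := near_eq_is_derive e (ray_velocity_derive hu).
split.
- by [].
- apply: differentiable_continuous; apply/derivable1_diffP; exact: ex_derive.
- by rewrite ray_derive1// ray_speed// /ray_position frame_radius// ltW// (re_r_gt0 (eqs hu)).
- by move=> _; rewrite ray_derive1.
Qed.

Lemma ray_covector u : s < u < t ->
  covector c ray_position u = frame e1 e2 (sg u / r u) (p / r u) (th u).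
Proof.
move=> hu; have e := eqs hu; have [cE _] := speed hu.
have r0 := re_r_gt0 e; have rho0 := re_rho_gt0 e.
rewrite /covector ray_derive1// /ray_position frame_radius// ?ltW// cE frameZ.
by congr frame; field; rewrite !gt_eqF.
Qed.

End PolarRays.

Section Stacking.
Context {R : realType}.

Definition clamp_to (T x : R) : R := Num.max 0 (Num.min x T).

(** The function with increments f (u - j T) over the successive intervals
    [j T, (j + 1) T]: it concatenates N copies of a leg. *)
Definition stacked (f : R -> R) (T : R) (N : nat) (u : R) : R :=
  \sum_(j < N) f (clamp_to T (u - j%:R * T)).

Variables (f : R -> R) (T : R).
Hypotheses (f0 : f 0 = 0) (T0 : 0 < T).

Lemma stacked_full (N : nat) (u : R) : N%:R * T <= u -> stacked f T N u = N%:R * f T.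
Proof.
have T0' := T0; rewrite /stacked; elim: N => [|N IH] Nu; first by rewrite big_ord0 mul0r.
move: Nu; rewrite -natr1 => Nu.
rewrite big_ord_recr /= IH; last by lra.
have l1 : T <= u - N%:R * T by lra.
have l2 : 0 <= T := ltW T0'.
by rewrite /clamp_to (min_r l1) (max_r l2); ring.
Qed.

Lemma stacked_leg (N i : nat) (u : R) : (i < N)%N -> i%:R * T <= u <= i.+1%:R * T ->
  stacked f T N u = i%:R * f T + f (u - i%:R * T).
Proof.
have T0' := T0; elim: N => // N IH; rewrite ltnS leq_eqVlt => /predU1P[->|iN] /andP[l1 l2].
  rewrite /stacked big_ord_recr /= -/(stacked f T N u) stacked_full//.
  move: l2; rewrite -natr1 => l2.
  by rewrite /clamp_to min_l ?max_r//; lra.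
rewrite /stacked big_ord_recr /= -/(stacked f T N u) IH// ?l1//.
have : i.+1%:R * T <= N%:R * T by rewrite ler_pM2r// ler_nat.
move=> l3; rewrite /clamp_to min_l ?max_l ?f0 ?addr0//; lra.
Qed.

Lemma clamp_to_continuous : continuous (clamp_to T).
Proof.
move=> w; have c : {for w, continuous (fun w : R => Num.min w T)}.
  by apply: continuous_min; [exact: cvg_id|exact: cst_continuous].
exact: (continuous_max (@cst_continuous R R 0 w) c).
Qed.

Lemma stacked_continuous (N : nat) : continuous f -> continuous (stacked f T N).
Proof.
move=> cf u; elim: N => [|N IH].
  rewrite (_ : stacked f T 0 = fun=> 0); first exact: cst_continuous.
  by apply/funext => v; rewrite /stacked big_ord0.
rewrite (_ : stacked f T N.+1 = fun u => stacked f T N u + f (clamp_to T (u - N%:R * T))); last first.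
  by apply/funext => v; rewrite /stacked big_ord_recr.
have c1 : {for u, continuous (fun u => u - N%:R * T)}.
  by apply: cvgB; [exact: cvg_id|exact: cvg_cst].
have c2 : {for u, continuous (fun u => f (clamp_to T (u - N%:R * T)))}.
  apply: (continuous_comp (f := fun u => clamp_to T (u - N%:R * T)) (g := f)); last exact: cf.
  apply: (continuous_comp (f := fun u => u - N%:R * T) (g := clamp_to T)) => //.
  exact: clamp_to_continuous.
exact: (continuousD IH c2).
Qed.

Lemma shift_derive (g : R -> R) (a u l : R) :
  is_derive (u - a) 1 g l -> is_derive u 1 (fun u => g (u - a)) l.
Proof.
move=> dg; have h : is_derive u 1 (fun u => u - a) 1 by apply: is_derive_eq; rewrite subr0.
have d := @is_derive1_comp _ g (fun u => u - a) u _ _ dg h.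
by apply: (is_derive_eq d); rewrite mulr1.
Qed.

Lemma stacked_derive (N i : nat) (u l : R) : (i < N)%N -> i%:R * T < u < i.+1%:R * T ->
  is_derive (u - i%:R * T) 1 f l -> is_derive u 1 (stacked f T N) l.
Proof.
move=> iN hu df.
have e : \forall v \near u, i%:R * f T + f (v - i%:R * T) = stacked f T N v.
  apply: filterS (near_itv hu) => v /andP[l1 l2].
  by rewrite (stacked_leg iN)// (ltW l1) (ltW l2).
apply: (near_eq_is_derive e).
apply: (is_derive_eq (is_deriveD (is_derive_cst (i%:R * f T) u 1) (shift_derive df))).
by rewrite add0r.
Qed.

End Stacking.

Section Billiard.
Context {R : realType} {n : nat}.
Variables e1 e2 : 'rV[R]_n.
Hypotheses (e11 : dotp e1 e1 = 1) (e22 : dotp e2 e2 = 1) (e12 : dotp e1 e2 = 0).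
Variables (rho rho1 c : R -> R) (x0 b m : R) (wt th : R -> R) (T D : R).
Hypothesis tp : turning_profile rho rho1 x0 b m.
Hypothesis lp : leg_param rho rho1 b m wt th T D.
Hypothesis speed : forall x, x0 < x < b -> speed_of rho rho1 c x.

Local Notation r := (traj_radius b m wt).
Local Notation sg := (traj_root rho rho1 b m wt).

Lemma leg_ray_equations (u : R) : 0 < u < T -> ray_equations rho rho1 (rho m) r th sg u.
Proof.
move=> hu; have [_ hr] := traj_radius_oo tp lp hu; split.
- exact (traj_radius_derive tp lp hu).
- exact (traj_angle_derive tp lp u).
- exact (traj_root_derive tp lp hu).
- exact: (traj_root_sqr tp wt u).
- exact: (traj_radius_gt0 tp wt u).
- exact: (traj_rho_gt0 tp wt u).
- exact: (tp_derive tp hr).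
Qed.

Variable N : nat.

Definition billiard_radius (u : R) : R := b + stacked (fun t => r t - b) T N u.
Definition billiard_angle (u : R) : R := stacked th T N u.
Definition billiard : R -> 'rV[R]_n := ray_position e1 e2 billiard_radius billiard_angle.

Let r00 : r 0 - b = 0.
Proof. by rewrite (traj_radius0 lp) subrr. Qed.
Let rT : r T - b = 0.
Proof. by rewrite (traj_radiusT lp) subrr. Qed.

Lemma billiard_radius_leg (i : nat) u : (i < N)%N -> i%:R * T <= u <= i.+1%:R * T ->
  billiard_radius u = r (u - i%:R * T).
Proof.
move=> iN hu; rewrite /billiard_radius (stacked_leg (f := fun t => r t - b) r00 (lp_T lp) iN hu).
by rewrite rT mulr0 add0r addrC subrK.
Qed.

Lemma billiard_angle_leg (i : nat) u : (i < N)%N -> i%:R * T <= u <= i.+1%:R * T ->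
  billiard_angle u = i%:R * D + th (u - i%:R * T).
Proof.
move=> iN hu; rewrite /billiard_angle (stacked_leg (lp_th0 lp) (lp_T lp) iN hu).
by rewrite (lp_thT lp).
Qed.

Lemma billiard_node (i : nat) : (0 < N)%N -> (i <= N)%N ->
  billiard_radius (i%:R * T) = b /\ billiard_angle (i%:R * T) = i%:R * D.
Proof.
have T0 := lp_T lp; move=> N0; rewrite leq_eqVlt => /predU1P[->|iN]; last first.
  have hu : i%:R * T <= i%:R * T <= i.+1%:R * T by rewrite lexx ler_pM2r// ler_nat /=.
  rewrite (billiard_radius_leg iN hu) (billiard_angle_leg iN hu) subrr.
  by rewrite (traj_radius0 lp) (lp_th0 lp) addr0.
case: N N0 billiard_radius_leg billiard_angle_leg => // N' _ h1 h2.
have hu : N'%:R * T <= N'.+1%:R * T <= N'.+1%:R * T by rewrite lexx andbT ler_pM2r// ler_nat.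
have e : N'.+1%:R * T - N'%:R * T = T by rewrite -natr1; ring.
rewrite (h1 N' _ _ hu)// (h2 N' _ _ hu)// e.
by rewrite (traj_radiusT lp) (lp_thT lp) -natr1; split => //; ring.
Qed.

Let th_cont : continuous th.
Proof. by move=> t; exact: is_derive1_continuous (lp_th lp t). Qed.

Lemma billiard_radius_continuous : continuous billiard_radius.
Proof.
move=> u; have c1 : continuous (fun t => r t - b).
  by move=> t; apply: cvgB; [exact: (traj_radius_continuous lp)|exact: cvg_cst].
exact: (continuousD (@cst_continuous R R b u) (stacked_continuous (N := N) c1 (x := u))).
Qed.

Lemma billiard_angle_continuous : continuous billiard_angle.
Proof. exact: stacked_continuous. Qed.

Lemma billiard_continuous : continuous billiard.
Proof.
apply: frame_continuous; [exact: billiard_radius_continuous| |exact: billiard_angle_continuous].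
exact: cst_continuous.
Qed.

Lemma billiard_leg_itv (i : nat) u : i%:R * T < u < i.+1%:R * T -> 0 < u - i%:R * T < T.
Proof. by rewrite -natr1 => hu; lra. Qed.

Lemma billiard_equations (i : nat) u : (i < N)%N -> i%:R * T < u < i.+1%:R * T ->
  ray_equations rho rho1 (rho m) billiard_radius billiard_angle (fun u => sg (u - i%:R * T)) u.
Proof.
move=> iN hu; have e := leg_ray_equations (billiard_leg_itv hu).
have hu' : i%:R * T <= u <= i.+1%:R * T by lra.
have E := billiard_radius_leg iN hu'.
split; rewrite E.
- have d : is_derive (u - i%:R * T) 1 (fun t => r t - b) (r (u - i%:R * T) * sg (u - i%:R * T) / rho (r (u - i%:R * T)) ^+ 2).
    apply: (is_derive_eq (is_deriveB (re_r e) (is_derive_cst b (u - i%:R * T) 1))).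
    by rewrite subr0.
  apply: (is_derive_eq (is_deriveD (is_derive_cst b u 1) (stacked_derive r00 (lp_T lp) iN hu d))).
  by rewrite add0r.
- exact: (stacked_derive (lp_th0 lp) (lp_T lp) iN hu (re_th e)).
- exact: (shift_derive (re_sg e)).
- exact: (re_sqr e).
- exact: (re_r_gt0 e).
- exact: (re_rho_gt0 e).
- exact: (re_rho e).
Qed.

Lemma billiard_radius_oo (i : nat) u : (i < N)%N -> i%:R * T < u < i.+1%:R * T ->
  x0 < billiard_radius u < b.
Proof.
move=> iN hu; have hu' : i%:R * T <= u <= i.+1%:R * T by lra.
rewrite (billiard_radius_leg iN hu').
by have [] := traj_radius_oo tp lp (billiard_leg_itv hu).
Qed.

Lemma billiard_geodesic (i : nat) : (i < N)%N -> geodesic c billiard (i%:R * T) (i.+1%:R * T).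
Proof.
move=> iN; apply: (ray_geodesic e11 e22 e12 (fun u => billiard_equations iN (u := u))) => u hu.
exact: (speed (billiard_radius_oo iN hu)).
Qed.

Lemma billiard_covector (i : nat) u : (i < N)%N -> i%:R * T < u < i.+1%:R * T ->
  covector c billiard u =
  frame e1 e2 (sg (u - i%:R * T) / billiard_radius u) (rho m / billiard_radius u) (billiard_angle u).
Proof.
move=> iN hu; apply: (ray_covector e11 e22 e12 (fun u => billiard_equations iN (u := u)) _ hu) => v hv.
exact: (speed (billiard_radius_oo iN hv)).
Qed.

Let b0 : b != 0.
Proof. by rewrite gt_eqF// (lt_trans (tp_x0 tp))// (lt_trans (tp_m tp))// (tp_b tp). Qed.

Lemma billiard_covector_cvg (i : nat) (u : R) : billiard_radius u = b ->
  frame e1 e2 (sg (v - i%:R * T) / billiard_radius v) (rho m / billiard_radius v) (billiard_angle v)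
    @[v --> u] --> frame e1 e2 (sg (u - i%:R * T) / b) (rho m / b) (billiard_angle u).
Proof.
move=> e; have c1 : (billiard_radius v)^-1 @[v --> u] --> b^-1.
  by rewrite -e; apply: cvgV; [rewrite e|exact: billiard_radius_continuous].
have c2 : sg (v - i%:R * T) @[v --> u] --> sg (u - i%:R * T).
  apply: (continuous_comp (f := fun v => v - i%:R * T) (g := sg)).
    by apply: cvgB; [exact: cvg_id|exact: cvg_cst].
  exact: (traj_root_continuous tp lp).
apply: frame_cvg; [exact: cvgM| |exact: billiard_angle_continuous].
by apply: cvgM => //; exact: cvg_cst.
Qed.

Lemma billiard_covector_left (i : nat) : (i < N)%N ->
  covector c billiard u @[u --> (i.+1%:R * T)^'-] -->
  frame e1 e2 (sg T / b) (rho m / b) (i.+1%:R * D).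
Proof.
move=> iN; have [eb ea] := billiard_node (leq_ltn_trans (leq0n i) iN) iN.
have e : \forall u \near (i.+1%:R * T)^'-,
    frame e1 e2 (sg (u - i%:R * T) / billiard_radius u) (rho m / billiard_radius u)
      (billiard_angle u) = covector c billiard u.
  have lt : i%:R * T < i.+1%:R * T by rewrite ltr_pM2r ?ltr_nat ?(lp_T lp).
  near=> u; rewrite (billiard_covector iN)//; apply/andP; split; near: u.
    exact: nbhs_left_gt.
  exact: nbhs_left_lt.
apply: cvg_trans (near_eq_cvg e) _.
have h := billiard_covector_cvg (i := i) eb.
rewrite ea (_ : i.+1%:R * T - i%:R * T = T) in h; last by rewrite -natr1; ring.
apply: cvg_within_filter; exact: h.
Unshelve. all: by end_near. Qed.

Lemma billiard_covector_right (i : nat) : (i < N)%N ->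
  covector c billiard u @[u --> (i%:R * T)^'+] -->
  frame e1 e2 (sg 0 / b) (rho m / b) (i%:R * D).
Proof.
move=> iN; have [eb ea] := billiard_node (leq_ltn_trans (leq0n i) iN) (ltnW iN).
have e : \forall u \near (i%:R * T)^'+,
    frame e1 e2 (sg (u - i%:R * T) / billiard_radius u) (rho m / billiard_radius u)
      (billiard_angle u) = covector c billiard u.
  have lt : i%:R * T < i.+1%:R * T by rewrite ltr_pM2r ?ltr_nat ?(lp_T lp).
  near=> u; rewrite (billiard_covector iN)//; apply/andP; split; near: u.
    exact: nbhs_right_gt.
  exact: nbhs_right_lt.
apply: cvg_trans (near_eq_cvg e) _.
have h := billiard_covector_cvg (i := i) eb.
rewrite subrr ea in h.
apply: cvg_within_filter; exact: h.
Unshelve. all: by end_near. Qed.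

(** The covector has the tangential part p / b at both ends of every leg. *)
Lemma billiard_reflects (i j : nat) : (i < N)%N -> (j < N)%N ->
  (forall a b, frame e1 e2 a b (i.+1%:R * D) = frame e1 e2 a b (j%:R * D)) ->
  reflects_or_refracts c billiard (i.+1%:R * T) (j%:R * T).
Proof.
move=> iN jN E; exists (frame e1 e2 (sg T / b) (rho m / b) (i.+1%:R * D)).
exists (frame e1 e2 (sg 0 / b) (rho m / b) (j%:R * D)).
split; [exact: billiard_covector_left|exact: billiard_covector_right|].
have N0 := leq_ltn_trans (leq0n i) iN.
have [b1 a1] := billiard_node N0 iN; have [b2 a2] := billiard_node N0 (ltnW jN).
by rewrite /billiard /ray_position b1 a1 b2 a2 !frame_tangential// E.
Qed.

End Billiard.

Section PeriodicLegs.
Context {R : realType}.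

Lemma plane_basis (n : nat) : (2 <= n)%N -> exists e1 e2 : 'rV[R]_n,
  [/\ dotp e1 e1 = 1, dotp e2 e2 = 1 & dotp e1 e2 = 0].
Proof.
case: n => [|[|n]] // _.
have E (i j : 'I_n.+2) : dotp (delta_mx ord0 i) (delta_mx ord0 j) = (i == j)%:R :> R.
  rewrite /dotp (bigD1 i)//= big1 ?addr0 => [|k ki]; rewrite !mxE eqxx /=.
    by rewrite eqxx mul1r eq_sym.
  by rewrite (negbTE ki) mul0r.
exists (delta_mx ord0 ord0), (delta_mx ord0 ord_max).
by split; rewrite E ?eqxx.
Qed.

Variables (n K k : nat) (rr : nat -> R) (rho rho1 c : R -> R) (x0 b m : R) (wt th : R -> R) (T D : R).
Hypothesis tp : turning_profile rho rho1 x0 b m.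
Hypothesis lp : leg_param rho rho1 b m wt th T D.
Hypothesis speed : forall x, x0 < x < b -> speed_of rho rho1 c x.

(** A leg whose aperture is a rational multiple of a full turn closes up after
    finitely many reflections. *)
Lemma leg_length_blsp (N M : nat) : (2 <= n)%N -> (k <= K)%N -> b = layer_radius K rr k -> b <= 1 ->
  layer_radius K rr k.+1 <= x0 ->
  (forall j, (j <= K)%N -> ~ (x0 < layer_radius K rr j < b)) ->
  (0 < N)%N -> N%:R * D = 2 * pi * M%:R -> blsp n K rr c (N%:R * T).
Proof.
move=> /plane_basis[e1 [e2 [e11 e22 e12]]] kK bE b1 x0E gamma N0 ND.
have T0 := lp_T lp.
pose g := billiard e1 e2 b m wt th T N.
have b0 : 0 < b by rewrite (lt_trans (tp_x0 tp))// (lt_trans (tp_m tp))// (tp_b tp).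
have nodeE i : (i <= N)%N -> enorm (g (i%:R * T)) = b.
  move=> iN; have [eb _] := billiard_node lp N0 iN.
  by rewrite /g /billiard /ray_position eb (frame_radius e11 e22 e12)// ltW.
have legs u : 0 <= u <= N%:R * T -> exists2 i, (i < N)%N & i%:R * T <= u <= i.+1%:R * T.
  clear -N0; case: N N0 => // N' _; elim: N' => [|N' IH] /andP[u0 u1].
    by exists 0%N => //; rewrite mul0r u0.
  have [l|l] := leP u (N'.+1%:R * T).
    by have [|i iN hi] := IH; [rewrite u0|exists i => //; exact: ltnW].
  by exists N'.+1 => //; rewrite (ltW l).
have radii u : 0 <= u <= N%:R * T -> layer_radius K rr k.+1 <= enorm (g u) <= b.
  move=> /legs[i iN hu]; rewrite /g /billiard /ray_position (billiard_radius_leg lp iN hu).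
  rewrite (frame_radius e11 e22 e12); last exact/ltW/(traj_radius_gt0 tp).
  have /andP[h1 ->] := traj_radius_itv tp wt (u - i%:R * T); rewrite andbT.
  by apply: le_trans h1; apply: le_trans x0E _; rewrite ltW// (tp_m tp).
have onG i : (i <= N)%N -> on_Gamma K rr (g (i%:R * T)).
  by move=> iN; exists k => //; rewrite nodeE.
have onG0 : on_Gamma K rr (g 0) by have := onG 0%N (leq0n N); rewrite mul0r.
have g0 : g (N%:R * T) = g 0.
  have [eb ea] := billiard_node lp N0 (leqnn N).
  have [eb0 ea0] := billiard_node lp N0 (leq0n N).
  rewrite mul0r in eb0 ea0.
  by rewrite /g /billiard /ray_position eb ea eb0 ea0 ND frame_full_turns mul0r.
have closing : reflects_or_refracts c g (N%:R * T) 0.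
  have N1 : N.-1.+1 = N by rewrite prednK.
  have := @billiard_reflects _ _ _ _ e11 e22 e12 _ _ _ _ _ _ _ _ _ _ tp lp speed N N.-1 0.
  rewrite N1 [0%:R * T]mul0r; apply=> // a a'.
  by rewrite ND frame_full_turns mul0r.
exists N, (fun i => i%:R * T), g; split; [split|split|by []].
- split.
  + by rewrite mul0r.
  + by move=> i iN; rewrite ltr_pM2r// ltr_nat.
  + split; last by move=> u /radii /andP[_ h]; exact: le_trans b1.
    by apply: continuous_subspaceT; exact: (billiard_continuous lp).
  + move=> i iN; split; first exact: (billiard_geodesic e11 e22 e12 tp lp speed).
    move=> u hu [j jK]; rewrite /g /billiard /ray_position.
    have ho := billiard_radius_oo tp lp iN hu.
    rewrite (frame_radius e11 e22 e12); last by rewrite ltW// (lt_trans (tp_x0 tp))//; case/andP: ho.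
    by move=> e; apply: (gamma j jK); rewrite -e.
  + move=> i /andP[i0 iN]; split; first exact: (onG _ (ltnW iN)).
    case: i i0 iN => // i _ iN.
    exact: (billiard_reflects e11 e22 e12 tp lp speed (ltnW iN) iN).
- exact: g0.
- exact: onG0.
- exact: closing.
- by exists k => // u hu; rewrite -bE radii.
- by left; exists k => // i iN; rewrite nodeE.
Qed.

End PeriodicLegs.

(** * Lipschitz functions are differentiable almost everywhere *)

Section Rademacher.
Context {R : realType}.
Local Notation mu := (@lebesgue_measure R).

Lemma ae_imply (P Q : R -> Prop) : (forall x, P x -> Q x) ->
  {ae mu, forall x, P x} -> {ae mu, forall x, Q x}.
Proof. by move=> PQ; apply: filterS => //; exact: (ae_filter_ringOfSetsType mu). Qed.

Lemma stieltjes_ocitv (G : cumulative R R) (a b : R) : a <= b ->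
  lebesgue_stieltjes_measure G `]a, b]%classic = (G b - G a)%:E.
Proof.
move=> ab; rewrite /lebesgue_stieltjes_measure/= /measure_extension/=.
rewrite measurable_mu_extE/=; last exact: is_ocitv.
by rewrite wlength_itv_bnd.
Qed.

(** The Stieltjes measures of G and H add up to Lebesgue measure. *)
Lemma stieltjes_le (G H : cumulative R R) : (forall x, G x + H x = x) ->
  forall A, measurable A -> (lebesgue_stieltjes_measure G A <= mu A)%E.
Proof.
move=> GH A mA; have GH' x : H x = x - G x by have := GH x; lra.
have -> : mu A = measure_add (lebesgue_stieltjes_measure G) (lebesgue_stieltjes_measure H) A.
  apply: lebesgue_measure_unique => // X /ocitvP[->|[[a b] /= ab ->]].
    by rewrite !measure0.
  transitivity (lebesgue_stieltjes_measure G `]a, b]%classic +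
    lebesgue_stieltjes_measure H `]a, b]%classic)%E; last by symmetry; exact: measure_addE.
  rewrite lebesgue_measure_itv /= lte_fin ab.
  by rewrite !stieltjes_ocitv ?ltW// -EFinD -EFinD !GH'; congr EFin; ring.
by rewrite measure_addE leeDl.
Qed.

(** The Stieltjes measure of G has a Radon-Nikodym density, since it is dominated by
    Lebesgue measure; G is a primitive of this density. *)
Lemma cumulative_ae_derivable (a b : R) (G H : cumulative R R) : (forall x, G x + H x = x) ->
  {ae mu, forall x, a < x < b -> derivable G x 1}.
Proof.
move=> GH; have [ab|ba] := ltP a b; last first.
  by apply: aeW => x hx; exfalso; lra.
pose D : set (measurableTypeR R) := `]a, b]%classic.
have mD : measurable D by exact: measurable_itv.
have fD : (lebesgue_stieltjes_measure G D < +oo)%E by rewrite stieltjes_ocitv ?ltW// ltry.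
pose nu : {finite_measure set (measurableTypeR R) -> \bar R} := mfrestr mD fD.
have numu : nu `<< mu.
  apply/null_content_dominatesP => A mA A0.
  apply/eqP; rewrite eq_le measure_ge0 andbT -A0.
  rewrite /nu /= /mfrestr /mrestr; apply: le_trans (stieltjes_le GH _) _.
    exact: measurableI.
  by apply: le_measure; rewrite ?inE//; exact: measurableI.
have [f [f0 ff intf fE]] := radon_nikodym_sigma_finite numu.
pose g x := fine (f x).
have fg : f = EFin \o g by apply/funext => x; rewrite /= fineK.
rewrite fg in intf.
have locg : locally_integrable [set: R] g by apply: open_integrable_locally => //; exact: openT.
have intg y : mu.-integrable [set` Interval (BRight a) (BRight y)] (EFin \o g).
  by apply: integrableS intf.
have /= hF := FTC1 intg locg.
apply: ae_imply hF => x h /andP[ax xb]; have [|+ _] := h; first by rewrite lte_fin.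
move=> dF; have e : \forall y \near x, (\int[mu]_(t in `]a, y]) g t)%R + G a = G y.
  have hx : a < x < b by rewrite ax.
  apply: filterS (near_itv hx) => y /andP[ay yb].
  have := fE `]a, y]%classic (measurable_itv _).
  rewrite /nu /= /mfrestr /mrestr (_ : _ `&` D = `]a, y]%classic); last first.
    apply/seteqP; split=> z /=; rewrite !in_itv /=; first by case=> /andP[-> ->].
    move=> /andP[az zy]; split; first by rewrite az.
    by rewrite /D /= in_itv /= az (le_trans zy (ltW yb)).
  rewrite stieltjes_ocitv ?ltW// fg /Rintegral /= => <- /=; ring.
have d1 := is_deriveD (derivableP dF) (is_derive_cst (G a) x 1).
by have d2 := near_eq_is_derive e d1; exact: ex_derive.
Qed.

(** The identity is the sum of the increasing functions (x + f / L) / 2 and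
    (x - f / L) / 2. *)
Lemma lipschitz_ae_derivable (f : R -> R) (L a b : R) : 0 < L ->
  (forall x y, `|f y - f x| <= L * `|y - x|) ->
  {ae mu, forall x, a < x < b -> derivable f x 1}.
Proof.
move=> L0 lip.
have aux s : `|s| = 1 -> exists G : cumulative R R, G = (fun x => (x + s * f x / L) / 2) :> (R -> R).
  move=> s1; pose g x := (x + s * f x / L) / 2.
  have lg x y : x <= y -> `|s * (f y - f x) / L| <= y - x.
    move=> xy; rewrite normrM normfV (gtr0_norm L0) normrM s1 mul1r ler_pdivrMr// mulrC.
    by have := lip x y; rewrite (ger0_norm (x := y - x))// subr_ge0.
  have nd : {homo g : x y / x <= y}.
    move=> x y xy; have := lg _ _ xy; rewrite ler_norml => /andP[h _].
    have e : s * (f y - f x) / L = s * f y / L - s * f x / L by rewrite mulrBr mulrBl.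
    by rewrite e in h; rewrite /g ler_pM2r ?invr_gt0//; lra.
  have cf : continuous f.
    move=> x; apply/cvgrPdist_le => e e0; apply: (@dist_near _ x (e / L)); first exact: divr_gt0.
    move=> y hy; rewrite distrC; apply: le_trans (lip x y) _.
    by rewrite mulrC -ler_pdivlMr// ltW.
  have cg : continuous g.
    move=> x; apply: cvgM; last exact: cvg_cst.
    apply: cvgD; first exact: cvg_id.
    by apply: cvgM; [apply: cvgM; [exact: cvg_cst|exact: cf]|exact: cvg_cst].
  have rc : right_continuous g by exact: right_continuousW.
  by exists (HB.pack_for (cumulative R R) g (isCumulative.Build R _ R g nd rc)).
have [G GE] := aux 1 (normr1 R).
have [H HE] := aux (-1) (normrN1 R).
have GH x : G x + H x = x by rewrite GE HE; field; rewrite gt_eqF.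
apply: ae_imply (cumulative_ae_derivable a b GH) => x h /h; rewrite GE => d.
have d1 := is_deriveB (is_deriveZ (2 * L) (derivableP d)) (is_deriveZ L (is_derive_id x (1 : R))).
have e : \forall y \near x, 2 * L * ((y + 1 * f y / L) / 2) - L * y = f y.
  by apply: (@filterE _ (nbhs x)) => y; field; rewrite gt_eqF.
by have d2 := near_eq_is_derive e d1; exact: ex_derive.
Qed.

(** Exhaustion by compact intervals, on which f extends to a Lipschitz function on the
    line. *)
Lemma lipschitz_oo_ae_derivable (f : R -> R) (L a b : R) : 0 < L ->
  (forall x y, a < x < b -> a < y < b -> `|f y - f x| <= L * `|y - x|) ->
  {ae mu, forall x, a < x < b -> derivable f x 1}.
Proof.
move=> L0 lip.
pose al (n : nat) := a + n.+1%:R^-1; pose bl (n : nat) := b - n.+1%:R^-1.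
have step n : {ae mu, forall x, al n < x < bl n -> derivable f x 1}.
  have [ab|ba] := ltP (al n) (bl n); last by apply: aeW => x hx; exfalso; lra.
  have n0 : 0 < (n.+1%:R^-1 : R) by rewrite invr_gt0.
  pose cl x := Num.max (al n) (Num.min x (bl n)).
  have clI x : a < cl x < b.
    have h1 : a < al n by rewrite ltrDl.
    have h2 : bl n < b by rewrite ltrBlDr ltrDl.
    by rewrite /cl lt_max h1 gt_max gt_min h2 orbT (lt_trans ab h2).
  have clL x y : `|cl y - cl x| <= `|y - x|.
    rewrite /cl; have a1 := ler_norm (y - x); have a2 := ler_norm (- (y - x)); rewrite normrN in a2.
    have := normr_ge0 (y - x); move: (`|y - x|) a1 a2 => d a1 a2 d0; rewrite ler_norml.
    have [h1|h1] := leP x (bl n); have [h2|h2] := leP y (bl n);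
    have [h3|h3] := leP (al n) x; have [h4|h4] := leP (al n) y;
    rewrite ?(max_r h3) ?(max_l (ltW h3)) ?(max_r h4) ?(max_l (ltW h4)) ?(max_r (ltW ab)); lra.
  have h := @lipschitz_ae_derivable (f \o cl) L (al n) (bl n) L0.
  have {}h := h (fun x y => le_trans (lip _ _ (clI x) (clI y)) (ler_wpM2l (ltW L0) (clL x y))).
  apply: ae_imply h => x h hx; have d := derivableP (h hx).
  have e : \forall y \near x, (f \o cl) y = f y.
    apply: filterS (near_itv hx) => y /andP[h1 h2] /=.
    by rewrite /cl min_l ?max_r// ltW.
  by have d2 := near_eq_is_derive e d; exact: ex_derive.
apply: ae_imply (ae_foralln step) => x h /andP[ax xb].
have [n [h1 h2]] : exists n, al n < x /\ x < bl n.
  pose d := Num.min (x - a) (b - x).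
  have d0 : 0 < d by rewrite lt_min !subr_gt0 ax.
  have [n hn] : exists n, (n.+1%:R^-1 : R) < d.
    near \oo => n; exists n; near: n; exact: near_infty_natSinv_lt (PosNum d0).
  exists n; move: hn; rewrite lt_min /al /bl => /andP[l1 l2].
  by split; [rewrite -ltrBrDl|rewrite ltrBrDr -ltrBrDl].
by apply: (h n); rewrite h1.
Unshelve. all: by end_near. Qed.

End Rademacher.

(** * Aperture and action as functions of the turning radius *)

Section Variation.
Context {R : realType}.
Variables (rho rho1 : R -> R) (b : R).
Implicit Types m w x : R.
Local Notation rad := (leg_radius b).
Local Notation root m w := (leg_root rho rho1 b m w).

(** The integrand of T - p Delta, the part of the duration due to radial momentum. *)
Definition leg_action m w : R := 2 * (b - m) * w * root m w / rad m w.

(** The quotient w / leg_root, regular at w = 0. *)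
Definition leg_kappa m w : R := (Num.sqrt (leg_slope rho rho1 b m w))^-1.

(** Divided by w^2, the difference of the derivatives in m of rho^2 / 2 at the radius
    of parameter w and at m; bounded because rho rho' is Lipschitz. *)
Definition leg_defect m w : R :=
  (rho (rad m w) * rho1 (rad m w) * (1 - w ^+ 2) - rho m * rho1 m) / w ^+ 2.

(** The derivative of leg_angle with respect to the turning radius, written so that
    it is bounded up to w = 0. *)
Definition leg_variation m w : R :=
  leg_kappa m w * (2 * rho1 m * (b - m) / rad m w - 2 * rho m / rad m w
    - 2 * rho m * (b - m) * (1 - w ^+ 2) / rad m w ^+ 2)
  - leg_kappa m w ^+ 3 * (2 * rho m * (b - m) / rad m w) * leg_defect m w.

(** The derivative of leg_action with respect to the turning radius. *)
Definition leg_action_variation m w : R :=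
  - 2 * w * root m w / rad m w
  + 2 * (b - m) * leg_kappa m w * (leg_defect m w * w ^+ 2) / rad m w
  - 2 * (b - m) * w * root m w * (1 - w ^+ 2) / rad m w ^+ 2.

Variables (x0 m1 m2 : R).
Hypothesis tp : forall m, m1 < m < m2 -> turning_profile rho rho1 x0 b m.

Let rad0 m w : m1 < m < m2 -> 0 < w < 1 -> rad m w != 0.
Proof. by move=> /tp h hw; rewrite gt_eqF// (rad_gt0 h)//; lra. Qed.

Lemma root_gt0 m w : m1 < m < m2 -> 0 < w < 1 -> 0 < root m w.
Proof.
move=> /tp h hw; have hw' : -1 <= w <= 1 by lra.
have w0 : 0 < w by case/andP: hw.
by rewrite /leg_root mulr_gt0// sqrtr_gt0 (slope_gt0 h).
Qed.

Lemma root_kappa m w : m1 < m < m2 -> 0 < w < 1 -> root m w * leg_kappa m w = w.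
Proof.
move=> /tp h hw; have hw' : -1 <= w <= 1 by lra.
by rewrite /leg_root /leg_kappa mulfK// gt_eqF// sqrtr_gt0 (slope_gt0 h).
Qed.

Lemma leg_angleE m w : m1 < m < m2 -> 0 < w < 1 ->
  leg_angle rho rho1 b m w = 2 * rho m * (b - m) * w / (rad m w * root m w).
Proof.
move=> hm hw; have r0 := rad0 hm hw; have s0 := root_gt0 hm hw.
transitivity (2 * rho m * (b - m) * (root m w * leg_kappa m w) / (rad m w * root m w)).
  by rewrite /leg_angle /leg_density -/(leg_kappa m w); field; rewrite r0 gt_eqF.
by rewrite root_kappa.
Qed.

Lemma rad_derive_m m w : is_derive m 1 (fun m => rad m w) (1 - w ^+ 2).
Proof. by rewrite /leg_radius; apply: is_derive_eq; rewrite /GRing.scale /=; ring. Qed.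

Lemma rho_derive_m m w : m1 < m < m2 -> 0 < w < 1 ->
  is_derive m 1 (fun m => rho (rad m w)) (rho1 (rad m w) * (1 - w ^+ 2)).
Proof.
move=> /tp h hw; apply: (@is_derive1_comp _ rho (fun m => rad m w)); last exact: rad_derive_m.
by apply: (tp_derive h); apply: (rad_itv_oo h); lra.
Qed.

Lemma root_derive_m m w : m1 < m < m2 -> 0 < w < 1 ->
  is_derive m 1 (fun m => root m w) (leg_defect m w * w ^+ 2 / root m w).
Proof.
move=> hm hw; have h := tp hm; have s0 := root_gt0 hm hw.
have hw' : -1 <= w <= 1 by lra.
pose S m := rho (rad m w) ^+ 2 - rho m ^+ 2.
have e : \forall m \near m, Num.sqrt (S m) = root m w.
  apply: filterS (near_itv hm) => y hy; rewrite /S -(root_sqr (tp hy) hw') sqrtr_sqr ger0_norm//.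
  exact/ltW/root_gt0.
apply: (near_eq_is_derive e).
have SE : S m = root m w ^+ 2 by rewrite /S (root_sqr h hw').
have S0 : 0 < S m by rewrite SE exprn_gt0.
have dm : is_derive m 1 rho (rho1 m).
  by apply: (tp_derive h); rewrite (tp_m h) (tp_b h).
have dr := rho_derive_m hm hw.
have dS : is_derive m 1 S (2 * (leg_defect m w * w ^+ 2)).
  apply: is_derive_eq; rewrite /leg_defect /GRing.scale /=; field.
  by case/andP: hw => /gt_eqF ->.
have d := @is_derive1_comp _ Num.sqrt S m _ _ (is_derive1_sqrt S0) dS.
apply: (is_derive_eq d); rewrite SE sqrtr_sqr (gtr0_norm s0).
by field; rewrite gt_eqF.
Qed.

Lemma leg_angle_derive_m m w : m1 < m < m2 -> 0 < w < 1 ->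
  is_derive m 1 (fun m => leg_angle rho rho1 b m w) (leg_variation m w).
Proof.
move=> hm hw; have h := tp hm; have s0 := root_gt0 hm hw.
have e : \forall m \near m, 2 * rho m * (b - m) * w / (rad m w * root m w) = leg_angle rho rho1 b m w.
  by apply: filterS (near_itv hm) => y hy; rewrite leg_angleE.
apply: (near_eq_is_derive e).
have dm : is_derive m 1 rho (rho1 m).
  by apply: (tp_derive h); rewrite (tp_m h) (tp_b h).
have dr := rad_derive_m m w; have ds := root_derive_m hm hw.
have d1 : is_derive m 1 (fun m => rad m w * root m w) _ := is_deriveM dr ds.
have n0 : rad m w * root m w != 0 by rewrite mulf_neq0 ?rad0// gt_eqF.
have d2 := @is_deriveV _ (fun m => rad m w * root m w) m _ 1 n0 d1.
have d3 : is_derive m 1 (fun m => 2 * rho m * (b - m) * w) ((2 * rho1 m * (b - m) - 2 * rho m) * w).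
  by apply: is_derive_eq; rewrite /GRing.scale /=; ring.
have d4 := is_deriveM d3 d2.
apply: (is_derive_eq d4); rewrite /leg_variation /GRing.scale /=.
have k := root_kappa hm hw.
have -> : leg_kappa m w = w / root m w by rewrite -{2}k; field; rewrite gt_eqF.
by field; rewrite (gt_eqF s0) rad0//; case/andP: hw => /gt_eqF ->.
Qed.

Lemma leg_action_derive_m m w : m1 < m < m2 -> 0 < w < 1 ->
  is_derive m 1 (fun m => leg_action m w) (leg_action_variation m w).
Proof.
move=> hm hw; have h := tp hm; have s0 := root_gt0 hm hw.
have dr := rad_derive_m m w; have ds := root_derive_m hm hw.
have r0 := rad0 hm hw.
have d2 := @is_deriveV _ (fun m => rad m w) m _ 1 r0 dr.
have d3 : is_derive m 1 (fun m => 2 * (b - m) * w) (- 2 * w).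
  by apply: is_derive_eq; rewrite /GRing.scale /=; ring.
apply: (is_derive_eq (is_deriveM (is_deriveM d3 ds) d2)).
rewrite /leg_action_variation /GRing.scale !fctE /=.
have k := root_kappa hm hw.
have -> : leg_kappa m w = w / root m w by rewrite -{2}k; field; rewrite gt_eqF.
by field; rewrite (gt_eqF s0) r0.
Qed.

(** Differentiating the action in m leaves - rho' times the aperture plus the
    derivative in w of this function, which vanishes at both ends. *)
Definition boundary_term m w : R := root m w * (1 - w ^+ 2) / rad m w.

Lemma boundary_term_derive m w : m1 < m < m2 -> 0 < w < 1 ->
  is_derive w 1 (boundary_term m)
    (leg_action_variation m w + rho1 m * leg_angle rho rho1 b m w).
Proof.
move=> hm hw; have h := tp hm; have s0 := root_gt0 hm hw; have r0 := rad0 hm hw.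
have hw' : -1 < w < 1 by lra.
have hw'' : -1 <= w <= 1 by lra.
have dr := rad_derive h hw'; have ds := root_derive h hw'.
have d2 := @is_deriveV _ (fun w => rad m w) w _ 1 r0 dr.
have d3 : is_derive w 1 (fun w => 1 - w ^+ 2) (- 2 * w).
  by apply: is_derive_eq; rewrite /GRing.scale /=; ring.
apply: (is_derive_eq (is_deriveM (is_deriveM ds d3) d2)).
rewrite (leg_angleE hm hw) /leg_action_variation /leg_defect /GRing.scale !fctE /=.
have k := root_kappa hm hw.
have kE : leg_kappa m w = w / root m w by rewrite -{2}k; field; rewrite gt_eqF.
have -> : leg_density rho rho1 b m w = 2 * (b - m) * w / root m w.
  by rewrite /leg_density -/(leg_kappa m w) kE; field; rewrite gt_eqF.
rewrite kE; have w0 : w != 0 by case/andP: hw => /gt_eqF ->.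
have := root_sqr h hw''; move: (root m w) s0 (rho (rad m w)) (rho m) (rad m w) r0 => s s0 a p r r0 sE.
have {s0} s0 : s != 0 by rewrite gt_eqF.
by field; rewrite w0 s0 r0.
Qed.

End Variation.

Section BoundedOn.
Context {R : realType} {Z : Type} (P : Z -> Prop).
Implicit Types f g : Z -> R.

Definition bounded_on f := exists C : R, forall z, P z -> `|f z| <= C.

Lemma bounded_onD f g : bounded_on f -> bounded_on g -> bounded_on (fun z => f z + g z).
Proof.
move=> [C hC] [D hD]; exists (C + D) => z Pz.
by apply: le_trans (ler_normD _ _) _; rewrite lerD ?hC ?hD.
Qed.

Lemma bounded_onN f : bounded_on f -> bounded_on (fun z => - f z).
Proof. by move=> [C hC]; exists C => z Pz; rewrite normrN hC. Qed.

Lemma bounded_onB f g : bounded_on f -> bounded_on g -> bounded_on (fun z => f z - g z).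
Proof. by move=> hf hg; apply: bounded_onD => //; exact: bounded_onN. Qed.

Lemma bounded_onM f g : bounded_on f -> bounded_on g -> bounded_on (fun z => f z * g z).
Proof.
move=> [C hC] [D hD]; exists (C * D) => z Pz.
by rewrite normrM ler_pM// ?hC ?hD.
Qed.

Lemma bounded_on_cst (k : R) : bounded_on (fun=> k).
Proof. by exists `|k|. Qed.

Lemma bounded_onX f n : bounded_on f -> bounded_on (fun z => f z ^+ n).
Proof.
move=> [C hC]; exists (C ^+ n) => z Pz.
by rewrite normrX lerXn2r ?nnegrE ?hC// (le_trans _ (hC z Pz)).
Qed.

End BoundedOn.

Section SteepFamily.
Context {R : realType} {T : Type}.

(** A family of profiles on ]x0, b[ with uniform bounds; legs with turning radius in
    ]m1, m2[ leave their turning point at a uniform rate.  This bounds all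
    integrands uniformly, although rho1 may tend to 0 at b. *)
Record steep_family (J : T -> Prop) (rho rho1 : T -> R -> R) (x0 b m1 m2 d N : R) : Prop :=
  SteepFamily {
  sf_tp : forall t m, J t -> m1 < m < m2 -> turning_profile (rho t) (rho1 t) x0 b m;
  sf_le : forall t r, J t -> x0 < r < b -> rho t r <= N /\ rho1 t r <= N;
  sf_lip : forall t r s, J t -> x0 < r -> r <= s -> s < b ->
    `|rho1 t s - rho1 t r| <= N * (s - r);
  sf_steep : forall t m r, J t -> m1 < m < m2 -> m < r < b ->
    d * (r - m) <= rho t r ^+ 2 - rho t m ^+ 2;
  sf_d : 0 < d;
  sf_m2 : m2 < b
}.

Variables (J : T -> Prop) (rho rho1 : T -> R -> R) (x0 b m1 m2 d N : R).
Hypothesis sf : steep_family J rho rho1 x0 b m1 m2 d N.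

Definition leg_range (z : T * R * R) := [/\ J z.1.1, m1 < z.1.2 < m2 & 0 < z.2 < 1].
Local Notation bd f := (bounded_on leg_range (fun z => f (z.1.1 : T) (z.1.2 : R) (z.2 : R))).

Let itv t m w : J t -> m1 < m < m2 -> 0 < w < 1 ->
  [/\ x0 < leg_radius b m w < b, m < leg_radius b m w, x0 < m < b & 0 < x0].
Proof.
move=> Jt hm hw; have tp := sf_tp sf Jt hm.
have hw' : -1 < w < 1 by lra.
have mb := tp_b tp; have xm := tp_m tp.
split; [exact: (rad_itv_oo tp hw')| |by rewrite xm|exact: (tp_x0 tp)].
by rewrite /leg_radius ltrDl mulr_gt0 ?subr_gt0// exprn_gt0//; case/andP: hw.
Qed.

Lemma bd_w : bd (fun t m w => w).
Proof. by exists 1 => -[[t m] w] [_ _ /= hw]; rewrite ger0_norm; lra. Qed.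

Lemma bd_width : bd (fun t m w => b - m).
Proof.
exists b => -[[t m] w] [/= Jt hm hw]; have [h1 h2 h3 h4] := itv Jt hm hw.
by rewrite /= in hm h1 h2 h3 *; rewrite ger0_norm; linarith.
Qed.

Lemma bd_rho_m : bd (fun t m w => rho t m).
Proof.
exists N => -[[t m] w] [/= Jt hm hw]; have [h1 h2 h3 h4] := itv Jt hm hw.
have [h _] := sf_le sf Jt h3; rewrite ger0_norm// ltW//.
exact: (tp_pos (sf_tp sf Jt hm)).
Qed.

Lemma bd_rho1_m : bd (fun t m w => rho1 t m).
Proof.
exists N => -[[t m] w] [/= Jt hm hw]; have [h1 h2 h3 h4] := itv Jt hm hw.
have [_ h] := sf_le sf Jt h3; rewrite ger0_norm// ltW//.
exact: (tp_pos1 (sf_tp sf Jt hm)).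
Qed.

Lemma bd_rad_inv : bd (fun t m w => (leg_radius b m w)^-1).
Proof.
exists x0^-1 => -[[t m] w] [/= Jt hm hw]; have [/andP[h1 _] h2 h3 h4] := itv Jt hm hw.
have h5 := lt_trans h4 h1.
by rewrite ger0_norm ?invr_ge0 ?(ltW h5)// lef_pV2 ?posrE// ltW.
Qed.

Lemma bd_kappa : bd (fun t m w => leg_kappa (rho t) (rho1 t) b m w).
Proof.
have d0 := sf_d sf; have mb := sf_m2 sf.
exists (Num.sqrt (d * (b - m2)))^-1 => -[[t m] w] [/= Jt hm hw].
have [h1 h2 h3 h4] := itv Jt hm hw.
have w0 : 0 < w by case/andP: hw.
have q0 : 0 < d * (b - m2) by rewrite mulr_gt0// subr_gt0.
have l : d * (b - m2) <= leg_slope (rho t) (rho1 t) b m w.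
  rewrite /leg_slope gt_eqF// ler_pdivlMr ?exprn_gt0//.
  have hr : m < leg_radius b m w < b by rewrite h2; case/andP: h1.
  apply: le_trans (sf_steep sf Jt hm hr).
  rewrite -mulrA ler_pM2l// /leg_radius [m + _]addrC addrK ler_pM2r ?exprn_gt0//.
  by case/andP: hm; move=> *; linarith.
rewrite /leg_kappa ger0_norm ?invr_ge0 ?sqrtr_ge0//.
by rewrite lef_pV2 ?posrE ?sqrtr_gt0 ?ler_wsqrtr// (lt_le_trans q0 l).
Qed.

Lemma bd_root : bd (fun t m w => leg_root (rho t) (rho1 t) b m w).
Proof.
exists N => -[[t m] w] [/= Jt hm hw]; have [h1 h2 h3 h4] := itv Jt hm hw.
have hw' : -1 <= w <= 1 by lra.
have tp := sf_tp sf Jt hm; have [h _] := sf_le sf Jt h1; have h0 := tp_pos tp h1.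
rewrite -ler_sqr ?nnegrE ?(le_trans (ltW h0) h)//.
rewrite real_normK ?num_real// (root_sqr tp hw').
apply: le_trans (_ : rho t (leg_radius b m w) ^+ 2 <= _); first by rewrite gerBl sqr_ge0.
by rewrite ler_sqr ?nnegrE// ltW// (lt_le_trans h0).
Qed.

Lemma bd_defect : bd (fun t m w => leg_defect (rho t) (rho1 t) b m w).
Proof.
exists (N * (N * b) + N * (N * b) + N * N) => -[[t m] w] [/= Jt hm hw].
have [h1 h2 h3 h4] := itv Jt hm hw; have tp := sf_tp sf Jt hm.
have w0 : 0 < w by case/andP: hw.
have [a1 a2] := sf_le sf Jt h1; have [a3 a4] := sf_le sf Jt h3.
have b1 := tp_pos tp h1; have b2 := tp_pos1 tp h1.
have b3 := tp_pos tp h3; have b4 := tp_pos1 tp h3.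
have lip := sf_lip sf Jt (andP h3).1 (ltW h2) (andP h1).2.
have mv : rho t (leg_radius b m w) - rho t m <= N * (leg_radius b m w - m).
  have [z hz ->] := mean_value (andP h3).1 h2 (andP h1).2 (tp_derive tp).
  rewrite ler_wpM2r ?subr_ge0 ?(ltW h2)//.
  by have [|] := sf_le sf Jt (r := z) => //; linarith.
have inc : 0 <= rho t (leg_radius b m w) - rho t m.
  by rewrite subr_ge0 ltW// (rho_increasing tp (tp_m tp) h2) // ltW//; case/andP: h1.
have rE : leg_radius b m w - m = (b - m) * w ^+ 2 by rewrite /leg_radius; ring.
rewrite rE in lip mv.
rewrite /leg_defect normrM normfV (ger0_norm (x := w ^+ 2)) ?sqr_ge0// ler_pdivrMr ?exprn_gt0//.
move: lip mv inc a1 a2 a3 a4 b1 b2 b3 b4; set r := leg_radius b m w.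
move: (rho t r) (rho1 t r) (rho t m) (rho1 t m) => x y p q lip mv inc a1 a2 a3 a4 b1 b2 b3 b4.
have W : 0 < w ^+ 2 by rewrite exprn_gt0.
have N0 : 0 <= N by linarith.
have bm : b - m <= b by linarith.
have e : x * y * (1 - w ^+ 2) - p * q = x * (y - q) + (x - p) * q - x * y * w ^+ 2 by ring.
rewrite e; apply: le_trans (ler_normB _ _) _.
rewrite [leRHS]mulrDl lerD//; last first.
  rewrite normrM (gtr0_norm W) normrM (gtr0_norm b1) (gtr0_norm b2) ler_wpM2r ?(ltW W)//.
  by rewrite ler_pM ?(ltW b1) ?(ltW b2).
have K : N * ((b - m) * w ^+ 2) <= N * b * w ^+ 2.
  by rewrite mulrA ler_wpM2r ?(ltW W)// ler_wpM2l.
apply: le_trans (ler_normD _ _) _; rewrite [leRHS]mulrDl -[N * (N * b) * w ^+ 2]mulrA lerD//.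
  rewrite normrM (gtr0_norm b1) ler_pM ?(ltW b1)//.
  exact: le_trans lip K.
rewrite normrM (ger0_norm inc) (gtr0_norm b4) [leLHS]mulrC ler_pM ?(ltW b4)//.
exact: le_trans mv K.
Qed.

Lemma bd_angle : bd (fun t m w => leg_angle (rho t) (rho1 t) b m w).
Proof.
have [C hC] : bounded_on leg_range (fun z => rho z.1.1 z.1.2 * (2 * (b - z.1.2) *
    leg_kappa (rho z.1.1) (rho1 z.1.1) b z.1.2 z.2) * (leg_radius b z.1.2 z.2)^-1).
  apply: bounded_onM bd_rad_inv; apply: bounded_onM bd_rho_m _; apply: bounded_onM bd_kappa.
  by apply: bounded_onM bd_width; exact: bounded_on_cst.
by exists C => z /hC.
Qed.

Lemma bd_square_w : bd (fun t m w => 1 - w ^+ 2).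
Proof. by apply: bounded_onB (bounded_on_cst _ _) (bounded_onX _ bd_w). Qed.

Lemma bd_variation : bd (fun t m w => leg_variation (rho t) (rho1 t) b m w).
Proof.
have c2 := bounded_on_cst leg_range (2 : R).
have i := bd_rad_inv; have i2 : bd (fun t m w => (leg_radius b m w ^+ 2)^-1).
  have [C hC] := bounded_onX 2 i.
  by exists C => z /hC; rewrite exprVn.
apply: bounded_onB.
  apply: bounded_onM bd_kappa _; apply: bounded_onB; first apply: bounded_onB.
  - by apply: bounded_onM i; apply: bounded_onM bd_width; apply: bounded_onM bd_rho1_m.
  - by apply: bounded_onM i; apply: bounded_onM bd_rho_m.
  - apply: bounded_onM i2; apply: bounded_onM bd_square_w; apply: bounded_onM bd_width.
    by apply: bounded_onM bd_rho_m.
apply: bounded_onM bd_defect; apply: bounded_onM (bounded_onX 3 bd_kappa) _.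
by apply: bounded_onM i; apply: bounded_onM bd_width; apply: bounded_onM bd_rho_m.
Qed.

Lemma bd_action : bd (fun t m w => leg_action (rho t) (rho1 t) b m w).
Proof.
have c2 := bounded_on_cst leg_range (2 : R).
apply: bounded_onM bd_rad_inv; apply: bounded_onM bd_root; apply: bounded_onM bd_w.
by apply: bounded_onM bd_width.
Qed.

Lemma bd_action_variation : bd (fun t m w => leg_action_variation (rho t) (rho1 t) b m w).
Proof.
have c2 := bounded_on_cst leg_range (2 : R).
have i := bd_rad_inv; have i2 : bd (fun t m w => (leg_radius b m w ^+ 2)^-1).
  have [C hC] := bounded_onX 2 i.
  by exists C => z /hC; rewrite exprVn.
have w2 := bounded_onX 2 bd_w.
apply: bounded_onB; first apply: bounded_onD.
- apply: bounded_onM i; apply: bounded_onM bd_root; apply: bounded_onM bd_w.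
  exact: bounded_on_cst.
- apply: bounded_onM i; apply: bounded_onM (bounded_onM bd_defect w2).
  by apply: bounded_onM bd_kappa; apply: bounded_onM bd_width.
- apply: bounded_onM i2; apply: bounded_onM bd_square_w; apply: bounded_onM bd_root.
  by apply: bounded_onM bd_w; apply: bounded_onM bd_width.
Qed.

End SteepFamily.

Section LegLimits.
Context {R : realType} {Z : Type} (F : set_system Z) {FF : Filter F}.

(** One notion of convergence of a leg, along any filter, serves both continuity in w
    for one profile and joint continuity in the profile and the turning radius. *)
Record leg_limit (b : R) (rho_ rho1_ : Z -> R -> R) (m_ w_ : Z -> R)
    (rho rho1 : R -> R) (m w : R) : Prop := LegLimit {
  ll_m : m_ z @[z --> F] --> m;
  ll_w : w_ z @[z --> F] --> w;
  ll_rho_m : rho_ z (m_ z) @[z --> F] --> rho m;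
  ll_rho1_m : rho1_ z (m_ z) @[z --> F] --> rho1 m;
  ll_rho_rad : rho_ z (leg_radius b (m_ z) (w_ z)) @[z --> F] --> rho (leg_radius b m w);
  ll_rho1_rad : rho1_ z (leg_radius b (m_ z) (w_ z)) @[z --> F] --> rho1 (leg_radius b m w);
  ll_w0 : 0 < w;
  ll_rad0 : leg_radius b m w != 0;
  ll_slope0 : 0 < leg_slope rho rho1 b m w
}.

Variables (b : R) (rho_ rho1_ : Z -> R -> R) (m_ w_ : Z -> R).
Variables (rho rho1 : R -> R) (m w : R).
Hypothesis L : leg_limit b rho_ rho1_ m_ w_ rho rho1 m w.
Let cm := ll_m L.
Let cw := ll_w L.
Let crm := ll_rho_m L.
Let cr1m := ll_rho1_m L.
Let crr := ll_rho_rad L.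
Let cr1r := ll_rho1_rad L.
Let w0 := ll_w0 L.
Let r0 := ll_rad0 L.
Let s0 := ll_slope0 L.

Lemma cvg_sq f (x : R) : f z @[z --> F] --> x -> (f z : R) ^+ 2 @[z --> F] --> x ^+ 2.
Proof. by move=> cf; exact: (cvgM cf cf). Qed.

Lemma rad_cvg : leg_radius b (m_ z) (w_ z) @[z --> F] --> leg_radius b m w.
Proof.
apply: cvgD => //; apply: cvgM; last exact: cvg_sq.
by apply: cvgB => //; exact: cvg_cst.
Qed.

Lemma rad_inv_cvg : (leg_radius b (m_ z) (w_ z))^-1 @[z --> F] --> (leg_radius b m w)^-1.
Proof. by apply: cvgV => //; exact: rad_cvg. Qed.

Lemma w2_inv_cvg : (w_ z ^+ 2)^-1 @[z --> F] --> (w ^+ 2)^-1.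
Proof. by apply: cvgV; [rewrite expf_neq0// gt_eqF|exact: cvg_sq]. Qed.

Lemma slope_cvg : leg_slope (rho_ z) (rho1_ z) b (m_ z) (w_ z) @[z --> F] --> leg_slope rho rho1 b m w.
Proof.
have e : \forall z \near F, (rho_ z (leg_radius b (m_ z) (w_ z)) ^+ 2 - rho_ z (m_ z) ^+ 2) / w_ z ^+ 2 =
    leg_slope (rho_ z) (rho1_ z) b (m_ z) (w_ z).
  have : \forall z \near F, 0 < w_ z by exact: (cvgr_gt w).
  by apply: filterS => z wz; rewrite /leg_slope gt_eqF.
apply: cvg_trans (near_eq_cvg e) _; rewrite /leg_slope gt_eqF//.
by apply: cvgM w2_inv_cvg; apply: cvgB; exact: cvg_sq.
Qed.

Lemma sqrt_slope_cvg :
  Num.sqrt (leg_slope (rho_ z) (rho1_ z) b (m_ z) (w_ z)) @[z --> F] --> Num.sqrt (leg_slope rho rho1 b m w).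
Proof. by apply: continuous_cvg slope_cvg; exact: sqrt_continuous. Qed.

Lemma kappa_cvg : leg_kappa (rho_ z) (rho1_ z) b (m_ z) (w_ z) @[z --> F] --> leg_kappa rho rho1 b m w.
Proof. by apply: cvgV sqrt_slope_cvg; rewrite gt_eqF// sqrtr_gt0. Qed.

Lemma root_cvg : leg_root (rho_ z) (rho1_ z) b (m_ z) (w_ z) @[z --> F] --> leg_root rho rho1 b m w.
Proof. by apply: cvgM sqrt_slope_cvg. Qed.

Lemma one_sub_cvg : 1 - w_ z ^+ 2 @[z --> F] --> 1 - w ^+ 2.
Proof. by apply: cvgB; [exact: cvg_cst|exact: cvg_sq]. Qed.

Lemma defect_cvg : leg_defect (rho_ z) (rho1_ z) b (m_ z) (w_ z) @[z --> F] --> leg_defect rho rho1 b m w.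
Proof.
apply: cvgM w2_inv_cvg; apply: cvgB; last exact: cvgM.
by apply: cvgM one_sub_cvg; exact: cvgM.
Qed.

Lemma width_cvg (k : R) : k * (b - m_ z) @[z --> F] --> k * (b - m).
Proof. by apply: cvgM; [exact: cvg_cst|apply: cvgB => //; exact: cvg_cst]. Qed.

Lemma angle_cvg : leg_angle (rho_ z) (rho1_ z) b (m_ z) (w_ z) @[z --> F] --> leg_angle rho rho1 b m w.
Proof.
by apply: cvgM rad_inv_cvg; apply: cvgM crm _; apply: cvgM kappa_cvg; exact: width_cvg.
Qed.

Lemma action_cvg : leg_action (rho_ z) (rho1_ z) b (m_ z) (w_ z) @[z --> F] --> leg_action rho rho1 b m w.
Proof.
apply: cvgM rad_inv_cvg; apply: cvgM root_cvg; by apply: cvgM cw; exact: width_cvg.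
Qed.

Lemma momentum_width_cvg : 2 * rho_ z (m_ z) * (b - m_ z) @[z --> F] --> 2 * rho m * (b - m).
Proof.
apply: cvgM; last by apply: cvgB => //; exact: cvg_cst.
by apply: cvgM => //; exact: cvg_cst.
Qed.

Lemma rad_sq_inv_cvg : (leg_radius b (m_ z) (w_ z) ^+ 2)^-1 @[z --> F] --> (leg_radius b m w ^+ 2)^-1.
Proof. by apply: cvgV; [rewrite expf_neq0|apply: cvg_sq; exact: rad_cvg]. Qed.

Lemma variation_cvg :
  leg_variation (rho_ z) (rho1_ z) b (m_ z) (w_ z) @[z --> F] --> leg_variation rho rho1 b m w.
Proof.
apply: cvgB.
  apply: cvgM kappa_cvg _; apply: cvgB; first apply: cvgB.
  - apply: cvgM rad_inv_cvg; apply: cvgM; last by apply: cvgB => //; exact: cvg_cst.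
    by apply: cvgM => //; exact: cvg_cst.
  - by apply: cvgM rad_inv_cvg; apply: cvgM => //; exact: cvg_cst.
  - by apply: cvgM rad_sq_inv_cvg; apply: cvgM momentum_width_cvg one_sub_cvg.
apply: cvgM defect_cvg; apply: cvgM; last exact: cvgM momentum_width_cvg rad_inv_cvg.
by apply: cvgM kappa_cvg _; apply: cvgM kappa_cvg kappa_cvg.
Qed.

Lemma action_variation_cvg :
  leg_action_variation (rho_ z) (rho1_ z) b (m_ z) (w_ z) @[z --> F] --> leg_action_variation rho rho1 b m w.
Proof.
apply: cvgB; first apply: cvgD.
- by apply: cvgM rad_inv_cvg; apply: cvgM root_cvg; apply: cvgM => //; exact: cvg_cst.
- apply: cvgM rad_inv_cvg; apply: cvgM; last exact: cvgM defect_cvg (cvg_sq cw).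
  by apply: cvgM kappa_cvg; exact: width_cvg.
- apply: cvgM rad_sq_inv_cvg; apply: cvgM one_sub_cvg; apply: cvgM root_cvg.
  by apply: cvgM cw; exact: width_cvg.
Qed.

End LegLimits.

Section LegIntegrals.
Context {R : realType} {T : Type}.
Variables (J : T -> Prop) (rho rho1 : T -> R -> R) (x0 b m1 m2 d N : R).
Hypothesis sf : steep_family J rho rho1 x0 b m1 m2 d N.
Variable t : T.
Hypothesis Jt : J t.
Implicit Types m w : R.

Let tp m := sf_tp sf Jt (m := m).

Lemma leg_cvg_w m w : m1 < m < m2 -> 0 < w < 1 ->
  [/\ {for w, continuous (leg_angle (rho t) (rho1 t) b m)},
      {for w, continuous (leg_action (rho t) (rho1 t) b m)},
      {for w, continuous (leg_variation (rho t) (rho1 t) b m)} &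
      {for w, continuous (leg_action_variation (rho t) (rho1 t) b m)}].
Proof.
move=> hm hw; have h := tp hm; have w0 : 0 < w by case/andP: hw.
have hw' : -1 < w < 1 by lra.
have hw'' : -1 <= w <= 1 by lra.
have r0 : leg_radius b m w != 0 by rewrite gt_eqF// (rad_gt0 h).
have s0 := slope_gt0 h hw''.
have cm : m @[z --> w] --> m by exact: cvg_cst.
have cw : z @[z --> w] --> w by exact: cvg_id.
have crm : rho t m @[z --> w] --> rho t m by exact: cvg_cst.
have cr1m : rho1 t m @[z --> w] --> rho1 t m by exact: cvg_cst.
have crr : rho t (leg_radius b m z) @[z --> w] --> rho t (leg_radius b m w).
  exact: is_derive1_continuous (rho_rad_derive h hw').
have cr1r : rho1 t (leg_radius b m z) @[z --> w] --> rho1 t (leg_radius b m w).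
  apply: (continuous_comp (f := leg_radius b m) (g := rho1 t)); first exact: rad_continuous.
  by apply: (tp_cont1 h); exact: (rad_itv_oo h).
have L : leg_limit (nbhs w) b (fun=> rho t) (fun=> rho1 t) (fun=> m) id (rho t) (rho1 t) m w.
  by split.
split.
- exact (angle_cvg L).
- exact (action_cvg L).
- exact (variation_cvg L).
- exact (action_variation_cvg L).
Qed.

Lemma leg_bounded_measurable m : m1 < m < m2 ->
  [/\ bounded_measurable 0 1 (leg_angle (rho t) (rho1 t) b m),
      bounded_measurable 0 1 (leg_action (rho t) (rho1 t) b m),
      bounded_measurable 0 1 (leg_variation (rho t) (rho1 t) b m) &
      bounded_measurable 0 1 (leg_action_variation (rho t) (rho1 t) b m)].
Proof.
move=> hm; have [C1 h1] := bd_angle sf; have [C2 h2] := bd_action sf.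
have [C3 h3] := bd_variation sf; have [C4 h4] := bd_action_variation sf.
split.
- apply: (@continuous_bounded_measurable _ _ _ _ C1) => w hw; first by have [] := leg_cvg_w hm hw.
  by apply: (h1 (t, m, w)); split.
- apply: (@continuous_bounded_measurable _ _ _ _ C2) => w hw; first by have [] := leg_cvg_w hm hw.
  by apply: (h2 (t, m, w)); split.
- apply: (@continuous_bounded_measurable _ _ _ _ C3) => w hw; first by have [] := leg_cvg_w hm hw.
  by apply: (h3 (t, m, w)); split.
- apply: (@continuous_bounded_measurable _ _ _ _ C4) => w hw; first by have [] := leg_cvg_w hm hw.
  by apply: (h4 (t, m, w)); split.
Qed.

Definition total_action (rho rho1 : R -> R) m := 2 * integral 0 1 (leg_action rho rho1 b m).
Definition total_variation (rho rho1 : R -> R) m := 2 * integral 0 1 (leg_variation rho rho1 b m).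

Lemma aperture_derive m : m1 < m < m2 ->
  is_derive m 1 (leg_aperture (rho t) (rho1 t) b) (total_variation (rho t) (rho1 t) m).
Proof.
move=> hm; have [C hC] := bd_variation sf.
have := @integral_derive_under _ 0 1 m1 m2 m (leg_angle (rho t) (rho1 t) b)
  (leg_variation (rho t) (rho1 t) b) C hm.
case=> [y /leg_bounded_measurable[]//|y w hy hw|y w hy hw|].
- exact (leg_angle_derive_m (@tp) hy hw).
- by apply: (hC (t, y, w)); split.
move=> dI eI; have h := DeriveDef dI eI.
by apply: (is_derive_eq (is_deriveZ 2 h)).
Qed.

Lemma boundary_integral m : m1 < m < m2 ->
  integral 0 1 (leg_action_variation (rho t) (rho1 t) b m) =
  - rho1 t m * integral 0 1 (leg_angle (rho t) (rho1 t) b m).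
Proof.
move=> hm; have h := tp hm; have [b1 _ _ b4] := leg_bounded_measurable hm.
have E : integral 0 1 (fun w => leg_action_variation (rho t) (rho1 t) b m w +
    rho1 t m * leg_angle (rho t) (rho1 t) b m w) =
    boundary_term (rho t) (rho1 t) b m 1 - boundary_term (rho t) (rho1 t) b m 0.
  have [_ [C1 h1]] := b1; have [_ [C4 h4]] := b4.
  apply: (@integral_fundamental _ 0 1 _ _ (C4 + `|rho1 t m| * C1)) => //.
  - move=> w hw; exact (boundary_term_derive (@tp) hm hw).
  - move=> w hw; have [c1 _ _ c4] := leg_cvg_w hm hw.
    exact: (continuousD c4 (continuousM (@cst_continuous R R (rho1 t m) w) c1)).
  - move=> w hw; apply: le_trans (ler_normD _ _) _; rewrite lerD ?h4// normrM.
    by rewrite ler_wpM2l ?h1.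
  apply: (@subspace_eq_continuous _ _ _ (fun w => boundary_term (rho t) (rho1 t) b m (clamp w))).
    move=> w; rewrite inE /= in_itv /= => hw; rewrite clamp_id//; lra.
  apply: continuous_subspaceT => w; apply: cvgM; first apply: cvgM.
  - exact: (root_clamp_continuous h).
  - apply: cvgB; first exact: cvg_cst.
    by have c := @clamp_continuous R w; exact: (cvgM c c).
  - apply: cvgV; first by rewrite gt_eqF// (rad_gt0 h) ?clamp_itv.
    exact: rad_clamp_continuous.
have := E; rewrite integralD ?integralZ//; last first.
  by apply: bounded_measurableM b1; exact: bounded_measurable_cst.
rewrite /boundary_term /leg_root expr1n subrr mul0r !mulr0 !mul0r subrr => e.
by rewrite mulNr; lra.
Qed.

(** The relation H' = - Delta between action and aperture, before the change of
    variable from the turning radius to the momentum. *)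
Lemma action_derive m : m1 < m < m2 ->
  is_derive m 1 (total_action (rho t) (rho1 t)) (- rho1 t m * leg_aperture (rho t) (rho1 t) b m).
Proof.
move=> hm; have [C hC] := bd_action_variation sf.
have := @integral_derive_under _ 0 1 m1 m2 m (leg_action (rho t) (rho1 t) b)
  (leg_action_variation (rho t) (rho1 t) b) C hm.
case=> [y /leg_bounded_measurable[]//|y w hy hw|y w hy hw|].
- exact (leg_action_derive_m (@tp) hy hw).
- by apply: (hC (t, y, w)); split.
rewrite boundary_integral// => dI eI; have h := DeriveDef dI eI.
apply: (is_derive_eq (is_deriveZ 2 h)).
by rewrite /leg_aperture /GRing.scale /=; ring.
Qed.

Lemma aperture_gt0 m : m1 < m < m2 -> 0 < leg_aperture (rho t) (rho1 t) b m.
Proof.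
move=> hm; have h := tp hm; have [b1 _ _ _] := leg_bounded_measurable hm.
have [c _ cmin] := EVT_min ler01 (continuous_subspaceT (leg_angle_continuous h)).
have c0 : 0 < leg_angle (rho t) (rho1 t) b m (clamp c).
  have hc := clamp_itv c; rewrite /leg_angle divr_gt0 ?(rad_gt0 h)//.
  by rewrite mulr_gt0 ?(rho_m_gt0 h) ?(density_gt0 h).
rewrite mulr_gt0//; apply: lt_le_trans c0 _.
rewrite -[leLHS]mulr1 -{1}[1]subr0 -(integral_cst _ ler01).
apply: integral_le => // [|w hw]; first exact: bounded_measurable_cst.
have hw' : w \in `[0, 1] by rewrite in_itv /=; lra.
by have := cmin w hw'; rewrite [clamp w]clamp_id//; lra.
Qed.

(** From rho^2 = (rho^2 - p^2) + p^2 in the integrand. *)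
Lemma duration_split m : m1 < m < m2 -> leg_duration (rho t) (rho1 t) b m =
  total_action (rho t) (rho1 t) m + rho t m * leg_aperture (rho t) (rho1 t) b m.
Proof.
move=> hm; have h := tp hm; have [b1 b2 _ _] := leg_bounded_measurable hm.
rewrite /total_action /leg_aperture mulrCA -mulrDr -integralZ// -integralD//; last first.
  by apply: bounded_measurableM b1; exact: bounded_measurable_cst.
congr (2 * _); apply: integral_eq => w hw.
have hw' : -1 <= w <= 1 by lra.
have r0 := rad_gt0 h hw'; have s0 := root_gt0 (@tp) hm hw.
have k := root_kappa (@tp) hm hw.
have e := root_sqr h hw'.
rewrite /leg_time /leg_angle /leg_action /leg_density -/(leg_kappa _ _ _ _ _).
move: (leg_root _ _ _ _ _) (leg_kappa _ _ _ _ _) (leg_radius _ _ _) k e r0 => x y z k e r0.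
have -> : rho t z ^+ 2 = x ^+ 2 + rho t m ^+ 2 by rewrite e; ring.
by rewrite -k; field; rewrite gt_eqF.
Qed.

End LegIntegrals.

(** * Families of profiles *)

Section FamilyCalculus.
Context {R : realType}.
Implicit Types t m p w : R.

(** What makes the integrals over a leg jointly continuous in the parameter and the
    turning radius. *)
Record regular_family (rho rho1 : R -> R -> R) (t1 t2 x0 b m1 m2 d N : R) : Prop :=
  RegularFamily {
  rf_steep : steep_family (fun t => t1 < t < t2) rho rho1 x0 b m1 m2 d N;
  rf_rho : forall t r, t1 < t < t2 -> x0 < r < b ->
    {for (t, r), continuous (fun z : R * R => rho z.1 z.2)};
  rf_rho1 : forall t r, t1 < t < t2 -> x0 < r < b ->
    {for (t, r), continuous (fun z : R * R => rho1 z.1 z.2)}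
}.

Variables (rho rho1 : R -> R -> R) (t1 t2 x0 b m1 m2 d N : R).
Hypothesis rf : regular_family rho rho1 t1 t2 x0 b m1 m2 d N.
Local Notation sf := (rf_steep rf).

Let tp t m (ht : t1 < t < t2) := sf_tp sf ht (m := m).

Lemma pair_near (u v u' v' t m : R) : u < t < v -> u' < m < v' ->
  \forall z \near (t, m), u < z.1 < v /\ u' < z.2 < v'.
Proof.
move=> ht hm.
exists ([set s | u < s < v], [set y | u' < y < v']); last by move=> [s y] [].
by split; exact: near_itv.
Qed.

Lemma leg_limit_family t m w : t1 < t < t2 -> m1 < m < m2 -> 0 < w < 1 ->
  leg_limit (nbhs (t, m)) b (fun z : R * R => rho z.1) (fun z => rho1 z.1) (fun z => z.2) (fun=> w)
    (rho t) (rho1 t) m w.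
Proof.
move=> ht hm hw; have h := tp ht hm; have w0 : 0 < w by case/andP: hw.
have hw' : -1 < w < 1 by lra.
have hw'' : -1 <= w <= 1 by lra.
have c1 : z.1 @[z --> (t, m)] --> t by exact: cvg_fst.
have c2 : z.2 @[z --> (t, m)] --> m by exact: cvg_snd.
have cr : leg_radius b z.2 w @[z --> (t, m)] --> leg_radius b m w.
  by apply: cvgD => //; apply: cvgM; [apply: cvgB => //; exact: cvg_cst|exact: cvg_cst].
have pairs (f : R * R -> R) (x : R) : f z @[z --> (t, m)] --> x ->
    (z.1, f z) @[z --> (t, m)] --> (t, x).
  move=> cf; exact: (@cvg_pair _ _ _ (nbhs (t, m)) (nbhs t) (nbhs x) _ _ _ _ _ c1 cf).
have mb : x0 < m < b by rewrite (tp_m h) (tp_b h).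
have rb := rad_itv_oo h hw'.
split => //.
- exact: cvg_cst.
- exact: (rf_rho rf ht mb).
- exact: (rf_rho1 rf ht mb).
- exact: (cvg_comp _ _ (pairs _ _ cr) (rf_rho rf ht rb)).
- exact: (cvg_comp _ _ (pairs _ _ cr) (rf_rho1 rf ht rb)).
- by rewrite gt_eqF// (rad_gt0 h).
- exact: (slope_gt0 h).
Qed.

Lemma aperture_joint t m : t1 < t < t2 -> m1 < m < m2 ->
  {for (t, m), continuous (fun z : R * R => leg_aperture (rho z.1) (rho1 z.1) b z.2)}.
Proof.
move=> ht hm; have [C hC] := bd_angle sf.
apply: cvgM; first exact: cvg_cst.
apply: (@integral_param_cvg _ _ (fun z : R * R => leg_angle (rho z.1) (rho1 z.1) b z.2) 0 1 (t, m) C).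
  apply: filterS (pair_near ht hm) => -[s y] [/= hs hy]; split.
    by have [[]] := leg_bounded_measurable sf hs hy.
  by move=> w hw; apply: (hC (s, y, w)); split.
by move=> w hw; exact: angle_cvg (leg_limit_family ht hm hw).
Qed.

Lemma variation_joint t m : t1 < t < t2 -> m1 < m < m2 ->
  {for (t, m), continuous (fun z : R * R => total_variation b (rho z.1) (rho1 z.1) z.2)}.
Proof.
move=> ht hm; have [C hC] := bd_variation sf.
apply: cvgM; first exact: cvg_cst.
apply: (@integral_param_cvg _ _ (fun z : R * R => leg_variation (rho z.1) (rho1 z.1) b z.2) 0 1 (t, m) C).
  apply: filterS (pair_near ht hm) => -[s y] [/= hs hy]; split.
    by have [_ _ [] //] := leg_bounded_measurable sf hs hy.
  by move=> w hw; apply: (hC (s, y, w)); split.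
by move=> w hw; exact: variation_cvg (leg_limit_family ht hm hw).
Qed.

Let bounded t m : t1 < t < t2 -> m1 < m < m2 -> bounded_profile x0 b N (rho t).
Proof.
move=> ht hm; have h := tp ht hm; split.
- exact: (tp_x0 h).
- exact: lt_trans (tp_m h) (tp_b h).
- by move=> r hr; exact: is_derive1_continuous (tp_derive h hr).
- by move=> r hr; rewrite ltW ?(tp_pos h)//; have [] := sf_le sf ht hr.
Qed.

(** Substitution of the radius for w in the action. *)
Lemma action_abel t m : t1 < t < t2 -> m1 < m < m2 ->
  total_action b (rho t) (rho1 t) m = 2 * abel x0 b (rho t) (rho t m ^+ 2).
Proof.
move=> ht hm; have h := tp ht hm; have [xm mb] := (tp_m h, tp_b h).
have bp := bounded ht hm; have bm := abel_integrand_bm (rho t m ^+ 2) bp.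
congr (2 * _); rewrite /abel (integral_split (ltW xm) (ltW mb) bm).
rewrite [X in _ = X + _](_ : _ = 0) ?add0r; last first.
  rewrite (_ : 0 = 0 * (m - x0)); last by rewrite mul0r.
  rewrite -(integral_cst 0 (ltW xm)); apply: integral_eq => r /andP[xr rm].
  rewrite ler0_sqrtr ?mul0r// subr_le0 ler_sqr ?nnegrE; last 2 first.
  - by rewrite ltW// (tp_pos h)// xr (lt_trans rm).
  - by rewrite ltW// (rho_m_gt0 h).
  - by rewrite ltW// (rho_increasing h xr rm)// ltW.
have [_ [C hC]] := bounded_measurable_sub (ltW xm) (lexx b) bm.
have l0 : 0 < b - m by rewrite subr_gt0.
have inc x y : 0 <= x -> x <= y -> y <= 1 ->
    0 <= (b - m) * y ^+ 2 - (b - m) * x ^+ 2 <= 2 * (b - m) * (y - x).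
  move=> x0' xy y1; rewrite -mulrBr [2 * _]mulrC -mulrA ler_pM2l// mulr_ge0 ?(ltW l0)//=; nra.
transitivity (integral 0 1 (fun w => Num.sqrt (rho t (leg_radius b m w) ^+ 2 - rho t m ^+ 2) /
  leg_radius b m w * (2 * (b - m) * w))); last first.
  apply/esym; apply: (@integral_substitution _ m b 0 1 _ (leg_radius b m)
    (fun w => 2 * (b - m) * w) C (2 * (b - m))); rewrite ?ltr01//.
  - by rewrite /leg_radius expr0n mulr0 addr0.
  - by rewrite /leg_radius expr1n mulr1 addrC subrK.
  - move=> w hw; have hw' : -1 < w < 1 by lra.
    have /andP[_ ->] := rad_itv_oo h hw'; rewrite andbT /leg_radius ltrDl mulr_gt0//.
    by rewrite exprn_gt0//; case/andP: hw.
  - move=> w hw; have hw' : -1 < w < 1 by lra.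
    apply: (is_derive_eq (rad_derive h hw')); have k := root_kappa (fun m => @tp t m ht) hm hw.
    by rewrite -[in RHS]k /leg_density /leg_kappa; ring.
  - by move=> w hw; apply: (@continuousM _ _ (fun=> 2 * (b - m)) id); [exact: cst_continuous|exact: cvg_id].
  - move=> w hw; rewrite normrM gtr0_norm ?mulr_gt0// -[leRHS]mulr1 ler_wpM2l//.
      by rewrite mulr_ge0// ltW.
    by rewrite ger0_norm; lra.
  - by move=> x y x0' xy y1; rewrite /leg_radius lerD2l; have := inc x y x0' xy y1; lra.
  - move=> x y x0' xy y1; rewrite /leg_radius opprD addrACA subrr add0r.
    by have /andP[i1 i2] := inc x y x0' xy y1; rewrite ger0_norm.
  - move=> r hr; have hr' : x0 < r < b by case/andP: hr => mr ->; rewrite (lt_trans xm mr).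
    apply: cvgM; last by apply: cvgV; [rewrite gt_eqF// (lt_trans (tp_x0 h))//; case/andP: hr'|exact: cvg_id].
    apply: continuous_cvg; first exact: sqrt_continuous.
    apply: cvgB; last exact: cvg_cst.
    by have c := is_derive1_continuous (tp_derive h hr'); exact: (cvgM c c).
apply: integral_eq => w hw; have hw' : -1 <= w <= 1 by lra.
have s0 := root_gt0 (fun m => @tp t m ht) hm hw.
rewrite -(root_sqr h hw') sqrtr_sqr gtr0_norm// /leg_action.
by have := rad_gt0 h hw'; move=> r0; field; rewrite gt_eqF.
Qed.

(** The inverse of the momentum: travel times are functions of the momentum p, while
    the integrals are written in terms of the turning radius. *)
Definition turning_radius (p1 p2 : R) (Rt : R -> R -> R) : Prop :=
  forall t p, t1 < t < t2 -> p1 < p < p2 -> m1 < Rt t p < m2 /\ rho t (Rt t p) = p.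

Lemma turning_radius_exists (p1 p2 : R) :
  (forall t p, t1 < t < t2 -> p1 < p < p2 -> exists2 m, m1 < m < m2 & rho t m = p) ->
  exists Rt, turning_radius p1 p2 Rt.
Proof.
move=> h; have hz (z : R * R) : exists m, t1 < z.1 < t2 -> p1 < z.2 < p2 ->
    m1 < m < m2 /\ rho z.1 m = z.2.
  have [hz1|hz1] := boolP (t1 < z.1 < t2); last by exists 0.
  have [hz2|hz2] := boolP (p1 < z.2 < p2); last by exists 0.
  by have [m hm hp] := h _ _ hz1 hz2; exists m.
have [f hf] := choice hz; exists (fun t p => f (t, p)) => t p ht hp.
exact: (hf (t, p)).
Qed.

Variables (p1 p2 : R) (Rt : R -> R -> R).
Hypothesis hR : turning_radius p1 p2 Rt.

Let rho_lt t x y : t1 < t < t2 -> m1 < x < m2 -> m1 < y < m2 -> x < y -> rho t x < rho t y.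
Proof.
move=> ht hx hy xy; have h := tp ht hx; have h' := tp ht hy.
by apply: (rho_increasing h) => //; [exact: tp_m h|rewrite ltW// (tp_b h')].
Qed.

Lemma turning_radius_id t m : t1 < t < t2 -> m1 < m < m2 -> p1 < rho t m < p2 -> Rt t (rho t m) = m.
Proof.
move=> ht hm hp; have [h1 h2] := hR ht hp.
have [l|l|//] := ltgtP (Rt t (rho t m)) m.
  by have := rho_lt ht h1 hm l; rewrite h2 ltxx.
by have := rho_lt ht hm h1 l; rewrite h2 ltxx.
Qed.

Lemma turning_radius_derive t p : t1 < t < t2 -> p1 < p < p2 ->
  is_derive p 1 (Rt t) (rho1 t (Rt t p))^-1.
Proof.
move=> ht hp; have [hm e] := hR ht hp; have h := tp ht hm.
have dr r : m1 < r < m2 -> is_derive r 1 (rho t) (rho1 t r).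
  by move=> hr; have h' := tp ht hr; apply: (tp_derive h'); rewrite (tp_m h') (tp_b h').
have q0 : rho1 t (Rt t p) != 0 by rewrite gt_eqF// (rho1_m_gt0 h).
have c1 : {near Rt t p, cancel (rho t) (Rt t)}.
  have c : \forall m \near Rt t p, p1 < rho t m < p2.
    have := near_itv hp; rewrite -{1}e => hn.
    exact (is_derive1_continuous (dr _ hm) hn).
  by apply: filterS2 (near_itv hm) c => m hm' hp'; exact: turning_radius_id.
have c2 : {near Rt t p, continuous (rho t)}.
  by apply: filterS (near_itv hm) => m /dr /is_derive1_continuous.
by have := is_derive_inverse c1 c2 (dr _ hm) q0; rewrite e.
Qed.

Lemma turning_radius_joint t p : t1 < t < t2 -> p1 < p < p2 ->
  (fun z : R * R => Rt z.1 z.2) z @[z --> (t, p)] --> Rt t p.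
Proof.
move=> ht hp; have [hm e] := hR ht hp; have h := tp ht hm.
apply/cvgrPdist_lt => eps eps0.
pose u := Num.max (Rt t p - eps / 2) ((m1 + Rt t p) / 2).
pose v := Num.min (Rt t p + eps / 2) ((m2 + Rt t p) / 2).
have [m1R Rm2] := andP hm.
have hu : m1 < u < Rt t p /\ Rt t p - eps < u.
  by rewrite /u !lt_max !gt_max; split; [apply/andP; split; [apply/orP; right|apply/andP; split]|apply/orP; left]; lra.
have hv : Rt t p < v < m2 /\ v < Rt t p + eps.
  by rewrite /v !lt_min !gt_min; split; [apply/andP; split; [apply/andP; split|apply/orP; right]|apply/orP; left]; lra.
have mu : m1 < u < m2 by case: hu => /andP[-> uR] _; rewrite (lt_trans uR).
have mv : m1 < v < m2 by case: hv => /andP[vR ->] _; rewrite (lt_trans _ vR).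
have lu : rho t u < p by rewrite -e; apply: rho_lt => //; case: hu => /andP[].
have lv : p < rho t v by rewrite -e; apply: rho_lt => //; case: hv => /andP[].
have crho m : m1 < m < m2 -> rho z.1 m @[z --> (t, p)] --> rho t m.
  move=> hm'; have h' := tp ht hm'.
  have hmb : x0 < m < b by rewrite (tp_m h') (tp_b h').
  apply: (cvg_comp (fun z : R * R => (z.1, m)) (fun z : R * R => rho z.1 z.2) _ (rf_rho rf ht hmb)).
  have c1 : z.1 @[z --> (t, p)] --> t by exact: cvg_fst.
  exact: (@cvg_pair _ _ _ (nbhs (t, p)) (nbhs t) (nbhs m) _ _ _ _ _ c1 (cvg_cst m)).
have c2 : z.2 @[z --> (t, p)] --> p by exact: cvg_snd.
have n1 : \forall z \near (t, p), rho z.1 u < (rho t u + p) / 2.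
  by apply: (cvgr_lt _ (crho u mu)); lra.
have n2 : \forall z \near (t, p), (rho t u + p) / 2 < z.2.
  by apply: (cvgr_gt _ c2); lra.
have n3 : \forall z \near (t, p), (rho t v + p) / 2 < rho z.1 v.
  by apply: (cvgr_gt _ (crho v mv)); lra.
have n4 : \forall z \near (t, p), z.2 < (rho t v + p) / 2.
  by apply: (cvgr_lt _ c2); lra.
near=> z.
have [hz1 hz2] : t1 < z.1 < t2 /\ p1 < z.2 < p2 by near: z; exact: pair_near.
have [hz e'] := hR hz1 hz2.
have l1 : rho z.1 u < z.2 by apply: lt_trans (near n1 z _) (near n2 z _).
have l2 : z.2 < rho z.1 v by apply: lt_trans (near n4 z _) (near n3 z _).
have Ru : u < Rt z.1 z.2.
  rewrite ltNge; apply/negP; rewrite le_eqVlt => /predU1P[E|l]; first by rewrite -e' E ltxx in l1.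
  by have := rho_lt hz1 hz mu l; rewrite e' => /(lt_trans l1); rewrite ltxx.
have Rv : Rt z.1 z.2 < v.
  rewrite ltNge; apply/negP; rewrite le_eqVlt => /predU1P[E|l]; first by rewrite -e' -E ltxx in l2.
  by have := rho_lt hz1 mv hz l; rewrite e' => /(lt_trans l2); rewrite ltxx.
case: hu hv => _ hu [_ hv].
by rewrite ltr_norml; lra.
Unshelve. all: by end_near. Qed.

Lemma turning_radius_increasing t p q : t1 < t < t2 -> p1 < p < p2 -> p1 < q < p2 -> p < q ->
  Rt t p < Rt t q.
Proof.
move=> ht hp hq pq; have [h1 e1] := hR ht hp; have [h2 e2] := hR ht hq.
rewrite ltNge; apply/negP; rewrite le_eqVlt => /predU1P[E|l].
  by move: pq; rewrite -e1 -e2 E ltxx.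
by have := rho_lt ht h2 h1 l; rewrite e1 e2 => /(lt_trans pq); rewrite ltxx.
Qed.

Lemma abel_dist (s t m x : R) : t1 < t < t2 -> t1 < s < t2 -> m1 < m < m2 ->
  `|abel x0 b (rho s) x - abel x0 b (rho t) x| <=
  integral x0 b (fun r => Num.sqrt `|rho s r ^+ 2 - rho t r ^+ 2| / r).
Proof.
move=> ht hs hm; have bt := bounded ht hm; have bs := bounded hs hm.
have [x00 _ _ _] := bt.
have bmt := abel_integrand_bm x bt; have bms := abel_integrand_bm x bs.
have bmd : bounded_measurable x0 b (fun r => Num.sqrt `|rho s r ^+ 2 - rho t r ^+ 2| / r).
  apply: bounded_measurableM; last exact: inv_bounded_measurable.
  apply: (@continuous_bounded_measurable _ _ _ _ (Num.sqrt (N ^+ 2 + N ^+ 2))) => r hr.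
    apply: (continuous_comp (f := fun r => `|rho s r ^+ 2 - rho t r ^+ 2|)); last exact: sqrt_continuous.
    apply: (continuous_comp (f := fun r => rho s r ^+ 2 - rho t r ^+ 2)); last exact: norm_continuous.
    by apply: cvgB; [exact: rho2_continuous bs hr|exact: rho2_continuous bt hr].
  rewrite ger0_norm ?sqrtr_ge0// ler_wsqrtr//; apply: le_trans (ler_normB _ _) _.
  by rewrite !ger0_norm ?sqr_ge0// lerD// (rho2_bound bs, rho2_bound bt).
rewrite /abel -integralB// ler_norml -[X in X <= _]mulN1r -integralZ//.
apply/andP; split; apply: integral_le => //.
- by apply: bounded_measurableM bmd; exact: bounded_measurable_cst.
- exact: bounded_measurableB.
- move=> r /andP[xr _]; rewrite mulN1r -mulNr -mulrBl ler_wpM2r ?invr_ge0 ?(ltW (lt_trans x00 xr))//.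
  have := sqrt_dist (rho s r ^+ 2 - x) (rho t r ^+ 2 - x).
  rewrite (_ : _ - x - _ = rho s r ^+ 2 - rho t r ^+ 2); last by ring.
  by rewrite ler_norml => /andP[].
- exact: bounded_measurableB.
- move=> r /andP[xr _]; rewrite -mulrBl ler_wpM2r ?invr_ge0 ?(ltW (lt_trans x00 xr))//.
  have := sqrt_dist (rho s r ^+ 2 - x) (rho t r ^+ 2 - x).
  rewrite (_ : _ - x - _ = rho s r ^+ 2 - rho t r ^+ 2); last by ring.
  by rewrite ler_norml => /andP[].
Qed.

(** Uniformity in x, because the square root is Hoelder continuous with a constant
    that does not depend on its argument. *)
Lemma abel_uniform (t m e : R) : t1 < t < t2 -> m1 < m < m2 -> 0 < e ->
  \forall s \near t, forall x, `|abel x0 b (rho s) x - abel x0 b (rho t) x| < e.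
Proof.
move=> ht hm e0; pose f s r := Num.sqrt `|rho s r ^+ 2 - rho t r ^+ 2| / r.
have bt := bounded ht hm; have [x00 xb _ _] := bt.
have f0 : integral x0 b (f t) = 0.
  rewrite (_ : 0 = 0 * (b - x0)); last by rewrite mul0r.
  rewrite -(integral_cst 0 (ltW xb)); apply: integral_eq => r hr.
  by rewrite /f subrr normr0 sqrtr0 mul0r.
have cf : integral x0 b (f s) @[s --> t] --> integral x0 b (f t).
  apply: (@integral_param_cvg _ _ f x0 b t (Num.sqrt (N ^+ 2 + N ^+ 2) / x0)).
    apply: filterS (near_itv ht) => s hs; have bs := bounded hs hm.
    have bnd r : x0 < r < b -> `|f s r| <= Num.sqrt (N ^+ 2 + N ^+ 2) / x0.
      move=> hr; have /andP[xr rb] := hr; have r0 := lt_trans x00 xr.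
      rewrite /f normrM ler_pM//; last by rewrite gtr0_norm ?invr_gt0// lef_pV2 ?posrE// ltW.
      rewrite ger0_norm ?sqrtr_ge0// ler_wsqrtr//; apply: le_trans (ler_normB _ _) _.
      by rewrite !ger0_norm ?sqr_ge0// lerD// (rho2_bound bs, rho2_bound bt).
    split => //; apply: continuous_measurable_itv => r hr.
    apply: cvgM; last by apply: cvgV; [rewrite gt_eqF// (lt_trans x00)//; case/andP: hr|exact: cvg_id].
    apply: (continuous_comp (f := fun r => `|rho s r ^+ 2 - rho t r ^+ 2|)); last exact: sqrt_continuous.
    apply: (continuous_comp (f := fun r => rho s r ^+ 2 - rho t r ^+ 2)); last exact: norm_continuous.
    by apply: cvgB; [exact: rho2_continuous bs hr|exact: rho2_continuous bt hr].
  move=> r hr; apply: cvgM; last exact: cvg_cst.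
  have cr : rho s r @[s --> t] --> rho t r.
    have c1 : (s, r) @[s --> t] --> (t, r).
      exact: (@cvg_pair _ _ _ (nbhs t) (nbhs t) (nbhs r) _ _ _ _ _ cvg_id (cvg_cst r)).
    exact: (cvg_comp _ _ c1 (rf_rho rf ht hr)).
  apply: continuous_cvg; first exact: sqrt_continuous.
  apply: (@cvg_norm _ _ _ (nbhs t)); apply: cvgB; last exact: cvg_cst.
  exact: (cvgM cr cr).
rewrite f0 in cf.
have : \forall s \near t, integral x0 b (f s) < e by apply: (cvgr_lt _ cf).
apply: filterS2 (near_itv ht) => s hs he x.
exact: le_lt_trans (abel_dist x ht hs hm) he.
Qed.

(** The chain rule for the change of variable from the turning radius to the
    momentum. *)
Lemma profiles_spectral_family (C : set R) :
  (forall t x y, t1 < t < t2 -> m1 < x -> x < y -> y < m2 ->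
    exists2 m, x < m < y & total_variation b (rho t) (rho1 t) m != 0) ->
  countable C ->
  (forall t m (n k : nat), t1 < t < t2 -> m1 < m < m2 -> (0 < n)%N -> (0 < k)%N ->
    n%:R * leg_aperture (rho t) (rho1 t) b m = 2 * pi * k%:R ->
    C (n%:R * leg_duration (rho t) (rho1 t) b m)) ->
  spectral_family p1 p2 t1 t2 (fun p t => total_action b (rho t) (rho1 t) (Rt t p))
    (fun p t => leg_aperture (rho t) (rho1 t) b (Rt t p))
    (fun p t => total_variation b (rho t) (rho1 t) (Rt t p) / rho1 t (Rt t p)) C.
Proof.
move=> dense cC lengths.
have swap (p t : R) : p1 < p < p2 -> t1 < t < t2 ->
    (z.2, Rt z.2 z.1) @[z --> (p, t)] --> (t, Rt t p).
  move=> hp ht.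
  have c1 : z.1 @[z --> (p, t)] --> p by exact: cvg_fst.
  have c2 : z.2 @[z --> (p, t)] --> t by exact: cvg_snd.
  have c3 : (z.2, z.1) @[z --> (p, t)] --> (t, p).
    exact: (@cvg_pair _ _ _ (nbhs (p, t)) (nbhs t) (nbhs p) _ _ _ _ _ c2 c1).
  have c4 := cvg_comp _ _ c3 (turning_radius_joint ht hp).
  exact: (@cvg_pair _ _ _ (nbhs (p, t)) (nbhs t) (nbhs (Rt t p)) _ _ _ _ _ c2 c4).
split.
- move=> p t hp ht; have [hm _] := hR ht hp; have h := tp ht hm.
  apply: (is_derive_eq (@is_derive1_comp _ _ (Rt t) p _ _ (action_derive sf ht hm) (turning_radius_derive ht hp))).
  by field; rewrite gt_eqF// (rho1_m_gt0 h).
- move=> p t hp ht; have [hm _] := hR ht hp; have h := tp ht hm.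
  exact: (@is_derive1_comp _ _ (Rt t) p _ _ (aperture_derive sf ht hm) (turning_radius_derive ht hp)).
- move=> p t hp ht; have [hm _] := hR ht hp; have h := tp ht hm.
  have hmb : x0 < Rt t p < b by rewrite (tp_m h) (tp_b h).
  have d1 := cvg_comp _ _ (swap _ _ hp ht) (variation_joint ht hm).
  have d2 := cvg_comp _ _ (swap _ _ hp ht) (rf_rho1 rf ht hmb).
  by apply: cvgM d1 _; apply: cvgV d2; rewrite gt_eqF//= (rho1_m_gt0 h).
- move=> p t hp ht; have [hm _] := hR ht hp.
  have c1 : (p, s) @[s --> t] --> (p, t).
    exact: (@cvg_pair _ _ _ (nbhs t) (nbhs p) (nbhs t) _ _ _ _ _ (cvg_cst p) cvg_id).
  have c2 := cvg_comp _ _ c1 (swap _ _ hp ht).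
  exact: (cvg_comp _ _ c2 (aperture_joint ht hm)).
- move=> t e ht e0.
  have [hp|hp] := ltP p1 p2; last by near=> s => p hp'; exfalso; lra.
  have hq : p1 < (p1 + p2) / 2 < p2 by lra.
  have [hm _] := hR ht hq; have e2 : 0 < e / 2 by lra.
  apply: filterS2 (near_itv ht) (abel_uniform ht hm e2) => s hs he p hp'.
  have [h1 e1] := hR ht hp'; have [h2 e3] := hR hs hp'.
  rewrite (action_abel ht h1) (action_abel hs h2) e1 e3 -mulrBr normrM ger0_norm//.
  by have := he (p ^+ 2); lra.
- by move=> p t hp ht; have [hm _] := hR ht hp; exact (aperture_gt0 sf ht hm).
- move=> t u v ht pu uv vp.
  have hu : p1 < u < p2 by rewrite pu (lt_trans uv).
  have hv : p1 < v < p2 by rewrite vp (lt_trans pu).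
  have [/andP[u1 _] eu] := hR ht hu; have [/andP[_ v2] ev] := hR ht hv.
  have l := turning_radius_increasing ht hu hv uv.
  have [m /andP[um mv] hV] := dense t _ _ ht u1 l v2.
  have hm : m1 < m < m2 by rewrite (lt_trans u1 um) (lt_trans mv v2).
  have [hru _] := hR ht hu; have [hrv _] := hR ht hv.
  have hp : u < rho t m < v.
    have a1 := rho_lt ht hru hm um; have a2 := rho_lt ht hm hrv mv.
    by rewrite eu in a1; rewrite ev in a2; rewrite a1.
  have hp' : p1 < rho t m < p2 by case/andP: hp => a1 a2; rewrite (lt_trans pu a1) (lt_trans a2 vp).
  exists (rho t m) => //; rewrite (turning_radius_id ht hm hp').
  by rewrite mulf_neq0// invr_neq0// gt_eqF// (rho1_m_gt0 (tp ht hm)).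
- exact: cC.
- move=> p t n k hp ht n0 k0 e; have [hm pe] := hR ht hp.
  have := lengths t _ n k ht hm n0 k0 e.
  by rewrite (duration_split sf ht hm) pe.
Unshelve. all: by end_near. Qed.

End FamilyCalculus.

(** Countability of the lengths forces the Abel transforms of a regular family to be
    independent of the parameter. *)
Lemma abel_rigidity {R : realType} (rho rho1 : R -> R -> R) (t1 t2 x0 b m1 m2 d N p1 p2 : R)
    (C : set R) :
  regular_family rho rho1 t1 t2 x0 b m1 m2 d N ->
  (forall t p, t1 < t < t2 -> p1 < p < p2 -> exists2 m, m1 < m < m2 & rho t m = p) ->
  (forall t x y, t1 < t < t2 -> m1 < x -> x < y -> y < m2 ->
    exists2 m, x < m < y & total_variation b (rho t) (rho1 t) m != 0) ->
  countable C ->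
  (forall t m (n k : nat), t1 < t < t2 -> m1 < m < m2 -> (0 < n)%N -> (0 < k)%N ->
    n%:R * leg_aperture (rho t) (rho1 t) b m = 2 * pi * k%:R ->
    C (n%:R * leg_duration (rho t) (rho1 t) b m)) ->
  forall p t t', p1 < p < p2 -> t1 < t < t2 -> t1 < t' < t2 ->
    abel x0 b (rho t) (p ^+ 2) = abel x0 b (rho t') (p ^+ 2).
Proof.
move=> rf hp dense cC lengths p t t' pp ht ht'.
have [Rt hR] := turning_radius_exists hp.
have sp := profiles_spectral_family rf hR dense cC lengths.
have := countable_spectrum_rigidity sp pp ht ht' => /=.
have [h1 e1] := hR _ _ ht pp; have [h2 e2] := hR _ _ ht' pp.
by rewrite (action_abel rf ht h1) (action_abel rf ht' h2) e1 e2; lra.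
Qed.

(** * Linearized geodesics and steepness *)

Section BoundedLipschitz.
Context {R : realType}.
Variables a b : R.
Implicit Types (f g : R -> R) (s t : R).

(** Products of such functions are again Lipschitz, unlike those of Lipschitz
    functions. *)
Definition bounded_lipschitz f := exists2 C : R, 0 <= C & forall s t, a < s < b -> a < t < b ->
  `|f s| <= C /\ `|f t - f s| <= C * `|t - s|.

Lemma bounded_lipschitz_cst (k : R) : bounded_lipschitz (fun=> k).
Proof. by exists `|k| => // s t _ _; rewrite subrr normr0 mulr_ge0. Qed.

Lemma bounded_lipschitzD f g : bounded_lipschitz f -> bounded_lipschitz g ->
  bounded_lipschitz (fun t => f t + g t).
Proof.
move=> [C C0 hC] [D D0 hD]; exists (C + D); first exact: addr_ge0.
move=> s t hs ht; have [c1 c2] := hC s t hs ht; have [d1 d2] := hD s t hs ht; split.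
  by apply: le_trans (ler_normD _ _) _; rewrite lerD.
rewrite opprD addrACA mulrDl; apply: le_trans (ler_normD _ _) _; exact: lerD.
Qed.

Lemma bounded_lipschitzN f : bounded_lipschitz f -> bounded_lipschitz (fun t => - f t).
Proof.
move=> [C C0 hC]; exists C => // s t hs ht; have [c1 c2] := hC s t hs ht.
by rewrite normrN -opprD normrN.
Qed.

Lemma bounded_lipschitzB f g : bounded_lipschitz f -> bounded_lipschitz g ->
  bounded_lipschitz (fun t => f t - g t).
Proof. by move=> hf hg; apply: bounded_lipschitzD => //; exact: bounded_lipschitzN. Qed.

Lemma bounded_lipschitzM f g : bounded_lipschitz f -> bounded_lipschitz g ->
  bounded_lipschitz (fun t => f t * g t).
Proof.
move=> [C C0 hC] [D D0 hD]; exists (C * D + C * D); first by rewrite addr_ge0// mulr_ge0.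
move=> s t hs ht; have [c1 c2] := hC s t hs ht; have [d1 d2] := hD s t hs ht.
have [c3 _] := hC t t ht ht; split.
  by rewrite normrM; apply: le_trans (ler_pM _ _ c1 d1) _ => //; rewrite lerDl mulr_ge0.
rewrite (_ : f t * g t - f s * g s = f t * (g t - g s) + (f t - f s) * g s); last by ring.
apply: le_trans (ler_normD _ _) _; rewrite [leRHS]mulrDl !normrM lerD//.
  by rewrite -mulrA ler_pM.
by rewrite mulrAC ler_pM.
Qed.

Lemma bounded_lipschitzV f (d : R) : 0 < d -> (forall t, a < t < b -> d <= f t) ->
  bounded_lipschitz f -> bounded_lipschitz (fun t => (f t)^-1).
Proof.
move=> d0 df [C C0 hC]; have d1 : 0 <= d^-1 by rewrite invr_ge0 ltW.
exists (d^-1 + C * (d^-1 * d^-1)); first by rewrite addr_ge0// !mulr_ge0.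
move=> s t hs ht; have [_ c2] := hC s t hs ht.
have fs := lt_le_trans d0 (df s hs); have ft := lt_le_trans d0 (df t ht).
have i1 : (f s)^-1 <= d^-1 by rewrite lef_pV2 ?posrE ?df.
have i2 : (f t)^-1 <= d^-1 by rewrite lef_pV2 ?posrE ?df.
split; first by rewrite gtr0_norm ?invr_gt0// (le_trans i1)// lerDl !mulr_ge0.
rewrite (_ : (f t)^-1 - (f s)^-1 = - ((f t - f s) * ((f t)^-1 * (f s)^-1))); last first.
  by field; rewrite !gt_eqF.
rewrite normrN normrM mulrDl; apply: le_trans (_ : C * (d^-1 * d^-1) * `|t - s| <= _); last first.
  by rewrite lerDr mulr_ge0.
rewrite mulrAC ler_pM// gtr0_norm ?mulr_gt0 ?invr_gt0//.
by rewrite ler_pM// invr_ge0 ltW.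
Qed.

Lemma bounded_lipschitz_derive f f' (C B : R) : (forall t, a < t < b -> is_derive t 1 f (f' t)) ->
  (forall t, a < t < b -> `|f' t| <= C) -> (forall t, a < t < b -> `|f t| <= B) ->
  bounded_lipschitz f.
Proof.
move=> df f'C fB; exists (`|C| + `|B|); first by rewrite addr_ge0.
move=> s t hs ht; split.
  by apply: le_trans (fB s hs) _; rewrite (le_trans (ler_norm B))// lerDr.
apply: le_trans (_ : `|C| * `|t - s| <= _); last by rewrite ler_wpM2r// lerDl.
wlog st : s t hs ht / s < t.
  move=> h; have [l|l|->] := ltgtP s t; [exact: h| |by rewrite !subrr normr0 mulr0].
  by rewrite distrC [`|t - s|]distrC; exact: h.
have [z hz ->] := mean_value (andP hs).1 st (andP ht).2 df.
rewrite normrM ler_wpM2r//; apply: le_trans (ler_norm C); apply: f'C.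
by case/andP: hz hs ht => h1 h2 /andP[h3 _] /andP[_ h4]; rewrite (lt_trans h3 h1) (lt_trans h2 h4).
Qed.

End BoundedLipschitz.

Section Linearization.
Context {R : realType} {n : nat}.
Variables e1 e2 : 'rV[R]_n.
Hypotheses (e11 : dotp e1 e1 = 1) (e22 : dotp e2 e2 = 1) (e12 : dotp e1 e2 = 0).
Local Notation frame := (frame e1 e2).

Lemma frame_lipschitz (s t : R) (A B th : R -> R) : bounded_lipschitz s t A -> bounded_lipschitz s t B ->
  bounded_lipschitz s t (fun u => cos (th u)) -> bounded_lipschitz s t (fun u => sin (th u)) ->
  exists C : R, forall u v, s < u < t -> s < v < t ->
    `|frame (A u) (B u) (th u) - frame (A v) (B v) (th v)| <= C * `|u - v|.
Proof.
move=> hA hB hc hs.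
have [C C0 hC] := bounded_lipschitzB (bounded_lipschitzM hA hc) (bounded_lipschitzM hB hs).
have [D D0 hD] := bounded_lipschitzD (bounded_lipschitzM hA hs) (bounded_lipschitzM hB hc).
exists (C * `|e1| + D * `|e2|) => u v hu hv; rewrite /frame opprD addrACA -!scalerBl.
apply: le_trans (ler_normD _ _) _; rewrite !normrZ mulrDl lerD//.
  by rewrite mulrAC ler_wpM2r//; have [] := hC v u hv hu.
by rewrite mulrAC ler_wpM2r//; have [] := hD v u hv hu.
Qed.

Lemma frame_is_derive0 (A B : R -> R) (A1 B1 th : R) : is_derive (0 : R) 1 A A1 ->
  is_derive (0 : R) 1 B B1 -> is_derive (0 : R) 1 (fun h => frame (A h) (B h) th) (frame A1 B1 th).
Proof.
move=> dA dB; apply: (is_derive_eq (frame_derive e1 e2 dA dB (is_derive_cst th (0 : R) 1))).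
by rewrite /cst !mulr0 subr0 addr0.
Qed.

(** The linearization of the geodesic equation in polar coordinates. *)
Lemma frame_accel_derive (c : R -> R) (c2 r v1 v2 A B A1 B1 th : R) : 0 < r -> c r != 0 ->
  derivable c r 1 -> is_derive r 1 (derive1 c) c2 ->
  let c1 := derive1 c r in
  let q := c1 / (c r * r) in
  let q' := c2 / (c r * r) - c1 ^+ 2 / (c r ^+ 2 * r) - c1 / (c r * r ^+ 2) in
  is_derive (0 : R) 1
    (fun h : R => accel c (frame r 0 th + h *: frame A B th) (frame v1 v2 th + h *: frame A1 B1 th))
    (frame
      (q' * A * (2 * r * v1 ^+ 2 - (v1 ^+ 2 + v2 ^+ 2) * r) +
       q * (2 * (A * v1 + r * A1 + B * v2) * v1 + 2 * r * v1 * A1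
            - 2 * (v1 * A1 + v2 * B1) * r - (v1 ^+ 2 + v2 ^+ 2) * A))
      (q' * A * (2 * r * v1 * v2) +
       q * (2 * (A * v1 + r * A1 + B * v2) * v2 + 2 * r * v1 * B1 - (v1 ^+ 2 + v2 ^+ 2) * B)) th).
Proof.
move=> r0 cr0 dc dc1 c1 q q'.
have id0 : is_derive (0 : R) 1 (fun h : R => h) (1 : R) by exact: is_derive_id.
have da : is_derive (0 : R) 1 (fun h => r + h * A) A.
  by apply: is_derive_eq; rewrite /GRing.scale /=; ring.
have db : is_derive (0 : R) 1 (fun h => 0 + h * B) B.
  by apply: is_derive_eq; rewrite /GRing.scale /=; ring.
have du : is_derive (0 : R) 1 (fun h => v1 + h * A1) A1.
  by apply: is_derive_eq; rewrite /GRing.scale /=; ring.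
have dv : is_derive (0 : R) 1 (fun h => v2 + h * B1) B1.
  by apply: is_derive_eq; rewrite /GRing.scale /=; ring.
pose s h := Num.sqrt ((r + h * A) ^+ 2 + (0 + h * B) ^+ 2).
have S0 : (r + 0 * A) ^+ 2 + (0 + 0 * B) ^+ 2 = r ^+ 2 :> R by ring.
have s0 : s 0 = r by rewrite /s S0 sqrtr_sqr gtr0_norm.
have ds : is_derive (0 : R) 1 s A.
  have dS : is_derive (0 : R) 1 (fun h => (r + h * A) ^+ 2 + (0 + h * B) ^+ 2) (2 * r * A).
    by apply: is_derive_eq; rewrite /GRing.scale /=; ring.
  have pS : 0 < (r + 0 * A) ^+ 2 + (0 + 0 * B) ^+ 2 :> R by rewrite S0 exprn_gt0.
  have d := @is_derive1_comp _ Num.sqrt _ 0 _ _ (is_derive1_sqrt pS) dS.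
  by apply: (is_derive_eq d); rewrite S0 sqrtr_sqr gtr0_norm//; field; rewrite gt_eqF.
have dcs : is_derive (s 0) 1 c c1.
  by rewrite s0 /c1 derive1E; exact/derivableP.
have dc1s : is_derive (s 0) 1 (derive1 c) c2 by rewrite s0.
have d1 := @is_derive1_comp _ (derive1 c) s 0 _ _ dc1s ds.
have d2 := @is_derive1_comp _ c s 0 _ _ dcs ds.
have n0 : (c (s 0)) * s 0 != 0 by rewrite s0 mulf_neq0// gt_eqF.
have d3 := @is_deriveV _ (fun h => c (s h) * s h) 0 _ 1 n0 (is_deriveM d2 ds).
have d4 := is_deriveM d1 d3.
have two : is_derive (0 : R) 1 (fun=> 2 : R) 0 by exact: is_derive_cst.
have dxv := is_deriveM two (is_deriveD (is_deriveM da du) (is_deriveM db dv)).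
have dvv := is_deriveD (is_deriveM du du) (is_deriveM dv dv).
have X := is_deriveM d4 (is_deriveB (is_deriveM dxv du) (is_deriveM dvv da)).
have Y := is_deriveM d4 (is_deriveB (is_deriveM dxv dv) (is_deriveM dvv db)).
rewrite (_ : (fun h => accel _ _ _) = fun h => frame
   (derive1 c (s h) / (c (s h) * s h) * (2 * ((r + h * A) * (v1 + h * A1) + (0 + h * B) * (v2 + h * B1)) * (v1 + h * A1)
     - ((v1 + h * A1) * (v1 + h * A1) + (v2 + h * B1) * (v2 + h * B1)) * (r + h * A)))
   (derive1 c (s h) / (c (s h) * s h) * (2 * ((r + h * A) * (v1 + h * A1) + (0 + h * B) * (v2 + h * B1)) * (v2 + h * B1)
     - ((v1 + h * A1) * (v1 + h * A1) + (v2 + h * B1) * (v2 + h * B1)) * (0 + h * B))) th); last first.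
  by apply/funext => h; rewrite !frameZ !frameD (frame_accel e11 e22 e12) /= -/(s h) -!expr2.
apply: (is_derive_eq (frame_is_derive0 _ X Y)).
rewrite /q' /q s0 /GRing.scale !fctE /= s0 -/c1.
have r0' : r != 0 by rewrite gt_eqF.
by f_equal; field; rewrite r0' cr0.
Qed.

End Linearization.

Section SteepBounds.
Context {R : realType}.

(** Uniform steepness from a positive lower bound of rho1 on ]x1, m3[ only: the
    derivative may degenerate at the outer radius b, but beyond m3 the increment of
    rho over [m2, m3] is already available. *)
Lemma steep_bound (rho rho1 : R -> R) (x0 b x1 m2 m3 d e : R) : 0 < x0 -> x0 <= x1 ->
  x1 < m2 -> m2 < m3 -> m3 < b -> 0 < d -> 0 < e ->
  (forall r, x0 < r < b -> is_derive r 1 rho (rho1 r)) ->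
  (forall r, x0 < r < b -> 0 < rho1 r) ->
  (forall r, x1 < r < m3 -> d <= rho1 r /\ e <= rho r) ->
  forall m r, x1 < m < m2 -> m < r < b ->
    d * e * ((m3 - m2) / (2 * b)) * (r - m) <= rho r ^+ 2 - rho m ^+ 2.
Proof.
move=> x00 x01 x1m2 m23 m3b d0 e0 dr p1 bd m r /andP[x1m mm2] /andP[mr rb].
have b0 : 0 < b by lra.
have inc x y : x0 < x -> x < y -> y < b -> rho x < rho y.
  exact: (derive_pos_increasing dr p1).
have lo x y : x1 < x -> x < y -> y < m3 -> d * (y - x) <= rho y - rho x.
  move=> x1x xy ym; have [||z hz ->] := @mean_value _ rho rho1 x0 b x y _ xy _ dr; try lra.
  by rewrite ler_wpM2r ?subr_ge0 ?(ltW xy)//; apply: (bd z _).1; lra.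
have em : e <= rho m by apply: (bd m _).2; lra.
have rr : rho m < rho r by apply: inc; lra.
have k0 : 0 < (m3 - m2) / (2 * b) by rewrite divr_gt0// ?mulr_gt0// subr_gt0.
suff key : d * ((m3 - m2) / (2 * b)) * (r - m) <= rho r - rho m.
  rewrite (_ : d * e * _ * _ = d * ((m3 - m2) / (2 * b)) * (r - m) * e); last by ring.
  rewrite subr_sqr; apply: ler_pM => //; [|exact: ltW|by lra].
  by rewrite (mulr_ge0 (mulr_ge0 (ltW d0) (ltW k0)))// subr_ge0 ltW.
have [rm3|m3r] := ltP r m3.
  apply: le_trans (lo m r x1m mr rm3); rewrite -mulrA ler_pM2l// ler_piMl ?subr_ge0 ?(ltW mr)//.
  by rewrite ler_pdivrMr ?mulr_gt0//; lra.
pose s := (m2 + m3) / 2.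
have hs : m < s < m3 by rewrite /s; lra.
have h1 := lo m s x1m (andP hs).1 (andP hs).2.
have h2 : rho s < rho r by apply: inc => //; lra.
apply: le_trans (_ : d * (s - m) <= _); last by lra.
rewrite -mulrA ler_pM2l//; apply: le_trans (_ : (m3 - m2) / (2 * b) * b <= _).
  by rewrite ler_wpM2l ?(ltW k0)//; lra.
rewrite (_ : _ * b = (m3 - m2) / 2); last by field; rewrite gt_eqF.
by rewrite /s; lra.
Qed.

(** This makes the differentiation formulas for families available for one profile. *)
Lemma steep_single (rho rho1 : R -> R) (x0 b m N : R) : turning_profile rho rho1 x0 b m ->
  (forall r, x0 < r < b -> rho r <= N /\ rho1 r <= N) ->
  (forall r s, x0 < r -> r <= s -> s < b -> `|rho1 s - rho1 r| <= N * (s - r)) ->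
  exists m1 m2 d, m1 < m < m2 /\
    steep_family (fun _ : unit => True) (fun=> rho) (fun=> rho1) x0 b m1 m2 d N.
Proof.
move=> tp bd lip; have [[x00 xm] mb] := (tp_x0 tp, tp_m tp, tp_b tp).
pose m1 := (x0 + m) / 2; pose m2 := (2 * m + b) / 3; pose m3 := (m + 2 * b) / 3.
have m13 : m1 <= m3 by rewrite /m1 /m3; lra.
have hI z : m1 <= z <= m3 -> x0 < z < b by rewrite /m1 /m3; lra.
have c1 : {within `[m1, m3], continuous rho1}.
  by apply: continuous_in_subspaceT => z; rewrite inE /= in_itv /= => /hI /(tp_cont1 tp).
have c2 : {within `[m1, m3], continuous rho}.
  apply: continuous_in_subspaceT => z; rewrite inE /= in_itv /= => /hI /(tp_derive tp).
  exact: is_derive1_continuous.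
have [z1 hz1 min1] := EVT_min m13 c1; have [z2 hz2 min2] := EVT_min m13 c2.
rewrite in_itv /= in hz1; rewrite in_itv /= in hz2.
have d0 := tp_pos1 tp (hI _ hz1); have e0 := tp_pos tp (hI _ hz2).
exists m1, m2, (rho1 z1 * rho z2 * ((m3 - m2) / (2 * b))); split.
  by rewrite /m1 /m2; lra.
split => //.
- move=> _ m' _ hm'; case: tp => *; split => //; move: hm'; rewrite /m1 /m2; lra.
- by move=> _ r _ hr; exact: bd.
- by move=> _ r s _; exact: lip.
- move=> _ m' r _; apply: steep_bound (tp_derive tp) (tp_pos1 tp) _ _ _ => //.
  + by rewrite /m1; lra.
  + by rewrite /m1 /m2; lra.
  + by rewrite /m2 /m3; lra.
  + by rewrite /m3; lra.
  + move=> r' hr'; have h : r' \in `[m1, m3] by rewrite in_itv /=; lra.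
    by split; [exact: min1|exact: min2].
- have m23 : 0 < m3 - m2 by rewrite /m2 /m3; lra.
  have b0 : 0 < b by lra.
  by rewrite (mulr_gt0 (mulr_gt0 d0 e0))// divr_gt0// mulr_gt0.
- by rewrite /m2; lra.
Qed.

End SteepBounds.

(** * Normal Jacobi fields along critical legs *)

Section ConjugateLeg.
Context {R : realType}.
Implicit Types s t w : R.

(** A leg along a profile with Lipschitz derivative, whose aperture is stationary
    under variations of the turning radius. *)
Record critical_leg (rho rho1 : R -> R) (x0 b m N : R) (wt th : R -> R) (T D : R) : Prop :=
  CriticalLeg {
  cl_tp : turning_profile rho rho1 x0 b m;
  cl_lp : leg_param rho rho1 b m wt th T D;
  cl_le : forall r, x0 < r < b -> rho r <= N /\ rho1 r <= N;
  cl_lip : forall r s, x0 < r -> r <= s -> s < b -> `|rho1 s - rho1 r| <= N * (s - r);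
  cl_var : total_variation b rho rho1 m = 0
}.

Variables (rho rho1 : R -> R) (x0 b m N : R) (wt th : R -> R) (T D : R).
Hypothesis cl : critical_leg rho rho1 x0 b m N wt th T D.
Let tp := cl_tp cl.
Let lp := cl_lp cl.

Local Notation y := (leg_variation rho rho1 b m).
Local Notation rad := (leg_radius b m).
Local Notation root := (leg_root rho rho1 b m).
Local Notation slope := (leg_slope rho rho1 b m).
Local Notation r := (traj_radius b m wt).
Local Notation sg := (traj_root rho rho1 b m wt).

Lemma variation_facts : exists2 C : R, 0 <= C & [/\ bounded_measurable 0 1 y,
  forall w, 0 < w < 1 -> `|y w| <= C & forall w, 0 < w < 1 -> {for w, continuous y}].
Proof.
have [m1 [m2 [d [hm sf]]]] := steep_single tp (cl_le cl) (cl_lip cl).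
have [_ _ bm _] := leg_bounded_measurable sf (t := tt) I hm.
have [C hC] := bd_variation sf; exists `|C| => //; split => //.
- by move=> w hw; apply: le_trans (ler_norm C); apply: (hC (tt, m, w)); split.
- by move=> w hw; have [] := leg_cvg_w sf (t := tt) I hm hw.
Qed.

Lemma leg_variationN w : y (- w) = y w.
Proof. by rewrite /leg_variation /leg_kappa /leg_defect /leg_slope /leg_radius !sqrrN oppr_eq0. Qed.

Lemma leg_rootN w : root (- w) = - root w.
Proof. by rewrite /leg_root (slope_even rho rho1 b m) mulNr. Qed.

(** Half the variation of the aperture accumulated since the turning point, extended
    as an odd function; it vanishes at the ends when the aperture is stationary. *)
Definition var_primitive w : R := if 0 <= w then integral 0 w y else - integral 0 (- w) y.
Local Notation Y := var_primitive.

Lemma var_primitiveN w : Y (- w) = - Y w.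
Proof.
rewrite /var_primitive oppr_ge0; have [l|l|<-] := ltgtP 0 w.
- by rewrite opprK.
- by rewrite opprK.
- by rewrite oppr0 (integral_empty _ (lexx 0)) oppr0.
Qed.

Lemma var_primitive1 : Y 1 = 0.
Proof. by have := cl_var cl; rewrite /total_variation /var_primitive ler01; lra. Qed.

Lemma var_primitive_lipschitz : exists2 C : R, 0 <= C & forall v w, -1 <= v <= 1 -> -1 <= w <= 1 ->
  `|Y v - Y w| <= C * `|v - w|.
Proof.
have [C C0 [[my _] yC cy]] := variation_facts; exists C => // v w.
have pos a c : 0 <= a -> a <= c -> c <= 1 -> `|Y c - Y a| <= C * (c - a).
  move=> a0 ac c1; rewrite /var_primitive a0 (le_trans a0 ac).
  by apply: (@integral_lipschitz _ 0 1 y C a c).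
have pos0 a : 0 <= a -> a <= 1 -> `|Y a| <= C * a.
  move=> a0 a1; have := pos 0 a (lexx 0) a0 a1.
  by rewrite /var_primitive lexx (integral_empty _ (lexx 0)) !subr0.
have pos' a c : 0 <= a <= 1 -> 0 <= c <= 1 -> `|Y c - Y a| <= C * `|c - a|.
  move=> /andP[a0 a1] /andP[c0 c1]; have [ac|ca] := leP a c.
    by rewrite (ger0_norm (x := c - a)) ?subr_ge0// pos.
  by rewrite distrC [`|c - a|]distrC (ger0_norm (x := a - c)) ?subr_ge0 ?(ltW ca)// pos// ltW.
have neg u : Y u = - Y (- u) by rewrite var_primitiveN opprK.
have mixed a c : 0 <= a <= 1 -> 0 <= c <= 1 -> `|Y c + Y a| <= C * `|c + a|.
  move=> /andP[a0 a1] /andP[c0 c1]; apply: le_trans (ler_normD _ _) _.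
  by rewrite (ger0_norm (x := c + a)) ?addr_ge0// mulrDr lerD// pos0.
move=> /andP[v0 v1] /andP[w0 w1]; have [hv|hv] := leP 0 v; have [hw|hw] := leP 0 w.
- by apply: pos'; rewrite ?hv ?hw.
- by rewrite (neg w) opprK; apply: mixed; lra.
- by rewrite (neg v) -opprD normrN distrC [w - v]addrC; apply: mixed; lra.
- rewrite (neg v) (neg w) -opprD normrN (_ : v - w = - (- v - - w)); last by ring.
  by rewrite normrN; apply: pos'; lra.
Qed.

Lemma var_primitive_derive w : w != 0 -> -1 < w < 1 -> is_derive w 1 Y (y w).
Proof.
move=> w0 hw; have [C C0 [bm yC cy]] := variation_facts.
have pos (v : R) : 0 < v < 1 -> is_derive v 1 (fun v : R => integral 0 v y) (y v).
  by move=> hv; apply: (@integral_derive _ 0 1 y v hv bm); exact: cy.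
move: w0; rewrite neq_lt => /orP[l|l].
- have e : \forall v \near w, - integral 0 (- v) y = Y v.
    by apply: filterS (lt_nbhsl l) => v v0; rewrite /var_primitive leNgt v0.
  apply: (near_eq_is_derive e).
  have h3 : is_derive w 1 (fun z => - z) (-1 : R) by apply: is_derive_eq.
  have hw' : 0 < - w < 1 by lra.
  have d := is_deriveN (@is_derive1_comp _ (fun v => integral 0 v y) (fun z => - z) w _ _ (pos _ hw') h3).
  by apply: (is_derive_eq d); rewrite leg_variationN mulrN1 opprK.
- have e : \forall v \near w, integral 0 v y = Y v.
    by apply: filterS (lt_nbhsr l) => v v0; rewrite /var_primitive ltW.
  by apply: (near_eq_is_derive e); apply: pos; lra.
Qed.

Lemma var_primitive_continuous : continuous (fun w => Y (clamp w)).
Proof.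
have [C C0 lipY] := var_primitive_lipschitz.
move=> w; apply/cvgrPdist_lt => e e0.
have d0 : 0 < e / (C + 1) by rewrite divr_gt0// ltr_wpDl.
near=> v.
have : `|clamp w - clamp v| < e / (C + 1).
  by near: v; apply: (@cvgr_dist_lt _ _ _ (nbhs w) _ clamp (clamp w)) => //; exact: clamp_continuous.
move=> h; apply: le_lt_trans (lipY _ _ (clamp_itv w) (clamp_itv v)) _.
have C1 : 0 < C + 1 by rewrite ltr_wpDl.
rewrite ltr_pdivlMr// mulrC in h; apply: le_lt_trans h.
by rewrite ler_wpM2r// lerDl.
Unshelve. all: by end_near. Qed.

(** The normal displacement of the ray, measured in its metric, per unit of change of
    the momentum, when the direction of the turning point is kept. *)
Definition jacobi_profile w : R :=
  (root w * Y w - rho m / rad w * (1 - w ^+ 2)) / rho1 m.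

Definition jacobi_normal t : R := jacobi_profile (clamp (wt t)).
Local Notation beta := jacobi_normal.
Local Notation kap t := (r t * rho1 (r t)).

(** The time derivative of jacobi_normal.  The quotient is singular at the turning
    point, where the derivative vanishes by symmetry. *)
Definition jacobi_slope t : R :=
  if t == T / 2 then 0 else (1 + beta t * kap t / rho (r t)) / sg t.

Let q0 : rho1 m != 0.
Proof. by rewrite gt_eqF// (rho1_m_gt0 tp). Qed.

Lemma jacobi_profileN w : jacobi_profile (- w) = jacobi_profile w.
Proof. by rewrite /jacobi_profile leg_rootN var_primitiveN mulrNN leg_radiusN sqrrN. Qed.

Lemma jacobi_normal_sym t : beta (T - t) = beta t.
Proof. by rewrite /jacobi_normal (lp_odd lp) clampN jacobi_profileN. Qed.

Lemma traj_radius_sym t : r (T - t) = r t.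
Proof. by rewrite /traj_radius (lp_odd lp) clampN leg_radiusN. Qed.

Lemma traj_root_sym t : sg (T - t) = - sg t.
Proof. by rewrite /traj_root (lp_odd lp) clampN leg_rootN. Qed.

Lemma jacobi_slope_sym t : jacobi_slope (T - t) = - jacobi_slope t.
Proof.
rewrite /jacobi_slope (_ : (T - t == T / 2) = (t == T / 2)); last first.
  by apply/eqP/eqP; lra.
case: eqP => _; first by rewrite oppr0.
by rewrite jacobi_normal_sym !traj_radius_sym traj_root_sym invrN mulrN.
Qed.

Lemma jacobi_normalT : beta T = 0.
Proof.
rewrite /jacobi_normal (lp_wtT lp) clamp_id ?lexx ?(le_trans (lerN10 _)) ?ler01//.
by rewrite /jacobi_profile var_primitive1 expr1n subrr !mulr0 subrr mul0r.
Qed.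

Lemma jacobi_normal0 : beta 0 = 0.
Proof. by rewrite -jacobi_normal_sym subr0 jacobi_normalT. Qed.

Lemma jacobi_normal_continuous : continuous beta.
Proof.
move=> t; apply: (continuous_comp (f := wt) (g := fun w => jacobi_profile (clamp w))).
  exact: (wt_continuous lp).
apply: cvgM; last exact: cvg_cst; apply: cvgB.
  by apply: cvgM; [exact: (root_clamp_continuous tp)|exact: var_primitive_continuous].
have c := @clamp_continuous R (wt t).
apply: cvgM; last by apply: cvgB; [exact: cvg_cst|exact: (cvgM c c)].
apply: cvgM; first exact: cvg_cst.
by apply: cvgV; [rewrite gt_eqF// (rad_gt0 tp) ?clamp_itv|exact: rad_clamp_continuous].
Qed.

Lemma wt_neq0 t : t != T / 2 -> wt t != 0.
Proof.
rewrite neq_lt => /orP[l|l]; have := wt_increasing tp lp l; rewrite (lp_wtm lp) => h.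
  by rewrite lt_eqF.
by rewrite gt_eqF.
Qed.

Lemma traj_root_neq0 t : t != T / 2 -> 0 < t < T -> sg t != 0.
Proof.
move=> /wt_neq0 w0 ht; have hw := wt_itv tp lp ht.
have hw' : -1 <= wt t <= 1 by lra.
by rewrite /traj_root clamp_id// /leg_root mulf_neq0// gt_eqF// sqrtr_gt0 (slope_gt0 tp).
Qed.

(** At the turning point the quotient defining the slope is singular; there the
    increment of the profile is w times a function that vanishes at w = 0. *)
Lemma jacobi_normal_derive t : 0 < t < T -> is_derive t 1 beta (jacobi_slope t).
Proof.
move=> ht; have hw := wt_itv tp lp ht; have et := clamp_wt_near tp lp ht.
have hw' : -1 <= wt t <= 1 by lra.
rewrite /jacobi_slope; case: eqVneq => [tE|tN].
  have w0 : wt t = 0 by rewrite tE (lp_wtm lp).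
  have [G [GE cG Gt]] := (is_derive1_caratheodory _ _ _).1 (lp_wt lp t).
  pose k w := (Num.sqrt (slope w) * Y w + rho m * b * w / (rad w * m)) / rho1 m.
  have Y0 : Y 0 = 0 by rewrite /var_primitive lexx (integral_empty _ (lexx 0)).
  have e : \forall s \near t, jacobi_profile (wt s) = beta s.
    by apply: filterS et => s es; rewrite /jacobi_normal -es.
  apply: (near_eq_is_derive e).
  apply/is_derive1_caratheodory; exists (fun s => G s * k (wt s)); split.
  - move=> s; rewrite mulrAC -GE w0 subr0 /jacobi_profile Y0 mulr0.
    have m0 := lt_trans (tp_x0 tp) (tp_m tp).
    have rs : 0 < rad (wt s).
      by rewrite /leg_radius ltr_wpDr// mulr_ge0 ?sqr_ge0// subr_ge0 ltW// (tp_b tp).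
    rewrite /k /leg_root; move: rs; rewrite /leg_radius => rs.
    by field; rewrite q0 !gt_eqF// mulr0 addr0.
  - have ck : {for t, continuous (fun s => k (clamp (wt s)))}.
      apply: (continuous_comp (f := wt) (g := fun w => k (clamp w))).
        exact: (wt_continuous lp).
      apply: cvgM; last exact: cvg_cst; apply: cvgD.
        by apply: cvgM; [exact: (sqrt_slope_clamp_continuous tp)|exact: var_primitive_continuous].
      apply: cvgM; first by apply: cvgM; [exact: cvg_cst|exact: clamp_continuous].
      apply: cvgV.
        by rewrite mulf_neq0// gt_eqF// ?(rad_gt0 tp) ?clamp_itv// (lt_trans (tp_x0 tp) (tp_m tp)).
      by apply: cvgM; [exact: rad_clamp_continuous|exact: cvg_cst].
    have ek : \forall s \near t, k (clamp (wt s)) = k (wt s) by apply: filterS et => s <-.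
    apply: cvgM cG _; rewrite -(nbhs_singleton ek); exact: (cvg_trans (near_eq_cvg ek) ck).
  - by rewrite w0 /k Y0 !(mulr0, mul0r, addr0).
have w0 := wt_neq0 tN; have s0 := traj_root_neq0 tN ht.
have e : \forall s \near t, (sg s * Y (wt s) - rho m / r s * (1 - wt s ^+ 2)) / rho1 m = beta s.
  by apply: filterS et => s es; rewrite /jacobi_normal /traj_root /traj_radius -es.
apply: (near_eq_is_derive e).
have dr := traj_radius_derive tp lp ht; have ds := traj_root_derive tp lp ht.
have r0 : r t != 0 by rewrite gt_eqF// (traj_radius_gt0 tp).
have rho0 : rho (r t) != 0 by rewrite gt_eqF// (traj_rho_gt0 tp).
have dY := @is_derive1_comp _ Y wt t _ _ (var_primitive_derive w0 hw) (lp_wt lp t).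
have dw := lp_wt lp t.
have dri := @is_deriveV _ (fun t => r t) t _ 1 r0 dr.
have dw2 : is_derive t 1 (fun t => 1 - wt t ^+ 2) _ :=
  is_deriveB (is_derive_cst (1 : R) t 1) (is_deriveM dw dw).
have d1 := is_deriveB (is_deriveM ds dY) (is_deriveM (is_deriveM (is_derive_cst (rho m) t 1) dri) dw2).
have d2 := is_deriveM d1 (is_derive_cst (rho1 m)^-1 t 1).
apply: (is_derive_eq d2); rewrite /GRing.scale !fctE /cst /=.
have r0' := r0; have rho0' := rho0; have s0' := s0.
have l0 : b - m != 0 by rewrite gt_eqF// subr_gt0 (tp_b tp).
have eq := nbhs_singleton et.
have kE : leg_kappa rho rho1 b m (wt t) = wt t / sg t.
  by rewrite /traj_root -eq /leg_root /leg_kappa invfM mulrA divff// mul1r.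
have tE : (leg_time rho rho1 b m (clamp (wt t)))^-1 = r t * sg t / (2 * (b - m) * wt t * rho (r t) ^+ 2).
  rewrite /leg_time /leg_density -/(leg_kappa rho rho1 b m (clamp (wt t))) -eq kE /traj_radius -eq.
  by rewrite /traj_radius -eq in r0 rho0; field; rewrite l0 w0 r0 rho0 s0.
have bE : beta t = (sg t * Y (wt t) - rho m / r t * (1 - wt t ^+ 2)) / rho1 m.
  by rewrite (nbhs_singleton e).
rewrite tE bE /leg_variation kE /leg_defect.
have -> : leg_radius b m (wt t) = r t by rewrite /traj_radius -eq.
have sE := traj_root_sqr tp wt t.
move: (sg t) (r t) (wt t) sE w0 r0' rho0' s0' => z v w sE w0 r1 rho2 s1.
apply: subr0_eq; transitivity ((z ^+ 2 + rho m ^+ 2 - rho v ^+ 2) / (z * rho v ^+ 2)).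
  by field; rewrite q0 l0 w0 r1 rho2 s1.
by rewrite sE; ring.
Qed.

(** The time derivative of the radial momentum as a function of the radius. *)
Definition root_rate x : R := x * rho1 x / rho x.

Lemma radial_lipschitz : let a := (x0 + m) / 2 in
  [/\ bounded_lipschitz a b rho, bounded_lipschitz a b rho1, bounded_lipschitz a b (fun x => (rho x)^-1) &
      bounded_lipschitz a b root_rate].
Proof.
move=> a; have [[x00 xm] mb] := (tp_x0 tp, tp_m tp, tp_b tp).
have ha x : a < x < b -> x0 < x < b by rewrite /a; lra.
have N0 : 0 <= N.
  have [|h _] := cl_le cl (r := m); first by rewrite xm.
  by apply: le_trans h; rewrite ltW// (rho_m_gt0 tp).
have l1 : bounded_lipschitz a b rho1.
  exists N => // s t /ha hs /ha ht; split.
    by rewrite gtr0_norm ?(tp_pos1 tp)//; exact: (cl_le cl hs).2.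
  have lip u v : x0 < u < b -> x0 < v < b -> u <= v -> `|rho1 v - rho1 u| <= N * `|v - u|.
    move=> hu hv uv; rewrite (ger0_norm (x := v - u)) ?subr_ge0//.
    by apply: (cl_lip cl) => //; [case/andP: hu|case/andP: hv].
  by have [st|/ltW ts] := leP s t; [exact: lip|rewrite distrC [`|t - s|]distrC; exact: lip].
have l0 : bounded_lipschitz a b rho.
  apply: (@bounded_lipschitz_derive _ a b rho rho1 N N) => x /ha hx.
  - exact: (tp_derive tp).
  - by rewrite gtr0_norm ?(tp_pos1 tp)//; exact: (cl_le cl hx).2.
  - by rewrite gtr0_norm ?(tp_pos tp)//; exact: (cl_le cl hx).1.
have ax : x0 < a < b by rewrite /a; lra.
have li : bounded_lipschitz a b (fun x => (rho x)^-1).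
  apply: (@bounded_lipschitzV _ a b rho (rho a)) => //; first exact: (tp_pos tp).
  move=> x /andP[a_x xb]; rewrite ltW// (rho_increasing tp _ a_x (ltW xb))//.
  by case/andP: ax.
split => //; apply: bounded_lipschitzM li; apply: bounded_lipschitzM l1.
apply: (@bounded_lipschitz_derive _ a b id (fun=> 1) 1 b) => x hx.
- by rewrite normr1.
- have {}hx := ha _ hx; rewrite gtr0_norm; [lra|by rewrite (lt_trans x00)//; case/andP: hx].
Qed.

Lemma traj_oo t : 0 < t < T -> (x0 + m) / 2 < r t < b.
Proof.
move=> ht; have [h1 /andP[_ h2]] := traj_radius_oo tp lp ht; have xm := tp_m tp.
by rewrite h2 andbT; lra.
Qed.

Lemma leg_time_bounds : exists2 M : R, 0 < M & forall w, leg_time rho rho1 b m (clamp w) <= M.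
Proof.
have m11 : -1 <= 1 :> R by rewrite (le_trans (lerN10 _)) ?ler01.
have [c hc cmax] := EVT_max m11 (continuous_subspaceT (leg_time_continuous tp)).
exists (leg_time rho rho1 b m (clamp c)); first by rewrite (leg_time_gt0 tp) ?clamp_itv.
move=> w; have := cmax (clamp w); rewrite [clamp (clamp w)]clamp_id ?clamp_itv//; apply.
by rewrite in_itv /=; exact: clamp_itv.
Qed.

Lemma slope_lower : exists2 d : R, 0 < d & forall w, d <= Num.sqrt (slope (clamp w)).
Proof.
have m11 : -1 <= 1 :> R by rewrite (le_trans (lerN10 _)) ?ler01.
have [c hc cmin] := EVT_min m11 (continuous_subspaceT (sqrt_slope_clamp_continuous tp)).
exists (Num.sqrt (slope (clamp c))); first by rewrite sqrtr_gt0 (slope_gt0 tp) ?clamp_itv.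
move=> w; have := cmin (clamp w); rewrite [clamp (clamp w)]clamp_id ?clamp_itv//; apply.
by rewrite in_itv /=; exact: clamp_itv.
Qed.

(** On the way up the radial momentum dominates the time since the turning point. *)
Lemma root_lower : exists2 C : R, 0 < C & forall t, T / 2 < t < T -> t - T / 2 <= C * sg t.
Proof.
have [M M0 hM] := leg_time_bounds; have [d d0 hd] := slope_lower.
have T0 := lp_T lp.
exists (M / d); first exact: divr_gt0.
move=> t ht; have ht' : 0 < t < T by lra.
have tl : T / 2 < t by case/andP: ht.
have [z hz e] := mean_value (a := T / 2 - 1) (b := t + 1) (f := wt)
  (f' := fun t => (leg_time rho rho1 b m (clamp (wt t)))^-1) (x := T / 2) (y := t)
  ltac:(lra) tl ltac:(lra) (fun z _ => lp_wt lp z).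
rewrite (lp_wtm lp) subr0 in e.
have lt0 := leg_time_gt0 tp (clamp_itv (wt z)).
have h1 : t - T / 2 <= M * wt t.
  rewrite e mulrA ler_peMl; [by []|by lra|].
  by rewrite -ler_pdivrMr ?invr_gt0// invrK mul1r.
have w0 : 0 < wt t by rewrite -(lp_wtm lp) (wt_increasing tp lp).
have hw := wt_itv tp lp ht'; have hw' : -1 <= wt t <= 1 by lra.
apply: le_trans h1 _; rewrite -mulrA ler_pM2l// /traj_root clamp_id// /leg_root.
rewrite mulrCA ler_peMr ?(ltW w0)// mulrC ler_pdivlMr// mul1r.
by have := hd (wt t); rewrite clamp_id.
Qed.

Lemma traj_root_increasing s t : 0 < s -> s < t -> t < T -> sg s < sg t.
Proof.
apply: (derive_pos_increasing (fun z hz => traj_root_derive tp lp hz)) => z hz.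
have [h1 h2] := traj_radius_oo tp lp hz.
by rewrite divr_gt0 ?(traj_rho_gt0 tp)// mulr_gt0 ?(traj_radius_gt0 tp)// (tp_pos1 tp).
Qed.

Lemma traj_root_mid : sg (T / 2) = 0.
Proof. by rewrite /traj_root (lp_wtm lp) clamp_id ?lerN10 ?ler01// /leg_root mul0r. Qed.

Lemma traj_root_gt0 t : T / 2 < t < T -> 0 < sg t.
Proof.
have T0 := lp_T lp; move=> /andP[t1 t2]; rewrite -traj_root_mid traj_root_increasing//; lra.
Qed.

Lemma rho_traj_bounds t : 0 < t < T -> rho m <= rho (r t) <= N.
Proof.
move=> ht; have [h1 h2] := traj_radius_oo tp lp ht; rewrite (cl_le cl h2).1 andbT.
move: h1; rewrite le_eqVlt => /predU1P[<-//|l].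
by rewrite ltW// (rho_increasing tp (tp_m tp) l)// ltW//; case/andP: h2.
Qed.

Lemma radius_increment : exists2 C : R, 0 < C & forall s t, T / 2 < s -> s < t -> t < T ->
  `|r t - r s| <= C * sg t * (t - s).
Proof.
have p0 := rho_m_gt0 tp; have T0 := lp_T lp.
have b0 : 0 < b by have [[? ?] ?] := (tp_x0 tp, tp_m tp, tp_b tp); lra.
exists (b / rho m ^+ 2); first by rewrite divr_gt0// exprn_gt0.
move=> s t s1 st tT.
have [|z hz ->] := mean_value (a := 0) (b := T) (x := s) (y := t) _ st tT
  (fun z hz => traj_radius_derive tp lp hz); first lra.
have hz' : 0 < z < T by lra.
have /andP[pz _] := rho_traj_bounds hz'.
have sz : 0 < sg z by apply: traj_root_gt0; lra.
have szt : sg z <= sg t by rewrite ltW// traj_root_increasing//; lra.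
have rz := traj_radius_gt0 tp wt z; have rhoz := traj_rho_gt0 tp wt z.
have /andP[_ rb] := traj_radius_itv tp wt z.
have k0 : 0 < r z * sg z / rho (r z) ^+ 2 by exact: (divr_gt0 (mulr_gt0 rz sz) (exprn_gt0 2 rhoz)).
rewrite gtr0_norm; last by rewrite mulr_gt0 ?subr_gt0.
rewrite ler_wpM2r ?subr_ge0 ?(ltW st)// mulrAC ler_pM ?(ltW sz)//.
  by rewrite mulr_ge0 ?invr_ge0 ?sqr_ge0// ltW.
rewrite ler_pM ?invr_ge0 ?sqr_ge0// ?(ltW rz)// lef_pV2 ?posrE ?exprn_gt0//.
by rewrite ler_sqr ?nnegrE ?(ltW p0) ?(ltW rhoz).
Qed.

Lemma jacobi_normal_bound : exists2 B : R, 0 <= B & forall t, 0 < t < T -> `|beta t| <= B.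
Proof.
have [_ [B hB]] := continuousT_bounded_measurable 0 T jacobi_normal_continuous.
by exists `|B| => // t /hB h; apply: le_trans h (ler_norm _).
Qed.

(** With root_rate frozen at the first time, the slope has a derivative that is an
    increment of root_rate divided by the square of the radial momentum.  One factor
    is compensated by radius_increment, the other by root_lower. *)
Lemma jacobi_slope_right : exists2 C : R, 0 <= C & forall s t, T / 2 < s -> s < t -> t < T ->
  `|jacobi_slope t - jacobi_slope s| <= C * (t - s).
Proof.
have [_ _ _ [L L0 hL]] := radial_lipschitz.
have [C1 C10 h1] := radius_increment; have [C2 C20 h2] := root_lower.
have [B B0 hB] := jacobi_normal_bound; have T0 := lp_T lp.
have kl s t : T / 2 < s -> s < t -> t < T -> `|root_rate (r t) - root_rate (r s)| <= L * (C1 * sg t * (t - s)).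
  move=> s1 st tT; have hs : 0 < s < T by lra.
  have ht : 0 < t < T by lra.
  apply: le_trans (hL _ _ (traj_oo hs) (traj_oo ht)).2 _.
  by rewrite ler_wpM2l// h1.
exists (L * C1 * C2 + B * (L * C1)); first by rewrite addr_ge0// !mulr_ge0// ltW.
move=> s t s1 st tT.
have slopeE z : T / 2 < z -> jacobi_slope z = beta z / sg z * root_rate (r z) + (sg z)^-1.
  move=> z1; rewrite /jacobi_slope gt_eqF// /root_rate.
  by rewrite mulrDl mul1r addrC; congr (_ + _); ring.
pose h z := beta z / sg z * root_rate (r s) + (sg z)^-1.
have dh z : T / 2 < z < T -> is_derive z 1 h ((root_rate (r s) - root_rate (r z)) / sg z ^+ 2).
  move=> hz; have hz' : 0 < z < T by lra.
  have s0 : sg z != 0 by rewrite gt_eqF// traj_root_gt0.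
  have db := jacobi_normal_derive hz'; have ds := traj_root_derive tp lp hz'.
  have di := @is_deriveV _ (fun t => sg t) z _ 1 s0 ds.
  have d1 := is_deriveD (is_deriveM (is_deriveM db di) (is_derive_cst (root_rate (r s)) z 1)) di.
  apply: (is_derive_eq d1); rewrite /GRing.scale !fctE /cst /=.
  have -> : jacobi_slope z = (1 + beta z * root_rate (r z)) / sg z.
    by rewrite slopeE; [field|case/andP: hz].
  rewrite -[_ * _ / rho (r z)]/(root_rate (r z)).
  by field.
have -> : jacobi_slope t - jacobi_slope s = (h t - h s) + beta t / sg t * (root_rate (r t) - root_rate (r s)).
  by rewrite !slopeE// /h; [ring|exact: lt_trans st].
have ht : T / 2 < t < T by rewrite tT (lt_trans s1).
have st0 := traj_root_gt0 ht.
rewrite mulrDl; apply: le_trans (ler_normD _ _) _; apply: lerD.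
  have [z hz ->] := mean_value s1 st tT dh.
  have hz' : T / 2 < z < T by lra.
  have sz0 := traj_root_gt0 hz'.
  rewrite normrM (ger0_norm (x := t - s)) ?subr_ge0 ?(ltW st)//.
  rewrite ler_wpM2r ?subr_ge0 ?(ltW st)// normrM normfV distrC [`|sg z ^+ 2|]gtr0_norm ?exprn_gt0//.
  rewrite ler_pdivrMr ?exprn_gt0//.
  apply: le_trans (kl s z s1 (andP hz).1 (andP hz').2) _.
  have zs : z - s <= C2 * sg z by apply: le_trans (h2 z hz'); lra.
  apply: le_trans (_ : L * (C1 * sg z * (C2 * sg z)) <= _).
    by rewrite ler_wpM2l// ler_wpM2l// mulr_ge0// ltW.
  by rewrite le_eqVlt; apply/orP; left; apply/eqP; ring.
rewrite normrM normrM normfV (gtr0_norm st0).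
apply: le_trans (_ : B / sg t * (L * (C1 * sg t * (t - s))) <= _).
  rewrite ler_pM ?mulr_ge0 ?invr_ge0 ?(ltW st0)//; last exact: kl.
  by rewrite ler_wpM2r ?invr_ge0 ?(ltW st0)// hB//; lra.
rewrite le_eqVlt; apply/orP; left; apply/eqP.
by field; rewrite gt_eqF.
Qed.

Lemma jacobi_slope_mid : exists2 C : R, 0 <= C & forall t, T / 2 < t < T ->
  `|jacobi_slope t| <= C * (t - T / 2).
Proof.
have [C C0 hC] := jacobi_slope_right; have T0 := lp_T lp.
exists C => // t ht; apply/ler_addgt0Pr => e e0.
have hm : 0 < T / 2 < T by lra.
have dm := jacobi_normal_derive hm; rewrite /jacobi_slope eqxx in dm.
have [G [GE cG Gm]] := (is_derive1_caratheodory _ _ _).1 dm.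
have [d d0 hd] : exists2 d, 0 < d & forall s, `|s - T / 2| < d -> `|G s| < e.
  have n : \forall s \near T / 2, `|G (T / 2) - G s| < e.
    by apply: (@cvgr_dist_lt _ _ _ (nbhs (T / 2)) _ G (G (T / 2))).
  by apply: near_dist; apply: filterS n => s; rewrite Gm sub0r normrN.
pose s := Num.min (T / 2 + d / 2) t.
have s1 : T / 2 < s by rewrite /s lt_min; lra.
have s2 : s <= t by rewrite /s ge_min lexx orbT.
have s3 : s < T / 2 + d by rewrite /s gt_min; lra.
have sT : s < T by lra.
have [|z hz ez] := mean_value (a := 0) (b := T) (x := T / 2) (y := s) _ s1 sT
  (fun z hz => jacobi_normal_derive hz); first lra.
have Gz : `|jacobi_slope z| < e.
  have sn : s - T / 2 != 0 by rewrite gt_eqF// subr_gt0.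
  have -> : jacobi_slope z = G s by apply: (mulIf sn); rewrite -ez GE.
  by apply: hd; rewrite gtr0_norm ?subr_gt0//; lra.
have zt : z < t by lra.
have h := hC z t (andP hz).1 zt (andP ht).2.
have : `|jacobi_slope t| <= `|jacobi_slope t - jacobi_slope z| + `|jacobi_slope z|.
  by rewrite -{1}[jacobi_slope t](subrK (jacobi_slope z)) ler_normD.
have : C * (t - z) <= C * (t - T / 2) by rewrite ler_wpM2l//; lra.
by lra.
Qed.

(** The two halves are exchanged by the symmetry of the leg and meet at the turning
    point, where the slope vanishes. *)
Lemma jacobi_slope_lipschitz : bounded_lipschitz 0 T jacobi_slope.
Proof.
have [C C0 hC] := jacobi_slope_right; have [C' C'0 hC'] := jacobi_slope_mid; have T0 := lp_T lp.
pose K := C + C'.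
have K0 : 0 <= K by exact: addr_ge0.
have right s t : T / 2 <= s -> s < t -> t < T -> `|jacobi_slope t - jacobi_slope s| <= K * (t - s).
  rewrite le_eqVlt => /predU1P[<-|s1] st tT.
    rewrite {2}/jacobi_slope eqxx subr0; have := hC' t; rewrite st tT => /(_ isT) h.
    by apply: le_trans h _; rewrite ler_wpM2r ?subr_ge0 ?(ltW st)// lerDr.
  apply: le_trans (hC s t s1 st tT) _.
  by rewrite ler_wpM2r ?subr_ge0 ?(ltW st)// lerDl.
have neg u : jacobi_slope u = - jacobi_slope (T - u) by rewrite jacobi_slope_sym opprK.
have mid0 : jacobi_slope (T / 2) = 0 by rewrite /jacobi_slope eqxx.
have lip s t : 0 < s -> s < t -> t < T -> `|jacobi_slope t - jacobi_slope s| <= K * (t - s).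
  move=> s0 st tT; have [h1|h1] := leP (T / 2) s; first exact: right.
  have left u v : 0 < u -> u < v -> v <= T / 2 -> `|jacobi_slope v - jacobi_slope u| <= K * (v - u).
    move=> u0 uv vT; rewrite (neg u) (neg v) opprK addrC.
    have := right (T - v) (T - u); rewrite (_ : T - u - (T - v) = v - u); last by ring.
    by apply; lra.
  have [h2|h2] := leP t (T / 2); first exact: left.
  have a1 := right (T / 2) t (lexx _) h2 tT; have a2 := left s (T / 2) s0 h1 (lexx _).
  rewrite mid0 subr0 in a1; rewrite mid0 sub0r normrN in a2.
  apply: le_trans (ler_normB _ _) _; lra.
exists (K + K * T); first by rewrite addr_ge0// mulr_ge0// ltW.
move=> s t hs ht; split.
  have hm : `|jacobi_slope s| <= K * T.
    have [l|l|->] := ltgtP s (T / 2); last by rewrite mid0 normr0 mulr_ge0// ltW.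
    - have := lip s (T / 2) (andP hs).1 l ltac:(lra); rewrite mid0 sub0r normrN => h.
      by apply: le_trans h _; rewrite ler_wpM2l//; lra.
    - have := lip (T / 2) s ltac:(lra) l (andP hs).2; rewrite mid0 subr0 => h.
      by apply: le_trans h _; rewrite ler_wpM2l//; lra.
  by apply: le_trans hm _; rewrite lerDr.
have KT : 0 <= K * T by rewrite mulr_ge0// ltW.
have [l|l|->] := ltgtP s t; last by rewrite !subrr normr0 mulr0.
- rewrite (gtr0_norm (x := t - s)) ?subr_gt0//.
  apply: le_trans (lip s t (andP hs).1 l (andP ht).2) _.
  by rewrite ler_wpM2r ?subr_ge0 ?(ltW l)// lerDl.
- rewrite distrC [`|t - s|]distrC (gtr0_norm (x := s - t)) ?subr_gt0//.
  apply: le_trans (lip t s (andP ht).1 l (andP hs).2) _.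
  by rewrite ler_wpM2r ?subr_ge0 ?(ltW l)// lerDl.
Qed.

End ConjugateLeg.

(** * Conjugate points *)

Section JacobiField.
Context {R : realType} {n : nat}.
Variables e1 e2 : 'rV[R]_n.
Hypotheses (e11 : dotp e1 e1 = 1) (e22 : dotp e2 e2 = 1) (e12 : dotp e1 e2 = 0).
Variables (rho rho1 c : R -> R) (x0 b m N : R) (wt th : R -> R) (T D : R).
Hypothesis cl : critical_leg rho rho1 x0 b m N wt th T D.
Hypothesis speed : forall x, x0 < x < b -> speed_of rho rho1 c x.
Implicit Types s t u : R.
Let tp := cl_tp cl.
Let lp := cl_lp cl.

Local Notation r := (traj_radius b m wt).
Local Notation sg := (traj_root rho rho1 b m wt).
Local Notation beta := (jacobi_normal rho rho1 b m wt).
Local Notation f := (jacobi_slope rho rho1 b m wt T).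
Local Notation frame := (frame e1 e2).

(** 1 / rho, and the sine and cosine of the angle between the ray and the sphere. *)
Let i t := (rho (r t))^-1.
Let sn t := sg t * i t.
Let cs t := rho m * i t.
Let k t := rho1 (r t).

Let rho0 t : rho (r t) != 0.
Proof. by rewrite gt_eqF// (traj_rho_gt0 tp). Qed.

Lemma sn_cs t : sn t ^+ 2 + cs t ^+ 2 = 1.
Proof.
transitivity ((sg t ^+ 2 + rho m ^+ 2) / rho (r t) ^+ 2).
  by rewrite /sn /cs /i; field.
by rewrite (traj_root_sqr tp); field.
Qed.

Lemma traj_derivatives t : 0 < t < T ->
  [/\ is_derive t 1 r (r t * i t * sn t), is_derive t 1 i (- (r t * k t) * sn t * i t ^+ 3),
      is_derive t 1 sn (r t * k t * i t ^+ 2 * (1 - sn t ^+ 2)),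
      is_derive t 1 cs (- (r t * k t) * i t ^+ 2 * sn t * cs t) & is_derive t 1 th (i t * cs t)].
Proof.
move=> ht; have [_ hr] := traj_radius_oo tp lp ht.
have dr := traj_radius_derive tp lp ht; have ds := traj_root_derive tp lp ht.
have drho := @is_derive1_comp _ rho (fun t => r t) t _ _ (tp_derive tp hr) dr.
have di := @is_deriveV _ (fun t => rho (r t)) t _ 1 (rho0 t) drho.
have r0 := rho0 t; split.
- by apply: (is_derive_eq dr); rewrite /sn /i; field.
- by apply: (is_derive_eq di); rewrite /GRing.scale /= /sn /i /k; field.
- by apply: (is_derive_eq (is_deriveM ds di)); rewrite /GRing.scale /= /sn /i /k; field.
- by apply: (is_derive_eq (is_deriveZ (rho m) di)); rewrite /GRing.scale /= /sn /cs /i /k; field.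
- by apply: (is_derive_eq (traj_angle_derive tp lp t)); rewrite /cs /i; field.
Qed.

(** The Jacobi field beta n, where n is the velocity rotated by a right angle. *)
Definition jacobi_field_at t := frame (- (beta t * r t * i t * cs t)) (beta t * r t * i t * sn t) (th t).

Let A1 t := - 2 * r t * i t ^+ 2 * sn t * cs t * beta t
  + 2 * r t ^+ 2 * i t ^+ 3 * sn t * cs t * k t * beta t - r t * i t * cs t * f t.
Let B1 t := r t * i t ^+ 2 * sn t ^+ 2 * beta t - 2 * r t ^+ 2 * i t ^+ 3 * sn t ^+ 2 * k t * beta t
  + r t ^+ 2 * i t ^+ 3 * k t * beta t + r t * i t * sn t * f t - r t * i t ^+ 2 * cs t ^+ 2 * beta t.

Lemma jacobi_field_derive t : 0 < t < T ->
  is_derive t 1 jacobi_field_at (frame (A1 t) (B1 t) (th t)).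
Proof.
move=> ht; have [dr di ds dc dth] := traj_derivatives ht.
have db := jacobi_normal_derive cl ht.
have dA := is_deriveN (is_deriveM (is_deriveM (is_deriveM db dr) di) dc).
have dB := is_deriveM (is_deriveM (is_deriveM db dr) di) ds.
apply: (is_derive_eq (frame_derive e1 e2 dA dB dth)).
by rewrite /A1 /B1 /GRing.scale !fctE /=; f_equal; ring.
Qed.

Lemma jacobi_field_derive1 t : 0 < t < T -> derive1 jacobi_field_at t = frame (A1 t) (B1 t) (th t).
Proof. by move=> /jacobi_field_derive h; rewrite derive1E; exact: derive_val. Qed.

Lemma bounded_lipschitz_comp (a1 b1 : R) (h g : R -> R) : bounded_lipschitz a1 b1 g ->
  (forall t, 0 < t < T -> a1 < h t < b1) -> bounded_lipschitz 0 T h ->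
  bounded_lipschitz 0 T (fun t => g (h t)).
Proof.
move=> [C C0 hC] hab [E E0 hE]; exists (C + C * E); first by rewrite addr_ge0// mulr_ge0.
move=> s t hs ht; have [c1 c2] := hC _ _ (hab s hs) (hab t ht); have [_ e2'] := hE s t hs ht.
split; first by apply: le_trans c1 _; rewrite lerDl mulr_ge0.
apply: le_trans c2 _; apply: le_trans (ler_wpM2l C0 e2') _.
by rewrite mulrA ler_wpM2r// lerDr.
Qed.

Let cr := traj_radius_continuous lp.
Let csg := traj_root_continuous tp lp.
Let crho := traj_rho_continuous tp lp.

Let ci : continuous i.
Proof. by move=> t; apply: cvgV; [exact: rho0|exact: crho]. Qed.

Lemma traj_bounded_lipschitz :
  [/\ bounded_lipschitz 0 T r, bounded_lipschitz 0 T i, bounded_lipschitz 0 T sn,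
      bounded_lipschitz 0 T cs & bounded_lipschitz 0 T k] /\
  [/\ bounded_lipschitz 0 T (fun t => cos (th t)), bounded_lipschitz 0 T (fun t => sin (th t)),
      bounded_lipschitz 0 T beta & bounded_lipschitz 0 T f].
Proof.
have [l1 l2 l3 l4] := radial_lipschitz cl.
have hoo t : 0 < t < T -> (x0 + m) / 2 < r t < b by exact: (traj_oo cl).
have lr : bounded_lipschitz 0 T r.
  have [_ [C hC]] := continuousT_bounded_measurable 0 T (cr : continuous (fun t => r t)).
  have c' : continuous (fun t => r t * i t * sn t).
    by move=> t; apply: cvgM; [apply: cvgM; [exact: cr|exact: ci]|apply: cvgM; [exact: csg|exact: ci]].
  have [_ [C' hC']] := continuousT_bounded_measurable 0 T c'.
  apply: (@bounded_lipschitz_derive _ 0 T _ (fun t => r t * i t * sn t) C' C) => t ht.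
  - by have [] := traj_derivatives ht.
  - exact: hC'.
  - exact: hC.
have li : bounded_lipschitz 0 T i := bounded_lipschitz_comp l3 hoo lr.
have lk : bounded_lipschitz 0 T k := bounded_lipschitz_comp l2 hoo lr.
have lsg : bounded_lipschitz 0 T sg.
  have [_ [C hC]] := continuousT_bounded_measurable 0 T (csg : continuous (fun t => sg t)).
  have [L L0 hL] := l4.
  apply: (@bounded_lipschitz_derive _ 0 T _ (fun t => r t * rho1 (r t) / rho (r t)) L C) => t ht.
  - exact: (traj_root_derive tp lp ht).
  - by have [] := hL _ _ (hoo _ ht) (hoo _ ht).
  - exact: hC.
have ls : bounded_lipschitz 0 T sn := bounded_lipschitzM lsg li.
have lc : bounded_lipschitz 0 T cs := bounded_lipschitzM (bounded_lipschitz_cst 0 T (rho m)) li.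
have lf : bounded_lipschitz 0 T f := jacobi_slope_lipschitz cl.
have c' : continuous (fun t => i t * cs t).
  by move=> t; apply: cvgM; [exact: ci|apply: cvgM; [exact: cvg_cst|exact: ci]].
have [_ [C' hC']] := continuousT_bounded_measurable 0 T c'.
split; split => //.
- apply: (@bounded_lipschitz_derive _ 0 T _ (fun t => - sin (th t) * (i t * cs t)) C' 1) => t ht.
  + have [_ _ _ _ dth] := traj_derivatives ht.
    by apply: (@is_derive1_comp _ cos th).
  + by rewrite normrM normrN -[leRHS]mul1r ler_pM// ?hC'// ler_norml sin_geN1 sin_le1.
  + by rewrite ler_norml cos_geN1 cos_le1.
- apply: (@bounded_lipschitz_derive _ 0 T _ (fun t => cos (th t) * (i t * cs t)) C' 1) => t ht.
  + have [_ _ _ _ dth] := traj_derivatives ht.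
    by apply: (@is_derive1_comp _ sin th).
  + by rewrite normrM -[leRHS]mul1r ler_pM// ?hC'// ler_norml cos_geN1 cos_le1.
  + by rewrite ler_norml sin_geN1 sin_le1.
- have [B B0 hB] := jacobi_normal_bound cl; have [F F0 hF] := lf.
  apply: (@bounded_lipschitz_derive _ 0 T _ f F B) => t ht.
  + exact: (jacobi_normal_derive cl ht).
  + by have [] := hF t t ht ht.
  + exact: hB.
Qed.

Lemma jacobi_derive_lipschitz : exists C : R, forall u v, 0 < u < T -> 0 < v < T ->
  `|derive1 jacobi_field_at u - derive1 jacobi_field_at v| <= C * `|u - v|.
Proof.
have [[lr li ls lc lk] [lcos lsin lb lf]] := traj_bounded_lipschitz.
have M := bounded_lipschitzM; have K x := bounded_lipschitz_cst 0 T x.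
have i2 := M _ _ _ _ _ li li; have i3 := M _ _ _ _ _ li i2.
have r2 := M _ _ _ _ _ lr lr.
have lA : bounded_lipschitz 0 T A1.
  apply: bounded_lipschitzB; last by do 3 apply: bounded_lipschitzM => //.
  apply: bounded_lipschitzD.
    by do 5 apply: bounded_lipschitzM => //.
  by do 6 apply: bounded_lipschitzM => //.
have s2 := M _ _ _ _ _ ls ls; have c2 := M _ _ _ _ _ lc lc.
have lB : bounded_lipschitz 0 T B1.
  apply: bounded_lipschitzB; last by do 3 apply: bounded_lipschitzM => //.
  apply: bounded_lipschitzD; last by do 3 apply: bounded_lipschitzM => //.
  apply: bounded_lipschitzD; last by do 3 apply: bounded_lipschitzM => //.
  apply: bounded_lipschitzB; first by do 3 apply: bounded_lipschitzM => //.
  by do 5 apply: bounded_lipschitzM => //.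
have [C hC] := frame_lipschitz e1 e2 lA lB lcos lsin.
by exists C => u v hu hv; rewrite !jacobi_field_derive1//; exact: hC.
Qed.

(** The composite of rho1 with the radius is Lipschitz in time, hence differentiable
    at almost every time; composing with a local inverse of the radius gives the
    derivative of rho1. *)
Lemma rho1_ae_derivable : {ae @lebesgue_measure R, forall t, 0 < t < T -> t != T / 2 ->
  exists2 k2, is_derive (r t) 1 rho1 k2 & is_derive t 1 k (k2 * (r t * i t * sn t))}.
Proof.
have [[_ _ _ _ [C C0 hC]] _] := traj_bounded_lipschitz.
have C1 : 0 < C + 1 by rewrite ltr_wpDl.
have := @lipschitz_oo_ae_derivable _ k (C + 1) 0 T C1.
have lip x y : 0 < x < T -> 0 < y < T -> `|k y - k x| <= (C + 1) * `|y - x|.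
  by move=> hx hy; apply: le_trans (hC x y hx hy).2 _; rewrite ler_wpM2r// lerDl.
move=> /(_ lip) ae; apply: ae_imply ae => t h ht tN.
have dk := derivableP (h ht); have hw := wt_itv tp lp ht; have w0 := wt_neq0 cl tN.
have l0 : 0 < b - m by rewrite subr_gt0 (tp_b tp).
have [tw [twK Ktw dtw]] := lp_inv lp.
have et := nbhs_singleton (clamp_wt_near tp lp ht).
have rE : r t = m + (b - m) * wt t ^+ 2 by rewrite /traj_radius -et.
(* The parameter w as a function of the radius, on the branch of wt t. *)
pose w_ x := Num.sg (wt t) * Num.sqrt ((x - m) / (b - m)).
have qE : (r t - m) / (b - m) = wt t ^+ 2 by rewrite rE; field; rewrite gt_eqF.
have wE : w_ (r t) = wt t by rewrite /w_ qE sqrtr_sqr -numEsg.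
have pos : 0 < (r t - m) / (b - m) by rewrite qE exprn_even_gt0.
have dw : derivable w_ (r t) 1.
  have d1 : is_derive (r t) 1 (fun x => (x - m) / (b - m)) (b - m)^-1.
    by apply: is_derive_eq; rewrite /GRing.scale /=; ring.
  have d2 := @is_derive1_comp _ Num.sqrt (fun x => (x - m) / (b - m)) (r t) _ _ (is_derive1_sqrt pos) d1.
  have d3 := is_deriveZ (Num.sg (wt t)) d2.
  have d4 : is_derive (r t) 1 w_ _ := d3.
  exact: ex_derive.
have dtww := dtw (w_ (r t)).
have d1 := @is_derive1_comp _ tw w_ (r t) _ _ dtww (derivableP dw).
have eT : tw (w_ (r t)) = t by rewrite wE twK.
have dk' : is_derive (tw (w_ (r t))) 1 k ('D_1 k t) by rewrite eT.
have d2 := @is_derive1_comp _ k (fun x => tw (w_ x)) (r t) _ _ dk' d1.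
have e : \forall x \near r t, k (tw (w_ x)) = rho1 x.
  have n1 : \forall x \near r t, -1 < w_ x < 1.
    have cw : {for r t, continuous w_} by apply: differentiable_continuous; exact/derivable1_diffP.
    have hn : \forall v \near w_ (r t), -1 < v < 1 by rewrite wE; exact: near_itv.
    exact (cw _ hn).
  have n2 : \forall x \near r t, m < x.
    apply: lt_nbhsr; rewrite rE ltrDl mulr_gt0// exprn_even_gt0//.
  apply: filterS2 n1 n2 => x hx mx; rewrite /k /traj_radius Ktw clamp_id; last by lra.
  rewrite /leg_radius /w_ exprMn sqr_sg w0 mul1r sqr_sqrtr; last by rewrite divr_ge0 ?(ltW l0)// subr_ge0 ltW.
  by congr rho1; field; rewrite gt_eqF.
have d3 := near_eq_is_derive e d2.
have [dr _ _ _ _] := traj_derivatives ht.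
set k2 := (X in is_derive _ _ _ X) in d3.
by exists k2 => //; apply: (@is_derive1_comp _ rho1 (fun t => r t) t _ _ d3 dr).
Qed.

(** The scalar Jacobi equation: the second derivative of the normal component is the
    normal component times minus the curvature. *)
Lemma jacobi_slope_derive t k2 : 0 < t < T -> t != T / 2 ->
  is_derive t 1 k (k2 * (r t * i t * sn t)) ->
  is_derive t 1 f (beta t * (r t * (k t + r t * k2) * i t ^+ 3 - (r t * k t) ^+ 2 * i t ^+ 4)).
Proof.
move=> ht tN dk; have [dr di ds dc dth] := traj_derivatives ht.
have db := jacobi_normal_derive cl ht; have dsg := traj_root_derive tp lp ht.
have s0 := traj_root_neq0 cl tN ht; have r0 := rho0 t.
have e : \forall u \near t, (1 + beta u * (r u * k u) * i u) / sg u = f u.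
  have : \forall u \near t, u != T / 2.
    by move: tN; rewrite neq_lt => /orP[l|l]; [apply: filterS (lt_nbhsl l) => u|apply: filterS (lt_nbhsr l) => u] => h; [rewrite lt_eqF|rewrite gt_eqF].
  by apply: filterS => u uN; rewrite /jacobi_slope (negbTE uN).
have fE := nbhs_singleton e.
apply: (near_eq_is_derive e).
have dsi := @is_deriveV _ (fun t => sg t) t _ 1 s0 dsg.
have d := is_deriveM (is_deriveD (is_derive_cst (1 : R) t 1) (is_deriveM (is_deriveM db (is_deriveM dr dk)) di)) dsi.
apply: (is_derive_eq d); rewrite /GRing.scale !fctE /cst /= -fE /sn /i /k.
by field; rewrite s0 r0.
Qed.

Lemma speed_near t : 0 < t < T ->
  [/\ c (r t) = r t * i t, is_derive (r t) 1 c (i t - r t * k t * i t ^+ 2) &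
      forall k2, is_derive (r t) 1 rho1 k2 -> is_derive (r t) 1 (derive1 c)
        (- 2 * k t * i t ^+ 2 - r t * k2 * i t ^+ 2 + 2 * r t * k t ^+ 2 * i t ^+ 3)].
Proof.
move=> ht; have [_ hr] := traj_radius_oo tp lp ht; have [h1 h2] := speed hr; have r0 := rho0 t.
split; [by rewrite h1| |move=> k2 dk2].
  by apply: (is_derive_eq h2); rewrite /i /k exprVn.
have e : \forall x \near r t, (rho x)^-1 - x * rho1 x / rho x ^+ 2 = derive1 c x.
  apply: filterS (near_itv hr) => x hx; have [_ dc] := speed hx.
  by rewrite derive1E; apply/esym; exact: derive_val.
apply: (near_eq_is_derive e).
have drho := tp_derive tp hr.
have d1 := @is_deriveV _ rho (r t) _ 1 r0 drho.
have r2 : rho (r t) ^+ 2 != 0 by rewrite expf_neq0.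
have d2 := @is_deriveV _ (fun x => rho x ^+ 2) (r t) _ 1 r2 (is_deriveM drho drho).
have d3 := is_deriveM (is_deriveM (is_derive_id (r t) (1 : R)) dk2) d2.
apply: (is_derive_eq (is_deriveB d1 d3)); rewrite /GRing.scale !fctE /= /i /k.
by field.
Qed.

(** A polynomial identity in the derivatives of rho, up to the relation sn^2 + cs^2 = 1. *)
Lemma jacobi_equation t k2 : 0 < t < T -> t != T / 2 -> is_derive (r t) 1 rho1 k2 ->
  is_derive t 1 k (k2 * (r t * i t * sn t)) ->
  exists2 w, is_derive t 1 (derive1 jacobi_field_at) w &
    is_derive (0 : R) 1 (fun h : R => accel c (ray_position e1 e2 r th t + h *: jacobi_field_at t)
      (ray_velocity e1 e2 rho (rho m) r th sg t + h *: derive1 jacobi_field_at t)) w.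
Proof.
move=> ht tN dk2 dk; have [dr di ds dc dth] := traj_derivatives ht.
have db := jacobi_normal_derive cl ht; have df := jacobi_slope_derive ht tN dk.
have [cE dcr dc1] := speed_near ht.
have r0 := traj_radius_gt0 tp wt t; have c0 : c (r t) != 0.
  by rewrite cE mulf_neq0 ?invr_neq0 ?rho0// gt_eqF.
have dc' : derivable c (r t) 1 by exact: ex_derive.
have lin := frame_accel_derive e11 e22 e12 (r t * i t * sn t) (r t * i t * cs t)
  (- (beta t * r t * i t * cs t)) (beta t * r t * i t * sn t) (A1 t) (B1 t) (th t) r0 c0
  dc' (dc1 _ dk2).
have c1E : derive1 c (r t) = i t - r t * k t * i t ^+ 2 by rewrite derive1E; exact: derive_val.
eexists; last first.
  rewrite /ray_position /ray_velocity jacobi_field_derive1//.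
  have -> : r t * sg t / rho (r t) ^+ 2 = r t * i t * sn t by rewrite /sn /i; field; exact: rho0.
  have -> : r t * rho m / rho (r t) ^+ 2 = r t * i t * cs t by rewrite /cs /i; field; exact: rho0.
  exact: lin.
have e : \forall u \near t, frame (A1 u) (B1 u) (th u) = derive1 jacobi_field_at u.
  by apply: filterS (near_itv ht) => u hu; rewrite jacobi_field_derive1.
apply: (near_eq_is_derive e).
have dA : is_derive t 1 A1 (- 2 * r t * i t ^+ 3 * sn t ^+ 2 * cs t * beta t + 12 * r t ^+ 2 * i t ^+ 4 * sn t ^+ 2 *
    cs t * k t * beta t - 3 * r t ^+ 2 * i t ^+ 4 * cs t * k t * beta t - 3 * r t * i t ^+ 2 *
    sn t * cs t * f t - 10 * r t ^+ 3 * i t ^+ 5 * sn t ^+ 2 * cs t * k t ^+ 2 * beta t + 3 *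
    r t ^+ 3 * i t ^+ 5 * cs t * k t ^+ 2 * beta t + 2 * r t ^+ 3 * i t ^+ 4 * sn t ^+ 2 * cs
    t * k2 * beta t + 4 * r t ^+ 2 * i t ^+ 3 * sn t * cs t * k t * f t - r t ^+ 3 * i t ^+ 4
    * cs t * k2 * beta t).
  by rewrite /A1; apply: is_derive_eq; rewrite /GRing.scale /=; ring.
have dB : is_derive t 1 B1 (r t * i t ^+ 3 * sn t ^+ 3 * beta t - 8 * r t ^+ 2 * i t ^+ 4 * sn t ^+ 3 * k t * beta t +
    5 * r t ^+ 2 * i t ^+ 4 * sn t * k t * beta t + 2 * r t * i t ^+ 2 * sn t ^+ 2 * f t + 10
    * r t ^+ 3 * i t ^+ 5 * sn t ^+ 3 * k t ^+ 2 * beta t - 8 * r t ^+ 3 * i t ^+ 5 * sn t * k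
    t ^+ 2 * beta t - 2 * r t ^+ 3 * i t ^+ 4 * sn t ^+ 3 * k2 * beta t - 4 * r t ^+ 2 * i t
    ^+ 3 * sn t ^+ 2 * k t * f t + 2 * r t ^+ 3 * i t ^+ 4 * sn t * k2 * beta t + 2 * r t ^+ 2
    * i t ^+ 3 * k t * f t - r t * i t ^+ 3 * sn t * cs t ^+ 2 * beta t + 4 * r t ^+ 2 * i t
    ^+ 4 * sn t * cs t ^+ 2 * k t * beta t - r t * i t ^+ 2 * cs t ^+ 2 * f t).
  by rewrite /B1; apply: is_derive_eq; rewrite /GRing.scale /=; ring.
apply: (is_derive_eq (frame_derive e1 e2 dA dB dth)).
have sc := sn_cs t; have i0 : i t != 0 by rewrite invr_neq0.
have {}r0 : r t != 0 by rewrite gt_eqF.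
rewrite c1E cE /A1 /B1.
move: (r t) (i t) (sn t) (cs t) (k t) (beta t) (f t) sc i0 r0 => r_ i_ s_ c_ k_ b_ f_ sc i0 r0.
f_equal; apply: subr0_eq.
- transitivity ((2 * r_ ^+ 2 * i_ ^+ 4 * c_ * k_ * b_ - r_ ^+ 3 * i_ ^+ 5 * c_ * k_ ^+ 2 * b_
    + r_ ^+ 3 * i_ ^+ 4 * c_ * k2 * b_) * (s_ ^+ 2 + c_ ^+ 2 - 1)).
    by field; rewrite r0 i0.
  by rewrite sc subrr mulr0.
- transitivity ((6 * r_ ^+ 3 * i_ ^+ 5 * s_ * k_ ^+ 2 * b_ - 3 * r_ ^+ 2 * i_ ^+ 4 * s_ * k_ * b_
    - 2 * r_ ^+ 3 * i_ ^+ 4 * s_ * k2 * b_ - 2 * r_ ^+ 2 * i_ ^+ 3 * k_ * f_) * (s_ ^+ 2 + c_ ^+ 2 - 1)).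
    by field; rewrite r0 i0.
  by rewrite sc subrr mulr0.
Qed.

Lemma jacobi_field_continuous : continuous jacobi_field_at.
Proof.
have cb := jacobi_normal_continuous cl.
have cbri : continuous (fun t => beta t * r t * i t).
  by move=> t; apply: cvgM; [apply: cvgM; [exact: cb|exact: cr]|exact: ci].
have csn : continuous sn by move=> t; apply: cvgM; [exact: csg|exact: ci].
have ccs : continuous cs by move=> t; apply: cvgM; [exact: cvg_cst|exact: ci].
apply: frame_continuous.
- by move=> t; apply: cvgN; apply: cvgM; [exact: cbri|exact: ccs].
- by move=> t; apply: cvgM; [exact: cbri|exact: csn].
- by move=> t; exact: is_derive1_continuous (lp_th lp t).
Qed.

Lemma frame00 t : frame 0 0 t = 0.
Proof. by rewrite /frame !mul0r subrr addr0 !scale0r addr0. Qed.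

(** Stationarity of the aperture makes the normal component vanish at both ends of
    the leg; at the turning point it does not vanish. *)
Lemma leg_conjugate : conjugate_along c (ray_position e1 e2 r th) 0 T.
Proof.
have T0 := lp_T lp.
have eqs u : 0 < u < T -> ray_equations rho rho1 (rho m) r th sg u.
  by move=> hu; exact (leg_ray_equations tp lp hu).
have sp u : 0 < u < T -> speed_of rho rho1 c (r u).
  by move=> hu; have [_ hr] := traj_radius_oo tp lp hu; exact: speed.
exists jacobi_field_at; split.
- split.
  + by apply: continuous_subspaceT; exact: jacobi_field_continuous.
  + by move=> u hu; have dJ := jacobi_field_derive hu; exact: ex_derive.
  + have [C hC] := jacobi_derive_lipschitz.
    exists (Num.max C 0); split; first exact: num_real.
    move=> M CM [u v] /= [hu hv]; rewrite in_itv /= in hu; rewrite in_itv /= in hv.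
    apply: le_trans (hC u v hu hv) _; rewrite ler_wpM2r// ltW//.
    by apply: le_lt_trans CM; rewrite le_max lexx.
  + have aemid : {ae @lebesgue_measure R, forall t, t != T / 2}.
      exists [set T / 2]; split; [exact: measurable_set1|exact: lebesgue_measure_set1|].
      by move=> t /= /negP; rewrite negbK => /eqP.
    have ae2 : {ae @lebesgue_measure R, forall t, t != T / 2 /\ (0 < t < T -> t != T / 2 ->
        exists2 k2, is_derive (r t) 1 rho1 k2 & is_derive t 1 k (k2 * (r t * i t * sn t)))}.
      apply: filterS2 aemid rho1_ae_derivable; last by move=> t.
      exact: (ae_filter_ringOfSetsType (@lebesgue_measure R)).
    apply: ae_imply ae2 => t [tN h] ht; have [k2 h1 h2] := h ht tN.
    have [w w1 w2] := jacobi_equation ht tN h1 h2; exists w => //.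
    by rewrite (ray_derive1 e1 e2 eqs ht).
- by rewrite /jacobi_field_at (jacobi_normal0 cl) !mul0r oppr0 frame00.
- by rewrite /jacobi_field_at (jacobi_normalT cl) !mul0r oppr0 frame00.
- have hm : 0 < T / 2 < T by lra.
  exists (T / 2) => //; apply: frame_neq0 => //; rewrite oppr_eq0.
  have p0 := rho_m_gt0 tp; have q0 := rho1_m_gt0 tp; have m0 := lt_trans (tp_x0 tp) (tp_m tp).
  have bE : beta (T / 2) = - (rho m / m / rho1 m).
    rewrite /jacobi_normal (lp_wtm lp) clamp_id ?lerN10 ?ler01//.
    rewrite /jacobi_profile /leg_root mul0r mul0r /leg_radius expr0n /= mulr0 addr0 subr0 mulr1.
    by rewrite sub0r mulNr.
  rewrite bE !mulf_neq0// ?oppr_eq0 ?mulf_neq0 ?invr_neq0//; try by rewrite gt_eqF.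
  by rewrite gt_eqF// (traj_radius_gt0 tp).
Qed.

Lemma leg_maximal (a : R) : a <= x0 -> maximal_geodesic c a b m T (ray_position e1 e2 r th).
Proof.
move=> ax.
have T0 := lp_T lp.
have eqs u : 0 < u < T -> ray_equations rho rho1 (rho m) r th sg u.
  by move=> hu; exact (leg_ray_equations tp lp hu).
have sp u : 0 < u < T -> speed_of rho rho1 c (r u).
  by move=> hu; have [_ hr] := traj_radius_oo tp lp hu; exact: speed.
have nrm u : enorm (ray_position e1 e2 r th u) = r u.
  by rewrite /ray_position (frame_radius e11 e22 e12)// ltW// (traj_radius_gt0 tp).
split => //.
- split; last exact: (ray_geodesic e11 e22 e12 eqs sp).
  apply: continuous_subspaceT; apply: frame_continuous.
  + exact: cr.
  + exact: cst_continuous.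
  + by move=> t; exact: is_derive1_continuous (lp_th lp t).
- move=> u hu; rewrite nrm; have [_ /andP[h1 h2]] := traj_radius_oo tp lp hu.
  by rewrite h2 (le_lt_trans ax h1).
- by rewrite !nrm (traj_radius0 lp) (traj_radiusT lp).
- split.
  + by move=> u _; rewrite nrm; have /andP[] := traj_radius_itv tp wt u.
  + by exists (T / 2); [lra|rewrite nrm (traj_radius_mid lp)].
Qed.

End JacobiField.

(** Where the aperture is stationary the leg is a maximal geodesic with conjugate
    endpoints. *)
Lemma countable_critical_radii {R : realType} (n : nat) (rho rho1 c : R -> R) (a x0 b N : R) :
  (2 <= n)%N -> a <= x0 ->
  (forall m, x0 < m < b -> turning_profile rho rho1 x0 b m) ->
  (forall x, x0 < x < b -> rho x <= N /\ rho1 x <= N) ->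
  (forall x y, x0 < x -> x <= y -> y < b -> `|rho1 y - rho1 x| <= N * (y - x)) ->
  (forall x, x0 < x < b -> speed_of rho rho1 c x) ->
  countable_conjugacy n c a b ->
  countable [set m | x0 < m < b /\ total_variation b rho rho1 m = 0].
Proof.
move=> n2 ax tp bd lip sp; apply: sub_countable; apply: subset_card_le => m [hm var].
split; first by case/andP: hm => h ->; rewrite (le_lt_trans ax h).
have [wt [th lp]] := leg_exists (tp m hm).
have cl : critical_leg rho rho1 x0 b m N wt th (leg_duration rho rho1 b m) (leg_aperture rho rho1 b m).
  by split => //; exact: tp.
have [e1 [e2 [e11 e22 e12]]] := @plane_basis R n n2.
exists (leg_duration rho rho1 b m), (ray_position e1 e2 (traj_radius b m wt) th); split.
  exact: (leg_maximal e11 e22 e12 cl sp ax).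
exact: (leg_conjugate e11 e22 e12 cl sp).
Qed.

(** * Radial rays *)

Section RadialRays.
Context {R : realType}.

(** With a continuous speed on the whole line, the radius of a radial ray is the
    inverse of a global primitive. *)
Lemma continuous_extension (c : R -> R) (a b la lb : R) : a < b ->
  (forall x, a < x < b -> {for x, continuous c}) ->
  c x @[x --> a^'+] --> la -> c x @[x --> b^'-] --> lb ->
  exists ch : R -> R, [/\ continuous ch, (forall x, a < x < b -> ch x = c x), ch a = la,
    ch b = lb & forall x, exists2 y, a <= y <= b & ch x = ch y].
Proof.
move=> ab cc ca cb.
pose ch x := if x <= a then la else if b <= x then lb else c x.
have chE x : a < x < b -> ch x = c x by move=> /andP[h1 h2]; rewrite /ch leNgt h1 leNgt h2.
have cha x : x <= a -> ch x = la by rewrite /ch => ->.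
have chb x : b <= x -> ch x = lb by move=> h; rewrite /ch leNgt (lt_le_trans ab h) h.
exists ch; split => //; [|exact: cha|exact: chb|]; last first.
  move=> x; have [xa|ax] := leP x a; first by exists a; rewrite ?lexx ?(ltW ab)// !cha.
  have [bx|xb] := leP b x; first by exists b; rewrite ?lexx ?(ltW ab)// !chb.
  by exists x => //; rewrite !ltW.
move=> x; apply/left_right_continuousP; split.
- have [xa|ax] := leP x a.
    rewrite cha//; have e : \forall y \near x^'-, la = ch y.
      near=> y; rewrite cha//; apply: le_trans xa; near: y; exact: nbhs_left_le.
    by apply: cvg_trans (near_eq_cvg e) _; exact: cvg_cst.
  have [xb|bx] := leP x b; last first.
    rewrite (chb x (ltW bx)); have e : \forall y \near x^'-, lb = ch y.
      near=> y; rewrite chb//; near: y; exact: nbhs_left_ge.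
    by apply: cvg_trans (near_eq_cvg e) _; exact: cvg_cst.
  have e : \forall y \near x^'-, c y = ch y.
    near=> y; rewrite chE//; apply/andP; split; first by near: y; exact: nbhs_left_gt.
    by apply: lt_le_trans xb; near: y; exact: nbhs_left_lt.
  apply: cvg_trans (near_eq_cvg e) _.
  have [xb'|bx] := ltP x b; last by rewrite (chb x bx) (le_anti (_ : x <= b <= x)) ?xb.
  by rewrite chE ?ax//; apply: cvg_within_filter; apply: cc; rewrite ax.
- have [bx|xb] := leP b x.
    rewrite chb//; have e : \forall y \near x^'+, lb = ch y.
      near=> y; rewrite chb//; apply: (le_trans bx); near: y; exact: nbhs_right_ge.
    by apply: cvg_trans (near_eq_cvg e) _; exact: cvg_cst.
  have [ax|xa] := leP a x; last first.
    rewrite (cha x (ltW xa)); have e : \forall y \near x^'+, la = ch y.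
      near=> y; rewrite cha//; near: y; exact: nbhs_right_le.
    by apply: cvg_trans (near_eq_cvg e) _; exact: cvg_cst.
  have e : \forall y \near x^'+, c y = ch y.
    near=> y; rewrite chE//; apply/andP; split; last by near: y; exact: nbhs_right_lt.
    by apply: le_lt_trans ax _; near: y; exact: nbhs_right_gt.
  apply: cvg_trans (near_eq_cvg e) _.
  have [ax'|xa] := ltP a x; last by rewrite (cha x xa) (le_anti (_ : x <= a <= x)) ?xa.
  by rewrite chE ?ax'//; apply: cvg_within_filter; apply: cc; rewrite ax'.
Unshelve. all: by end_near. Qed.

Variables (n K k : nat) (rr : nat -> R) (c : R -> R) (a b la : R).

(** The ray going straight down from the outer to the inner sphere of a layer and
    back up is periodic: with no angular momentum both reflections are trivially
    satisfied. *)
Lemma radial_length_blsp : (2 <= n)%N -> (k < K)%N -> a = layer_radius K rr k.+1 ->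
  b = layer_radius K rr k -> 0 < a -> a < b -> b <= 1 ->
  (forall j, (j <= K)%N -> ~ (a < layer_radius K rr j < b)) ->
  (forall x, a < x < b -> 0 < c x /\ derivable c x 1) ->
  c x @[x --> a^'+] --> la -> 0 < la -> c x @[x --> b^'-] --> c b -> 0 < c b ->
  blsp n K rr c (2 * integral a b (fun x => (c x)^-1)).
Proof.
move=> n2 kK aE bE a0 ab b1 gamma hc ca la0 cb cb0.
have [e1 [e2 [e11 e22 e12]]] := @plane_basis R n n2.
have cc x : a < x < b -> {for x, continuous c}.
  by move=> /hc[_ dc]; apply: differentiable_continuous; exact/derivable1_diffP.
have [ch [cch chE cha chb chI]] := continuous_extension ab cc ca cb.
have ch0 x : 0 < ch x.
  have [y /andP[ay yb] ->] := chI x; move: ay yb; rewrite !le_eqVlt.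
  move=> /predU1P[<-|ay] /predU1P[->|yb]; rewrite ?cha ?chb// chE ?ay//.
  by apply: (hc _ _).1; rewrite ay yb.
have ch0' x : ch x != 0 by rewrite gt_eqF.
have [z hz chz] : exists2 z, z \in `[a, b] & forall x, x \in `[a, b] -> ch x <= ch z.
  by apply: EVT_max; [exact: ltW|exact: continuous_subspaceT].
have chM x : ch x <= ch z by have [y hy ->] := chI x; apply: chz; rewrite in_itv.
have cg : continuous (fun x => (ch x)^-1).
  by move=> x; apply: cvgV; [exact: ch0'|exact: cch].
have [G dG] := primitive_exists cg.
have [inv [invK Kinv dinv]] : exists inv : R -> R, [/\ cancel inv G, cancel G inv &
    forall t : R, is_derive t 1 inv ((ch (inv t))^-1)^-1].
  apply: (@increasing_inverse _ G (fun x => (ch x)^-1) (ch z)^-1) => // [|x].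
    by rewrite invr_gt0.
  by rewrite lef_pV2 ?posrE.
pose T := G b - G a.
have GE : integral a b (fun x => (c x)^-1) = T.
  have [_ [C hC]] := continuousT_bounded_measurable a b cg.
  rewrite (@integral_eq _ a b _ (fun x => (ch x)^-1)); last by move=> x hx; rewrite chE.
  apply: (@integral_fundamental _ a b _ G C) => //; first by move=> x _; exact: cg.
  by apply: continuous_subspaceT => x; exact: is_derive1_continuous (dG x).
have incG x y : x < y -> G x < G y.
  move=> xy; apply: (@derive_pos_increasing _ G (fun x => (ch x)^-1) (x - 1) (y + 1)) => //; try lra.
  by move=> z' _; rewrite invr_gt0.
have T0 : 0 < T by rewrite subr_gt0 incG.
pose r u := inv (G a + `|u - T|).
pose rho x := x / ch x; pose rho1 x := (ch x - x * derive1 c x) / ch x ^+ 2.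
have crho : continuous rho by move=> x; apply: cvgM; [exact: cvg_id|exact: cg].
have cinv : continuous inv by move=> t; exact: is_derive1_continuous (dinv t).
have cr : continuous r.
  move=> u; apply: (continuous_comp (f := fun u => G a + `|u - T|) (g := inv)); last exact: cinv.
  apply: cvgD; first exact: cvg_cst.
  by apply: cvg_norm; apply: cvgB; [exact: cvg_id|exact: cvg_cst].
have rG u : G (r u) = G a + `|u - T| by rewrite /r invK.
have lerG x y : G x <= G y -> x <= y by move=> h; rewrite leNgt; apply/negP => /incG; rewrite ltNge h.
have ltrG x y : G x < G y -> x < y.
  by move=> h; rewrite ltNge le_eqVlt; apply/negP => /predU1P[e|/incG]; [move: h; rewrite e ltxx|rewrite ltNge ltW].
have rT u : `|u - T| = T -> r u = b by move=> e; rewrite /r e /T addrC subrK Kinv.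
have r0 : r 0 = b by apply: rT; rewrite sub0r normrN gtr0_norm.
have r2T : r (2 * T) = b by apply: rT; rewrite (_ : 2 * T - T = T) ?gtr0_norm//; ring.
have rTa : r T = a by rewrite /r subrr normr0 addr0 Kinv.
have rI u : 0 <= u <= 2 * T -> a <= r u <= b.
  move=> hu; have h1 : `|u - T| <= T by rewrite ler_norml; lra.
  apply/andP; split; apply: lerG; rewrite rG ?lerDl//.
  by rewrite -lerBrDl.
have rJ u : 0 < u < 2 * T -> u != T -> a < r u < b.
  move=> hu uT; have h1 : `|u - T| < T by rewrite ltr_norml; lra.
  apply/andP; split; apply: ltrG; rewrite rG ?ltrDl ?normr_gt0 ?subr_eq0//.
  by rewrite -ltrBrDl.
have rp u : 0 < r u by apply: lt_le_trans a0 _; apply: lerG; rewrite rG lerDl.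
pose s (i : nat) : R := if i is 0%N then -1 else 1.
have s2 i : s i ^+ 2 = 1 by case: i => [|i] /=; rewrite ?sqrrN expr1n.
have leg i u : (i < 2)%N -> i%:R * T < u < i.+1%:R * T ->
    [/\ 0 < u < 2 * T, u != T & `|u - T| = s i * (u - T)].
  case: i => [|[|i]] // _ hu.
    have h : u - T < 0 by lra.
    by split; [lra|apply: contraTneq h => ->; rewrite subrr ltxx|rewrite ltr0_norm// mulN1r].
  have h : 0 < u - T by lra.
  by split; [lra|apply: contraTneq h => ->; rewrite subrr ltxx|rewrite gtr0_norm// mul1r].
have sp x : a < x < b -> speed_of rho rho1 c x.
  move=> hx; have [c0 dc] := hc x hx; split; first by rewrite /rho chE//; field; rewrite !gt_eqF//; lra.
  have -> : (rho x)^-1 - x * rho1 x / rho x ^+ 2 = derive1 c x.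
    by rewrite /rho /rho1; field; rewrite ch0' gt_eqF//; lra.
  by rewrite derive1E; exact/derivableP.
have drho x : a < x < b -> is_derive x 1 rho (rho1 x).
  move=> hx; have [c0 dc] := hc x hx; have cx : c x != 0 by rewrite gt_eqF.
  have dc' : is_derive x 1 c (derive1 c x) by rewrite derive1E; exact/derivableP.
  have e : \forall y \near x, y / c y = rho y by apply: filterS (near_itv hx) => y /chE E; rewrite /rho E.
  apply: (near_eq_is_derive e).
  have dV := @is_deriveV _ c x _ 1 cx dc'.
  have h := is_deriveM (is_derive_id x (1 : R)) dV; apply: (is_derive_eq h).
  by rewrite /GRing.scale /= /rho1 chE//; field.
have eqs i u : (i < 2)%N -> i%:R * T < u < i.+1%:R * T ->
    ray_equations rho rho1 0 r (fun=> 0) (fun u => s i * rho (r u)) u.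
  move=> i2 hu; have [h1 h2 h3] := leg i u i2 hu; have hr := rJ u h1 h2.
  have dr : is_derive u 1 r (s i * ch (r u)).
    have e : \forall v \near u, inv (G a + s i * (v - T)) = r v.
      by apply: filterS (near_itv hu) => v hv; have [_ _ E] := leg i v i2 hv; rewrite /r E.
    apply: (near_eq_is_derive e).
    have d1 : is_derive u 1 (fun v => G a + s i * (v - T)) (s i).
      by apply: is_derive_eq; rewrite /GRing.scale /=; ring.
    have d := @is_derive1_comp _ inv (fun v => G a + s i * (v - T)) u _ _ (dinv _) d1.
    by apply: (is_derive_eq d); rewrite invrK -h3 -/(r u) mulrC.
  split.
  - by apply: (is_derive_eq dr); rewrite /rho; field; rewrite ch0' gt_eqF.
  - by rewrite mul0r; exact: is_derive_cst.
  - have d := @is_derive1_comp _ rho r u _ _ (drho _ hr) dr.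
    apply: (is_derive_eq (is_deriveM (is_derive_cst (s i) u 1) d)).
    rewrite /cst /GRing.scale /= mulr0 addr0 /rho.
    transitivity (s i ^+ 2 * (rho1 (r u) * ch (r u))); first by ring.
    by rewrite s2; field; rewrite ch0' gt_eqF.
  - by rewrite exprMn s2 mul1r expr0n /= subr0.
  - exact: rp.
  - by rewrite divr_gt0.
  - exact: drho.
pose g := ray_position e1 e2 r (fun=> 0).
have nrm u : enorm (g u) = r u by rewrite /g /ray_position (frame_radius e11 e22 e12)// ltW.
have spr i u : (i < 2)%N -> i%:R * T < u < i.+1%:R * T -> speed_of rho rho1 c (r u).
  by move=> i2 hu; have [h1 h2 _] := leg i u i2 hu; apply: sp; exact: rJ.
have cov i t (F : set_system R) : (i < 2)%N -> Filter F -> F --> t ->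
    (\forall u \near F, i%:R * T < u < i.+1%:R * T) ->
    covector c g u @[u --> F] --> frame e1 e2 (s i * rho (r t) / r t) 0 0.
  move=> i2 FF Ft hF.
  have e : \forall u \near F, frame e1 e2 (s i * rho (r u) / r u) 0 0 = covector c g u.
    apply: filterS hF => u hu.
    have h := ray_covector e11 e22 e12 (fun u => eqs i u i2) (fun u => spr i u i2) hu.
    by rewrite h mul0r.
  apply: cvg_trans (near_eq_cvg e) _.
  have cru : r u @[u --> F] --> r t by exact (cvg_trans (cvg_app r Ft) (cr t)).
  apply: frame_cvg; [|exact: cvg_cst|exact: cvg_cst].
  apply: cvgM; last by apply: cvgV => //; rewrite gt_eqF.
  apply: cvgM; first exact: cvg_cst.
  exact: (continuous_cvg _ (crho (r t))).
have covl i : (i < 2)%N -> covector c g u @[u --> (i.+1%:R * T)^'-] -->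
    frame e1 e2 (s i * rho (r (i.+1%:R * T)) / r (i.+1%:R * T)) 0 0.
  move=> i2; apply: cov => //.
    by apply: cvg_within.
  have l : i%:R * T < i.+1%:R * T by rewrite ltr_pM2r ?ltr_nat.
  near=> u; apply/andP; split; near: u; [exact: nbhs_left_gt|exact: nbhs_left_lt].
have covr i : (i < 2)%N -> covector c g u @[u --> (i%:R * T)^'+] -->
    frame e1 e2 (s i * rho (r (i%:R * T)) / r (i%:R * T)) 0 0.
  move=> i2; apply: cov => //.
    by apply: cvg_within.
  have l : i%:R * T < i.+1%:R * T by rewrite ltr_pM2r ?ltr_nat.
  near=> u; apply/andP; split; near: u; [exact: nbhs_right_gt|exact: nbhs_right_lt].
have tang u X : tangential (g u) (frame e1 e2 X 0 0) = frame e1 e2 0 0 0.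
  by rewrite /g /ray_position frame_tangential// gt_eqF.
have refl i j : (i < 2)%N -> (j < 2)%N -> reflects_or_refracts c g (i.+1%:R * T) (j%:R * T).
  move=> i2 j2; exists (frame e1 e2 (s i * rho (r (i.+1%:R * T)) / r (i.+1%:R * T)) 0 0).
  exists (frame e1 e2 (s j * rho (r (j%:R * T)) / r (j%:R * T)) 0 0).
  by split; [exact: covl|exact: covr|rewrite !tang].
have onb u : r u = b -> on_Gamma K rr (g u) by move=> e; exists k; [exact: ltnW|rewrite nrm e].
rewrite GE; exists 2, (fun i => i%:R * T), g; split; [split|split|by []].
- split.
  + by rewrite mul0r.
  + by move=> i i2; rewrite ltr_pM2r// ltr_nat.
  + split; last by move=> u /rI /andP[_ h]; rewrite nrm; exact: le_trans b1.
    apply: continuous_subspaceT; apply: frame_continuous => //; exact: cst_continuous.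
  + move=> i i2; split.
      exact: (ray_geodesic e11 e22 e12 (fun u => eqs i u i2) (fun u => spr i u i2)).
    move=> u hu [j jK]; rewrite nrm => e; have [h1 h2 _] := leg i u i2 hu.
    by apply: (gamma j jK); rewrite -e; exact: rJ.
  + move=> [|[|i]] // _; split; last exact: (refl 0%N 1%N).
    by exists k.+1 => //; rewrite nrm mul1r rTa.
- by rewrite /g /ray_position r2T r0.
- exact: onb.
- by have := refl 1%N 0%N; rewrite mul0r; apply.
- exists k; first exact: ltnW.
  by move=> u /rI; rewrite nrm -aE -bE.
- right; exists e1 => u _; exists (r u).
  by rewrite /g /ray_position /frame cos0 sin0 !mulr0 !mul0r mulr1 subr0 addr0 scale0r addr0.
Unshelve. all: by end_near. Qed.

End RadialRays.

(** * Local constancy of families of profiles *)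

Section ProfileFamilies.
Context {R : realType}.
Implicit Types (s t x y p u : R).

(** The bounds that a steep family requires of its profiles; they pass to limits of
    parameters, as Baire's theorem needs. *)
Definition tame (x0 b N : R) (rho rho1 : R -> R) : Prop := forall x y, x0 < x -> x <= y -> y < b ->
  [/\ rho y <= N, rho1 x <= N & `|rho1 y - rho1 x| <= N * (y - x)].

Record profile_family (J : R -> Prop) (rho rho1 : R -> R -> R) (x0 b : R) : Prop := ProfileFamily {
  pf_x0 : 0 < x0;
  pf_b : x0 < b;
  pf_open : forall t, J t -> \forall s \near t, J s;
  pf_derive : forall t x, J t -> x0 < x < b -> is_derive x 1 (rho t) (rho1 t x);
  pf_pos1 : forall t x, J t -> x0 < x < b -> 0 < rho1 t x;
  pf_pos : forall t x, J t -> x0 < x < b -> 0 < rho t x;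
  pf_left : forall t, J t -> rho t x @[x --> b^'-] --> rho t b;
  pf_cont : forall t x, J t -> x0 < x < b -> {for (t, x), continuous (fun z : R * R => rho z.1 z.2)};
  pf_cont1 : forall t x, J t -> x0 < x < b -> {for (t, x), continuous (fun z : R * R => rho1 z.1 z.2)};
  pf_tame : forall t, J t -> exists N : R, tame x0 b N (rho t) (rho1 t)
}.

Lemma slice_continuous1 (f : R -> R -> R) t x : {for (t, x), continuous (fun z : R * R => f z.1 z.2)} ->
  {for t, continuous (f ^~ x)}.
Proof.
move=> cf; have c : (s, x) @[s --> t] --> (t, x).
  apply: (@cvg_pair _ _ _ (nbhs t) (nbhs t) (nbhs x)); [exact: cvg_id|exact: cvg_cst].
exact (cvg_comp _ _ c cf).
Qed.

Lemma slice_continuous2 (f : R -> R -> R) t x : {for (t, x), continuous (fun z : R * R => f z.1 z.2)} ->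
  {for x, continuous (f t)}.
Proof.
move=> cf; have c : (t, y) @[y --> x] --> (t, x).
  apply: (@cvg_pair _ _ _ (nbhs x) (nbhs t) (nbhs x)); [exact: cvg_cst|exact: cvg_id].
exact (cvg_comp _ _ c cf).
Qed.

Lemma continuous_near_gt (f : R -> R) t p : {for t, continuous f} -> p < f t ->
  \forall s \near t, p < f s.
Proof. by move=> cf h; exact: (cvgr_gt (f t) cf). Qed.

Lemma continuous_near_lt (f : R -> R) t p : {for t, continuous f} -> f t < p ->
  \forall s \near t, f s < p.
Proof. by move=> cf h; exact: (cvgr_lt (f t) cf). Qed.

Lemma near_box (P : R * R -> Prop) t x : (\forall z \near (t, x), P z) ->
  exists2 d : R, 0 < d & forall s y, `|s - t| < d -> `|y - x| < d -> P (s, y).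
Proof.
move=> [[A B] /= [/near_dist[d d0 hA] /near_dist[e e0 hB]] AB].
exists (Num.min d e); first by rewrite lt_min d0.
by move=> s y; rewrite !lt_min => /andP[h _] /andP[_ h']; apply: AB; split => /=; [exact: hA|exact: hB].
Qed.

Section OneFamily.
Variables (J : R -> Prop) (rho rho1 : R -> R -> R) (x0 b : R).
Hypothesis pf : profile_family J rho rho1 x0 b.

Lemma family_turning t m : J t -> x0 < m < b -> turning_profile (rho t) (rho1 t) x0 b m.
Proof.
move=> Jt /andP[xm mb]; split => //; try by move=> r.
- exact: pf_x0 pf.
- by move=> r hr; exact: pf_derive pf _ _ Jt hr.
- by move=> r hr; exact: pf_pos1 pf _ _ Jt hr.
- by move=> r hr; exact: slice_continuous2 (pf_cont1 pf Jt hr).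
- by move=> r hr; exact: pf_pos pf _ _ Jt hr.
- exact: pf_left pf _ Jt.
Qed.

Lemma family_increasing t x y : J t -> x0 < x -> x < y -> y < b -> rho t x < rho t y.
Proof.
move=> Jt; apply: (@derive_pos_increasing _ (rho t) (rho1 t)).
- by move=> z; exact: pf_derive pf _ _ Jt.
- by move=> z; exact: pf_pos1 pf _ _ Jt.
Qed.

Lemma family_restrict (J' : R -> Prop) : (forall t, J' t -> J t) ->
  (forall t, J' t -> \forall s \near t, J' s) -> profile_family J' rho rho1 x0 b.
Proof.
move=> sub op; case: pf => *; split=> //; move=> t; eauto.
Qed.

(** Each of the inequalities in tame involves finitely many radii, so its failure is
    an open condition on the parameter. *)
Lemma untame_open N t : J t -> ~ tame x0 b N (rho t) (rho1 t) ->
  \forall s \near t, ~ tame x0 b N (rho s) (rho1 s).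
Proof.
move=> Jt nt.
have [x [y [x0x xy yb h]]] : exists x y, [/\ x0 < x, x <= y, y < b &
    ~ [/\ rho t y <= N, rho1 t x <= N & `|rho1 t y - rho1 t x| <= N * (y - x)]].
  apply: contrapT => h; apply: nt => x y x0x xy yb; apply: contrapT => h'.
  by apply: h; exists x, y.
have hx : x0 < x < b by lra.
have hy : x0 < y < b by lra.
have c0 := slice_continuous1 (pf_cont pf Jt hy).
have cx := slice_continuous1 (pf_cont1 pf Jt hx).
have cy := slice_continuous1 (pf_cont1 pf Jt hy).
have [l1|l1] := leP (rho t y) N; last first.
  have e : \forall s \near t, N  < rho s y := continuous_near_gt c0 l1.
  apply: filterS e => s l /(_ x y x0x xy yb)[].
  by rewrite leNgt l.
have [l2|l2] := leP (rho1 t x) N; last first.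
  have e : \forall s \near t, N  < rho1 s x := continuous_near_gt cx l2.
  apply: filterS e => s l /(_ x y x0x xy yb)[].
  by move=> _; rewrite leNgt l.
have [l3|l3] := leP `|rho1 t y - rho1 t x| (N * (y - x)); first by case: h.
have cn : {for t, continuous (fun s => `|rho1 s y - rho1 s x|)}.
  by apply: cvg_norm; apply: cvgB.
have e : \forall s \near t, N * (y - x)  < `|rho1 s y - rho1 s x| := continuous_near_gt cn l3.
  apply: filterS e => s l /(_ x y x0x xy yb)[].
by move=> _ _; rewrite leNgt l.
Qed.

(** Baire: the parameters with tameness constant at most N form closed sets that
    cover the interval, so one of them has interior points. *)
Lemma uniformly_tame t1 t2 : t1 < t2 -> (forall t, t1 <= t <= t2 -> J t) ->
  exists s1 s2 N : R, [/\ t1 <= s1, s1 < s2, s2 <= t2 &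
    forall t, s1 < t < s2 -> tame x0 b N (rho t) (rho1 t)].
Proof.
move=> t12 tJ.
pose E (N : nat) : set R := [set t | t1 <= t <= t2 /\ tame x0 b N%:R (rho t) (rho1 t)].
apply: contrapT => none.
have op i : open (~` E i).
  rewrite openE => t /= nE; rewrite /interior.
  have [ht|ht] := pselect (t1 <= t <= t2).
    have nt : ~ tame x0 b i%:R (rho t) (rho1 t) by move=> h; apply: nE.
    by apply: filterS (untame_open (tJ t ht) nt) => s h [_].
  move: ht => /negP; rewrite negb_and -!ltNge => /orP[l|l].
    by apply: filterS (lt_nbhsl l) => s l' [/andP[h _] _]; move: l'; rewrite ltNge h.
  by apply: filterS (lt_nbhsr l) => s l' [/andP[_ h] _]; move: l'; rewrite ltNge h.
have de i : dense (~` E i).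
  move=> O [u Ou] oO; apply: contrapT => h.
  have OE v : O v -> E i v by move=> Ov; apply: contrapT => nE; apply: h; exists v.
  have [d d0 hd] := near_dist (open_nbhs_nbhs (conj oO Ou)).
  have near v : u - d < v < u + d -> E i v.
    by move=> hv; apply: OE; apply: hd; rewrite ltr_distl; lra.
  have k1 : t1 <= u - d / 2 <= t2 by apply: (near _ _).1; lra.
  have k2 : t1 <= u + d / 2 <= t2 by apply: (near _ _).1; lra.
  apply: none; exists (u - d / 2), (u + d / 2), i%:R; split; [lra|lra|lra|].
  by move=> t ht; apply: (near t _).2; lra.
have o12 : open [set` `]t1, t2[] by exact: interval_open.
have [|t [/= ht hE]] := @Baire R R (fun i => ~` E i) (fun i => conj (op i) (de i)) [set` `]t1, t2[] _ o12.
  by exists ((t1 + t2) / 2); rewrite /= in_itv /=; lra.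
rewrite in_itv /= in ht.
have ht' : t1 <= t <= t2 by lra.
have [N hN] := pf_tame pf (tJ t ht').
apply: (hE (Num.truncn N).+1 I); split => // x y h1 h2 h3; have [a1 a2 a3] := hN x y h1 h2 h3.
have lN : N <= (Num.truncn N).+1%:R by rewrite ltW// truncnS_gt.
split; [exact: le_trans lN|exact: le_trans lN|apply: le_trans a3 _].
by rewrite ler_wpM2r// subr_ge0.
Qed.

End OneFamily.

Lemma near_ball_itv t (P : R -> Prop) : (\forall s \near t, P s) ->
  exists s1 s2 : R, s1 < t < s2 /\ forall s, s1 < s < s2 -> P s.
Proof.
move=> /near_dist[d d0 hd]; exists (t - d), (t + d); split; first by lra.
by move=> s hs; apply: hd; rewrite ltr_distl; lra.
Qed.

Section TameFamily.
Variables (J : R -> Prop) (rho rho1 : R -> R -> R) (x0 b N : R) (C : set R).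
Hypothesis pf : profile_family J rho rho1 x0 b.
Hypothesis tm : forall t, J t -> tame x0 b N (rho t) (rho1 t).
Hypothesis crit : forall t, J t ->
  countable [set m | x0 < m < b /\ total_variation b (rho t) (rho1 t) m = 0].
Hypothesis C_countable : countable C.
Hypothesis lengths : forall t m (n k : nat), J t -> x0 < m < b -> (0 < n)%N -> (0 < k)%N ->
  n%:R * leg_aperture (rho t) (rho1 t) b m = 2 * pi * k%:R ->
  C (n%:R * leg_duration (rho t) (rho1 t) b m).

(** A box around (t, m) small enough that joint continuity bounds rho and rho1 from
    below gives uniform steepness, and the momenta between those of its sides are
    attained for all nearby parameters. *)
Lemma family_box t m : J t -> x0 < m < b -> exists s1 s2 m1 m2 p1 p2 d : R,
  [/\ s1 < t < s2, p1 < rho t m < p2, (forall s, s1 < s < s2 -> J s) /\ x0 < m1,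
    regular_family rho rho1 s1 s2 x0 b m1 m2 d N &
    forall s p, s1 < s < s2 -> p1 < p < p2 -> exists2 m', m1 < m' < m2 & rho s m' = p].
Proof.
move=> Jt hm; have [x00 b0] := (pf_x0 pf, lt_trans (pf_x0 pf) (pf_b pf)).
have q0 := pf_pos1 pf Jt hm; have r0 := pf_pos pf Jt hm.
have [d1 d10 box1] : exists2 d : R, 0 < d & forall s y, `|s - t| < d -> `|y - m| < d ->
    rho1 t m / 2 < rho1 s y.
  apply: (@near_box (fun z => rho1 t m / 2 < rho1 z.1 z.2)).
  by apply: (cvgr_gt _ (pf_cont1 pf Jt hm)) => /=; lra.
have [d2 d20 box2] : exists2 d : R, 0 < d & forall s y, `|s - t| < d -> `|y - m| < d ->
    rho t m / 2 < rho s y.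
  apply: (@near_box (fun z => rho t m / 2 < rho z.1 z.2)).
  by apply: (cvgr_gt _ (pf_cont pf Jt hm)) => /=; lra.
(* The box and the radii m1 < m2 < m3 around m fit within 4 h. *)
have [h [h0 hd1 hd2 hx hb]] : exists h : R, [/\ 0 < h, 4 * h <= d1, 4 * h <= d2,
    4 * h <= m - x0 & 4 * h <= b - m].
  exists (Num.min (Num.min d1 d2) (Num.min (m - x0) (b - m)) / 4).
  set w := Num.min _ _; rewrite (_ : 4 * (w / 4) = w); last by field.
  have w0 : 0 < w by rewrite !lt_min d10 d20 /=; apply/andP; split; linarith.
  by split; [lra|by rewrite /w !ge_min lexx ?orbT..].
pose m1 := m - h; pose m2 := m + h; pose m3 := m + 2 * h.
have h1 : x0 < m1 by rewrite /m1; lra.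
have h2 : m1 < m by rewrite /m1; lra.
have h3 : m < m2 by rewrite /m2; lra.
have h4 : m3 < b by rewrite /m3; lra.
have h5 : m2 < m3 by rewrite /m2 /m3; lra.
have im1 : rho t m1 < rho t m by apply: (family_increasing pf) => //; lra.
have im2 : rho t m < rho t m2 by apply: (family_increasing pf) => //; lra.
pose p1 := (rho t m1 + rho t m) / 2; pose p2 := (rho t m + rho t m2) / 2.
have e1 : \forall s \near t, rho s m1 < p1.
  apply: (@continuous_near_lt (rho^~ m1)); last by rewrite /p1; lra.
  by apply: slice_continuous1; apply: (pf_cont pf) => //; lra.
have e2 : \forall s \near t, p2 < rho s m2.
  apply: (@continuous_near_gt (rho^~ m2)); last by rewrite /p2; lra.
  by apply: slice_continuous1; apply: (pf_cont pf) => //; lra.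
have e3 : \forall s \near t, `|s - t| < d1 by apply: (@dist_near _ t _ _ d10) => s; rewrite distrC.
have e4 : \forall s \near t, `|s - t| < d2 by apply: (@dist_near _ t _ _ d20) => s; rewrite distrC.
have [s1 [s2 [ht hs]]] := near_ball_itv (filterI (filterI (pf_open pf Jt) (filterI e1 e2)) (filterI e3 e4)).
exists s1, s2, m1, m2, p1, p2, (rho1 t m / 2 * (rho t m / 2) * ((m3 - m2) / (2 * b))).
split => //.
- by rewrite /p1 /p2; lra.
- by split => // s /hs[[]].
- have Js s : s1 < s < s2 -> J s by move=> /hs[[]].
  split.
  + split.
    * by move=> s m' /Js Jt' hm'; apply: (family_turning pf) => //; lra.
    * move=> s r /Js Jt' /andP[hr1 hr2].
      by have [] := tm Jt' hr1 (lexx r) hr2.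
    * by move=> s r r' /Js Jt' hr1 hr2 hr3; have [] := tm Jt' hr1 hr2 hr3.
    * move=> s m' r /[dup] hss /Js Jt'; apply: (@steep_bound _ (rho s) (rho1 s) x0 b m1 m2 m3) => //.
      - exact: ltW.
      - by linarith.
      - by apply: divr_gt0.
      - by apply: divr_gt0.
      - by move=> y; exact: pf_derive pf _ _ Jt'.
      - by move=> y; exact: pf_pos1 pf _ _ Jt'.
      - move=> y hy; have [_ [k1 k2]] := hs s hss.
        have hy1 : `|y - m| < d1 by rewrite ltr_distl; move: hy; rewrite /m1 /m3; lra.
        have hy2 : `|y - m| < d2 by rewrite ltr_distl; move: hy; rewrite /m1 /m3; lra.
        by split; apply: ltW; [exact: box1|exact: box2].
    * apply: mulr_gt0; first by apply: mulr_gt0; apply: divr_gt0.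
      by apply: divr_gt0; [linarith|apply: mulr_gt0].
    * by linarith.
  + by move=> s r /Js Jt'; exact: pf_cont pf _ _ Jt'.
  + by move=> s r /Js Jt'; exact: pf_cont1 pf _ _ Jt'.
- move=> s p /hs[[Js [l1 l2]] _] hp.
  have m12 : m1 <= m2 by linarith.
  have cts : {within `[m1, m2], continuous (rho s)}.
    apply: continuous_itvW => z hz; apply: (slice_continuous2 (f := rho)).
    by apply: (pf_cont pf) => //; linarith.
  have l12 : rho s m1 < rho s m2 by linarith.
  have [|z hz zE] := IVT m12 cts (v := p).
    by rewrite (min_l (ltW l12)) (max_r (ltW l12)); linarith.
  exists z => //; move: hz; rewrite in_itv /= !le_eqVlt.
  move=> /andP[/predU1P[k1|->] /predU1P[k2|->]] //; first 1 last.
  + by move: hp; rewrite -zE -k1; lra.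
  + by move: hp; rewrite -zE k2; lra.
  + by move: hp; rewrite -zE -k1; lra.
Qed.

(** Where the level p is attained the travel-time data determine the Abel transform,
    which is therefore locally constant in the parameter. *)
Lemma abel_locally_constant t m : J t -> x0 < m < b ->
  \forall s \near t, abel x0 b (rho s) (rho t m ^+ 2) = abel x0 b (rho t) (rho t m ^+ 2).
Proof.
move=> Jt hm; have [s1 [s2 [m1 [m2 [p1 [p2 [d [ht hp [Js xm] rf attained]]]]]]]] := family_box Jt hm.
have m2b := sf_m2 (rf_steep rf).
apply: filterS (near_itv ht) => s hs.
apply: (abel_rigidity rf attained _ C_countable _ hp hs ht).
- move=> u x y hu m1x xy ym2.
  have [z hz nz] := countable_codense xy (crit (Js u hu)).
  exists z => //; apply/eqP => e; apply: nz; split => //; linarith.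
- by move=> u y i j hu hy; apply: lengths; [exact: Js|linarith].
Qed.

Lemma abel_parameter_continuous t (X : R) : J t -> {for t, continuous (fun s => abel x0 b (rho s) X)}.
Proof.
move=> Jt.
apply: (@integral_param_cvg _ _ (fun s r => Num.sqrt (rho s r ^+ 2 - X) / r) x0 b t
  (Num.sqrt (N ^+ 2 - X) * x0^-1)).
- apply: filterS (pf_open pf Jt) => s Js.
  have bp : bounded_profile x0 b N (rho s).
    split; [exact: pf_x0 pf|exact: pf_b pf| |].
      by move=> r hr; apply: (slice_continuous2 (f := rho)); apply: (pf_cont pf).
    move=> r hr; rewrite (ltW (pf_pos pf Js hr)); case/andP: hr => hr1 hr2.
    by have [] := tm Js hr1 (lexx r) hr2.
  split; first by case: (abel_integrand_bm X bp).
  move=> r hr; rewrite normrM; apply: ler_pM => //; last exact: (inv_bound (pf_x0 pf) hr).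
  by rewrite ger0_norm ?sqrtr_ge0// ler_wsqrtr// lerD2r (rho2_bound bp hr).
- move=> r hr; apply: cvgM; last exact: cvg_cst.
  have c := slice_continuous1 (pf_cont pf Jt hr).
  apply: (continuous_comp (f := fun s => rho s r ^+ 2 - X) (g := Num.sqrt)); last exact: sqrt_continuous.
  by apply: cvgB; [apply: cvgM|exact: cvg_cst].
Qed.

Lemma abel_zero t (X : R) : (forall r, x0 < r < b -> rho t r ^+ 2 <= X) -> abel x0 b (rho t) X = 0.
Proof.
move=> h; rewrite /abel (@integral_eq _ x0 b _ (fun=> 0)); last first.
  by move=> r hr; rewrite ler0_sqrtr ?mul0r// subr_le0; exact: h.
by rewrite integral_cst ?mul0r// ltW// (pf_b pf).
Qed.

(** The Abel transform vanishes where the level is not attained and is locally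
    constant elsewhere; being continuous in the parameter, it is constant. *)
Lemma abel_constant s1 s2 x1 p : (forall s, s1 < s < s2 -> J s) -> x0 < x1 < b -> 0 <= p ->
  (forall s, s1 < s < s2 -> rho s x1 < p) ->
  forall t u, s1 < t < s2 -> s1 < u < s2 -> abel x0 b (rho t) (p ^+ 2) = abel x0 b (rho u) (p ^+ 2).
Proof.
move=> sub hx p0 lo.
pose f s := abel x0 b (rho s) (p ^+ 2).
have loc t : s1 < t < s2 -> f t != 0 -> \forall s \near t, f s = f t.
  move=> ht f0; have Jt := sub t ht.
  have [r hr pr] : exists2 r, x0 < r < b & p < rho t r.
    apply: contrapT => h; move/eqP: f0; apply; apply: abel_zero => r hr.
    have rp : rho t r <= p by rewrite leNgt; apply/negP => l; apply: h; exists r.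
    by rewrite ler_sqr ?nnegrE//; exact/ltW/(pf_pos pf Jt hr).
  have x1r : x1 < r.
    rewrite ltNge le_eqVlt; apply/negP => /predU1P[e|l].
      by have := lo t ht; rewrite -e; lra.
    have i : rho t r < rho t x1 by apply: (family_increasing pf) => //; lra.
    by have := lo t ht; lra.
  have cts : {within `[x1, r], continuous (rho t)}.
    apply: continuous_itvW => z hz; apply: (slice_continuous2 (f := rho)).
    by apply: (pf_cont pf) => //; linarith.
  have l := lo t ht.
  have [|z hz zE] := IVT (ltW x1r) cts (v := p).
    have l' : rho t x1 <= rho t r by lra.
    by rewrite (min_l l') (max_r l'); linarith.
  rewrite in_itv /= in hz; rewrite /f -zE; apply: abel_locally_constant => //; linarith.
have ct t : s1 < t < s2 -> {for t, continuous f}.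
  by move=> /sub; exact: abel_parameter_continuous.
have key t u : s1 < t < s2 -> s1 < u < s2 -> f t != 0 -> f t = f u.
  move=> ht hu f0; apply: esym; apply: (@clopen_interval _ (fun s => f s = f t) s1 s2 t) => //.
  - by move=> s hs e; rewrite -e; apply: loc => //; rewrite e.
  - move=> s hs /eqP; rewrite neq_lt => /orP[l|l].
      by apply: filterS (continuous_near_lt (ct s hs) l) => v + e; rewrite e ltxx.
    by apply: filterS (continuous_near_gt (ct s hs) l) => v + e; rewrite e ltxx.
move=> t u ht hu; rewrite -!/(f _).
have [e1|] := eqVneq (f t) 0; last exact: key.
by have [e2|n2] := eqVneq (f u) 0; [rewrite e1 e2|apply: esym; exact: key].
Qed.

(** Levels above the momentum at a slightly smaller radius are either attained in the
    interior or exceed the whole profile, for all nearby parameters, so all the Abel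
    transforms agree above it; Abel's equation has a unique solution there. *)
Lemma profile_locally_constant t x : J t -> x0 < x < b ->
  \forall s \near t, rho s x = rho t x.
Proof.
move=> Jt hx; pose x1 := (x0 + x) / 2.
have hx1 : x0 < x1 < x by rewrite /x1; lra.
have hx1' : x0 < x1 < b by lra.
have i : rho t x1 < rho t x by apply: (family_increasing pf) => //; lra.
(* A level that separates the momenta at x1 and x for all nearby parameters. *)
pose p := (rho t x1 + rho t x) / 2.
have p0 : 0 < p by have := pf_pos pf Jt hx1'; have := pf_pos pf Jt hx; rewrite /p; lra.
have e1 : \forall s \near t, rho s x1 < p.
  apply: (@continuous_near_lt (rho^~ x1)); last by rewrite /p; lra.
  by apply: slice_continuous1; apply: (pf_cont pf).
have e2 : \forall s \near t, p < rho s x.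
  apply: (@continuous_near_gt (rho^~ x)); last by rewrite /p; lra.
  by apply: slice_continuous1; apply: (pf_cont pf).
have [s1 [s2 [ht hs]]] := near_ball_itv (filterI (pf_open pf Jt) (filterI e1 e2)).
have bp s : s1 < s < s2 -> bounded_profile x0 b N (rho s).
  move=> /hs[Js _]; split; [exact: pf_x0 pf|exact: pf_b pf| |].
    by move=> r hr; apply: (slice_continuous2 (f := rho)); apply: (pf_cont pf).
  move=> r hr; rewrite (ltW (pf_pos pf Js hr)); case/andP: hr => hr1 hr2.
  by have [] := tm Js hr1 (lexx r) hr2.
have mono s r r' : s1 < s < s2 -> x0 < r -> r <= r' -> r' < b -> rho s r <= rho s r'.
  move=> /hs[Js _] hr; rewrite le_eqVlt => /predU1P[->//|rr'] hr'.
  by apply/ltW/(family_increasing pf).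
have ab s s' X : s1 < s < s2 -> s1 < s' < s2 -> p ^+ 2 < X ->
    abel x0 b (rho s) X = abel x0 b (rho s') X.
  move=> h h' pX; have X0 : 0 <= X by apply: le_trans (ltW pX); exact: sqr_ge0.
  rewrite -(sqr_sqrtr X0).
  apply: (@abel_constant s1 s2 x1 (Num.sqrt X)) => //.
  + by move=> u /hs[].
  + move=> u /hs[_ [l _]]; apply: lt_trans l _.
    by rewrite -ltr_sqr ?nnegrE ?sqrtr_ge0 ?(ltW p0)// sqr_sqrtr.
have le s s' : s1 < s < s2 -> s1 < s' < s2 -> rho s x <= rho s' x.
  move=> h h'; apply: (@abel_injective_le _ x0 b N (rho s) (rho s') (p ^+ 2)) => //.
  + exact: bp.
  + exact: bp.
  + by move=> r r'; exact: mono.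
  + by move=> r r'; exact: mono.
  + by move=> X; exact: ab.
  + have [_ [_ l]] := hs s h; rewrite ltr_sqr ?nnegrE ?(ltW p0)// ltW//; exact: lt_trans l.
apply: filterS (near_itv ht) => s h; apply: le_anti; rewrite !le//.
Qed.

End TameFamily.

End ProfileFamilies.

(** * Speeds within a layer *)

Section LayerFamilies.
Context {R : realType}.
Implicit Types (s t x y u : R).

(** The speeds in one layer with fixed outer radius b, while the inner radius a
    depends on the parameter. *)
Record layer_family (n : nat) (I : R -> Prop) (a : R -> R) (b : R) (c c1 c2 : R -> R -> R) : Prop :=
  LayerFamily {
  lf_open : forall t, I t -> \forall s \near t, I s;
  lf_itv : forall t, I t -> 0 <= a t /\ a t < b;
  lf_inner : forall t, I t -> {for t, continuous a};
  lf_pos : forall t x, I t -> a t < x <= b -> 0 < c t x;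
  lf_derive : forall t x, I t -> a t < x < b -> is_derive x 1 (c t) (c1 t x);
  lf_derive2 : forall t x, I t -> a t < x < b -> is_derive t 1 (c ^~ x) (c2 t x);
  lf_cont1 : forall t x, I t -> a t < x < b -> {for (t, x), continuous (fun z : R * R => c1 z.1 z.2)};
  lf_cont2 : forall t x, I t -> a t < x < b -> {for (t, x), continuous (fun z : R * R => c2 z.1 z.2)};
  lf_lip : forall t, I t -> exists L : R, forall x y, a t < x < b -> a t < y < b ->
    `|c1 t y - c1 t x| <= L * `|y - x|;
  lf_left : forall t, I t -> c t x @[x --> b^'-] --> c t b;
  lf_herglotz : forall t x, I t -> a t < x < b -> 0 < c t x - x * c1 t x;
  lf_conj : forall t, I t -> countable_conjugacy n (c t) (a t) b
}.

Variables (n : nat) (I : R -> Prop) (a : R -> R) (b : R) (c c1 c2 : R -> R -> R).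
Hypothesis lf : layer_family n I a b c c1 c2.

(** The spherical slowness, called rho where a single profile is considered. *)
Definition slowness (t x : R) : R := x / c t x.
Definition slowness1 (t x : R) : R := slowness t x / x - c1 t x * slowness t x ^+ 2 / x.

Lemma layer_gt0 t x : I t -> a t < x < b -> 0 < x /\ 0 < c t x.
Proof.
move=> It hx; have [a0 _] := lf_itv lf It; split; first by lra.
by apply: (lf_pos lf) => //; lra.
Qed.

Lemma slowness_gt0 t x : I t -> a t < x < b -> 0 < slowness t x.
Proof. by move=> It /(layer_gt0 It)[x0 c0]; rewrite divr_gt0. Qed.

Lemma slowness_derive t x : I t -> a t < x < b -> is_derive x 1 (slowness t) (slowness1 t x).
Proof.
move=> It hx; have [x0 c0] := layer_gt0 It hx; have cx : c t x != 0 by rewrite gt_eqF.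
have dV := @is_deriveV _ (c t) x _ 1 cx (lf_derive lf It hx).
have h := is_deriveM (is_derive_id x (1 : R)) dV; apply: (is_derive_eq h).
by rewrite /GRing.scale /= /slowness1 /slowness; field; rewrite cx gt_eqF.
Qed.

Lemma slowness1_gt0 t x : I t -> a t < x < b -> 0 < slowness1 t x.
Proof.
move=> It hx; have [x0 c0] := layer_gt0 It hx.
have -> : slowness1 t x = (c t x - x * c1 t x) / c t x ^+ 2.
  by rewrite /slowness1 /slowness; field; rewrite !gt_eqF.
by apply: (divr_gt0 (lf_herglotz lf It hx)); exact: (exprn_gt0 2 c0).
Qed.

Lemma slowness_increasing t x y : I t -> a t < x -> x < y -> y < b -> slowness t x < slowness t y.
Proof.
move=> It; apply: (@derive_pos_increasing _ (slowness t) (slowness1 t)).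
- by move=> z; exact: slowness_derive.
- by move=> z; exact: slowness1_gt0.
Qed.

Lemma slowness_left t : I t -> slowness t x @[x --> b^'-] --> slowness t b.
Proof.
move=> It; have [a0 ab] := lf_itv lf It; apply: cvgM; first exact/cvg_at_left_filter/cvg_id.
apply: cvgV; last exact: lf_left lf _ It.
by rewrite gt_eqF// (lf_pos lf)// ab lexx.
Qed.

Lemma slowness_le t x : I t -> a t < x < b -> slowness t x <= slowness t b.
Proof.
move=> It /andP[ax xb].
apply: (cvgr_to_ge (slowness_left It)); near=> y; by apply/ltW/slowness_increasing.
Unshelve. all: by end_near. Qed.

Lemma layer_near t x : I t -> a t < x < b -> \forall s \near t, I s /\ a s < x.
Proof.
move=> It /andP[ax _]; apply: filterI; first exact: (lf_open lf It).
exact: continuous_near_lt (lf_inner lf It) ax.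
Qed.

Lemma slowness_parameter_continuous t x : I t -> a t < x < b -> {for t, continuous (slowness^~ x)}.
Proof.
move=> It hx; have [x0 c0] := layer_gt0 It hx.
have cc : {for t, continuous (c^~ x)} := is_derive1_continuous (lf_derive2 lf It hx).
by apply: cvgM; [exact: cvg_cst|apply: cvgV => //; rewrite gt_eqF].
Qed.

(** Monotonicity in the radius upgrades separate to joint continuity. *)
Lemma slowness_continuous t x : I t -> a t < x < b ->
  {for (t, x), continuous (fun z : R * R => slowness z.1 z.2)}.
Proof.
move=> It hx; have cx := is_derive1_continuous (slowness_derive It hx).
apply/cvgrPdist_lt => e e0 /=.
have e1 : \forall y \near x, slowness t x - e < slowness t y.
  by apply: continuous_near_gt cx _; lra.
have e2 : \forall y \near x, slowness t y < slowness t x + e.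
  by apply: continuous_near_lt cx _; lra.
have [y1 [y2 [hy hI]]] := near_ball_itv (filterI (near_itv hx) (filterI e1 e2)).
pose z1 := (y1 + x) / 2; pose z2 := (x + y2) / 2.
have h1 : y1 < z1 < y2 by rewrite /z1; lra.
have h2 : y1 < z2 < y2 by rewrite /z2; lra.
have h3 : z1 < x < z2 by rewrite /z1 /z2; lra.
have [i1 [l1 _]] := hI _ h1; have [i2 [_ l2]] := hI _ h2.
have f1 : \forall s \near t, slowness t x - e < slowness s z1.
  exact: continuous_near_gt (slowness_parameter_continuous It i1) l1.
have f2 : \forall s \near t, slowness s z2 < slowness t x + e.
  exact: continuous_near_lt (slowness_parameter_continuous It i2) l2.
exists ([set s | (I s /\ a s < z1) /\ (slowness t x - e < slowness s z1 /\
    slowness s z2 < slowness t x + e)], [set y | z1 < y < z2]).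
  split => /=; last exact: near_itv.
  by apply: filterI; [exact: layer_near|exact: filterI].
move=> [s y] /= [[[Is as1] [g1 g2]] hy'].
have j1 : slowness s z1 < slowness s y by apply: slowness_increasing => //; lra.
have j2 : slowness s y < slowness s z2 by apply: slowness_increasing => //; lra.
by rewrite distrC ltr_distl; lra.
Qed.

Lemma slowness1_continuous t x : I t -> a t < x < b ->
  {for (t, x), continuous (fun z : R * R => slowness1 z.1 z.2)}.
Proof.
move=> It hx; have [x0 c0] := layer_gt0 It hx.
have cs := slowness_continuous It hx; have cc := lf_cont1 lf It hx.
have cV : {for (t, x), continuous (fun z : R * R => z.2^-1)}.
  by apply: cvgV; [rewrite gt_eqF|exact: cvg_snd].
apply: cvgB; first exact: cvgM.
by apply: cvgM => //; apply: cvgM => //; apply: cvgM.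
Qed.

(** The bounds near the inner radius use x0 > 0, those near the outer radius that rho
    is increasing and that the derivative of the speed is Lipschitz up to b. *)
Lemma slowness_tame t x0 : I t -> 0 < x0 -> a t < x0 -> x0 < b ->
  exists N : R, tame x0 b N (slowness t) (slowness1 t).
Proof.
move=> It x00 ax0 x0b; have [L hL] := lf_lip lf It.
have sub x : x0 < x < b -> a t < x < b by lra.
pose x2 := (x0 + b) / 2; have hx2 : x0 < x2 < b by rewrite /x2; lra.
have b1 : bounded_lipschitz x0 b (c1 t).
  exists (`|c1 t x2| + `|L| * (1 + (b - x0))).
    by rewrite addr_ge0// mulr_ge0//; lra.
  have l x y : x0 < x < b -> x0 < y < b -> `|c1 t y - c1 t x| <= `|L| * `|y - x|.
    move=> hx hy; apply: le_trans (hL x y (sub x hx) (sub y hy)) _.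
    by rewrite ler_wpM2r// ler_norm.
  move=> x y hx hy; split.
    have -> : c1 t x = c1 t x2 + (c1 t x - c1 t x2) by ring.
    apply: le_trans (ler_normD _ _) _; rewrite lerD2l; apply: le_trans (l _ _ hx2 hx) _.
    by rewrite ler_wpM2l// ler_norml; lra.
  apply: le_trans (l x y hx hy) _; rewrite ler_wpM2r// mulrDr mulr1.
  have k1 := normr_ge0 (c1 t x2); have k2 : 0 <= `|L| * (b - x0) by apply: mulr_ge0 => //; lra.
  by linarith.
have bi : bounded_lipschitz x0 b (fun x => x^-1).
  apply: (@bounded_lipschitzV _ x0 b (fun x => x) x0) => //; first by move=> x; lra.
  exists (`|x0| + `|b| + 1); first by rewrite !addr_ge0.
  move=> x y hx hy; split; last by rewrite ler_peMl// lerDr addr_ge0.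
  by rewrite ger0_norm; [have := ler_norm b; have := normr_ge0 x0; lra|lra].
have bnd x : x0 < x < b -> `|slowness t x| <= slowness t b.
  move=> hx; rewrite ger0_norm; first exact: (slowness_le It (sub x hx)).
  exact/ltW/(slowness_gt0 It (sub x hx)).
have [C1 C10 hC1] := b1; have [Ci Ci0 hCi] := bi.
have bs : bounded_lipschitz x0 b (slowness t).
  apply: (@bounded_lipschitz_derive _ x0 b _ (slowness1 t)
    (slowness t b * Ci + C1 * slowness t b ^+ 2 * Ci) (slowness t b)) => //.
    by move=> x hx; exact: (slowness_derive It (sub x hx)).
  move=> x hx; have [k1 _] := hC1 x x hx hx; have [k2 _] := hCi x x hx hx.
  have k3 := bnd x hx.
  rewrite /slowness1; move: (slowness t x) (c1 t x) k1 k3 => w v k1 k3.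
  apply: le_trans (ler_normB _ _) _; rewrite !normrM; apply: lerD.
    by apply: ler_pM.
  apply: ler_pM => //; rewrite ?mulr_ge0//.
  by apply: ler_pM => //; rewrite ?mulr_ge0// expr2; apply: ler_pM.
have bs1 : bounded_lipschitz x0 b (slowness1 t).
  apply: bounded_lipschitzB; first exact: bounded_lipschitzM.
  by apply: bounded_lipschitzM => //; apply: bounded_lipschitzM => //; exact: bounded_lipschitzM.
have [A A0 hA] := bs1; exists (slowness t b + A) => x y hx xy hy.
have hx' : x0 < x < b by lra.
have hy' : x0 < y < b by lra.
have sb0 : 0 <= slowness t b by apply: le_trans (bnd x hx').
have [k1 _] := hA x x hx' hx'; have [_ k2] := hA x y hx' hy'; split.
- by apply: le_trans (slowness_le It (sub y hy')) _; rewrite lerDl.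
- by apply: le_trans (ler_norm _) _; apply: le_trans k1 _; rewrite lerDr.
- apply: le_trans k2 _; rewrite [`|y - x|]ger0_norm ?subr_ge0//.
  by rewrite ler_wpM2r ?subr_ge0// lerDr.
Qed.

Lemma slowness_speed t x : I t -> a t < x < b -> speed_of (slowness t) (slowness1 t) (c t) x.
Proof.
move=> It hx; have [x0 c0] := layer_gt0 It hx; split.
  by rewrite /slowness; field; rewrite !gt_eqF.
apply: (is_derive_eq (lf_derive lf It hx)).
by rewrite /slowness1 /slowness; field; rewrite !gt_eqF.
Qed.

Variable C : set R.
Hypothesis C_countable : countable C.
Hypothesis n2 : (2 <= n)%N.
Hypothesis leg_lengths : forall t rho rho1 x0 m wt th T D (N M : nat), I t -> a t <= x0 ->
  turning_profile rho rho1 x0 b m -> leg_param rho rho1 b m wt th T D ->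
  (forall x, x0 < x < b -> speed_of rho rho1 (c t) x) ->
  (0 < N)%N -> N%:R * D = 2 * pi * M%:R -> C (N%:R * T).

(** If the derivative of the speed in the parameter did not vanish at some point, it
    would not vanish for all nearby parameters.  Some of these have a uniformly tame
    neighbourhood, where the speed is locally constant. *)
Lemma layer_stationary t x : I t -> a t < x < b -> c2 t x = 0.
Proof.
move=> It hx; apply: contrapT => /eqP n0; have [a0 ab] := lf_itv lf It.
pose x0 := (a t + x) / 2; have hx0 : a t < x0 < x by rewrite /x0; lra.
have hx0' : a t < x0 < b by lra.
have x00 : 0 < x0 by lra.
have cn0 : \forall s \near t, c2 s x != 0.
  have cc := slice_continuous1 (lf_cont2 lf It hx).
  move: n0; rewrite neq_lt => /orP[l|l].
    by apply: filterS (continuous_near_lt cc l) => s l'; rewrite lt_eqF.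
  by apply: filterS (continuous_near_gt cc l) => s l'; rewrite gt_eqF.
have [t1 [t2 [ht hJ]]] := near_ball_itv (filterI (layer_near It hx0') cn0).
have sub s y : t1 < s < t2 -> x0 < y < b -> I s /\ a s < y < b.
  by move=> /hJ[[Is l] _] hy; split => //; lra.
have pf : profile_family (fun s => t1 < s < t2) slowness slowness1 x0 b.
  split=> //; first by lra.
  - by move=> s; exact: near_itv.
  - by move=> s y hs hy; have [Is hy'] := sub s y hs hy; exact: slowness_derive.
  - by move=> s y hs hy; have [Is hy'] := sub s y hs hy; exact: slowness1_gt0.
  - by move=> s y hs hy; have [Is hy'] := sub s y hs hy; exact: slowness_gt0.
  - by move=> s /hJ[[Is _] _]; exact: slowness_left.
  - by move=> s y hs hy; have [Is hy'] := sub s y hs hy; exact: slowness_continuous.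
  - by move=> s y hs hy; have [Is hy'] := sub s y hs hy; exact: slowness1_continuous.
  - by move=> s /hJ[[Is as0] _]; apply: slowness_tame => //; lra.
have lt12 : (t1 + t) / 2 < (t + t2) / 2 by lra.
have in12 s : (t1 + t) / 2 <= s <= (t + t2) / 2 -> t1 < s < t2 by lra.
have [s1 [s2 [N [h1 s12 h2 htame]]]] := uniformly_tame pf lt12 in12.
have JJ s : s1 < s < s2 -> t1 < s < t2 by lra.
have pf' := family_restrict pf JJ (fun s hs => near_itv hs).
pose s := (s1 + s2) / 2; have hs : s1 < s < s2 by rewrite /s; lra.
have hx' : x0 < x < b by lra.
have lc : \forall u \near s, slowness u x = slowness s x.
  apply: (profile_locally_constant pf' htame _ C_countable _ hs hx').
  + move=> u hu; have [Iu au] := (hJ u (JJ u hu)).1.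
    apply: (@countable_critical_radii R n (slowness u) (slowness1 u) (c u) (a u) x0 b N) => //.
    * exact: ltW.
    * by move=> m hm; exact: (family_turning pf' hu hm).
    * by move=> y /andP[y1 y2]; have [] := htame u hu y y y1 (lexx y) y2.
    * by move=> y z y1 yz z1; have [] := htame u hu y z y1 yz z1.
    * by move=> y hy; apply: slowness_speed => //; lra.
    * exact: (lf_conj lf Iu).
  + move=> u m i j hu hm i0 j0 e; have [Iu au] := (hJ u (JJ u hu)).1.
    have tp := family_turning pf' hu hm; have [wt [th lp]] := leg_exists tp.
    apply: (leg_lengths Iu (ltW au) tp lp _ i0 e).
    by move=> y hy; apply: slowness_speed => //; lra.
have [[Is as0] cs0] := hJ s (JJ s hs); have hxs : a s < x < b by lra.
have [p0 q0] := layer_gt0 Is hxs.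
have e : \forall u \near s, c s x = c u x.
  apply: filterS lc => u; rewrite /slowness => /(mulfI (lt0r_neq0 p0)) /invr_inj.
  by move=> ->.
have d0 := near_eq_is_derive e (is_derive_cst (c s x) s 1).
have dz := lf_derive2 lf Is hxs.
by move/eqP: cs0; apply; rewrite -(derive_val (is_derive := dz)) (derive_val (is_derive := d0)).
Qed.

End LayerFamilies.

(** * Interfaces and layered profiles *)

Section MovingInterfaces.
Context {R : realType}.
Implicit Types (s t x y u : R).

Lemma countable_injective (L : R -> R) (C : set R) (s1 s2 : R) : s1 < s2 -> countable C ->
  (forall t, s1 < t < s2 -> C (L t)) ->
  ~ (forall t u, s1 < t < s2 -> s1 < u < s2 -> t < u -> L t != L u).
Proof.
move=> s12 cC LC inj; apply: (@countable_itv_absurd R [set t | s1 < t < s2] s1 s2) => //.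
have inj' : {in [set t | s1 < t < s2] &, injective L}.
  move=> t u; rewrite !inE /= => ht hu e; apply/eqP; apply: contrapT => /negP.
  rewrite neq_lt => /orP[l|l]; first by have := inj t u ht hu l; rewrite e eqxx.
  by have := inj u t hu ht l; rewrite e eqxx.
rewrite -(eq_countable (inj_card_eq inj')); apply: sub_countable cC; apply: subset_card_le.
by move=> _ [t ht <-]; exact: LC.
Qed.

Variables (n : nat) (I : R -> Prop) (a : R -> R) (b : R) (c c1 c2 : R -> R -> R).
Hypothesis lf : layer_family n I a b c c1 c2.

Lemma travel_time_measurable t : I t -> 0 < a t ->
  bounded_measurable (a t) b (fun x => (c t x)^-1).
Proof.
move=> It a0; apply: (@continuous_bounded_measurable _ _ _ _ (slowness c t b / a t)) => x hx.
  have [x0 c0] := layer_gt0 lf It hx.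
  by apply: cvgV; [rewrite gt_eqF|exact: is_derive1_continuous (lf_derive lf It hx)].
have [x0 c0] := layer_gt0 lf It hx.
have -> : (c t x)^-1 = slowness c t x / x by rewrite /slowness; field; rewrite !gt_eqF.
have s0 := slowness_gt0 lf It hx.
rewrite ger0_norm; last by rewrite divr_ge0// ltW.
apply: ler_pM; rewrite ?invr_ge0 ?(ltW x0) ?(ltW s0)//.
  exact: (slowness_le lf It hx).
by rewrite lef_pV2 ?posrE// ltW//; case/andP: hx.
Qed.

(** The travel times differ by the integral over the radii between the two inner
    spheres. *)
Lemma travel_time_decreasing t u : I t -> I u -> 0 < a t -> a t < a u ->
  (forall x, a u < x < b -> c t x = c u x) ->
  integral (a u) b (fun x => (c u x)^-1) < integral (a t) b (fun x => (c t x)^-1).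
Proof.
move=> It Iu a0 l E; have [_ ub] := lf_itv lf Iu.
have bm := travel_time_measurable It a0.
rewrite (@integral_split _ (a t) (a u) b)//; [|exact: ltW..].
rewrite (@integral_eq _ (a u) b _ (fun x => (c t x)^-1)); last by move=> x /E ->.
rewrite ltrDr; pose m := (a t + a u) / 2.
have hm : a t < m < a u by rewrite /m; lra.
have hmb : a t < m < b by lra.
have sm := slowness_gt0 lf It hmb.
have b0 : 0 < b by lra.
rewrite (@integral_split _ (a t) m (a u)); [|lra|lra|]; last first.
  by apply: bounded_measurable_sub bm; [exact: lexx|exact: ltW].
apply: ltr_wpDl.
  apply: integral_ge0 => x hx; rewrite invr_ge0.
  by have [|_ /ltW//] := layer_gt0 (x := x) lf It; lra.
apply: lt_le_trans (_ : integral m (a u) (fun=> slowness c t m / b) <= _).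
  by rewrite integral_cst; [apply: mulr_gt0; [exact: divr_gt0|lra]|lra].
apply: integral_le; first exact: bounded_measurable_cst.
  by apply: bounded_measurable_sub bm; [lra|exact: ltW].
move=> x hx; have hxb : a t < x < b by lra.
have [x0 c0] := layer_gt0 lf It hxb.
have -> : (c t x)^-1 = slowness c t x / x by rewrite /slowness; field; rewrite !gt_eqF.
apply: ler_pM; rewrite ?invr_ge0 ?(ltW b0) ?(ltW sm)//.
  by apply/ltW/(slowness_increasing lf It); lra.
by rewrite lef_pV2 ?posrE//; lra.
Qed.

Lemma stationary_constant t u x : t < u -> (forall w, t <= w <= u -> I w /\ a w < x) -> x < b ->
  (forall w, I w -> a w < x < b -> c2 w x = 0) -> c t x = c u x.
Proof.
move=> tu h xb z; have d w : t <= w <= u -> is_derive w 1 (c ^~ x) (c2 w x).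
  by move=> /h[Iw aw]; apply: (lf_derive2 lf) => //; rewrite aw.
have [||w hw e] := @MVT_segment _ (c^~ x) (c2^~ x) t u (ltW tu) _ _.
- by move=> w; rewrite in_itv /= => hw; apply: d; lra.
- by apply: continuous_itvW => w hw; exact: is_derive1_continuous (d w hw).
apply/esym/eqP; rewrite -subr_eq0 e; rewrite in_itv /= in hw; have [Iw aw] := h w hw.
by rewrite z ?mul0r ?aw.
Qed.

(** While an interface moves strictly monotonically the travel time across the layer
    above it changes injectively. *)
Lemma interface_stationary (C : set R) t : countable C -> (forall s, I s -> 0 < a s) ->
  (forall s, I s -> derivable a s 1 /\ {for s, continuous (derive1 a)}) ->
  (forall s x, I s -> a s < x < b -> c2 s x = 0) ->
  (forall s, I s -> C (2 * integral (a s) b (fun x => (c s x)^-1))) ->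
  I t -> is_derive t 1 a 0.
Proof.
move=> cC ap da c20 radial It; have [dat ca] := da t It.
have dE s : I s -> is_derive s 1 a (derive1 a s).
  by move=> /da[ds _]; rewrite derive1E; exact/derivableP.
have [e|n0] := eqVneq (derive1 a t) 0; first by have := dE t It; rewrite e.
have [s1 [s2 [ht [sI mono]]]] : exists s1 s2 : R, s1 < t < s2 /\ (forall s, s1 < s < s2 -> I s) /\
    ((forall u v, s1 < u -> u < v -> v < s2 -> a u < a v) \/
     (forall u v, s1 < u -> u < v -> v < s2 -> a v < a u)).
  move: n0; rewrite neq_lt => /orP[l|l].
    have [s1 [s2 [ht hs]]] := near_ball_itv (filterI (lf_open lf It) (continuous_near_lt ca l)).
    exists s1, s2; split => //; split; first by move=> s /hs[].
    right => u v; rewrite -(ltrN2 (a u)); apply: (@derive_pos_increasing _ (fun s => - a s) (fun s => - derive1 a s)).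
      by move=> s /hs[Is _]; apply: is_deriveN; exact: dE.
    by move=> s /hs[_]; rewrite oppr_gt0.
  have [s1 [s2 [ht hs]]] := near_ball_itv (filterI (lf_open lf It) (continuous_near_gt ca l)).
  exists s1, s2; split => //; split; first by move=> s /hs[].
  left => u v; apply: (@derive_pos_increasing _ a (derive1 a)).
    by move=> s /hs[Is _]; exact: dE.
  by move=> s /hs[].
exfalso; have s12 : s1 < s2 by lra.
apply: (countable_injective s12 cC (fun s hs => radial s (sI s hs))) => u v hu hv uv.
have two : 2 != 0 :> R by [].
apply/eqP => /(mulfI two) e.
have [Iu Iv] := (sI u hu, sI v hv).
have itv w : u <= w <= v -> s1 < w < s2 by lra.
have mx w : u <= w <= v -> a w <= Num.max (a u) (a v).
  move=> /andP[uw wv]; rewrite le_max; move: uw; rewrite le_eqVlt => /predU1P[<-|uw]; first by rewrite lexx.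
  move: wv; rewrite le_eqVlt => /predU1P[->|wv]; first by rewrite lexx orbT.
  case: mono => m.
    by rewrite (ltW (m w v _ wv _)) ?orbT//; lra.
  by rewrite (ltW (m u w _ uw _))//; lra.
have cuv x : Num.max (a u) (a v) < x < b -> c u x = c v x.
  move=> /andP[mxx xb]; apply: (stationary_constant uv) => //.
    by move=> w hw; split; [exact/sI/itv|exact: le_lt_trans (mx w hw) mxx].
  by move=> w Iw; exact: c20.
case: mono => m.
  have l : a u < a v by apply: m; lra.
  have h x : a v < x < b -> c u x = c v x by move=> hx; apply: cuv; rewrite (max_r (ltW l)).
  by have := travel_time_decreasing Iu Iv (ap u Iu) l h; rewrite e ltxx.
have l : a v < a u by apply: m; lra.
have h x : a u < x < b -> c v x = c u x by move=> hx; apply/esym/cuv; rewrite (max_l (ltW l)).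
by have := travel_time_decreasing Iv Iu (ap v Iv) l h; rewrite e ltxx.
Qed.

End MovingInterfaces.

Section LayeredProfiles.
Context {R : realType}.
Implicit Types (t x y : R).

(** Difference quotients relative to a neighbourhood are the ordinary ones. *)
Lemma is_derive_in_interior (D : set R) (f : R -> R) x (l : R) : nbhs x D ->
  is_derive_in D f x l -> is_derive x 1 f l.
Proof.
move=> xD h; apply/is_derive_cvg.
have e : \forall k \near 0^', (f (k + x) - f x) / (k + x - x) = k^-1 *: (f (k + x) - f x).
  by near=> k; rewrite addrK mulrC.
have g : k + x @[k --> 0^'] --> within D x^'.
  move=> P hP; have hP' : \forall y \near x, y != x -> D y -> P y := hP.
  change (\forall k \near (0 : R), k != 0 -> P (k + x)).
  have c : k + x @[k --> (0 : R)] --> x.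
    by rewrite -[in X in _ --> X](add0r x); apply: cvgD; [exact: cvg_id|exact: cvg_cst].
  have hn : \forall k \near (0 : R), (k + x != x -> D (k + x) -> P (k + x)) /\ D (k + x).
    exact: (c _ (filterI hP' xD)).
  apply: filterS hn => k [h1 h2] k0; apply: h1 => //.
  by rewrite -subr_eq0 addrK.
exact (cvg_trans (near_eq_cvg e) (cvg_comp _ _ g h)).
Unshelve. all: by end_near. Qed.

Lemma within_continuous_interior (T U : topologicalType) (A : set T) (f : T -> U) z :
  {within A, continuous f} -> nbhs z A -> {for z, continuous f}.
Proof.
move=> /subspace_continuousP h zA; have Az : A z by exact: nbhs_singleton.
by have := h z Az; rewrite within_interior.
Qed.

Lemma continuous_swap (f : R * R -> R) t x : {for (x, t), continuous f} ->
  {for (t, x), continuous (fun z : R * R => f (z.2, z.1))}.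
Proof.
move=> cf; have c : (z.2, z.1) @[z --> (t, x)] --> (x, t).
  apply: (@cvg_pair _ _ _ (nbhs (t, x)) (nbhs x) (nbhs t)); [exact: cvg_snd|exact: cvg_fst].
exact (cvg_comp _ _ c cf).
Qed.

Variables (n K : nat) (eps : R) (r : nat -> R -> R) (c : R -> R -> R).
Hypothesis adm : admissible n K eps r c.
Local Notation I := (fun t => - eps < t < eps).
Local Notation radius k := (fun t => layer_radius K (r ^~ t) k).

Lemma layer_radius_decreasing t i j : I t -> (i < j)%N -> (j <= K.+1)%N -> radius j t < radius i t.
Proof.
move=> It; elim: j => // j IH; rewrite ltnS leq_eqVlt => /predU1P[->|ij] jK.
  exact: (adm_radius_order adm).
by apply: lt_trans (IH ij (ltnW jK)); exact: (adm_radius_order adm).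
Qed.

Lemma layer_radius_top t : radius K.+1 t = 0.
Proof. by rewrite /layer_radius /= ltnn. Qed.

Lemma layer_radius_bounds t k : I t -> (k <= K)%N -> 0 <= radius k.+1 t /\ radius k t <= 1.
Proof.
move=> It kK; split.
  rewrite -(layer_radius_top t); move: kK; rewrite leq_eqVlt => /predU1P[->//|kK].
  exact/ltW/layer_radius_decreasing.
case: k kK => [|k] kK; first by rewrite /layer_radius.
by apply: ltW; apply: (@layer_radius_decreasing t 0 k.+1) => //; exact: leqW.
Qed.

Lemma layer_radius_between t k j x : I t -> (k <= K)%N -> (j <= K)%N ->
  radius k.+1 t < x < radius k t -> x != radius j t.
Proof.
move=> It kK jK /andP[l1 l2]; have [jk|kj] := leqP j k.
  rewrite lt_eqF//; apply: (lt_le_trans l2); move: jk; rewrite leq_eqVlt => /predU1P[->//|jk].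
  by apply/ltW/layer_radius_decreasing => //; exact: leqW.
rewrite gt_eqF//; apply: le_lt_trans l1; move: kj; rewrite leq_eqVlt => /predU1P[->//|kj].
by apply/ltW/layer_radius_decreasing => //; exact: leqW.
Qed.

Lemma layer_jump_free t k x : I t -> (k <= K)%N -> radius k.+1 t < x < radius k t ->
  ~ is_jump_radius K (r ^~ t) x.
Proof.
move=> It kK hx [j /andP[j0 jK] e]; have := layer_radius_between It kK jK hx.
by rewrite /layer_radius gtn_eqF// jK e eqxx.
Qed.

Lemma layer_radius_continuous t k : I t -> {for t, continuous (radius k)}.
Proof.
move=> It; case: k => [|k]; first exact: cst_continuous.
rewrite /layer_radius /=; have [kK|kK] := leqP k.+1 K; last exact: cst_continuous.
have [d _] := adm_radius_C1 adm It (k := k.+1) kK.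
by apply: differentiable_continuous; exact/derivable1_diffP.
Qed.

Lemma open_parameters t : I t -> \forall s \near t, I s.
Proof. exact: near_itv. Qed.

(** A layer whose outer interface does not move.  Away from the interfaces its points
    are interior to the set of regular points, so relative derivatives and
    continuity are the ordinary ones. *)
Lemma admissible_layer k b : (k <= K)%N -> (forall t, I t -> radius k t = b) ->
  exists c1 c2, layer_family n I (radius k.+1) b c c1 c2.
Proof.
move=> kK bE; have [d1 [d2 [hd cd1 cd2]]] := adm_C1 adm.
exists (fun t x => d1 (x, t)), (fun t x => d2 (x, t)).
have ab t : I t -> radius k.+1 t < b.
  by move=> It; rewrite -(bE t It); exact: (adm_radius_order adm).
have a0 t : I t -> 0 <= radius k.+1 t by move=> It; have [] := layer_radius_bounds It kK.
have b1 t : I t -> b <= 1 by move=> It; rewrite -(bE t It); have [] := layer_radius_bounds It kK.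
have itv t x : I t -> radius k.+1 t < x < b -> 0 < x < 1.
  by move=> It hx; have := a0 t It; have := b1 t It; lra.
have hb t x : I t -> radius k.+1 t < x < b -> radius k.+1 t < x < radius k t.
  by move=> It; rewrite bE.
have reg t x : I t -> radius k.+1 t < x < b -> regular_points K eps r (x, t).
  move=> It hx; split => //=; first by have := itv t x It hx; lra.
  exact: layer_jump_free It kK (hb t x It hx).
have regN t x : I t -> radius k.+1 t < x < b -> nbhs (x, t) (regular_points K eps r).
  move=> It hx; pose m := (radius k.+1 t + x) / 2.
  have am : radius k.+1 t < m by rewrite /m; lra.
  have mb : m < x < b by rewrite /m; lra.
  exists ([set y | m < y < b], [set s | I s /\ radius k.+1 s < m]).
    split => /=; first exact: near_itv.
    apply: filterI; first exact: near_itv.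
    exact (@continuous_near_lt R (radius k.+1) t m (layer_radius_continuous (k := k.+1) It) am).
  by move=> [y s] /= [hy [Is l]]; apply: reg => //; lra.
have dx t x : I t -> radius k.+1 t < x < b -> is_derive x 1 (c t) (d1 (x, t)).
  move=> It hx; have [h _] := hd _ (reg t x It hx); apply: is_derive_in_interior h.
  apply: filterS (near_itv (itv t x It hx)) => y /=; rewrite in_itv /=; lra.
have C t (It : I t) := (adm_C11 adm It).1 k kK.
have cp t x : I t -> radius k.+1 t < x <= b -> 0 < c t x.
  by move=> It hx; apply: (adm_pos adm) => //; have := a0 t It; have := b1 t It; lra.
split => //.
- exact: open_parameters.
- by move=> t It; split; [exact: a0|exact: ab].
- by move=> t It; exact: layer_radius_continuous.
- by move=> t x It hx; have [_ h] := hd _ (reg t x It hx).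
- by move=> t x It hx; apply: (@continuous_swap d1); apply: within_continuous_interior cd1 _; exact: regN.
- by move=> t x It hx; apply: (@continuous_swap d2); apply: within_continuous_interior cd2 _; exact: regN.
- move=> t It; have [_ [M [_ hM]] _] := C t It; exists (M + 1) => x y hx hy.
  have E z : radius k.+1 t < z < b -> d1 (z, t) = derive1 (c t) z.
    by move=> hz; rewrite derive1E; have dz := dx t z It hz; exact/esym/derive_val.
  rewrite !E//; apply: (hM (M + 1) _ (y, x)); first by rewrite ltrDl.
  by rewrite /= !in_itv /= !(bE t It).
- by move=> t It; have [_ _] := C t It; rewrite bE.
- move=> t x It hx; have hx' := itv t x It hx.
  have [|l h l0] := adm_herglotz adm It (x := x) _ (layer_jump_free It kK (hb t x It hx)).
    by lra.
  have dl : is_derive x 1 (fun y => y / c t y) l.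
    apply: is_derive_in_interior h.
    apply: filterS (near_itv hx') => y /=; rewrite in_itv /=; lra.
  have c0 : 0 < c t x by apply: cp => //; lra.
  have cx : c t x != 0 by rewrite gt_eqF.
  have dV := @is_deriveV _ (c t) x _ 1 cx (dx t x It hx).
  have dq := is_deriveM (is_derive_id x (1 : R)) dV.
  have : l = (c t x - x * d1 (x, t)) / c t x ^+ 2.
    rewrite -(derive_val (is_derive := dl)) (derive_val (is_derive := dq)) /GRing.scale /=; field.
    by [].
  by move=> lE; move: l0; rewrite lE pmulr_lgt0// invr_gt0 exprn_gt0.
- by move=> t It; have := adm_conjugacy adm It kK; rewrite bE.
Qed.

Hypothesis n2 : (2 <= n)%N.
Variable C : set R.
Hypothesis C_countable : countable C.
Hypothesis spectrum : forall t, I t -> blsp n K (r ^~ t) (c t) `<=` C.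

(** Periodic rays reflected at the outer interface of the layer are basic, so their
    lengths are among the countably many values C. *)
Lemma layer_rigid k b : (k <= K)%N -> (forall t, I t -> radius k t = b) ->
  exists c1 c2, layer_family n I (radius k.+1) b c c1 c2 /\
    forall t x, I t -> radius k.+1 t < x < b -> c2 t x = 0.
Proof.
move=> kK bE; have [c1 [c2 lf]] := admissible_layer kK bE; exists c1, c2; split => // t x.
apply: (layer_stationary lf C_countable n2) => {t x} t rho rho1 x0 m wt th T D N M It ax tp lp sp N0 e.
apply: (spectrum It).
apply: (leg_length_blsp tp lp sp n2 kK (esym (bE t It)) _ ax _ N0 e).
  by rewrite -(bE t It); have [] := layer_radius_bounds It kK.
move=> j jK /andP[l1 l2]; have := @layer_radius_between t k j (radius j t) It kK jK.
by rewrite eqxx bE// l2 (le_lt_trans ax l1) => /(_ isT).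
Qed.

(** The Herglotz condition bounds rho from above, hence the speed from below. *)
Lemma inner_limit_gt0 k t : I t -> (k < K)%N ->
  (forall s, I s -> radius k s = radius k t) ->
  exists2 l : R, c t y @[y --> (radius k.+1 t)^'+] --> l & 0 < l.
Proof.
move=> It kK bE; have [c1 [c2 lf]] := admissible_layer (ltnW kK) bE.
have [l cl _] := adm_jump adm It (k := k.+1) kK.
have E : radius k.+1 t = r k.+1 t by rewrite /layer_radius /= kK.
have [_ ab] := lf_itv lf It; exists l; first by rewrite E.
have a0 : 0 < radius k.+1 t by rewrite -(layer_radius_top t); exact: layer_radius_decreasing.
have s0 : 0 < slowness c t (radius k t).
  apply: divr_gt0; first exact: lt_trans ab.
  by apply: (lf_pos lf It); rewrite ab lexx.
apply: lt_le_trans (divr_gt0 a0 s0) _; apply: (cvgr_to_ge cl); rewrite -E.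
near=> y; have hy : radius k.+1 t < y < radius k t.
  by apply/andP; split; near: y; [exact: nbhs_right_gt|exact: nbhs_right_lt].
have [y0 cy] := layer_gt0 lf It hy; have sy := slowness_gt0 lf It hy.
have -> : c t y = y / slowness c t y by rewrite /slowness; field; rewrite !gt_eqF.
have sI : (slowness c t (radius k t))^-1 <= (slowness c t y)^-1.
  by rewrite lef_pV2 ?posrE//; exact: (slowness_le lf It hy).
by case/andP: hy => /ltW ay _; apply: ler_pM sI => //; [exact: ltW|rewrite invr_ge0 ltW].
Unshelve. all: by end_near. Qed.

(** Induction from the outside in: the interface above a layer is fixed, so the speed
    in the layer is, so the interface below it is. *)
Lemma layer_radius_constant k t u : (k <= K.+1)%N -> I t -> I u -> radius k t = radius k u.
Proof.
elim: k t u => // k IH t u; rewrite ltnS leq_eqVlt => /predU1P[->|kK] It Iu.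
  by rewrite !layer_radius_top.
have bE s : I s -> radius k s = radius k t by move=> Is; apply: IH => //; exact/ltnW/leqW.
have [c1 [c2 [lf z]]] := layer_rigid (ltnW kK) bE.
have E : radius k.+1 = r k.+1 by apply/funext => s; rewrite /layer_radius /= kK.
have a0 s : I s -> 0 < radius k.+1 s.
  by move=> Is; rewrite -(layer_radius_top s); exact: layer_radius_decreasing.
apply: (@derive_eq0_constant _ (radius k.+1) (- eps) eps) => // s Is.
apply: (interface_stationary lf C_countable a0 _ z _ Is).
  by rewrite E => v Iv; exact: (adm_radius_C1 adm).
move=> v Iv; apply: (spectrum Iv); have bEv s' : I s' -> radius k s' = radius k v by move=> Is'; rewrite !bE.
have [l cl l0] := inner_limit_gt0 Iv kK bEv.
have [_ vb] := lf_itv lf Iv.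
apply: (@radial_length_blsp _ n K k (r^~ v) (c v) _ _ l n2 kK erefl (esym (bE v Iv)) (a0 v Iv) vb) => //.
- by rewrite -(bE v Iv); have [] := layer_radius_bounds Iv (ltnW kK).
- move=> j jK hj; have := @layer_radius_between v k j (radius j v) Iv (ltnW kK) jK.
  by rewrite eqxx bE// => /(_ hj).
- move=> x hx; have dx := lf_derive lf Iv hx; split; last exact: ex_derive.
  by have [] := layer_gt0 lf Iv hx.
- exact: (lf_left lf Iv).
- by apply: (lf_pos lf Iv); rewrite vb lexx.
Qed.

Lemma profile_constant k x t u : (k <= K)%N -> I t -> I u -> radius k.+1 t < x < radius k t ->
  c t x = c u x.
Proof.
move=> kK It Iu hx.
have bE s : I s -> radius k s = radius k t.
  by move=> Is; apply: layer_radius_constant => //; exact: leqW.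
have [c1 [c2 [lf z]]] := layer_rigid kK bE.
have hs s : I s -> radius k.+1 s < x < radius k t.
  by move=> Is; rewrite (@layer_radius_constant k.+1 s t).
apply: (@derive_eq0_constant _ (c^~ x) (- eps) eps) => // s Is.
by have := lf_derive2 lf Is (hs s Is); rewrite z//; exact: hs.
Qed.

Lemma layer_exists t x : 0 < x <= 1 -> exists2 k, (k <= K)%N & radius k.+1 t < x <= radius k t.
Proof.
move=> /andP[x0 x1].
have ex : exists k, radius k t < x by exists K.+1; rewrite layer_radius_top.
have top : radius K.+1 t < x by rewrite layer_radius_top.
case: (ex_minnP ex) => -[|k] h hmin; first by move: h; rewrite /layer_radius /= ltNge x1.
exists k; first by have := hmin _ top; rewrite ltnS.
by rewrite h leNgt; apply/negP => /hmin; rewrite ltnn.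
Qed.

(** At the interfaces and at the origin the speed is the limit from within a layer. *)
Lemma profile_eq t u x : I t -> I u -> 0 <= x <= 1 -> c t x = c u x.
Proof.
move=> It Iu /andP[]; rewrite le_eqVlt => /predU1P[<- _|x0 x1].
  have b0 : 0 < radius K t by rewrite -(layer_radius_top t); exact: (adm_radius_order adm).
  have e : \forall y \near 0^'+, c t y = c u y.
    near=> y; apply: (@profile_constant K) => //; rewrite layer_radius_top.
    by apply/andP; split; near: y; [exact: nbhs_right_gt|exact: nbhs_right_lt].
  have ct := (adm_C11 adm It).2; have cu := (adm_C11 adm Iu).2.
  exact: (cvg_unique _ (cvg_trans (near_eq_cvg e) ct) cu).
have [|k kK /andP[lx]] := layer_exists t (x := x); first by rewrite x0.
rewrite le_eqVlt => /predU1P[xE|xb]; last by apply: (@profile_constant k); rewrite ?lx.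
have [_ _ ct] := (adm_C11 adm It).1 k kK; have [_ _ cu] := (adm_C11 adm Iu).1 k kK.
rewrite (@layer_radius_constant k u t) -?xE ?leqW// in cu; rewrite -xE in ct.
have e : \forall y \near x^'-, c t y = c u y.
  near=> y; apply: (@profile_constant k) => //; rewrite -xE.
  by apply/andP; split; near: y; [exact: nbhs_left_gt|exact: nbhs_left_lt].
exact: (cvg_unique _ (cvg_trans (near_eq_cvg e) ct) cu).
Unshelve. all: by end_near. Qed.

End LayeredProfiles.

Theorem theorem1p2 (R : realType) (n K : nat) (eps : R)
    (r : nat -> R -> R) (c : R -> R -> R) (S : R -> set R)
    (n_ge2 : (2 <= n)%N) (eps_gt0 : 0 < eps)
    (adm : admissible n K eps r c)
    (blsp_countable : forall tau, - eps < tau < eps ->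
       countable (blsp n K (r ^~ tau) (c tau)))
    (S_countable : forall tau, - eps < tau < eps -> countable (S tau))
    (spectra_agree : forall tau, - eps < tau < eps ->
       blsp n K (r ^~ tau) (c tau) `|` S tau =
       blsp n K (r ^~ 0) (c 0) `|` S 0) :
  forall tau, - eps < tau < eps ->
    (forall x, 0 <= x <= 1 -> c tau x = c 0 x) /\
    (forall k, (1 <= k <= K)%N -> r k tau = r k 0).
Proof.
have I0 : - eps < 0 < eps by rewrite oppr_lt0 eps_gt0.
have countable_spectrum : countable (blsp n K (r ^~ 0) (c 0) `|` S 0).
  rewrite -bigcup2E; apply: bigcup_countable => // -[|[|i]] _ /=.
  - exact: blsp_countable.
  - exact: S_countable.
  - exact: countable0.
have spectrum tau : - eps < tau < eps ->
    blsp n K (r ^~ tau) (c tau) `<=` blsp n K (r ^~ 0) (c 0) `|` S 0.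
  by move=> It L hL; rewrite -(spectra_agree tau It); left.
move=> tau It; split=> [x hx|k /andP[k0 kK]].
  exact: (profile_eq adm n_ge2 countable_spectrum spectrum).
have := layer_radius_constant adm n_ge2 countable_spectrum spectrum (leqW kK) It I0.
by rewrite /layer_radius gtn_eqF// kK.
Qed.
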